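(* Let $\nu\in\{2,4,8\}$. Then the imaginary axis $\Re(s)=0$ is a natural boundary of $\zeta_{\sqrt{+^2}}(s;\nu)$: for every point $it_0$ ($t_0\in\mathbb{R}$) and every open disc $D$ centered at $it_0$, there is no meromorphic function on $\{\Re(s)>0\}\cup D$ that coincides with $\zeta_{\sqrt{+^2}}(s;\nu)$ on $\Re(s)>0$.
   Context: For $\mathbf{x}\in\mathbb{R}^{\nu}$, $|\mathbf{x}|$ is the Euclidean norm. A vector $\mathbf{p}\in\mathbb{Z}^{\nu}\setminus\{\mathbf{0}\}$ is primitive if $\gcd\mathbf{p}=1$ (gcd of the absolute values of its nonzero entries). For $\Re(s)>0$, \[ \zeta_{\sqrt{+^2}}(s;\nu)=\prod_{\mathbf{p}\in\mathbb{Z}^{\nu},\ \gcd\mathbf{p}=1}\bigl(1-e^{-s|\mathbf{p}|}\bigr)^{-1}, \] the product over all primitive vectors (including both $\mathbf{p}$ and $-\mathbf{p}$); it converges absolutely and defines a holomorphic function on $\Re(s)>0$. *)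

(* Defs.v *)
From Stdlib Require Import Reals ZArith List.
From Coquelicot Require Import Coquelicot.
Open Scope R_scope.

(* Vectors of Z^nu are lists of integers of length nu. *)

Fixpoint box (n N : nat) : list (list Z) :=
  match n with
  | O => nil :: nil
  | S m =>
      flat_map (fun a => map (fun v => a :: v) (box m N))
               (map (fun k => (Z.of_nat k - Z.of_nat N)%Z) (seq 0 (2 * N + 1)))
  end.

Definition zgcd (p : list Z) : Z := fold_right Z.gcd 0%Z p.

(* p is primitive: gcd p = 1 (this excludes the zero vector) *)
Definition primitive (p : list Z) : bool := Z.eqb (zgcd p) 1.

Definition vnorm (p : list Z) : R :=
  sqrt (fold_right (fun a acc => IZR a ^ 2 + acc) 0 p).

Definition cexp_neg (s : C) (r : R) : C :=
  (exp (- r * Re s) * cos (- r * Im s), exp (- r * Re s) * sin (- r * Im s)).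

Definition factor (s : C) (p : list Z) : C :=
  Cinv (Cminus 1 (cexp_neg s (vnorm p))).

Definition partial_prod (nu : nat) (s : C) (N : nat) : C :=
  fold_right Cmult 1 (map (factor s) (filter primitive (box nu N))).

Definition C_holo_at (g : C -> C) (z : C) : Prop :=
  ex_derive (K := C_AbsRing) (V := C_NormedModule) g z.

(* meromorphic on the (open) set U: there is a set P of poles, contained
   in U and without accumulation point in U, such that g is holomorphic at
   every point of U \ P and |g w| -> +oo as w -> z for each z in P
   (the values of g at the poles are irrelevant). *)
Definition meromorphic_on (U : C -> Prop) (g : C -> C) : Prop :=
  exists P : C -> Prop,
    (forall z, P z -> U z) /\
    (forall z, U z -> exists r, 0 < r /\
        forall w, Cmod (Cminus w z) < r -> P w -> w = z) /\
    (forall z, U z -> ~ P z -> C_holo_at g z) /\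
    (forall z, P z ->
       filterlim (fun w => Cmod (g w))
                 (within (fun w => w <> z) (locally z))
                 (Rbar_locally p_infty)).

(* Main.v *)
Require Import Defs.
From Stdlib Require Import Reals ZArith List Lra Lia Psatz Permutation Factorial Classical ClassicalEpsilon.
From Coquelicot Require Import Coquelicot.
Open Scope R_scope.

(* Let F be the logarithm of zeta. Expanding the Euler product and grouping vectors by their gcd gives
   F(s) = sum_k c(k) (Theta(k s) - 1), where Theta(s) = sum_m exp (-s |m|) over Z^nu and the coefficients
   satisfy sum_{d | g} c(d) = 1/g. Writing exp (-s x) as a superposition of Gaussians and applying Poisson
   summation yields, with r(n) the number of m with |m|^2 = n and a = (nu+1)/2,
     Theta(s) = const * s * sum_n r(n) (s^2 + 4 pi^2 n)^(-a).
   For s = sigma + 2 pi i q, where q^2 is rational, the terms with n = k^2 q^2 are resonant: together they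
   contribute sigma^(-a) W S(q), where W has a nonzero real part of known sign as sigma -> 0 and
   S(q) = sum_k c(k) k^(-nu) r(k^2 q^2). The other terms with k <= A sigma^(-1/2) are o(sigma^(-a)), by
   r(n) = O(n^(nu/2-2/3)), which follows from an O(n^(1/3)) bound for lattice points on circles (three of them
   span a triangle of area at least 1/2); the terms with k > A sigma^(-1/2) are bounded using
   Theta(k s) - 1 = O((k sigma)^(-nu)). So log |zeta| -> +oo at 2 pi i q whenever S(q) has the right sign.
   Such q = sqrt n0 / b are dense: b is made divisible by all (odd, if nu = 2, 4) primes up to P, so that the
   terms k = b j with j <= P have the sign of c(b), which is adjusted by one further prime, and the rest of the
   sum is a small tail. For nu = 2, 4 one takes n0 a power of 4 and uses r(16 n) = r(4 n); for nu = 8 one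
   uses r(n) = O(n^3) and, by pigeonhole, an n in the required range with r(n) >> n^3.
   A meromorphic extension would be bounded near all but discretely many points of the imaginary axis. *)

(** * Unconditional sums *)

(** On s = h^2 + i tau the resonant terms have size h^(-nu-1). The tail k > K is bounded by h^(-2
    nu) K^(1-nu), comparable with h^(-nu-1) exactly when K is of order 1/h; a large A in K = A/h
    makes it a small fraction of the resonant part. This cutoff dictates what the other terms may
    cost. If r(n) = O(n^(nu/2-1+delta)) with delta < 1/2, so that the sum over n converges, one k
    contributes O(k^(nu-1+2 delta)) and all k up to A/h contribute O(h^(-nu-2 delta)). The trivial
    delta = 1/2 for the circle just fails, any power saving suffices, and delta = 1/3 leaves a
    factor h^(1/3). The sign of S(q) matters because only log |zeta| -> +oo contradicts holomorphy
    at a single point; divergence to -oo would merely look like a boundary zero. As the sign of W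
    depends on nu, resonances of both signs are constructed. For Re s > 0 the root s^(1/2) lies in
    the sector |Im| < Re, where Gaussian integrals can be rotated; fractional powers are therefore
    powers of principal roots. All sums are unconditional, and regroupings by norm, gcd or k are
    instances of one fibre lemma. *)

Definition eqd {T : Type} (x y : T) : {x = y} + {x <> y} :=
  excluded_middle_informative (x = y).

Definition csum {T : Type} (f : T -> C) (l : list T) : C :=
  fold_right (fun t a => Cplus (f t) a) 0 l.

Definition rsum {T : Type} (g : T -> R) (l : list T) : R :=
  fold_right (fun t a => g t + a) 0 l.

(** Unconditional summability: the net of sums over finite duplicate-free lists, ordered by
    inclusion, converges to l. No enumeration of the index type enters, so regrouping and reindexing
    raise no question of rearrangement. *)
Definition hs {T : Type} (f : T -> C) (l : C) : Prop :=
  forall eps, 0 < eps -> exists L0, NoDup L0 /\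
    forall L, NoDup L -> incl L0 L -> Cmod (csum f L - l) < eps.

(** Summability of a nonnegative family through bounded finite sums; this is the form of the
    majorants in the exchanges of limits below. *)
Definition smb_by {T : Type} (g : T -> R) (B : R) : Prop :=
  (forall t, 0 <= g t) /\ forall L, NoDup L -> rsum g L <= B.

Definition smb {T : Type} (g : T -> R) : Prop := exists B, smb_by g B.

Section FiniteSums.
Context {T : Type}.
Implicit Types (f : T -> C) (g : T -> R) (L : list T).

Lemma csum_app f L1 L2 : csum f (L1 ++ L2) = (csum f L1 + csum f L2)%C.
Proof. induction L1; simpl; [ring | rewrite IHL1; ring]. Qed.

Lemma rsum_app g L1 L2 : rsum g (L1 ++ L2) = rsum g L1 + rsum g L2.
Proof. induction L1; simpl; [ring | rewrite IHL1; ring]. Qed.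

Lemma csum_ext_in f1 f2 L : (forall t, In t L -> f1 t = f2 t) -> csum f1 L = csum f2 L.
Proof.
  induction L; simpl; intros H; auto.
  rewrite H, IHL; auto.
Qed.

Lemma rsum_ext_in g1 g2 L : (forall t, In t L -> g1 t = g2 t) -> rsum g1 L = rsum g2 L.
Proof.
  induction L; simpl; intros H; auto.
  rewrite H, IHL; auto.
Qed.

Lemma csum_perm f L1 L2 : Permutation L1 L2 -> csum f L1 = csum f L2.
Proof. induction 1; simpl; [auto | congruence | ring | congruence]. Qed.

Lemma rsum_perm g L1 L2 : Permutation L1 L2 -> rsum g L1 = rsum g L2.
Proof. induction 1; simpl; [auto | congruence | ring | congruence]. Qed.

Lemma csum_plus f1 f2 L : csum (fun t => f1 t + f2 t)%C L = (csum f1 L + csum f2 L)%C.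
Proof. induction L; simpl; [ring | rewrite IHL; ring]. Qed.

Lemma csum_scal a f L : csum (fun t => a * f t)%C L = (a * csum f L)%C.
Proof. induction L; simpl; [ring | rewrite IHL; ring]. Qed.

Lemma rsum_plus g1 g2 L : rsum (fun t => g1 t + g2 t) L = rsum g1 L + rsum g2 L.
Proof. induction L; simpl; [ring | rewrite IHL; ring]. Qed.

Lemma rsum_scal a g L : rsum (fun t => a * g t) L = a * rsum g L.
Proof. induction L; simpl; [ring | rewrite IHL; ring]. Qed.

Lemma rsum_le g1 g2 L : (forall t, In t L -> g1 t <= g2 t) -> rsum g1 L <= rsum g2 L.
Proof.
  induction L; simpl; intros H; [lra |].
  apply Rplus_le_compat; auto.
Qed.

Lemma rsum_pos g L : (forall t, 0 <= g t) -> 0 <= rsum g L.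
Proof. induction L; simpl; intros H; [lra | specialize (H a) as Ha; specialize (IHL H); lra]. Qed.

Lemma rsum_const a L : rsum (fun _ => a) L = INR (length L) * a.
Proof.
  induction L; [simpl; lra |].
  change (a + rsum (fun _ => a) L = INR (S (length L)) * a). rewrite IHL, S_INR; ring.
Qed.

Lemma csum_const a L : csum (fun _ => a) L = (INR (length L) * a)%C.
Proof.
  induction L; [simpl; ring |].
  change ((a + csum (fun _ => a) L)%C = (INR (S (length L)) * a)%C).
  rewrite IHL, S_INR, RtoC_plus; ring.
Qed.

Lemma csum_le f g L : (forall t, In t L -> Cmod (f t) <= g t) -> Cmod (csum f L) <= rsum g L.
Proof.
  induction L; simpl; intros H; [rewrite Cmod_0; lra |].
  eapply Rle_trans; [apply Cmod_triangle |]. apply Rplus_le_compat; auto.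
Qed.

Lemma csum_re f L : Re (csum f L) = rsum (fun t => Re (f t)) L.
Proof. induction L; simpl; [reflexivity |]. rewrite <- IHL. reflexivity. Qed.

Lemma csum_im f L : Im (csum f L) = rsum (fun t => Im (f t)) L.
Proof. induction L; simpl; [reflexivity |]. rewrite <- IHL. reflexivity. Qed.

Lemma rsum_incl g L1 L2 : (forall t, 0 <= g t) -> NoDup L1 -> incl L1 L2 ->
  rsum g L1 <= rsum g L2.
Proof.
  intros Hg; revert L2; induction L1 as [| a L1 IH]; intros L2 Hn Hi.
  - apply rsum_pos; auto.
  - inversion Hn; subst. destruct (in_split a L2) as [l1 [l2 E]].
    { apply Hi; simpl; auto. }
    subst L2. rewrite (rsum_perm g _ _ (Permutation_sym (Permutation_middle l1 l2 a))).
    simpl. apply Rplus_le_compat_l. apply IH; auto.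
    intros t Ht. assert (Ht2 : In t (l1 ++ a :: l2)) by (apply Hi; simpl; auto).
    apply in_app_iff in Ht2. apply in_app_iff. simpl in Ht2.
    destruct Ht2 as [|[|]]; auto. subst; contradiction.
Qed.

Definition diffl L L0 : list T := filter (fun t => if in_dec eqd t L0 then false else true) L.

Lemma diffl_in t L L0 : In t (diffl L L0) <-> In t L /\ ~ In t L0.
Proof.
  unfold diffl. rewrite filter_In. destruct (in_dec eqd t L0); intuition; discriminate.
Qed.

Lemma diffl_perm L L0 : NoDup L -> NoDup L0 -> incl L0 L -> Permutation L (L0 ++ diffl L L0).
Proof.
  intros H H0 Hi. apply NoDup_Permutation; auto.
  - apply NoDup_app; auto.
    + apply NoDup_filter; auto.
    + intros t Ht Hd. apply diffl_in in Hd. tauto.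
  - intros t. rewrite in_app_iff, diffl_in. split; [| intros [|[]]; auto].
    intros; destruct (in_dec eqd t L0); tauto.
Qed.

Definition unionl (L L' : list T) : list T := nodup eqd (L ++ L').

Lemma unionl_nd L L' : NoDup (unionl L L').
Proof. apply NoDup_nodup. Qed.
Lemma unionl_l L L' : incl L (unionl L L').
Proof. intros t Ht. apply nodup_In, in_app_iff; auto. Qed.
Lemma unionl_r L L' : incl L' (unionl L L').
Proof. intros t Ht. apply nodup_In, in_app_iff; auto. Qed.

Lemma csum_zero f L : (forall t, In t L -> f t = 0) -> csum f L = 0.
Proof.
  induction L; simpl; intros H; auto. rewrite H, IHL by auto. apply Cplus_0_l.
Qed.

Lemma rsum_zero g L : (forall t, In t L -> g t = 0) -> rsum g L = 0.
Proof.
  induction L; simpl; intros H; auto. rewrite H, IHL by auto. ring.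
Qed.

End FiniteSums.

Section Hs.
Context {T : Type}.
Implicit Types (f : T -> C) (g : T -> R) (L : list T).

(** Take [L0] with sum within eps of the supremum of all finite sums; a disjoint list with sum at
    least eps would push past the supremum. *)
Lemma smb_tail g : smb g -> forall eps, 0 < eps -> exists L0, NoDup L0 /\
  forall L, NoDup L -> (forall t, In t L -> ~ In t L0) -> rsum g L < eps.
Proof.
  intros [B [Hp HB]] eps He.
  set (E := fun x => exists L, NoDup L /\ x = rsum g L).
  destruct (completeness E) as [s [Hs1 Hs2]].
  - exists B. intros x [L [HL ->]]; auto.
  - exists 0, nil. split; [constructor | reflexivity].
  - destruct (classic (exists L0, NoDup L0 /\ s - eps < rsum g L0)) as [[L0 [Hn H0]] | Hno].
    + exists L0; split; auto. intros L HL Hd.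
      assert (rsum g (L0 ++ L) <= s).
      { apply Hs1. exists (L0 ++ L); split; auto. apply NoDup_app; auto.
        intros t H1 H2. apply (Hd t); auto. }
      rewrite rsum_app in H. lra.
    + exfalso. assert (s <= s - eps); [| lra].
      apply Hs2. intros x [L [HL ->]]. apply Rnot_lt_le. intros Hc. apply Hno. eauto.
Qed.

Lemma smb_le g1 g2 : (forall t, 0 <= g1 t <= g2 t) -> smb g2 -> smb g1.
Proof.
  intros H [B [_ HB]]. exists B. split; [intros t; apply H |].
  intros L HL. eapply Rle_trans; [| apply HB; eauto]. apply rsum_le. intros; apply H.
Qed.

Lemma smb_scal a g : 0 <= a -> smb g -> smb (fun t => a * g t).
Proof.
  intros Ha [B [Hp HB]]. exists (a * B). split.
  - intros t; apply Rmult_le_pos; auto.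
  - intros L HL. rewrite rsum_scal. apply Rmult_le_compat_l; auto.
Qed.

Lemma smb_plus g1 g2 : smb g1 -> smb g2 -> smb (fun t => g1 t + g2 t).
Proof.
  intros [B [Hp HB]] [B' [Hp' HB']]. exists (B + B'). split.
  - intros t; specialize (Hp t); specialize (Hp' t); lra.
  - intros L HL. rewrite rsum_plus. apply Rplus_le_compat; auto.
Qed.

Lemma hs_unique f l1 l2 : hs f l1 -> hs f l2 -> l1 = l2.
Proof.
  intros H1 H2. destruct (Req_dec (Cmod (l1 - l2)) 0) as [E | E].
  - apply Cmod_eq_0 in E. replace l1 with ((l1 - l2) + l2)%C by ring. rewrite E; ring.
  - exfalso. assert (Hd : 0 < Cmod (l1 - l2) / 2).
    { pose proof (Cmod_ge_0 (l1 - l2)); lra. }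
    destruct (H1 _ Hd) as [L1 [_ K1]]. destruct (H2 _ Hd) as [L2 [_ K2]].
    specialize (K1 _ (unionl_nd L1 L2) (unionl_l L1 L2)).
    specialize (K2 _ (unionl_nd L1 L2) (unionl_r L1 L2)).
    set (x := csum f (unionl L1 L2)) in *.
    pose proof (Cmod_triangle (-(x - l1)) (x - l2)) as Ht.
    replace (- (x - l1) + (x - l2))%C with (l1 - l2)%C in Ht by ring.
    rewrite Cmod_opp in Ht. lra.
Qed.

Lemma hs_ext f1 f2 l : (forall t, f1 t = f2 t) -> hs f1 l -> hs f2 l.
Proof.
  intros E H eps He. destruct (H eps He) as [L0 [Hn K]]. exists L0; split; auto.
  intros L HL Hi. rewrite (csum_ext_in f2 f1); auto.
Qed.

Lemma hs_plus f1 f2 l1 l2 : hs f1 l1 -> hs f2 l2 -> hs (fun t => f1 t + f2 t)%C (l1 + l2)%C.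
Proof.
  intros H1 H2 eps He.
  destruct (H1 (eps / 2)) as [L1 [_ K1]]; [lra |].
  destruct (H2 (eps / 2)) as [L2 [_ K2]]; [lra |].
  exists (unionl L1 L2). split; [apply unionl_nd |].
  intros L HL Hi. rewrite csum_plus.
  replace (csum f1 L + csum f2 L - (l1 + l2))%C with ((csum f1 L - l1) + (csum f2 L - l2))%C by ring.
  eapply Rle_lt_trans; [apply Cmod_triangle |].
  assert (Cmod (csum f1 L - l1) < eps / 2) by (apply K1; auto; eapply incl_tran; [apply unionl_l | eauto]).
  assert (Cmod (csum f2 L - l2) < eps / 2) by (apply K2; auto; eapply incl_tran; [apply unionl_r | eauto]).
  lra.
Qed.

Lemma hs_scal a f l : hs f l -> hs (fun t => a * f t)%C (a * l)%C.
Proof.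
  intros H eps He. pose proof (Cmod_ge_0 a).
  destruct (H (eps / (Cmod a + 1))) as [L0 [Hn K]]; [apply Rdiv_lt_0_compat; lra |].
  exists L0; split; auto. intros L HL Hi. rewrite csum_scal.
  replace (a * csum f L - a * l)%C with (a * (csum f L - l))%C by ring.
  rewrite Cmod_mult. specialize (K L HL Hi).
  apply Rle_lt_trans with ((Cmod a + 1) * Cmod (csum f L - l)).
  - apply Rmult_le_compat_r; [apply Cmod_ge_0 | lra].
  - replace eps with ((Cmod a + 1) * (eps / (Cmod a + 1))) by (field; lra).
    apply Rmult_lt_compat_l; lra.
Qed.

Lemma hs_minus f1 f2 l1 l2 : hs f1 l1 -> hs f2 l2 -> hs (fun t => f1 t - f2 t)%C (l1 - l2)%C.
Proof.
  intros H1 H2. apply (hs_ext (fun t => f1 t + (-(1)) * f2 t)%C); [intros; ring |].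
  replace (l1 - l2)%C with (l1 + (-(1)) * l2)%C by ring.
  apply hs_plus; auto. apply hs_scal; auto.
Qed.

Lemma hs_zero : hs (fun _ : T => 0) 0.
Proof.
  intros eps He. exists nil. split; [constructor |]. intros L _ _.
  rewrite csum_zero by auto. replace (RtoC 0 - RtoC 0)%C with (RtoC 0) by ring. rewrite Cmod_0; auto.
Qed.

Lemma hs_finite f L0 : NoDup L0 -> (forall t, ~ In t L0 -> f t = 0) -> hs f (csum f L0).
Proof.
  intros Hn H0 eps He. exists L0; split; auto. intros L HL Hi.
  rewrite (csum_perm f _ _ (diffl_perm L L0 HL Hn Hi)), csum_app.
  rewrite (csum_zero f (diffl L L0)).
  - replace (csum f L0 + 0 - csum f L0)%C with (RtoC 0) by ring. rewrite Cmod_0; auto.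
  - intros t Ht. apply diffl_in in Ht. apply H0; tauto.
Qed.

Lemma hs_single f t0 : (forall t, t <> t0 -> f t = 0) -> hs f (f t0).
Proof.
  intros H. replace (f t0) with (csum f (t0 :: nil)) by (simpl; apply Cplus_0_r).
  apply hs_finite; [repeat constructor; auto |].
  intros t Ht. apply H. intros ->. apply Ht; simpl; auto.
Qed.

Lemma hs_bound f g l B : hs f l -> (forall t, Cmod (f t) <= g t) ->
  (forall L, NoDup L -> rsum g L <= B) -> Cmod l <= B.
Proof.
  intros H Hg HB. apply le_epsilon. intros eps He.
  destruct (H eps He) as [L0 [Hn K]].
  specialize (K L0 Hn (incl_refl _)). specialize (HB L0 Hn).
  pose proof (csum_le f g L0 (fun t _ => Hg t)).
  pose proof (Cmod_triangle (csum f L0) (-(csum f L0 - l))) as Ht.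
  rewrite Cmod_opp in Ht. replace (csum f L0 + - (csum f L0 - l))%C with l in Ht by ring. lra.
Qed.

Lemma hs_re_im_intro f x y :
  (forall eps, 0 < eps -> exists L0, NoDup L0 /\
    forall L, NoDup L -> incl L0 L -> Rabs (rsum (fun t => Re (f t)) L - x) < eps) ->
  (forall eps, 0 < eps -> exists L0, NoDup L0 /\
    forall L, NoDup L -> incl L0 L -> Rabs (rsum (fun t => Im (f t)) L - y) < eps) ->
  hs f (x, y).
Proof.
  intros H1 H2 eps He.
  destruct (H1 (eps / 2)) as [L1 [_ K1]]; [lra |].
  destruct (H2 (eps / 2)) as [L2 [_ K2]]; [lra |].
  exists (unionl L1 L2). split; [apply unionl_nd |].
  intros L HL Hi.
  assert (A1 := K1 L HL (incl_tran (unionl_l _ _) Hi)).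
  assert (A2 := K2 L HL (incl_tran (unionl_r _ _) Hi)).
  rewrite <- csum_re in A1. rewrite <- csum_im in A2.
  set (z := csum f L) in *.
  replace (z - (x, y))%C with (RtoC (Re z - x) + Ci * RtoC (Im z - y))%C.
  - eapply Rle_lt_trans; [apply Cmod_triangle |].
    rewrite Cmod_mult, !Cmod_R.
    replace (Cmod Ci) with 1. lra.
    unfold Cmod, Ci; simpl. replace (0 * (0 * 1) + 1 * (1 * 1)) with 1 by ring. symmetry; apply sqrt_1.
  - destruct z as [a b]. unfold Re, Im, Ci, RtoC, Cplus, Cminus, Copp, Cmult; simpl.
    apply injective_projections; simpl; ring.
Qed.

Lemma pos_sum_exists g B : smb_by g B -> exists s,
  forall eps, 0 < eps -> exists L0, NoDup L0 /\
    forall L, NoDup L -> incl L0 L -> Rabs (rsum g L - s) < eps.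
Proof.
  intros [Hp HB].
  set (E := fun x => exists L, NoDup L /\ x = rsum g L).
  destruct (completeness E) as [s [Hs1 Hs2]].
  - exists B. intros x [L [HL ->]]; auto.
  - exists 0, nil. split; [constructor | reflexivity].
  - exists s. intros eps He.
    destruct (classic (exists L0, NoDup L0 /\ s - eps < rsum g L0)) as [[L0 [Hn H0]] | Hno].
    + exists L0; split; auto. intros L HL Hi.
      pose proof (rsum_incl g L0 L Hp Hn Hi).
      assert (rsum g L <= s) by (apply Hs1; exists L; auto).
      apply Rabs_def1; lra.
    + exfalso. assert (s <= s - eps); [| lra].
      apply Hs2. intros x [L [HL ->]]. apply Rnot_lt_le. intros Hc. apply Hno. eauto.
Qed.

(** u = (u + g) - g is a difference of nonnegative summable families, and for each of these the
    supremum of the finite sums is the limit. *)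
Lemma real_sum_exists (u : T -> R) g : (forall t, Rabs (u t) <= g t) -> smb g -> exists s,
  forall eps, 0 < eps -> exists L0, NoDup L0 /\
    forall L, NoDup L -> incl L0 L -> Rabs (rsum u L - s) < eps.
Proof.
  intros Hu [B HB].
  destruct (pos_sum_exists g B HB) as [s1 K1].
  assert (H2 : smb (fun t => u t + g t)).
  { apply (smb_le _ (fun t => 2 * g t)).
    - intros t. specialize (Hu t). apply Rabs_le_between in Hu. lra.
    - apply smb_scal; [lra | exists B; auto]. }
  destruct H2 as [B2 H2]. destruct (pos_sum_exists _ B2 H2) as [s2 K2].
  exists (s2 - s1). intros eps He.
  destruct (K1 (eps / 2)) as [L1 [_ J1]]; [lra |].
  destruct (K2 (eps / 2)) as [L2 [_ J2]]; [lra |].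
  exists (unionl L1 L2). split; [apply unionl_nd |].
  intros L HL Hi.
  assert (A1 := J1 L HL (incl_tran (unionl_l _ _) Hi)).
  assert (A2 := J2 L HL (incl_tran (unionl_r _ _) Hi)).
  rewrite rsum_plus in A2. apply Rabs_def2 in A1. apply Rabs_def2 in A2.
  apply Rabs_def1; lra.
Qed.

Lemma hs_exists f g : (forall t, Cmod (f t) <= g t) -> smb g -> exists l, hs f l.
Proof.
  intros Hf Hg.
  destruct (real_sum_exists (fun t => Re (f t)) g) as [x Hx]; auto.
  { intros t. eapply Rle_trans; [apply re_le_Cmod | auto]. }
  destruct (real_sum_exists (fun t => Im (f t)) g) as [y Hy]; auto.
  { intros t. eapply Rle_trans; [| apply (Hf t)].
    eapply Rle_trans; [| apply Rmax_Cmod]. apply Rmax_r. }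
  exists (x, y). apply hs_re_im_intro; auto.
Qed.

(** The lists only have to exhaust the support of f: adjoining the missing members of [L0] adds
    zeros and makes the list admissible in [hs]. This admits boxes of vectors of one fixed length,
    although the index type is all lists. *)
Lemma hs_lim f l (Ln : nat -> list T) : hs f l ->
  (forall n, NoDup (Ln n)) ->
  (forall t, f t <> 0 -> exists N, forall n, (N <= n)%nat -> In t (Ln n)) ->
  forall eps, 0 < eps -> exists N, forall n, (N <= n)%nat -> Cmod (csum f (Ln n) - l) < eps.
Proof.
  intros H Hn Hex eps He. destruct (H eps He) as [L0 [HL0 K]].
  assert (exists N, forall n, (N <= n)%nat -> forall t, In t L0 -> f t <> 0 -> In t (Ln n)) as [N HN].
  { clear HL0 K. induction L0 as [| a L0 [N IH]].
    - exists 0%nat. simpl; tauto.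
    - destruct (eqd (f a) 0) as [E | E].
      + exists N. intros n Hle t [<- | Ht] Hf; [contradiction | eauto].
      + destruct (Hex a E) as [N' HN']. exists (max N N').
        intros n Hle t [<- | Ht] Hf; [apply HN'; lia | apply IH; auto; lia]. }
  exists N. intros n Hle.
  set (L := Ln n ++ diffl L0 (Ln n)).
  replace (csum f (Ln n)) with (csum f L).
  - apply K.
    + apply NoDup_app; auto; [apply NoDup_filter; auto |].
      intros t H1 H2. apply diffl_in in H2. tauto.
    + intros t Ht. unfold L. rewrite in_app_iff, diffl_in.
      destruct (in_dec eqd t (Ln n)); auto.
  - unfold L. rewrite csum_app, (csum_zero f (diffl L0 (Ln n))); [apply Cplus_0_r |].
    intros t Ht. apply diffl_in in Ht. destruct Ht as [H1 H2].
    destruct (eqd (f t) 0); auto. exfalso. eauto.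
Qed.

(** Dominated convergence for sums: outside one finite list both F n and f contribute at most eps/4,
    and on that list convergence is termwise. *)
Lemma hs_tannery (F : nat -> T -> C) f g (l : nat -> C) l0 :
  (forall n t, Cmod (F n t) <= g t) -> smb g ->
  (forall t eps, 0 < eps -> exists N, forall n, (N <= n)%nat -> Cmod (F n t - f t) < eps) ->
  (forall n, hs (F n) (l n)) -> hs f l0 ->
  forall eps, 0 < eps -> exists N, forall n, (N <= n)%nat -> Cmod (l n - l0) < eps.
Proof.
  intros Hd Hg Hl HF Hf eps He.
  assert (Hd0 : forall t, Cmod (f t) <= g t).
  { intros t. apply le_epsilon. intros e Hee. destruct (Hl t e Hee) as [N HN].
    specialize (HN N (Nat.le_refl _)). specialize (Hd N t).
    pose proof (Cmod_triangle (F N t) (-(F N t - f t))) as Ht. rewrite Cmod_opp in Ht.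
    replace (F N t + - (F N t - f t))%C with (f t) in Ht by ring. lra. }
  destruct (smb_tail g Hg (eps / 8)) as [L0 [HL0 Htail]]; [lra |].
  assert (Hfin : exists N, forall n, (N <= n)%nat -> Cmod (csum (F n) L0 - csum f L0) < eps / 4).
  { clear Htail HL0. assert (He4 : 0 < eps / 4) by lra. revert He4. generalize (eps / 4).
    induction L0 as [| a L0 IH]; intros e Hee.
    - exists 0%nat. intros n _. simpl. replace (RtoC 0 - RtoC 0)%C with (RtoC 0) by ring.
      rewrite Cmod_0; auto.
    - destruct (IH (e / 2)) as [N1 H1]; [lra |].
      destruct (Hl a (e / 2)) as [N2 H2]; [lra |].
      exists (max N1 N2). intros n Hn. simpl.
      replace (F n a + csum (F n) L0 - (f a + csum f L0))%C with
        ((F n a - f a) + (csum (F n) L0 - csum f L0))%C by ring.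
      eapply Rle_lt_trans; [apply Cmod_triangle |].
      assert (Cmod (F n a - f a) < e / 2) by (apply H2; lia).
      assert (Cmod (csum (F n) L0 - csum f L0) < e / 2) by (apply H1; lia). lra. }
  destruct Hfin as [N HN]. exists N. intros n Hn.
  assert (Hrest : forall f' l', (forall t, Cmod (f' t) <= g t) -> hs f' l' -> Cmod (csum f' L0 - l') <= eps / 8 + eps / 8).
  { intros f' l' Hb Hh. destruct (Hh (eps / 8)) as [L1 [H1 K1]]; [lra |].
    specialize (K1 (unionl L0 L1) (unionl_nd _ _) (unionl_r _ _)).
    rewrite (csum_perm f' _ _ (diffl_perm _ L0 (unionl_nd L0 L1) HL0 (unionl_l _ _))), csum_app in K1.
    set (D := diffl (unionl L0 L1) L0) in *.
    assert (Cmod (csum f' D) < eps / 8).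
    { eapply Rle_lt_trans; [apply (csum_le f' g); auto |]. apply Htail.
      - apply NoDup_filter, unionl_nd.
      - intros t Ht. apply diffl_in in Ht. tauto. }
    replace (csum f' L0 - l')%C with ((csum f' L0 + csum f' D - l') + - csum f' D)%C by ring.
    eapply Rle_trans; [apply Cmod_triangle |]. rewrite Cmod_opp. lra. }
  pose proof (Hrest _ _ (Hd n) (HF n)) as R1.
  pose proof (Hrest _ _ Hd0 Hf) as R2. specialize (HN n Hn).
  replace (l n - l0)%C with (-(csum (F n) L0 - l n) + ((csum (F n) L0 - csum f L0) + (csum f L0 - l0)))%C by ring.
  eapply Rle_lt_trans; [apply Cmod_triangle |]. rewrite Cmod_opp.
  pose proof (Cmod_triangle (csum (F n) L0 - csum f L0) (csum f L0 - l0)). lra.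
Qed.

End Hs.

Definition onfib {A B : Type} (p : A -> B) (b : B) (f : A -> C) (a : A) : C :=
  if eqd (p a) b then f a else 0.

Section Fiber.
Context {A B : Type}.
Variables (p : A -> B) (f : A -> C) (g : A -> R).
Hypothesis Hfg : forall a, Cmod (f a) <= g a.
Variable gB : B -> C.
Hypothesis HB : forall b, hs (onfib p b f) (gB b).

Lemma hs_list_fibers (LB : list B) : NoDup LB ->
  hs (fun a => if in_dec eqd (p a) LB then f a else 0) (csum gB LB).
Proof.
  induction LB as [| b LB IH]; intros Hn.
  - apply hs_zero.
  - inversion Hn; subst. simpl csum.
    eapply hs_ext; [| apply hs_plus; [apply (HB b) | apply IH; auto]].
    intros a. unfold onfib; cbv beta.
    destruct (eqd (p a) b) as [E | E]; destruct (in_dec eqd (p a) LB) as [I1 | I1];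
      destruct (in_dec eqd (p a) (b :: LB)) as [I2 | I2]; simpl in I2;
      try (subst; contradiction); try (exfalso; tauto);
      try (exfalso; apply I2; auto; fail); try ring.
    all: exfalso; destruct I2; auto; congruence.
Qed.

(** Fubini: the sum over finitely many complete fibres differs from l by terms outside these fibres,
    and their total is below the tail of g once the fibres cover the list from [smb_tail]. *)
Lemma hs_fiber l : smb g -> hs f l -> hs gB l.
Proof.
  intros Hg Hl eps He.
  destruct (smb_tail g Hg (eps / 2)) as [L0 [HL0 Ht]]; [lra |].
  exists (nodup eqd (map p L0)). split; [apply NoDup_nodup |].
  intros LB HLB Hi.
  pose proof (hs_minus _ _ _ _ (hs_list_fibers LB HLB) Hl) as Hd.
  apply Rle_lt_trans with (eps / 2); [| lra].
  apply (hs_bound _ (fun a => if in_dec eqd (p a) LB then 0 else g a) _ _ Hd).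
  - intros a. destruct (in_dec eqd (p a) LB).
    + replace (f a - f a)%C with (RtoC 0) by ring. rewrite Cmod_0; lra.
    + replace (0 - f a)%C with (- f a)%C by ring. rewrite Cmod_opp; auto.
  - intros L HL.
    replace (rsum (fun a => if in_dec eqd (p a) LB then 0 else g a) L)
      with (rsum g (filter (fun a => if in_dec eqd (p a) LB then false else true) L)).
    + left. apply Ht; [apply NoDup_filter; auto |].
      intros a Ha Ha0. apply filter_In in Ha. destruct Ha as [_ Ha].
      destruct (in_dec eqd (p a) LB) as [|Hno]; [discriminate |].
      apply Hno, Hi, nodup_In, in_map; auto.
    + clear HL. induction L as [| a L IH]; simpl; auto.
      destruct (in_dec eqd (p a) LB); simpl; rewrite IH; ring.
Qed.

(* Multiplying f by a phase depending on the fibre only makes every fibre sum nonnegative,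
   so absolute summability is inherited. *)
Lemma smb_fiber : smb g -> smb (fun b => Cmod (gB b)).
Proof.
  intros [M [Hp HM]]. exists M. split; [intros; apply Cmod_ge_0 |].
  intros LB HLB.
  set (u := fun b : B => if eqd (gB b) 0 then RtoC 0 else (Cconj (gB b) / Cmod (gB b))%C).
  assert (Hu1 : forall b, Cmod (u b) <= 1).
  { intros b. unfold u. destruct (eqd (gB b) 0) as [E | E]; [rewrite Cmod_0; lra |].
    assert (Cmod (gB b) <> 0) by (intros K; apply E, Cmod_eq_0; auto).
    unfold Cdiv. rewrite Cmod_mult, Cmod_inv, Cmod_conj, Cmod_R.
    - rewrite Rabs_pos_eq by apply Cmod_ge_0. right; field; auto.
    - intros K. apply RtoC_inj in K; auto. }
  assert (Hu2 : forall b, (u b * gB b)%C = Cmod (gB b)).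
  { intros b. unfold u. destruct (eqd (gB b) 0) as [E | E].
    - rewrite E, Cmod_0. ring.
    - assert (Cmod (gB b) <> 0) by (intros K; apply E, Cmod_eq_0; auto).
      assert (RtoC (Cmod (gB b)) <> 0) by (intros K; apply RtoC_inj in K; auto).
      unfold Cdiv. replace (Cconj (gB b) * / Cmod (gB b) * gB b)%C
        with (gB b * Cconj (gB b) * / Cmod (gB b))%C by ring.
      rewrite <- Cmod2_conj. rewrite ?RtoC_pow. field; auto. }
  set (f' := fun a => (u (p a) * f a)%C).
  assert (K : hs (fun a => if in_dec eqd (p a) LB then f' a else 0) (csum (fun b => u b * gB b)%C LB)).
  { clear - HB HLB. induction LB as [| b LB IH].
    - apply hs_zero.
    - inversion HLB; subst. simpl csum.
      eapply hs_ext; [| apply hs_plus; [apply (hs_scal (u b)), (HB b) | apply IH; auto]].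
      intros a. unfold onfib, f'; cbv beta.
      destruct (eqd (p a) b) as [E | E]; destruct (in_dec eqd (p a) LB) as [I1 | I1];
        destruct (in_dec eqd (p a) (b :: LB)) as [I2 | I2]; simpl in I2;
        try (subst; contradiction); try (exfalso; tauto);
        try (exfalso; apply I2; auto; fail); try (subst; ring).
      all: exfalso; destruct I2; auto; congruence. }
  replace (rsum (fun b => Cmod (gB b)) LB) with (Cmod (csum (fun b => u b * gB b)%C LB)).
  - apply (hs_bound _ g _ _ K); auto.
    intros a. destruct (in_dec eqd (p a) LB); [| rewrite Cmod_0; auto].
    unfold f'. rewrite Cmod_mult. specialize (Hu1 (p a)). specialize (Hfg a).
    pose proof (Cmod_ge_0 (f a)). pose proof (Cmod_ge_0 (u (p a))). nra.
  - rewrite (csum_ext_in _ (fun b => RtoC (Cmod (gB b))) LB) by (intros; auto).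
    replace (csum (fun b => RtoC (Cmod (gB b))) LB) with (RtoC (rsum (fun b => Cmod (gB b)) LB)).
    + rewrite Cmod_R. apply Rabs_pos_eq. apply rsum_pos. intros; apply Cmod_ge_0.
    + clear. induction LB as [| b LB IH]; simpl; auto. rewrite RtoC_plus, IH. auto.
Qed.

End Fiber.

Section Reindex.
Context {A B : Type}.
Variable p : A -> B.

Lemma onfib_single (f : A -> C) a0 :
  (forall a, f a <> 0 -> f a0 <> 0 \/ p a = p a0 -> p a = p a0 -> a = a0) ->
  hs (onfib p (p a0) f) (f a0).
Proof.
  intros H.
  replace (f a0) with (onfib p (p a0) f a0).
  - apply hs_single. intros a Ha. unfold onfib. destruct (eqd (p a) (p a0)); auto.
    destruct (eqd (f a) 0); auto. exfalso. apply Ha, H; auto.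
  - unfold onfib. destruct (eqd (p a0) (p a0)); [auto | contradiction].
Qed.

(** A map that is a bijection between the supports of f and fB leaves at most one nonzero term in
    each fibre, so a change of variables becomes a special case of [hs_fiber]. *)
Lemma fibers_reindex (f : A -> C) (fB : B -> C) :
  (forall a a', f a <> 0 -> f a' <> 0 -> p a = p a' -> a = a') ->
  (forall a, f a <> 0 -> fB (p a) = f a) ->
  (forall b, fB b <> 0 -> exists a, f a <> 0 /\ p a = b) ->
  forall b, hs (onfib p b f) (fB b).
Proof.
  intros Hinj Hpull Hsurj b.
  destruct (eqd (fB b) 0) as [E | E].
  - rewrite E. apply (hs_ext (fun _ => 0)); [| apply hs_zero].
    intros a. unfold onfib. destruct (eqd (p a) b) as [Ep | Ep]; auto.
    destruct (eqd (f a) 0) as [|Ef]; auto. subst b. rewrite Hpull in E; auto.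
  - destruct (Hsurj b E) as [a0 [H1 H2]]. subst b. rewrite Hpull by auto.
    apply onfib_single. intros a Ha _ Hp. auto.
Qed.

End Reindex.

Lemma rsum_list_prod {A B : Type} (g1 : A -> R) (g2 : B -> R) LA LB :
  rsum (fun ab => g1 (fst ab) * g2 (snd ab)) (list_prod LA LB) = rsum g1 LA * rsum g2 LB.
Proof.
  induction LA as [| a LA IH]; simpl; [ring |].
  rewrite rsum_app, IH.
  replace (rsum (fun ab => g1 (fst ab) * g2 (snd ab)) (map (fun y => (a, y)) LB)) with (g1 a * rsum g2 LB).
  - ring.
  - clear. induction LB; simpl; [ring | rewrite <- IHLB; ring].
Qed.

Lemma smb_prod {A B : Type} (g1 : A -> R) (g2 : B -> R) :
  smb g1 -> smb g2 -> smb (fun ab => g1 (fst ab) * g2 (snd ab)).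
Proof.
  intros [M1 [Hp1 H1]] [M2 [Hp2 H2]]. exists (M1 * M2). split.
  - intros; apply Rmult_le_pos; auto.
  - intros L HL.
    set (LA := nodup eqd (map fst L)). set (LB := nodup eqd (map snd L)).
    apply Rle_trans with (rsum (fun ab => g1 (fst ab) * g2 (snd ab)) (list_prod LA LB)).
    + apply rsum_incl; auto.
      * intros; apply Rmult_le_pos; auto.
      * intros [a b] Hab. apply in_prod; apply nodup_In.
        -- apply (in_map fst _ _ Hab).
        -- apply (in_map snd _ _ Hab).
    + rewrite rsum_list_prod. apply Rmult_le_compat; try (apply rsum_pos; auto).
      * apply H1, NoDup_nodup.
      * apply H2, NoDup_nodup.
Qed.

Lemma smb_rows {A B : Type} (w : A * B -> R) (rowsum : A -> R) :
  (forall ab, 0 <= w ab) ->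
  (forall a L, NoDup L -> rsum (fun b => w (a, b)) L <= rowsum a) ->
  smb rowsum -> smb w.
Proof.
  intros Hp Hrow [M [Hr HM]]. exists M. split; auto.
  intros L HL.
  set (LA := nodup eqd (map fst L)). set (LB := nodup eqd (map snd L)).
  apply Rle_trans with (rsum w (list_prod LA LB)).
  - apply rsum_incl; auto. intros [a b] Hab. apply in_prod; apply nodup_In.
    + apply (in_map fst _ _ Hab).
    + apply (in_map snd _ _ Hab).
  - apply Rle_trans with (rsum rowsum LA).
    + clearbody LA. assert (HLB : NoDup LB) by apply NoDup_nodup. clearbody LB. clear - Hrow HLB.
      induction LA as [| a LA IH]; simpl; [lra |].
      rewrite rsum_app. apply Rplus_le_compat; auto.
      eapply Rle_trans; [| apply (Hrow a LB); auto].
      clear. induction LB; simpl; lra.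
    + apply HM, NoDup_nodup.
Qed.

Lemma smb_inj {A B : Type} (p : A -> B) (g : B -> R) :
  (forall a a', p a = p a' -> a = a') -> smb g -> smb (fun a => g (p a)).
Proof.
  intros Hinj [M [Hp HM]]. exists M. split; [auto |].
  intros L HL. replace (rsum (fun a => g (p a)) L) with (rsum g (map p L)).
  - apply HM. apply FinFun.Injective_map_NoDup; auto.
  - induction L; simpl; auto. inversion HL; subst. rewrite IHL; auto.
Qed.

Lemma smb_push {A B : Type} (q : B -> A) (g : A -> R) (h : B -> R) :
  (forall b, 0 <= h b) ->
  (forall b, h b <> 0 -> h b <= g (q b)) ->
  (forall b b', h b <> 0 -> h b' <> 0 -> q b = q b' -> b = b') ->
  smb g -> smb h.
Proof.
  intros Hh Hle Hinj [M [Hp HM]]. exists M. split; auto.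
  intros L HL.
  set (L' := filter (fun b => if eqd (h b) 0 then false else true) L).
  assert (E : rsum h L = rsum h L').
  { unfold L'. clear. induction L as [| b L IH]; simpl; auto.
    destruct (eqd (h b) 0) as [E | E]; simpl; rewrite IH; lra. }
  assert (Hs : forall b, In b L' -> h b <> 0).
  { intros b Hb. apply filter_In in Hb. destruct Hb as [_ Hb].
    destruct (eqd (h b) 0); [discriminate | auto]. }
  assert (HN : NoDup L') by (apply NoDup_filter; auto).
  clearbody L'. rewrite E. apply Rle_trans with (rsum g (map q L')).
  - clear - Hs Hle. induction L' as [| b L' IH]; simpl; [lra |].
    apply Rplus_le_compat.
    + apply Hle, Hs; simpl; auto.
    + apply IH. intros; apply Hs; simpl; auto.
  - apply HM.
    clear - HN Hs Hinj. induction L' as [| b L' IH]; simpl; [constructor |].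
    inversion HN; subst. constructor.
    + intros Hin. apply in_map_iff in Hin. destruct Hin as [b' [E Hb']].
      assert (b' = b) by (apply Hinj; auto; apply Hs; simpl; auto). subst; contradiction.
    + apply IH; auto. intros; apply Hs; simpl; auto.
Qed.

(** The total exists by domination, and summing it by rows identifies it as l1 l2. *)
Lemma hs_pair {A B : Type} (f1 : A -> C) (f2 : B -> C) g1 g2 l1 l2 :
  (forall a, Cmod (f1 a) <= g1 a) -> (forall b, Cmod (f2 b) <= g2 b) -> smb g1 -> smb g2 ->
  hs f1 l1 -> hs f2 l2 ->
  hs (fun ab => f1 (fst ab) * f2 (snd ab))%C (l1 * l2)%C.
Proof.
  intros H1 H2 S1 S2 K1 K2.
  assert (Hd : forall ab : A * B, Cmod (f1 (fst ab) * f2 (snd ab)) <= g1 (fst ab) * g2 (snd ab)).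
  { intros [a b]. simpl. rewrite Cmod_mult. apply Rmult_le_compat; auto; apply Cmod_ge_0. }
  destruct (hs_exists _ _ Hd (smb_prod _ _ S1 S2)) as [l Hl].
  assert (Hrow : hs (fun a => f1 a * l2)%C l).
  { apply (hs_fiber fst _ _ Hd (fun a => f1 a * l2)%C) with (l := l); auto; [| apply smb_prod; auto].
    intros a.
    assert (E : exists m, hs (onfib fst a (fun ab : A * B => f1 (fst ab) * f2 (snd ab))%C) m).
    { apply hs_exists with (fun ab => g1 (fst ab) * g2 (snd ab)); [| apply smb_prod; auto].
      intros ab. unfold onfib. destruct (eqd (fst ab) a); auto.
      rewrite Cmod_0. eapply Rle_trans; [| apply Hd]. apply Cmod_ge_0. }
    destruct E as [m Hm].
    assert (hs (fun b => f1 a * f2 b)%C m).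
    { eapply (hs_fiber snd _ (fun ab => g1 (fst ab) * g2 (snd ab))); [| | apply smb_prod; auto | exact Hm].
      - intros ab. unfold onfib. destruct (eqd (fst ab) a); auto.
        rewrite Cmod_0. eapply Rle_trans; [| apply Hd]. apply Cmod_ge_0.
      - intros b. replace (f1 a * f2 b)%C with
          (onfib snd b (onfib fst a (fun ab : A * B => f1 (fst ab) * f2 (snd ab))%C) (a, b)).
        + apply hs_single. intros [a' b'] Hne. unfold onfib. simpl.
          destruct (eqd b' b); auto. destruct (eqd a' a); auto. subst; contradiction.
        + unfold onfib; simpl. destruct (eqd b b); [| contradiction]. destruct (eqd a a); [auto | contradiction]. }
    rewrite (hs_unique _ _ _ (hs_scal (f1 a) _ _ K2) H). auto. }
  replace (l1 * l2)%C with l; auto.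
  assert (K : hs (fun a => f1 a * l2)%C (l2 * l1)%C).
  { eapply hs_ext; [| apply (hs_scal l2 _ _ K1)]. intros; cbv beta; ring. }
  rewrite (hs_unique _ _ _ Hrow K). ring.
Qed.

Lemma rsum_seq_le (g : nat -> R) L : (forall n, 0 <= g n) -> NoDup L ->
  exists N, rsum g L <= rsum g (seq 0 N).
Proof.
  intros Hg HL. exists (S (fold_right max 0%nat L)). apply rsum_incl; auto.
  intros n Hn. apply in_seq. split; [lia |]. clear - Hn.
  induction L as [| m L IH]; simpl in *; [tauto |]. destruct Hn as [-> | Hn]; [lia |].
  specialize (IH Hn). lia.
Qed.

Lemma smb_nat (g : nat -> R) M : (forall n, 0 <= g n) ->
  (forall N, rsum g (seq 0 N) <= M) -> smb g.
Proof.
  intros Hg HM. exists M. split; auto. intros L HL.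
  destruct (rsum_seq_le g L Hg HL) as [N HN]. eapply Rle_trans; eauto.
Qed.

Lemma hs_nat_lim (f : nat -> C) l : hs f l ->
  forall eps, 0 < eps -> exists N, forall n, (N <= n)%nat -> Cmod (csum f (seq 0 n) - l) < eps.
Proof.
  intros H. apply (hs_lim f l (fun n => seq 0 n) H).
  - intros; apply seq_NoDup.
  - intros t _. exists (S t). intros n Hn. apply in_seq; lia.
Qed.

Lemma smb_telescope (g h : nat -> R) : (forall n, 0 <= g n) -> (forall n, 0 <= h n) ->
  (forall n, g n <= h n - h (S n)) -> smb g.
Proof.
  intros Hg Hh H. apply (smb_nat _ (h 0%nat)); auto.
  assert (forall N k, rsum g (seq k N) <= h k - h (k + N)%nat).
  { induction N; intros k; simpl.
    - rewrite Nat.add_0_r. lra.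
    - specialize (IHN (S k)). specialize (H k). replace (k + S N)%nat with (S k + N)%nat by lia. lra. }
  intros N. specialize (H0 N 0%nat). specialize (Hh (0 + N)%nat). lra.
Qed.

Lemma smb_geom x : 0 <= x < 1 -> smb (fun n => x ^ n).
Proof.
  intros Hx. apply (smb_telescope _ (fun n => x ^ n / (1 - x))).
  - intros; apply pow_le; lra.
  - intros n. apply Rmult_le_pos; [apply pow_le; lra | left; apply Rinv_0_lt_compat; lra].
  - intros n. simpl. right. field. lra.
Qed.

Lemma smb_Z (g : Z -> R) (h : nat -> R) : (forall m, 0 <= g m <= h (Z.abs_nat m)) -> smb h -> smb g.
Proof.
  intros Hg [M [Hp HM]]. exists (M + M). split; [intros; apply Hg |].
  intros L HL.
  set (L1 := filter (fun m => (0 <=? m)%Z) L). set (L2 := filter (fun m => negb (0 <=? m)%Z) L).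
  assert (E : rsum g L = rsum g L1 + rsum g L2).
  { unfold L1, L2. clear. induction L as [| a L IH]; simpl; [ring |].
    destruct (0 <=? a)%Z; simpl; rewrite IH; ring. }
  assert (K : forall L', NoDup (map Z.abs_nat L') -> rsum g L' <= M).
  { intros L' Hn. eapply Rle_trans; [| apply (HM _ Hn)]. clear - Hg.
    induction L'; simpl; [lra |]. apply Rplus_le_compat; auto. apply Hg. }
  rewrite E. apply Rplus_le_compat; apply K.
  - assert (HN : NoDup L1) by (apply NoDup_filter; auto).
    assert (Hs : forall m, In m L1 -> (0 <= m)%Z) by (intros m Hm; apply filter_In in Hm; lia).
    clearbody L1. clear - HN Hs. induction L1 as [| b L1 IH]; simpl; [constructor |]. inversion HN; subst.
    constructor; [| apply IH; auto; intros; apply Hs; simpl; auto].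
    intros Hin. apply in_map_iff in Hin. destruct Hin as [b' [E Hb']].
    assert (b' = b); [| subst; auto]. pose proof (Hs b' (or_intror Hb')). pose proof (Hs b (or_introl eq_refl)). lia.
  - assert (HN : NoDup L2) by (apply NoDup_filter; auto).
    assert (Hs : forall m, In m L2 -> (m < 0)%Z) by (intros m Hm; apply filter_In in Hm; lia).
    clearbody L2. clear - HN Hs. induction L2 as [| b L2 IH]; simpl; [constructor |]. inversion HN; subst.
    constructor; [| apply IH; auto; intros; apply Hs; simpl; auto].
    intros Hin. apply in_map_iff in Hin. destruct Hin as [b' [E Hb']].
    assert (b' = b); [| subst; auto]. pose proof (Hs b' (or_intror Hb')). pose proof (Hs b (or_introl eq_refl)). lia.
Qed.

(** * Integrals of complex-valued functions and the Gaussian *)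

Definition cexp (z : C) : C := (exp (Re z) * cos (Im z), exp (Re z) * sin (Im z)).

Lemma C_eq (x y : C) : Re x = Re y -> Im x = Im y -> x = y.
Proof. destruct x, y; simpl; congruence. Qed.

Lemma Re_plus (x y : C) : Re (x + y) = Re x + Re y. Proof. reflexivity. Qed.
Lemma Im_plus (x y : C) : Im (x + y) = Im x + Im y. Proof. reflexivity. Qed.
Lemma Re_opp (x : C) : Re (- x) = - Re x. Proof. reflexivity. Qed.
Lemma Im_opp (x : C) : Im (- x) = - Im x. Proof. reflexivity. Qed.
Lemma Re_minus (x y : C) : Re (x - y) = Re x - Re y. Proof. reflexivity. Qed.
Lemma Im_minus (x y : C) : Im (x - y) = Im x - Im y. Proof. reflexivity. Qed.
Lemma Re_mult (x y : C) : Re (x * y) = Re x * Re y - Im x * Im y. Proof. reflexivity. Qed.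
Lemma Im_mult (x y : C) : Im (x * y) = Re x * Im y + Im x * Re y. Proof. reflexivity. Qed.
Lemma Re_R (x : R) : Re (RtoC x) = x. Proof. reflexivity. Qed.
Lemma Im_R (x : R) : Im (RtoC x) = 0. Proof. reflexivity. Qed.
Lemma Re_RM (x : R) (y : C) : Re (x * y)%C = x * Re y.
Proof. rewrite Re_mult, Re_R, Im_R; ring. Qed.
Lemma Im_RM (x : R) (y : C) : Im (x * y)%C = x * Im y.
Proof. rewrite Im_mult, Re_R, Im_R; ring. Qed.

Ltac cri := repeat progress rewrite ?Re_plus, ?Im_plus, ?Re_minus, ?Im_minus, ?Re_opp, ?Im_opp, ?Re_mult, ?Im_mult, ?Re_R, ?Im_R.

Lemma cexp_plus (x y : C) : cexp (x + y) = (cexp x * cexp y)%C.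
Proof.
  unfold cexp. apply C_eq; cri; unfold Re, Im; simpl; rewrite exp_plus, ?cos_plus, ?sin_plus; ring.
Qed.

Lemma cexp_0 : cexp 0 = 1.
Proof. unfold cexp. apply C_eq; simpl; rewrite exp_0, ?cos_0, ?sin_0; ring. Qed.

Lemma Cmod_cexp (z : C) : Cmod (cexp z) = exp (Re z).
Proof.
  unfold Cmod, cexp; simpl.
  replace (exp (Re z) * cos (Im z) * (exp (Re z) * cos (Im z) * 1) +
    exp (Re z) * sin (Im z) * (exp (Re z) * sin (Im z) * 1))
    with (exp (Re z) * exp (Re z) * ((sin (Im z))² + (cos (Im z))²)) by (unfold Rsqr; ring).
  rewrite sin2_cos2, Rmult_1_r. apply sqrt_square. left; apply exp_pos.
Qed.

Lemma cexp_neq_0 (z : C) : cexp z <> 0.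
Proof.
  intros H. assert (K : Cmod (cexp z) = 0) by (rewrite H; apply Cmod_0).
  rewrite Cmod_cexp in K. pose proof (exp_pos (Re z)); lra.
Qed.

Lemma cexp_R (x : R) : cexp x = exp x.
Proof. unfold cexp. apply C_eq; simpl; rewrite ?cos_0, ?sin_0; ring. Qed.

Lemma Cmod_RM (x : R) (z : C) : 0 <= x -> Cmod (x * z) = x * Cmod z.
Proof. intros. rewrite Cmod_mult, Cmod_R, Rabs_pos_eq; auto. Qed.

Lemma Cmod_Re_le (z : C) : Re z <= Cmod z.
Proof. eapply Rle_trans; [apply Rle_abs | apply re_le_Cmod]. Qed.

Lemma Cmod_ReIm (z : C) : Cmod z <= Rabs (Re z) + Rabs (Im z).
Proof.
  assert (E : z = (RtoC (Re z) + Ci * RtoC (Im z))%C).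
  { apply C_eq; cri; simpl; ring. }
  rewrite E at 1. eapply Rle_trans; [apply Cmod_triangle |]. rewrite Cmod_mult, !Cmod_R.
  replace (Cmod Ci) with 1; [lra |].
  unfold Cmod, Ci; simpl. replace (0 * (0 * 1) + 1 * (1 * 1)) with 1 by ring. symmetry; apply sqrt_1.
Qed.

Lemma Cmod_dist (x y : C) : Cmod x - Cmod y <= Cmod (x - y).
Proof.
  pose proof (Cmod_triangle (x - y) y). replace (x - y + y)%C with x in H by ring. lra.
Qed.

(** Componentwise real derivatives: the variable is real, and the integrals [CI] are pairs of real
    Riemann integrals. *)
Definition Dc (f : R -> C) (x : R) (l : C) : Prop :=
  is_derive (fun t => Re (f t)) x (Re l) /\ is_derive (fun t => Im (f t)) x (Im l).

Definition Cc (f : R -> C) (x : R) : Prop :=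
  continuity_pt (fun t => Re (f t)) x /\ continuity_pt (fun t => Im (f t)) x.

Definition CI (f : R -> C) (a b : R) : C :=
  (RInt (fun t => Re (f t)) a b, RInt (fun t => Im (f t)) a b).

Lemma Dc_ext f1 f2 x l : (forall t, f1 t = f2 t) -> Dc f1 x l -> Dc f2 x l.
Proof.
  intros E [H1 H2]. split; [apply (is_derive_ext (fun t => Re (f1 t))) | apply (is_derive_ext (fun t => Im (f1 t)))];
  auto; intros; rewrite E; auto.
Qed.

Lemma Dc_eq f x l l' : l = l' -> Dc f x l -> Dc f x l'.
Proof. intros ->; auto. Qed.

Lemma Dc_const a x : Dc (fun _ => a) x 0.
Proof. split; apply (is_derive_const (V := R_NormedModule)). Qed.

Lemma Dc_plus f g x l m : Dc f x l -> Dc g x m -> Dc (fun t => f t + g t)%C x (l + m)%C.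
Proof. intros [H1 H2] [H3 H4]. split; apply (is_derive_plus (V := R_NormedModule)); auto. Qed.

Lemma Dc_mult f g x l m : Dc f x l -> Dc g x m -> Dc (fun t => f t * g t)%C x (l * g x + f x * m)%C.
Proof.
  intros [H1 H2] [H3 H4]. split.
  - apply (is_derive_ext (fun t => Re (f t) * Re (g t) - Im (f t) * Im (g t))); [reflexivity |].
    replace (Re (l * g x + f x * m)) with
      ((Re l * Re (g x) + Re (f x) * Re m) - (Im l * Im (g x) + Im (f x) * Im m)) by (cri; ring).
    apply (is_derive_minus (V := R_NormedModule)); apply (is_derive_mult (K := R_AbsRing)); auto; intros; apply Rmult_comm.
  - apply (is_derive_ext (fun t => Re (f t) * Im (g t) + Im (f t) * Re (g t))); [reflexivity |].
    replace (Im (l * g x + f x * m)) with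
      ((Re l * Im (g x) + Re (f x) * Im m) + (Im l * Re (g x) + Im (f x) * Re m)) by (cri; ring).
    apply (is_derive_plus (V := R_NormedModule)); apply (is_derive_mult (K := R_AbsRing)); auto; intros; apply Rmult_comm.
Qed.

Lemma Dc_R (u : R -> R) x l : is_derive u x l -> Dc (fun t => RtoC (u t)) x (RtoC l).
Proof. intros H. split; simpl; auto. apply (is_derive_const (V := R_NormedModule)). Qed.

Lemma Dc_id x : Dc (fun t => RtoC t) x 1.
Proof. apply Dc_R. apply (is_derive_id (K := R_AbsRing)). Qed.

Lemma Dc_cexp f x l : Dc f x l -> Dc (fun t => cexp (f t)) x (l * cexp (f x))%C.
Proof.
  intros [H1 H2].
  assert (E : is_derive (fun t => exp (Re (f t))) x (Re l * exp (Re (f x)))).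
  { apply (is_derive_comp (V := R_NormedModule) exp (fun t => Re (f t))); auto.
    apply is_derive_Reals, derivable_pt_lim_exp. }
  split.
  - apply (is_derive_ext (fun t => exp (Re (f t)) * cos (Im (f t)))); [reflexivity |].
    replace (Re (l * cexp (f x))) with
      (Re l * exp (Re (f x)) * cos (Im (f x)) + exp (Re (f x)) * (Im l * - sin (Im (f x))))
      by (cri; unfold cexp; simpl; ring).
    apply (is_derive_mult (K := R_AbsRing) (fun t => exp (Re (f t))) (fun t => cos (Im (f t)))); [exact E | | intros; apply Rmult_comm].
    apply (is_derive_comp (V := R_NormedModule) cos (fun t => Im (f t))); auto.
    apply is_derive_Reals, derivable_pt_lim_cos.
  - apply (is_derive_ext (fun t => exp (Re (f t)) * sin (Im (f t)))); [reflexivity |].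
    replace (Im (l * cexp (f x))) with
      (Re l * exp (Re (f x)) * sin (Im (f x)) + exp (Re (f x)) * (Im l * cos (Im (f x))))
      by (cri; unfold cexp; simpl; ring).
    apply (is_derive_mult (K := R_AbsRing) (fun t => exp (Re (f t))) (fun t => sin (Im (f t)))); [exact E | | intros; apply Rmult_comm].
    apply (is_derive_comp (V := R_NormedModule) sin (fun t => Im (f t))); auto.
    apply is_derive_Reals, derivable_pt_lim_sin.
Qed.

Lemma Dc_pow f x l k : Dc f x l -> Dc (fun t => f t ^ k)%C x (INR k * l * f x ^ (k - 1))%C.
Proof.
  intros H. induction k.
  - eapply Dc_eq; [| apply (Dc_const 1)]. simpl. ring.
  - apply (Dc_ext (fun t => f t * f t ^ k)%C); [intros; rewrite Cpow_S; reflexivity |].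
    eapply Dc_eq; [| apply Dc_mult; eauto].
    rewrite S_INR, RtoC_plus. destruct k.
    + simpl. ring.
    + replace (S (S k) - 1)%nat with (S k) by lia. replace (S k - 1)%nat with k by lia.
      rewrite !Cpow_S. ring.
Qed.

Lemma Dc_Cc f x l : Dc f x l -> Cc f x.
Proof.
  intros [H1 H2]; split; apply continuity_pt_filterlim.
  - apply (ex_derive_continuous (V := R_NormedModule)); eexists; eauto.
  - apply (ex_derive_continuous (V := R_NormedModule)); eexists; eauto.
Qed.

Definition Cci f a b := forall x, a <= x <= b -> Cc f x.

Lemma cont_ex_RInt (u : R -> R) a b : a <= b -> (forall x, a <= x <= b -> continuity_pt u x) -> ex_RInt u a b.
Proof.
  intros Hab H. apply (ex_RInt_continuous (V := R_CompleteNormedModule)).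
  rewrite Rmin_left, Rmax_right by auto. intros z Hz. apply continuity_pt_filterlim, H; auto.
Qed.

Lemma Cci_ex f a b : a <= b -> Cci f a b ->
  ex_RInt (fun t => Re (f t)) a b /\ ex_RInt (fun t => Im (f t)) a b.
Proof. intros Hab H; split; apply cont_ex_RInt; auto; intros; apply H; auto. Qed.

Lemma CI_FTC F f a b : a <= b -> (forall x, a <= x <= b -> Dc F x (f x)) -> Cci f a b ->
  CI f a b = (F b - F a)%C.
Proof.
  intros Hab HD Hc. apply C_eq; cri; simpl.
  - apply is_RInt_unique. apply (is_RInt_derive (V := R_CompleteNormedModule) (fun t => Re (F t))).
    + rewrite Rmin_left, Rmax_right by auto. intros; apply HD; auto.
    + rewrite Rmin_left, Rmax_right by auto. intros; apply continuity_pt_filterlim, Hc; auto.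
  - apply is_RInt_unique. apply (is_RInt_derive (V := R_CompleteNormedModule) (fun t => Im (F t))).
    + rewrite Rmin_left, Rmax_right by auto. intros; apply HD; auto.
    + rewrite Rmin_left, Rmax_right by auto. intros; apply continuity_pt_filterlim, Hc; auto.
Qed.

Lemma CI_ext f g a b : (forall x, Rmin a b < x < Rmax a b -> f x = g x) -> CI f a b = CI g a b.
Proof. intros H. unfold CI. f_equal; apply RInt_ext; intros; rewrite H; auto. Qed.

Lemma CI_plus f g a b : a <= b -> Cci f a b -> Cci g a b ->
  CI (fun t => f t + g t)%C a b = (CI f a b + CI g a b)%C.
Proof.
  intros Hab Hf Hg. destruct (Cci_ex f a b Hab Hf), (Cci_ex g a b Hab Hg).
  apply C_eq; cri; simpl; apply (RInt_plus (V := R_CompleteNormedModule)); auto.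
Qed.

Lemma CI_scal c f a b : a <= b -> Cci f a b -> CI (fun t => c * f t)%C a b = (c * CI f a b)%C.
Proof.
  intros Hab Hf. destruct (Cci_ex f a b Hab Hf) as [H1 H2].
  apply C_eq; cri; simpl.
  - rewrite (RInt_ext _ (fun t => minus (scal (Re c) (Re (f t))) (scal (Im c) (Im (f t))))) by (intros; reflexivity).
    rewrite (RInt_minus (V := R_CompleteNormedModule)); [| apply (ex_RInt_scal (V := R_NormedModule)); auto ..].
    rewrite !(RInt_scal (V := R_CompleteNormedModule)) by auto. reflexivity.
  - rewrite (RInt_ext _ (fun t => plus (scal (Re c) (Im (f t))) (scal (Im c) (Re (f t))))) by (intros; reflexivity).
    rewrite (RInt_plus (V := R_CompleteNormedModule)); [| apply (ex_RInt_scal (V := R_NormedModule)); auto ..].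
    rewrite !(RInt_scal (V := R_CompleteNormedModule)) by auto. reflexivity.
Qed.

Lemma CI_Chasles f a b c : a <= b -> b <= c -> Cci f a c -> (CI f a b + CI f b c = CI f a c)%C.
Proof.
  intros Hab Hbc Hf.
  destruct (Cci_ex f a b Hab); [intros x Hx; apply Hf; lra |].
  destruct (Cci_ex f b c Hbc); [intros x Hx; apply Hf; lra |].
  apply C_eq; cri; simpl; apply (RInt_Chasles (V := R_CompleteNormedModule)); auto.
Qed.

(** Multiplying f by the unit u that cancels the phase of the integral makes the integral equal to
    its modulus; then Re (u f) <= |f| <= g reduces the claim to real integrals. *)
Lemma CI_bound f (g : R -> R) a b : a <= b -> Cci f a b -> ex_RInt g a b ->
  (forall x, a <= x <= b -> Cmod (f x) <= g x) -> Cmod (CI f a b) <= RInt g a b.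
Proof.
  intros Hab Hf Hg Hle.
  set (w := CI f a b). destruct (Req_dec (Cmod w) 0) as [E | E].
  - rewrite E. apply RInt_ge_0; auto. intros x Hx.
    eapply Rle_trans; [apply Cmod_ge_0 | apply Hle; lra].
  - assert (Ew : RtoC (Cmod w) <> 0) by (intros K; apply RtoC_inj in K; auto).
    set (u := (Cconj w / Cmod w)%C).
    assert (Hu : Cmod u = 1).
    { unfold u, Cdiv. rewrite Cmod_mult, Cmod_inv, Cmod_conj, Cmod_R by auto.
      rewrite Rabs_pos_eq by apply Cmod_ge_0. field; auto. }
    assert (Hw : Cmod w = Re (CI (fun t => u * f t)%C a b)).
    { rewrite CI_scal by auto. fold w. unfold u.
      replace (Cconj w / Cmod w * w)%C with (w * Cconj w / Cmod w)%C by (field; auto).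
      rewrite <- Cmod2_conj. rewrite ?RtoC_pow.
      replace ((RtoC (Cmod w)) ^ 2 / Cmod w)%C with (RtoC (Cmod w)) by (field; auto). reflexivity. }
    rewrite Hw. simpl. apply RInt_le; auto.
    + apply (cont_ex_RInt (fun t => Re u * Re (f t) - Im u * Im (f t))); auto.
      intros x Hx. destruct (Hf x Hx). apply continuity_pt_minus; apply continuity_pt_mult; auto;
      apply continuity_pt_const; intros ? ?; auto.
    + intros x Hx. eapply Rle_trans; [apply (Cmod_Re_le (u * f x))|].
      rewrite Cmod_mult, Hu, Rmult_1_l. apply Hle; lra.
Qed.

Lemma CI_bound_const f M a b : a <= b -> Cci f a b ->
  (forall x, a <= x <= b -> Cmod (f x) <= M) -> Cmod (CI f a b) <= (b - a) * M.
Proof.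
  intros Hab Hf Hle.
  replace ((b - a) * M) with (RInt (fun _ => M) a b) by (rewrite RInt_const; reflexivity).
  apply CI_bound; auto. apply ex_RInt_const.
Qed.

Lemma Cc_mult f g x : Cc f x -> Cc g x -> Cc (fun t => f t * g t)%C x.
Proof.
  intros [H1 H2] [H3 H4]. split.
  - apply (continuity_pt_minus (fun t => Re (f t) * Re (g t)) (fun t => Im (f t) * Im (g t)));
    apply continuity_pt_mult; auto.
  - apply (continuity_pt_plus (fun t => Re (f t) * Im (g t)) (fun t => Im (f t) * Re (g t)));
    apply continuity_pt_mult; auto.
Qed.

Lemma Cc_plus f g x : Cc f x -> Cc g x -> Cc (fun t => f t + g t)%C x.
Proof.
  intros [H1 H2] [H3 H4]. split.
  - apply (continuity_pt_plus (fun t => Re (f t)) (fun t => Re (g t))); auto.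
  - apply (continuity_pt_plus (fun t => Im (f t)) (fun t => Im (g t))); auto.
Qed.

Lemma Cc_const a x : Cc (fun _ => a) x.
Proof. split; apply continuity_pt_const; intros ? ?; auto. Qed.

Lemma Cc_csum {T : Type} (f : T -> R -> C) (L : list T) x :
  (forall t, Cc (f t) x) -> Cc (fun w => fold_right (fun t a => f t w + a)%C 0 L) x.
Proof. intros H. induction L; simpl; [apply Cc_const | apply Cc_plus; auto]. Qed.

Lemma CI_csum {T : Type} (f : T -> R -> C) (L : list T) a b : a <= b ->
  (forall t, Cci (f t) a b) ->
  CI (fun w => fold_right (fun t s => f t w + s)%C 0 L) a b = fold_right (fun t s => CI (f t) a b + s)%C 0 L.
Proof.
  intros Hab H. induction L; simpl.
  - unfold CI. simpl. rewrite !RInt_const. unfold scal; simpl. unfold mult; simpl. rewrite Rmult_0_r; auto.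
  - rewrite CI_plus; auto.
    + rewrite IHL; auto.
    + intros x Hx. apply Cc_csum. intros t; apply H; auto.
Qed.

Definition Cc2 (f : R -> R -> C) (x y : R) : Prop :=
  continuity_2d_pt (fun u v => Re (f u v)) x y /\ continuity_2d_pt (fun u v => Im (f u v)) x y.

Lemma Cc2_const a x y : Cc2 (fun _ _ => a) x y.
Proof. split; apply continuity_2d_pt_const. Qed.
Lemma Cc2_1 x y : Cc2 (fun u _ => RtoC u) x y.
Proof. split; [exact (continuity_2d_pt_id1 x y) | exact (continuity_2d_pt_const x y 0)]. Qed.
Lemma Cc2_2 x y : Cc2 (fun _ v => RtoC v) x y.
Proof. split; [exact (continuity_2d_pt_id2 x y) | exact (continuity_2d_pt_const x y 0)]. Qed.
Lemma Cc2_plus f g x y : Cc2 f x y -> Cc2 g x y -> Cc2 (fun u v => f u v + g u v)%C x y.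
Proof.
  intros [H1 H2] [H3 H4]; split.
  - apply (continuity_2d_pt_plus (fun u v => Re (f u v)) (fun u v => Re (g u v))); auto.
  - apply (continuity_2d_pt_plus (fun u v => Im (f u v)) (fun u v => Im (g u v))); auto.
Qed.
Lemma Cc2_mult f g x y : Cc2 f x y -> Cc2 g x y -> Cc2 (fun u v => f u v * g u v)%C x y.
Proof.
  intros [H1 H2] [H3 H4]; split.
  - apply (continuity_2d_pt_minus (fun u v => Re (f u v) * Re (g u v)) (fun u v => Im (f u v) * Im (g u v)));
    apply continuity_2d_pt_mult; auto.
  - apply (continuity_2d_pt_plus (fun u v => Re (f u v) * Im (g u v)) (fun u v => Im (f u v) * Re (g u v)));
    apply continuity_2d_pt_mult; auto.
Qed.
Lemma Cc2_cexp f x y : Cc2 f x y -> Cc2 (fun u v => cexp (f u v)) x y.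
Proof.
  intros [H1 H2].
  assert (E : continuity_2d_pt (fun u v => exp (Re (f u v))) x y).
  { apply (continuity_1d_2d_pt_comp exp); auto. apply derivable_continuous_pt, derivable_pt_exp. }
  split.
  - apply (continuity_2d_pt_mult (fun u v => exp (Re (f u v))) (fun u v => cos (Im (f u v)))); auto.
    apply (continuity_1d_2d_pt_comp cos); auto. apply derivable_continuous_pt, derivable_pt_cos.
  - apply (continuity_2d_pt_mult (fun u v => exp (Re (f u v))) (fun u v => sin (Im (f u v)))); auto.
    apply (continuity_1d_2d_pt_comp sin); auto. apply derivable_continuous_pt, derivable_pt_sin.
Qed.
Lemma Cc2_pow f x y k : Cc2 f x y -> Cc2 (fun u v => f u v ^ k)%C x y.
Proof.
  intros H. induction k; simpl; [apply Cc2_const | apply Cc2_mult; auto].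
Qed.

Lemma CI_param (X dX : R -> R -> C) a b x : a <= b ->
  (forall u v, Dc (fun z => X z v) u (dX u v)) ->
  (forall u v, Cc2 dX u v) -> (forall u, Cci (X u) a b) ->
  Dc (fun u => CI (X u) a b) x (CI (dX x) a b).
Proof.
  intros Hab HD HC HX. split; simpl.
  - replace (RInt (fun t => Re (dX x t)) a b) with (RInt (fun t => Derive (fun u => Re (X u t)) x) a b).
    + apply is_derive_RInt_param.
      * apply filter_forall. intros u t _. exists (Re (dX u t)). exact (proj1 (HD u t)).
      * intros t _. apply (continuity_2d_pt_ext (fun u v => Re (dX u v))); [| exact (proj1 (HC x t))].
        intros u v. symmetry. apply is_derive_unique. exact (proj1 (HD _ _)).
      * apply filter_forall. intros u. exact (proj1 (Cci_ex _ a b Hab (HX u))).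
    + apply RInt_ext. intros t _. apply is_derive_unique. exact (proj1 (HD _ _)).
  - replace (RInt (fun t => Im (dX x t)) a b) with (RInt (fun t => Derive (fun u => Im (X u t)) x) a b).
    + apply is_derive_RInt_param.
      * apply filter_forall. intros u t _. exists (Im (dX u t)). exact (proj2 (HD u t)).
      * intros t _. apply (continuity_2d_pt_ext (fun u v => Im (dX u v))); [| exact (proj2 (HC x t))].
        intros u v. symmetry. apply is_derive_unique. exact (proj2 (HD _ _)).
      * apply filter_forall. intros u. exact (proj2 (Cci_ex _ a b Hab (HX u))).
    + apply RInt_ext. intros t _. apply is_derive_unique. exact (proj2 (HD _ _)).
Qed.

Lemma CI_mvt F f M a b : a <= b -> (forall x, Dc F x (f x)) -> Cci f a b ->
  (forall x, a <= x <= b -> Cmod (f x) <= M) -> Cmod (F b - F a) <= (b - a) * M.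
Proof.
  intros Hab HD Hc HM. rewrite <- (CI_FTC F f a b) by auto. apply CI_bound_const; auto.
Qed.

(** * Gaussian integrals along complex lines *)

Definition gk (k : nat) (u : C) : C := (u ^ k * cexp (- (u * u)))%C.
(** The derivative of [gk k]; for k = 0 the truncated exponent k - 1 occurs with the coefficient
    [INR 0]. *)
Definition dgk (k : nat) (u : C) : C := ((INR k * u ^ (k - 1) - 2 * u ^ (k + 1)) * cexp (- (u * u)))%C.

Lemma Dc_opp f x l : Dc f x l -> Dc (fun t => - f t)%C x (- l)%C.
Proof.
  intros H. apply (Dc_ext (fun t => (-(1)) * f t)%C); [intros; ring |].
  eapply Dc_eq; [| apply Dc_mult; [apply Dc_const | apply H]]. cbv beta. ring.
Qed.

Lemma Dc_gk k f x l : Dc f x l -> Dc (fun t => gk k (f t)) x (l * dgk k (f x))%C.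
Proof.
  intros H. unfold gk. eapply Dc_eq; [| apply Dc_mult; [apply Dc_pow; eauto | apply Dc_cexp, Dc_opp, Dc_mult; eauto]].
  unfold dgk. rewrite Cpow_add_r, Cpow_1_r. ring.
Qed.

Lemma Cc2_opp f x y : Cc2 f x y -> Cc2 (fun u v => - f u v)%C x y.
Proof.
  intros [H1 H2]; split.
  - apply (continuity_2d_pt_opp (fun u v => Re (f u v))); auto.
  - apply (continuity_2d_pt_opp (fun u v => Im (f u v))); auto.
Qed.

Lemma Cc2_gk k f x y : Cc2 f x y -> Cc2 (fun u v => gk k (f u v)) x y.
Proof. intros H. apply Cc2_mult; [apply Cc2_pow | apply Cc2_cexp, Cc2_opp, Cc2_mult]; auto. Qed.

Lemma Cc2_dgk k f x y : Cc2 f x y -> Cc2 (fun u v => dgk k (f u v)) x y.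
Proof.
  intros H. apply Cc2_mult; [| apply Cc2_cexp, Cc2_opp, Cc2_mult; auto].
  apply Cc2_plus; [apply Cc2_mult; [apply Cc2_const | apply Cc2_pow; auto] |].
  apply Cc2_opp, Cc2_mult; [apply Cc2_const | apply Cc2_pow; auto].
Qed.

(* Cauchy's theorem for the family of affine paths from v to c v + d: the integral of
   u^k exp(-u^2) along them varies only through the end points. *)
Lemma gauss_homotopy k (c d : C) a b M : a <= b ->
  (forall x v, 0 <= x <= 1 -> v = a \/ v = b ->
     Cmod (((c - 1) * v + d) * gk k ((1 + x * (c - 1)) * v + x * d)) <= M) ->
  Cmod (CI (fun v => c * gk k (c * v + d))%C a b - CI (fun v => gk k v) a b) <= 2 * M.
Proof.
  intros Hab HM.
  set (P := fun x v : R => ((1 + x * (c - 1)) * v + x * d)%C).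
  (* X and Y are the dv- and dx-coefficients of the pullback of u^k exp(-u^2) du under P. The form
     is closed, so the x-derivative of X and the v-derivative of Y are the same function [dX]. *)
  set (X := fun x v : R => ((1 + x * (c - 1)) * gk k (P x v))%C).
  set (Y := fun x v : R => (((c - 1) * v + d) * gk k (P x v))%C).
  set (dX := fun x v : R => ((c - 1) * gk k (P x v) + (1 + x * (c - 1)) * (((c - 1) * v + d) * dgk k (P x v)))%C).
  assert (DP1 : forall u v, Dc (fun z => P z v) u ((c - 1) * v + d)%C).
  { intros u v. unfold P. eapply Dc_eq; [| apply Dc_plus; apply Dc_mult;
      [apply Dc_plus; [apply Dc_const | apply Dc_mult; [apply Dc_id | apply Dc_const]] | apply Dc_const |
       apply Dc_id | apply Dc_const]]. cbv beta. (cbv beta; ring). }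
  assert (DP2 : forall u v, Dc (fun z => P u z) v (1 + u * (c - 1))%C).
  { intros u v. unfold P. eapply Dc_eq; [| apply Dc_plus; [apply Dc_mult; [apply Dc_const | apply Dc_id] | apply Dc_const]]. (cbv beta; ring). }
  assert (DX : forall u v, Dc (fun z => X z v) u (dX u v)).
  { intros u v. unfold X. eapply Dc_eq; [| apply Dc_mult; [apply Dc_plus; [apply Dc_const | apply Dc_mult; [apply Dc_id | apply Dc_const]] | apply Dc_gk, DP1]].
    unfold dX; cbv beta. (cbv beta; ring). }
  assert (DY : forall u v, Dc (fun z => Y u z) v (dX u v)).
  { intros u v. unfold Y. eapply Dc_eq; [| apply Dc_mult; [apply Dc_plus; [apply Dc_mult; [apply Dc_const | apply Dc_id] | apply Dc_const] | apply Dc_gk, DP2]].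
    unfold dX; cbv beta. (cbv beta; ring). }
  assert (CP : forall u v, Cc2 P u v).
  { intros u v. apply Cc2_plus; apply Cc2_mult; try apply Cc2_const; try apply Cc2_1; try apply Cc2_2.
    apply Cc2_plus; [apply Cc2_const | apply Cc2_mult; [apply Cc2_1 | apply Cc2_const]]. }
  assert (CdX : forall u v, Cc2 dX u v).
  { intros u v. apply Cc2_plus; [apply Cc2_mult; [apply Cc2_const | apply Cc2_gk; auto] |].
    apply Cc2_mult; [apply Cc2_plus; [apply Cc2_const | apply Cc2_mult; [apply Cc2_1 | apply Cc2_const]] |].
    apply Cc2_mult; [apply Cc2_plus; [apply Cc2_mult; [apply Cc2_const | apply Cc2_2] | apply Cc2_const] |].
    apply Cc2_dgk; auto. }
  assert (CX : forall u, Cci (X u) a b).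
  { intros u v _. apply (Dc_Cc _ v ((1 + u * (c - 1)) * ((1 + u * (c - 1)) * dgk k (P u v)))%C).
    unfold X. eapply Dc_eq; [| apply Dc_mult; [apply Dc_const | apply Dc_gk, DP2]]. cbv beta; (cbv beta; ring). }
  assert (Cc1 : forall f u, (forall v, Cc2 f u v) -> Cci (f u) a b).
  { intros f u Hf v _. destruct (Hf v) as [F1 F2]. split.
    - intros e He. destruct (F1 (mkposreal e He)) as [dl Hd]. exists dl. split; [apply cond_pos |].
      intros z [_ Hz]. apply Hd; [rewrite Rminus_diag, Rabs_R0; apply cond_pos | apply Hz].
    - intros e He. destruct (F2 (mkposreal e He)) as [dl Hd]. exists dl. split; [apply cond_pos |].
      intros z [_ Hz]. apply Hd; [rewrite Rminus_diag, Rabs_R0; apply cond_pos | apply Hz]. }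
  assert (DH : forall u, Dc (fun z => CI (X z) a b) u (Y u b - Y u a)%C).
  { intros u. rewrite <- (CI_FTC (Y u) (dX u) a b) by auto. apply CI_param; auto. }
  assert (K : Cmod (CI (X 1) a b - CI (X 0) a b) <= (1 - 0) * (2 * M)).
  { apply CI_mvt with (F := fun z => CI (X z) a b) (f := fun u => (Y u b - Y u a)%C); auto; [lra | |].
    - intros u _.
      assert (DYu : forall v u, Dc (fun z => Y z v) u (((c - 1) * v + d) * (((c - 1) * v + d) * dgk k (P u v)))%C).
      { intros v u'. unfold Y. eapply Dc_eq; [| apply Dc_mult; [apply Dc_const | apply Dc_gk, DP1]]. cbv beta; (cbv beta; ring). }
      apply (Cc_plus (fun u => Y u b) (fun u => - Y u a)%C).
      + eapply Dc_Cc, DYu.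
      + eapply Dc_Cc, Dc_opp, DYu.
    - intros u Hu. pose proof (HM u a Hu (or_introl eq_refl)). pose proof (HM u b Hu (or_intror eq_refl)).
      pose proof (Cmod_triangle (Y u b) (- Y u a)) as Ht. rewrite Cmod_opp in Ht.
      unfold Y, P in *. unfold Cminus at 1. lra. }
  replace (CI (fun v => c * gk k (c * v + d))%C a b) with (CI (X 1) a b).
  replace (CI (fun v => gk k v) a b) with (CI (X 0) a b). lra.
  - apply CI_ext. intros v _. unfold X, P.
    replace ((1 + 0 * (c - 1)) * v + 0 * d)%C with (RtoC v) by (cbv beta; ring). ring.
  - apply CI_ext. intros v _. unfold X, P.
    replace ((1 + 1 * (c - 1)) * v + 1 * d)%C with (c * v + d)%C by (cbv beta; ring). ring.
Qed.

Lemma exp_le x y : x <= y -> exp x <= exp y.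
Proof. intros [H | ->]; [left; apply exp_increasing; auto | right; auto]. Qed.

Definition climA (F : R -> C) (l : C) : Prop :=
  forall eps, 0 < eps -> exists B, forall b, B <= b -> Cmod (F b - l) < eps.

Lemma climA_ext F1 F2 l : (forall b, 0 <= b -> F1 b = F2 b) -> climA F1 l -> climA F2 l.
Proof.
  intros E H eps He. destruct (H eps He) as [B HB]. exists (Rmax B 0). intros b Hb.
  rewrite <- E; [apply HB |]; pose proof (Rmax_l B 0); pose proof (Rmax_r B 0); lra.
Qed.

Lemma climA_plus F1 F2 l1 l2 : climA F1 l1 -> climA F2 l2 -> climA (fun b => F1 b + F2 b)%C (l1 + l2)%C.
Proof.
  intros H1 H2 eps He. destruct (H1 (eps / 2)) as [B1 K1]; [lra |]. destruct (H2 (eps / 2)) as [B2 K2]; [lra |].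
  exists (Rmax B1 B2). intros b Hb. pose proof (Rmax_l B1 B2); pose proof (Rmax_r B1 B2).
  replace (F1 b + F2 b - (l1 + l2))%C with ((F1 b - l1) + (F2 b - l2))%C by ring.
  eapply Rle_lt_trans; [apply Cmod_triangle |].
  specialize (K1 b ltac:(lra)). specialize (K2 b ltac:(lra)). lra.
Qed.

Lemma climA_scal a F l : climA F l -> climA (fun b => a * F b)%C (a * l)%C.
Proof.
  intros H eps He. pose proof (Cmod_ge_0 a).
  destruct (H (eps / (Cmod a + 1))) as [B K]; [apply Rdiv_lt_0_compat; lra |].
  exists B. intros b Hb. specialize (K b Hb).
  replace (a * F b - a * l)%C with (a * (F b - l))%C by ring. rewrite Cmod_mult.
  apply Rle_lt_trans with ((Cmod a + 1) * Cmod (F b - l)).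
  - apply Rmult_le_compat_r; [apply Cmod_ge_0 | lra].
  - replace eps with ((Cmod a + 1) * (eps / (Cmod a + 1))) by (field; lra).
    apply Rmult_lt_compat_l; lra.
Qed.

Lemma climA_close F1 F2 l : climA F1 l ->
  (forall eps, 0 < eps -> exists B, forall b, B <= b -> Cmod (F2 b - F1 b) < eps) -> climA F2 l.
Proof.
  intros H1 H2 eps He. destruct (H1 (eps / 2)) as [B1 K1]; [lra |]. destruct (H2 (eps / 2)) as [B2 K2]; [lra |].
  exists (Rmax B1 B2). intros b Hb. pose proof (Rmax_l B1 B2); pose proof (Rmax_r B1 B2).
  replace (F2 b - l)%C with ((F2 b - F1 b) + (F1 b - l))%C by ring.
  eapply Rle_lt_trans; [apply Cmod_triangle |].
  specialize (K1 b ltac:(lra)). specialize (K2 b ltac:(lra)). lra.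
Qed.

Lemma pow_le_exp k : exists M, 0 < M /\ forall x, 0 <= x -> x ^ k <= M * exp x.
Proof.
  induction k as [| k [M [HM IH]]].
  - exists 1. split; [lra |]. intros x Hx. simpl. pose proof (exp_ineq1_le x). lra.
  - exists (2 ^ S k * M). split; [apply Rmult_lt_0_compat; [apply pow_lt; lra | auto] |].
    intros x Hx. specialize (IH (x / 2) ltac:(lra)).
    replace x with (x / 2 + x / 2) at 2 by field. rewrite exp_plus.
    replace (x ^ S k) with (2 ^ S k * ((x / 2) * (x / 2) ^ k)).
    + rewrite Rmult_assoc. apply Rmult_le_compat_l; [apply pow_le; lra |].
      pose proof (exp_ineq1_le (x / 2)). pose proof (exp_pos (x / 2)).
      replace (M * (exp (x / 2) * exp (x / 2))) with (exp (x / 2) * (M * exp (x / 2))) by ring.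
      apply Rmult_le_compat; try lra. apply pow_le; lra.
    + replace x with (2 * (x / 2)) at 3 by field. rewrite Rpow_mult_distr. simpl. ring.
Qed.

Lemma gauss_decay k m L : 0 < m -> 0 <= L -> forall eps, 0 < eps ->
  exists B, 1 <= B /\ forall b, B <= b -> b ^ k * exp (- (m * (b * b)) + L * b + L) < eps.
Proof.
  intros Hm HL eps He. destruct (pow_le_exp (S k)) as [M [HM HP]].
  set (B := Rmax (Rmax 1 ((L + 1) / m)) (M * exp L / eps + 1)).
  exists B. split.
  - unfold B. eapply Rle_trans; [| apply Rmax_l]. apply Rmax_l.
  - intros b Hb.
    assert (H1 : 1 <= b). { eapply Rle_trans; [| exact Hb]. unfold B. eapply Rle_trans; [| apply Rmax_l]. apply Rmax_l. }
    assert (H2 : (L + 1) / m <= b). { eapply Rle_trans; [| exact Hb]. unfold B. eapply Rle_trans; [| apply Rmax_l]. apply Rmax_r. }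
    assert (H3 : M * exp L / eps + 1 <= b). { eapply Rle_trans; [| exact Hb]. unfold B. apply Rmax_r. }
    assert (H2' : L + 1 <= m * b).
    { replace (L + 1) with (m * ((L + 1) / m)) by (field; lra). apply Rmult_le_compat_l; lra. }
    assert (E : exp (- (m * (b * b)) + L * b + L) <= exp (- b) * exp L).
    { rewrite <- exp_plus. apply exp_le. nra. }
    apply Rle_lt_trans with (b ^ k * (exp (- b) * exp L)).
    { apply Rmult_le_compat_l; [apply pow_le; lra | auto]. }
    specialize (HP b ltac:(lra)). simpl in HP.
    assert (b * (b ^ k * exp (- b)) <= M).
    { replace M with (M * exp b * exp (- b)).
      - rewrite <- Rmult_assoc. apply Rmult_le_compat_r; [left; apply exp_pos | lra].
      - rewrite Rmult_assoc, <- exp_plus, Rplus_opp_r, exp_0. ring. }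
    apply Rmult_lt_reg_l with b; [lra |].
    apply Rle_lt_trans with (M * exp L).
    { replace (b * (b ^ k * (exp (- b) * exp L))) with (b * (b ^ k * exp (- b)) * exp L) by ring.
      apply Rmult_le_compat_r; [left; apply exp_pos | auto]. }
    apply Rlt_le_trans with ((M * exp L / eps + 1) * eps).
    { replace ((M * exp L / eps + 1) * eps) with (M * exp L + eps) by (field; lra). lra. }
    apply Rmult_le_compat_r; lra.
Qed.

Lemma Cci_gk k (c d : C) a b : Cci (fun v => gk k (c * v + d))%C a b.
Proof.
  intros x _. eapply Dc_Cc. apply Dc_gk, Dc_plus; [apply Dc_mult; [apply Dc_const | apply Dc_id] | apply Dc_const].
Qed.

Section Cone.
Variables (c d : C) (k : nat).
Hypothesis Hc : Rabs (Im c) < Re c.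

(** The sector |Im c| < Re c is convex and contains 1, so the slopes 1 + x (c - 1) all have squares
    with real part at least m0^2. The integrand then decays like exp(-m0^2 v^2), up to terms linear
    in v that come from d. *)
Lemma gauss_boundary : exists m L M, 0 < m /\ 0 <= L /\ 0 <= M /\
  forall x v, 0 <= x <= 1 -> 1 <= Rabs v ->
  Cmod (((c - 1) * v + d) * gk k ((1 + x * (c - 1)) * v + x * d)) <=
  M * (Rabs v ^ (S k) * exp (- (m * (Rabs v * Rabs v)) + L * Rabs v + L)).
Proof.
  set (m0 := Rmin 1 (Re c - Rabs (Im c))).
  assert (Hm0 : 0 < m0) by (unfold m0; apply Rmin_glb_lt; lra).
  assert (Hm1 : m0 <= 1) by apply Rmin_l.
  assert (Hm2 : m0 <= Re c - Rabs (Im c)) by apply Rmin_r.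
  set (D := 1 + Cmod (c - 1) + Cmod d).
  pose proof (Cmod_ge_0 (c - 1)). pose proof (Cmod_ge_0 d).
  assert (HD : 1 <= D) by (unfold D; lra).
  exists (m0 * m0), (2 * D * D), (D ^ S k). repeat split; [nra | nra | apply pow_le; lra |].
  intros x v Hx Hv. set (b := Rabs v) in *.
  set (cx := (1 + x * (c - 1))%C).
  assert (Hcx : Cmod cx <= 1 + Cmod (c - 1)).
  { unfold cx. eapply Rle_trans; [apply Cmod_triangle |]. rewrite Cmod_1, Cmod_RM by lra. nra. }
  assert (Hxd : Cmod (x * d) <= Cmod d) by (rewrite Cmod_RM by lra; nra).
  assert (A1 : Cmod ((c - 1) * v + d) <= D * b).
  { eapply Rle_trans; [apply Cmod_triangle |]. rewrite Cmod_mult, Cmod_R. fold b. unfold D. nra. }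
  set (u := (cx * v + x * d)%C).
  assert (A2 : Cmod u <= D * b).
  { unfold u. eapply Rle_trans; [apply Cmod_triangle |]. rewrite Cmod_mult, Cmod_R. fold b. unfold D. nra. }
  assert (Hb2 : v * v = b * b) by (unfold b; rewrite <- Rabs_mult, Rabs_pos_eq; nra).
  assert (A3 : m0 * m0 * (b * b) - 2 * D * D * b - 2 * D * D <= Re (u * u)).
  { assert (E : (u * u = RtoC (v * v) * (cx * cx) + (2 * v * (cx * (x * d)) + (x * d) * (x * d)))%C).
    { unfold u. rewrite RtoC_mult. ring. }
    rewrite E, Re_plus, Re_RM.
    assert (m0 * m0 <= Re (cx * cx)).
    { rewrite Re_mult. unfold cx. cri. pose proof (Rle_abs (Im c)). pose proof (Rle_abs (- Im c)) as H2.
      rewrite Rabs_Ropp in H2.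
      set (p := Re c) in *. set (q := Im c) in *.
      set (y := Rabs q) in *.
      assert (Hq : q * q = y * y) by (unfold y; rewrite <- Rabs_mult, Rabs_pos_eq; nra).
      assert (0 <= y) by apply Rabs_pos.
      assert (m0 <= 1 - x + x * (p - y)) by nra.
      assert (m0 <= 1 - x + x * (p + y)) by nra.
      apply Rle_trans with ((1 - x + x * (p - y)) * (1 - x + x * (p + y)) + x * x * (y * y - q * q)).
      - rewrite Hq. nra.
      - right. ring. }
    assert (B1 : - Re (2 * v * (cx * (x * d)) + x * d * (x * d)) <= 2 * D * D * b + 2 * D * D).
    { rewrite <- Re_opp. eapply Rle_trans; [apply Cmod_Re_le |]. rewrite Cmod_opp.
      eapply Rle_trans; [apply Cmod_triangle |]. rewrite !Cmod_mult, !Cmod_R. fold b.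
      rewrite (Rabs_pos_eq 2), (Rabs_pos_eq x) by lra.
      assert (x * Cmod d <= D) by (unfold D; nra). assert (Cmod cx <= D) by (unfold D; lra).
      assert (0 <= x * Cmod d) by nra. pose proof (Cmod_ge_0 cx).
      assert (Cmod cx * (x * Cmod d) <= D * D) by (apply Rmult_le_compat; auto).
      assert (x * Cmod d * (x * Cmod d) <= D * D) by (apply Rmult_le_compat; auto). nra. }
    rewrite Hb2. nra. }
  fold cx. fold u. rewrite Cmod_mult. unfold gk. rewrite Cmod_mult, Cmod_pow, Cmod_cexp, Re_opp.
  apply Rle_trans with ((D * b) * ((D * b) ^ k * exp (- (m0 * m0 * (b * b)) + 2 * D * D * b + 2 * D * D))).
  - apply Rmult_le_compat; auto; [apply Cmod_ge_0 | apply Rmult_le_pos; [apply pow_le, Cmod_ge_0 | left; apply exp_pos] |].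
    apply Rmult_le_compat; [apply pow_le, Cmod_ge_0 | left; apply exp_pos | apply pow_incr; split; [apply Cmod_ge_0 | auto] |].
    apply exp_le. lra.
  - right. rewrite Rpow_mult_distr. simpl. ring.
Qed.

Lemma gauss_shift_line : forall eps, 0 < eps -> exists B, forall b, B <= b ->
  Cmod (CI (fun v => c * gk k (c * v + d))%C (- b) b - CI (fun v => gk k v) (- b) b) < eps.
Proof.
  intros eps He. destruct gauss_boundary as [m [L [M [Hm [HL [HM H]]]]]].
  destruct (gauss_decay (S k) m L Hm HL (eps / (4 * (M + 1)))) as [B [HB1 HB]].
  { apply Rdiv_lt_0_compat; lra. }
  exists B. intros b Hb. specialize (HB b Hb).
  apply Rle_lt_trans with (2 * (M * (eps / (4 * (M + 1))))).
  - apply gauss_homotopy; [lra |]. intros x v Hx Hv.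
    assert (E : Rabs v = b).
    { destruct Hv as [-> | ->]; [rewrite Rabs_Ropp |]; apply Rabs_pos_eq; lra. }
    eapply Rle_trans; [apply H; auto; lra |]. rewrite E. apply Rmult_le_compat_l; lra.
  - assert (M / (M + 1) <= 1).
    { apply Rmult_le_reg_r with (M + 1); [lra |]. unfold Rdiv. rewrite Rmult_assoc, Rinv_l by lra. lra. }
    replace (2 * (M * (eps / (4 * (M + 1))))) with (eps / 2 * (M / (M + 1))) by (field; lra). nra.
Qed.

(** Rotating a half-line fixes its end point: with d = 0 the boundary term at v = 0 carries the
    factor (c - 1) 0 + d = 0. *)
Lemma gauss_shift_half : d = 0 -> forall eps, 0 < eps -> exists B, forall b, B <= b ->
  Cmod (CI (fun v => c * gk k (c * v + d))%C 0 b - CI (fun v => gk k v) 0 b) < eps.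
Proof.
  intros Hd eps He. destruct gauss_boundary as [m [L [M [Hm [HL [HM H]]]]]].
  destruct (gauss_decay (S k) m L Hm HL (eps / (4 * (M + 1)))) as [B [HB1 HB]].
  { apply Rdiv_lt_0_compat; lra. }
  exists B. intros b Hb. specialize (HB b Hb).
  assert (Hp : 0 < eps / (4 * (M + 1))) by (apply Rdiv_lt_0_compat; lra).
  apply Rle_lt_trans with (2 * (M * (eps / (4 * (M + 1))))).
  - apply gauss_homotopy; [lra |]. intros x v Hx [Hv | Hv]; subst v.
    + rewrite Hd at 1. replace ((c - 1) * 0 + 0)%C with (RtoC 0) by ring.
      rewrite Cmult_0_l, Cmod_0. apply Rmult_le_pos; lra.
    + assert (E : Rabs b = b) by (apply Rabs_pos_eq; lra).
      eapply Rle_trans; [apply H; auto; lra |]. rewrite E. apply Rmult_le_compat_l; lra.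
  - assert (M / (M + 1) <= 1).
    { apply Rmult_le_reg_r with (M + 1); [lra |]. unfold Rdiv. rewrite Rmult_assoc, Rinv_l by lra. lra. }
    replace (2 * (M * (eps / (4 * (M + 1))))) with (eps / 2 * (M / (M + 1))) by (field; lra). nra.
Qed.

End Cone.

Definition gr (k : nat) (v : R) : R := v ^ k * exp (- (v * v)).

Lemma gk_R k (v : R) : gk k v = gr k v.
Proof.
  unfold gk, gr. rewrite RtoC_mult, RtoC_pow. f_equal.
  rewrite <- cexp_R. f_equal. rewrite RtoC_opp, RtoC_mult. reflexivity.
Qed.

Lemma gr_cont k x : continuity_pt (gr k) x.
Proof.
  apply continuity_pt_filterlim, (ex_derive_continuous (V := R_NormedModule)).
  unfold gr. auto_derive. auto.
Qed.

Lemma gr_ex k a b : ex_RInt (gr k) a b.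
Proof.
  apply (ex_RInt_continuous (V := R_CompleteNormedModule)). intros z _. apply continuity_pt_filterlim, gr_cont.
Qed.

Lemma CI_gk_R k a b : CI (fun v => gk k v) a b = RInt (gr k) a b.
Proof.
  apply C_eq; [change (RInt (fun t => Re (gk k t)) a b = RInt (gr k) a b) | change (RInt (fun t => Im (gk k t)) a b = 0)].
  - apply RInt_ext. intros; rewrite gk_R; reflexivity.
  - rewrite (RInt_ext _ (fun _ => 0)) by (intros; rewrite gk_R; reflexivity).
    rewrite RInt_const. unfold scal; simpl; unfold mult; simpl. ring.
Qed.

(** The integral is monotone in b and dominated by a multiple of the integral of exp(-v), so its
    supremum is the limit; the piece over [1, 2] makes it positive. *)
Lemma gauss_moment k : exists G, 0 < G /\ climA (fun b => CI (fun v => gk k v) 0 b) G.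
Proof.
  destruct (pow_le_exp k) as [M [HM HP]].
  assert (Hpos : forall v, 0 <= v -> 0 <= gr k v).
  { intros v Hv. unfold gr. apply Rmult_le_pos; [apply pow_le; auto | left; apply exp_pos]. }
  assert (Hle : forall v, 0 <= v -> gr k v <= M * exp 1 * exp (- v)).
  { intros v Hv. unfold gr. apply Rle_trans with (M * exp v * exp (- (v * v))).
    - apply Rmult_le_compat_r; [left; apply exp_pos | auto].
    - rewrite !Rmult_assoc, <- !exp_plus. apply Rmult_le_compat_l; [lra |]. apply exp_le. pose proof (Rle_0_sqr (v - 1)) as K. unfold Rsqr in K. lra. }
  assert (Hexp : forall b, is_RInt (fun v => M * exp 1 * exp (- v)) 0 b (minus (- (M * exp 1) * exp (- b)) (- (M * exp 1) * exp (- 0)))).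
  { intros b. apply (is_RInt_derive (V := R_CompleteNormedModule) (fun v => - (M * exp 1) * exp (- v))).
    - intros x _. auto_derive; auto. ring.
    - intros x _. apply (ex_derive_continuous (V := R_NormedModule)). auto_derive; auto. }
  assert (Hbd : forall b, 0 <= b -> RInt (gr k) 0 b <= M * exp 1).
  { intros b Hb. eapply Rle_trans.
    - apply RInt_le with (g := fun v => M * exp 1 * exp (- v)); auto; [apply gr_ex | eexists; apply Hexp |].
      intros x Hx. apply Hle; lra.
    - rewrite (is_RInt_unique _ _ _ _ (Hexp b)). unfold minus, plus, opp; simpl.
      rewrite Ropp_0, exp_0. pose proof (exp_pos (- b)). pose proof (exp_pos 1).
      assert (0 <= M * exp 1 * exp (- b)); [| lra]. apply Rmult_le_pos; [apply Rmult_le_pos |]; lra. }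
  assert (Hmon : forall a b, 0 <= a <= b -> RInt (gr k) 0 a <= RInt (gr k) 0 b).
  { intros a b Hab. rewrite <- (RInt_Chasles (V := R_CompleteNormedModule) (gr k) 0 a b) by apply gr_ex.
    unfold plus; simpl. assert (0 <= RInt (gr k) a b); [| lra].
    apply RInt_ge_0; [lra | apply gr_ex |]. intros; apply Hpos; lra. }
  set (E := fun x => exists b, 0 <= b /\ x = RInt (gr k) 0 b).
  destruct (completeness E) as [s [Hs1 Hs2]].
  - exists (M * exp 1). intros x [b [Hb ->]]; auto.
  - exists (RInt (gr k) 0 0), 0. split; [lra | auto].
  - exists s. split.
    + apply Rlt_le_trans with (RInt (gr k) 0 2); [| apply Hs1; exists 2; split; [lra | auto]].
      apply Rlt_le_trans with (RInt (gr k) 1 2).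
      * apply RInt_gt_0; [lra | |].
        -- intros x Hx. unfold gr. apply Rmult_lt_0_compat; [apply pow_lt; lra | apply exp_pos].
        -- intros x _. apply continuity_pt_filterlim, gr_cont.
      * rewrite <- (RInt_Chasles (V := R_CompleteNormedModule) (gr k) 0 1 2) by apply gr_ex.
        unfold plus; simpl. assert (0 <= RInt (gr k) 0 1); [| lra].
        apply RInt_ge_0; [lra | apply gr_ex |]. intros; apply Hpos; lra.
    + intros eps He.
      destruct (classic (exists b, 0 <= b /\ s - eps < RInt (gr k) 0 b)) as [[B [HB0 HB]] | Hno].
      * exists B. intros b Hb. rewrite CI_gk_R, <- RtoC_minus, Cmod_R.
        pose proof (Hmon B b ltac:(lra)).
        assert (RInt (gr k) 0 b <= s) by (apply Hs1; exists b; split; [lra | auto]).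
        apply Rabs_def1; lra.
      * exfalso. assert (s <= s - eps); [| lra].
        apply Hs2. intros x [b [Hb ->]]. apply Rnot_lt_le. intros Hc. apply Hno; eauto.
Qed.

Lemma gr0_even b : RInt (gr 0) (- b) b = 2 * RInt (gr 0) 0 b.
Proof.
  rewrite <- (RInt_Chasles (V := R_CompleteNormedModule) (gr 0) (- b) 0 b) by apply gr_ex.
  unfold plus; simpl.
  assert (E : RInt (gr 0) (- b) 0 = RInt (gr 0) 0 b); [| lra].
  pose proof (RInt_comp_lin (V := R_CompleteNormedModule) (gr 0) (-1) 0 b 0 (gr_ex 0 _ _)) as K.
  replace (-1 * b + 0) with (- b) in K by ring. replace (-1 * 0 + 0) with 0 in K by ring.
  rewrite <- K.
  rewrite (RInt_ext _ (fun y => opp (gr 0 y))).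
  - rewrite (RInt_opp (V := R_CompleteNormedModule)) by apply gr_ex.
    apply (opp_RInt_swap (V := R_CompleteNormedModule)), gr_ex.
  - intros x _. unfold gr, scal, opp; simpl. unfold mult; simpl.
    replace ((-1 * x + 0) * (-1 * x + 0)) with (x * x) by ring. ring.
Qed.

Lemma gauss_constants : exists G, 0 < G /\
  climA (fun b => CI (fun v => gk 0 v) (- b) b) G.
Proof.
  destruct (gauss_moment 0) as [G [HG H]]. exists (2 * G). split; [lra |].
  apply (climA_ext (fun b => 2 * CI (fun v => gk 0 v) 0 b)%C).
  - intros b _. rewrite !CI_gk_R, gr0_even, RtoC_mult. reflexivity.
  - rewrite RtoC_mult. apply climA_scal; auto.
Qed.

Lemma cexp_i_cos (y : R) : (cexp (Ci * y) + cexp (- (Ci * y)))%C = (2 * RtoC (cos y))%C.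
Proof.
  unfold cexp. apply C_eq; cri; unfold Ci; simpl;
  rewrite ?Rmult_0_l, ?Rmult_0_r, ?Rmult_1_l, ?Rminus_0_r, ?Rplus_0_l, ?Rplus_0_r, ?Ropp_0, exp_0.
  - rewrite cos_neg. ring.
  - rewrite sin_neg. ring.
Qed.

Lemma cone_neq_0 (c : C) : Rabs (Im c) < Re c -> c <> 0.
Proof.
  intros H ->. simpl in H. pose proof (Rabs_pos 0). lra.
Qed.

Lemma cone_re_sq (c : C) : Rabs (Im c) < Re c -> 0 < Re (c * c).
Proof.
  intros H. cri. pose proof (Rabs_pos (Im c)).
  assert (E : Im c * Im c = Rabs (Im c) * Rabs (Im c)) by (rewrite <- Rabs_mult, Rabs_pos_eq; nra).
  rewrite E. nra.
Qed.

Definition gexp (z : C) (v : R) : C := cexp (- (z * (v * v)%R)).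

Lemma Dc_ge z v : Dc (gexp z) v (- (2 * z * v) * gexp z v)%C.
Proof.
  unfold gexp. eapply Dc_eq; [| apply Dc_cexp, Dc_opp, Dc_mult; [apply Dc_const |]].
  2:{ apply (Dc_R (fun v => v * v) v (2 * v)). auto_derive; auto. ring. }
  cbv beta. rewrite !RtoC_mult. ring.
Qed.

Lemma Cmod_ge z v : Cmod (gexp z v) = exp (- (Re z * (v * v))).
Proof. unfold gexp. rewrite Cmod_cexp. cri. f_equal. ring. Qed.

Lemma Cci_cos y a b : Cci (fun v => RtoC (cos (y * v))) a b.
Proof.
  intros x _. apply (Dc_Cc _ x (RtoC (- (y * sin (y * x))))). apply Dc_R. auto_derive; auto. ring.
Qed.

Lemma Cci_ge z a b : Cci (gexp z) a b.
Proof. intros x _. eapply Dc_Cc, Dc_ge. Qed.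

Lemma Cci_mult f g a b : Cci f a b -> Cci g a b -> Cci (fun t => f t * g t)%C a b.
Proof. intros H1 H2 x Hx. apply Cc_mult; auto. Qed.

Section Gauss.
Variable G : R.
Hypothesis HG : climA (fun b => CI (fun v => gk 0 v) (- b) b) G.
Variable c : C.
Hypothesis Hc : Rabs (Im c) < Re c.

Lemma gauss_line d : climA (fun b => CI (fun v => c * gk 0 (c * v + d))%C (- b) b) G.
Proof. eapply climA_close; [apply HG | apply gauss_shift_line; auto]. Qed.

Lemma gauss_fourier (y : R) :
  climA (fun b => CI (fun v => gexp (c * c) v * cos (y * v)%R)%C (- b) b)
    (G / c * cexp (- ((y * y / 4)%R / (c * c))))%C.
Proof.
  pose proof (cone_neq_0 c Hc) as Hc0.
  (* Completing the square: -(c v + d)^2 = -c^2 v^2 + i y v + y^2/(4 c^2). The lines with d and -d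
     together produce 2 cos(y v), and e cancels the constant. *)
  set (d := (- (Ci * y) / (2 * c))%C).
  set (e := cexp (- ((y * y / 4)%R / (c * c)))).
  assert (H2 : (2 : C) <> 0) by (intros K; apply RtoC_inj in K; lra).
  apply (climA_ext (fun b => e / (2 * c) * (CI (fun v => c * gk 0 (c * v + d))%C (- b) b + CI (fun v => c * gk 0 (c * v + (- d)))%C (- b) b))%C).
  - intros b Hb. rewrite <- CI_plus, <- CI_scal; try lra.
    + apply CI_ext. intros v _. unfold gk, gexp. rewrite !Cpow_0_r || simpl Cpow.
      assert (Ed : forall s : C, (s * s = 1)%C ->
        (e / (2 * c) * (c * (1 * cexp (- ((c * v + s * d) * (c * v + s * d))))))%C =
        (/ 2 * (cexp (- (c * c * (v * v)%R)) * cexp (s * (Ci * (y * v)%R))))%C).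
      { intros s Hs. rewrite <- cexp_plus.
        replace (e / (2 * c) * (c * (1 * cexp (- ((c * v + s * d) * (c * v + s * d))))))%C
          with (/ 2 * (e * cexp (- ((c * v + s * d) * (c * v + s * d)))))%C by (field; auto).
        f_equal. unfold e. rewrite <- cexp_plus. f_equal.
        replace ((c * v + s * d) * (c * v + s * d))%C with (c * c * v * v + 2 * s * c * v * d + (s * s) * (d * d))%C by ring.
        rewrite Hs. unfold d. unfold Rdiv. rewrite !RtoC_mult, RtoC_inv by lra.
        assert (HCi : (Ci * Ci = -1)%C) by (apply C_eq; unfold Ci; cri; simpl; ring).
        assert (H4 : (RtoC 4 = 2 * 2)%C) by (rewrite <- RtoC_mult; f_equal; ring).
        replace (- (Ci * y) / (2 * c) * (- (Ci * y) / (2 * c)))%C with ((Ci * Ci) * y * y / (2 * 2 * c * c))%C by (field; auto).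
        rewrite HCi, H4. replace (RtoC (-1)) with (- RtoC 1)%C by (rewrite <- RtoC_opp; reflexivity).
        field. auto. }
      assert (E1 := Ed 1 ltac:(ring)).
      assert (E2 := Ed (- RtoC 1)%C ltac:(ring)).
      replace (1 * d)%C with d in E1 by ring. replace (- RtoC 1 * d)%C with (- d)%C in E2 by ring.
      replace (1 * (Ci * (y * v)%R))%C with (Ci * (y * v)%R)%C in E1 by ring.
      replace (- RtoC 1 * (Ci * (y * v)%R))%C with (- (Ci * (y * v)%R))%C in E2 by ring.
      rewrite Cmult_plus_distr_l, E1, E2.
      rewrite <- Cmult_plus_distr_l, <- Cmult_plus_distr_l, cexp_i_cos. field. auto.
    + intros x Hx. apply Cc_plus; apply Cc_mult; try apply Cc_const; eapply Cci_gk; eauto.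
    + intros x Hx. apply Cc_mult; try apply Cc_const; eapply Cci_gk; eauto.
    + intros x Hx. apply Cc_mult; try apply Cc_const; eapply Cci_gk; eauto.
  - replace (G / c * e)%C with (e / (2 * c) * (G + G))%C by (field; auto).
    apply climA_scal, climA_plus; apply gauss_line.
Qed.

End Gauss.

Lemma gauss_moment_c k (Gk : R) (c : C) : climA (fun b => CI (fun v => gk k v) 0 b) Gk ->
  Rabs (Im c) < Re c ->
  climA (fun b => CI (fun w => RtoC (w ^ k) * gexp (c * c) w)%C 0 b) (Gk / c ^ (k + 1))%C.
Proof.
  intros HG Hc. pose proof (cone_neq_0 c Hc) as Hc0.
  apply (climA_ext (fun b => / c ^ (k + 1) * CI (fun v => c * gk k (c * v + 0))%C 0 b)%C).
  - intros b Hb. rewrite <- CI_scal; auto.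
    + apply CI_ext. intros v _. unfold gk, gexp. rewrite RtoC_pow.
      replace ((c * v + 0) ^ k)%C with (c ^ k * v ^ k)%C by (rewrite <- Cpow_mult_l; f_equal; ring).
      replace (- ((c * v + 0) * (c * v + 0)))%C with (- (c * c * (v * v)%R))%C by (rewrite RtoC_mult; ring).
      rewrite Cpow_add_r, Cpow_1_r. field. split; auto. apply Cpow_nz; auto.
    + intros x Hx. apply Cc_mult; [apply Cc_const | eapply Cci_gk; eauto].
  - replace (Gk / c ^ (k + 1))%C with (/ c ^ (k + 1) * Gk)%C by (unfold Cdiv; ring).
    apply climA_scal. eapply climA_close; [apply HG | apply gauss_shift_half; auto].
Qed.

Lemma smb_gauss_nat a : 0 < a -> smb (fun n => (INR n + 1) * exp (- (a * (INR n * INR n)))).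
Proof.
  intros Ha. apply (smb_le _ (fun n => exp (/ a) * exp (-1) ^ n)).
  - intros n. pose proof (pos_INR n). split.
    + apply Rmult_le_pos; [lra | left; apply exp_pos].
    + apply Rle_trans with (exp (INR n) * exp (- (a * (INR n * INR n)))).
      * apply Rmult_le_compat_r; [left; apply exp_pos |]. pose proof (exp_ineq1_le (INR n)). lra.
      * rewrite <- exp_plus. rewrite <- Rpower_pow by apply exp_pos. unfold Rpower. rewrite ln_exp, <- exp_plus.
        apply exp_le. pose proof (Rle_0_sqr (a * INR n - 1)) as K. unfold Rsqr in K.
        apply Rmult_le_reg_l with a; auto.
        replace (a * (/ a + INR n * -1)) with (1 - a * INR n) by (field; lra). nra.
  - apply smb_scal; [left; apply exp_pos |]. apply smb_geom. split; [left; apply exp_pos |].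
    rewrite <- exp_0. apply exp_increasing. lra.
Qed.

Lemma smb_gauss_Z a : 0 < a -> smb (fun m : Z => (Rabs (IZR m) + 1) * exp (- (a * (IZR m * IZR m)))).
Proof.
  intros Ha. eapply smb_Z; [| apply (smb_gauss_nat a Ha)].
  intros m. cbv beta.
  assert (E : Rabs (IZR m) = INR (Z.abs_nat m)).
  { rewrite INR_IZR_INZ, <- abs_IZR. f_equal. lia. }
  assert (E2 : IZR m * IZR m = INR (Z.abs_nat m) * INR (Z.abs_nat m)).
  { rewrite <- E, <- Rabs_mult, Rabs_pos_eq; nra. }
  rewrite E, E2. pose proof (pos_INR (Z.abs_nat m)). split; [| right; auto].
  apply Rmult_le_pos; [lra | left; apply exp_pos].
Qed.

(** * Fejer kernel and inversion of the one-dimensional theta series *)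

Definition zr (B : nat) : list Z := map (fun k => (Z.of_nat k - Z.of_nat B)%Z) (seq 0 (2 * B + 1)).

Lemma zr_S B : zr (S B) = (- Z.of_nat (S B))%Z :: zr B ++ (Z.of_nat (S B) :: nil).
Proof.
  unfold zr. replace (2 * S B + 1)%nat with (S ((2 * B + 1) + 1)) by lia.
  rewrite <- cons_seq, seq_app, map_cons, map_app. f_equal. f_equal.
  - rewrite <- seq_shift, map_map. apply map_ext. intros; lia.
  - change (seq (1 + (2 * B + 1)) 1) with ((1 + (2 * B + 1))%nat :: nil). rewrite map_cons. f_equal. lia.
Qed.

Lemma zr_in B m : In m (zr B) <-> (Z.abs m <= Z.of_nat B)%Z.
Proof.
  unfold zr. rewrite in_map_iff. split.
  - intros [k [<- Hk]]. apply in_seq in Hk. lia.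
  - intros H. exists (Z.to_nat (m + Z.of_nat B)). split; [lia | apply in_seq; lia].
Qed.

Lemma zr_nd B : NoDup (zr B).
Proof. apply FinFun.Injective_map_NoDup; [intros x y; lia | apply seq_NoDup]. Qed.

Lemma hs_Z_lim f l : hs f l -> forall eps, 0 < eps -> exists N, forall n, (N <= n)%nat ->
  Cmod (csum f (zr n) - l) < eps.
Proof.
  intros H. apply (hs_lim f l zr H zr_nd).
  intros m _. exists (Z.abs_nat m). intros n Hn. apply zr_in. lia.
Qed.

Definition Dk (n : nat) (v : R) : R := 1 + 2 * rsum (fun i => cos (2 * PI * INR i * v)) (seq 1 n).

(** The Fejer kernel of period 1, the mean of the first N Dirichlet kernels [Dk]. Unlike these it is
    nonnegative, so a Lipschitz bound suffices for the Poisson formula. *)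
Definition Fj (N : nat) (v : R) : R := / INR N * rsum (fun n => Dk n v) (seq 0 N).

Lemma rsum_rev_seq (h : nat -> R) N : rsum (fun j => h (N - j)%nat) (seq 0 N) = rsum h (seq 1 N).
Proof.
  induction N; auto. rewrite (seq_S N 1), rsum_app, <- IHN, <- (cons_seq N 0), <- seq_shift.
  assert (E : forall l, rsum (fun j => h (S N - j)%nat) (map S l) = rsum (fun j => h (N - j)%nat) l).
  { induction l; cbn [rsum fold_right map]; auto. unfold rsum in IHl. rewrite IHl. auto. }
  change (h (S N - 0)%nat + rsum (fun j => h (S N - j)%nat) (map S (seq 0 N)) =
    rsum (fun j => h (N - j)%nat) (seq 0 N) + (h (1 + N)%nat + 0)).
  rewrite E, Nat.sub_0_r. simpl (1 + N)%nat. ring.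
Qed.

(** The right side is |sum_{j<N} exp(2 pi i j v)|^2; adjoining the exponential with j = N adds 1
    plus twice the cosines of 2 pi i v for i from 1 to N, which is [Dk N v]. *)
Lemma fejer_sq N v : rsum (fun n => Dk n v) (seq 0 N) =
  rsum (fun j => cos (2 * PI * INR j * v)) (seq 0 N) ^ 2 + rsum (fun j => sin (2 * PI * INR j * v)) (seq 0 N) ^ 2.
Proof.
  induction N; [simpl; ring |].
  rewrite !seq_S, !rsum_app, IHN. cbn [Nat.add rsum fold_right].
  set (Cs := rsum (fun j => cos (2 * PI * INR j * v)) (seq 0 N)).
  set (Sn := rsum (fun j => sin (2 * PI * INR j * v)) (seq 0 N)).
  assert (E : rsum (fun i => cos (2 * PI * INR i * v)) (seq 1 N) = Cs * cos (2 * PI * INR N * v) + Sn * sin (2 * PI * INR N * v)).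
  { rewrite <- (rsum_rev_seq (fun i => cos (2 * PI * INR i * v))).
    unfold Cs, Sn.
    assert (K : forall l, (forall j, In j l -> (j <= N)%nat) ->
      rsum (fun j => cos (2 * PI * INR (N - j) * v)) l =
      rsum (fun j => cos (2 * PI * INR j * v)) l * cos (2 * PI * INR N * v) + rsum (fun j => sin (2 * PI * INR j * v)) l * sin (2 * PI * INR N * v)).
    { induction l; intros Hl; [simpl; ring |]. simpl rsum. rewrite IHl by (intros; apply Hl; simpl; auto).
      rewrite minus_INR by (apply Hl; simpl; auto).
      replace (2 * PI * (INR N - INR a) * v) with (2 * PI * INR N * v - 2 * PI * INR a * v) by ring.
      rewrite cos_minus. ring. }
    apply K. intros j Hj. apply in_seq in Hj. lia. }
  unfold Dk. rewrite E. pose proof (sin2_cos2 (2 * PI * INR N * v)) as SC. unfold Rsqr in SC.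
  set (cc := cos (2 * PI * INR N * v)) in *. set (ss := sin (2 * PI * INR N * v)) in *.
  match goal with |- ?l = ?r =>
    replace l with (Cs ^ 2 + Sn ^ 2 + (1 + 2 * (Cs * cc + Sn * ss))) by ring;
    replace r with (Cs ^ 2 + Sn ^ 2 + ((ss * ss + cc * cc) + 2 * (Cs * cc + Sn * ss))) by ring end.
  rewrite SC; reflexivity.
Qed.

Lemma fejer_geom N (th : R) : Cmod (1 - cexp (Ci * th)) *
  Cmod (csum (fun j => cexp (Ci * (INR j * th)%R)) (seq 0 N)) <= 2.
Proof.
  rewrite <- Cmod_mult.
  assert (E : ((1 - cexp (Ci * th)) * csum (fun j => cexp (Ci * (INR j * th)%R)) (seq 0 N) = 1 - cexp (Ci * (INR N * th)%R))%C).
  { induction N.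
    - simpl. rewrite Rmult_0_l. replace (Ci * 0)%C with (RtoC 0) by ring. rewrite cexp_0. ring.
    - rewrite seq_S, csum_app, Cmult_plus_distr_l, IHN. simpl Nat.add. simpl csum.
      assert (E : cexp (Ci * (INR (S N) * th)%R) = (cexp (Ci * (INR N * th)%R) * cexp (Ci * th))%C).
      { rewrite <- cexp_plus. f_equal. rewrite S_INR, !RtoC_mult, RtoC_plus. ring. }
      rewrite E. ring. }
  rewrite E. unfold Cminus. eapply Rle_trans; [apply Cmod_triangle |].
  rewrite Cmod_opp, Cmod_1, Cmod_cexp. cri. unfold Ci; simpl.
  replace (0 * (INR N * th) - 1 * 0) with 0 by ring. rewrite exp_0. lra.
Qed.

(** Up to pi/3 the mean value theorem applies with cos >= 1/2; beyond, sin >= 1/2 while x/pi <=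
    1/2. *)
Lemma sin_lower x : 0 <= x <= PI / 2 -> x / PI <= sin x.
Proof.
  intros Hx. pose proof PI_RGT_0. pose proof PI2_1.
  destruct (Rle_dec x (PI / 3)) as [H1 | H1].
  - destruct (MVT_gen sin 0 x cos) as [xi [Hxi E]].
    + intros; apply is_derive_Reals, derivable_pt_lim_sin.
    + intros; apply derivable_continuous_pt, derivable_pt_sin.
    + rewrite Rmin_left, Rmax_right in Hxi by lra. rewrite sin_0 in E.
      assert (1 / 2 <= cos xi).
      { rewrite <- cos_PI3. apply cos_decr_1; lra. }
      assert (x / PI <= x * (1 / 2)).
      { unfold Rdiv. apply Rmult_le_compat_l; [lra |]. rewrite Rmult_1_l. apply Rinv_le_contravar; lra. }
      nra.
  - apply Rle_trans with (1 / 2).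
    + apply Rmult_le_reg_r with PI; auto. unfold Rdiv at 1. rewrite Rmult_assoc, Rinv_l by lra. lra.
    + rewrite <- sin_PI6. apply sin_incr_1; lra.
Qed.

(** N times the kernel is the squared modulus of a geometric sum, at most 4/|1 - exp(2 pi i v)|^2 =
    1/sin(pi v)^2 <= 1/v^2. *)
Lemma fejer_bound N v : (1 <= N)%nat -> - / 2 <= v <= / 2 -> 0 <= Fj N v /\ v * v * Fj N v <= / INR N.
Proof.
  intros HN Hv. assert (HN' : 0 < INR N) by (apply lt_0_INR; lia).
  assert (Hi : 0 < / INR N) by (apply Rinv_0_lt_compat; auto).
  unfold Fj. rewrite fejer_sq.
  set (Cs := rsum (fun j => cos (2 * PI * INR j * v)) (seq 0 N)).
  set (Sn := rsum (fun j => sin (2 * PI * INR j * v)) (seq 0 N)).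
  split; [apply Rmult_le_pos; [lra | nra] |].
  pose proof (fejer_geom N (2 * PI * v)) as H.
  set (T := csum (fun j => cexp (Ci * (INR j * (2 * PI * v))%R)) (seq 0 N)) in *.
  assert (ReT : Re T = Cs).
  { unfold T, Cs. rewrite csum_re. apply rsum_ext_in. intros j _. unfold cexp, Ci; cri; simpl.
    replace (0 * (INR j * (2 * PI * v)) - 1 * 0) with 0 by ring. rewrite exp_0, Rmult_1_l. f_equal. ring. }
  assert (ImT : Im T = Sn).
  { unfold T, Sn. rewrite csum_im. apply rsum_ext_in. intros j _. unfold cexp, Ci; cri; simpl.
    replace (0 * (INR j * (2 * PI * v)) - 1 * 0) with 0 by ring. rewrite exp_0, Rmult_1_l. f_equal. ring. }
  assert (MT : Cmod T ^ 2 = Cs ^ 2 + Sn ^ 2).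
  { unfold Cmod. rewrite pow2_sqrt; [| apply Rplus_le_le_0_compat; apply pow2_ge_0].
    rewrite <- ReT, <- ImT. reflexivity. }
  assert (ME : Cmod (1 - cexp (Ci * (2 * PI * v)%R)) ^ 2 = 4 * (sin (PI * v) * sin (PI * v))).
  { unfold Cmod. rewrite pow2_sqrt; [| apply Rplus_le_le_0_compat; apply pow2_ge_0].
    change (Re (1 - cexp (Ci * (2 * PI * v)%R)) ^ 2 + Im (1 - cexp (Ci * (2 * PI * v)%R)) ^ 2 = 4 * (sin (PI * v) * sin (PI * v))).
    unfold cexp, Ci; cri; simpl.
    replace (0 * (2 * PI * v) - 1 * 0) with 0 by ring.
    replace (0 * 0 + 1 * (2 * PI * v)) with (2 * (PI * v)) by ring.
    rewrite exp_0. rewrite sin_2a, cos_2a. pose proof (sin2_cos2 (PI * v)) as SC. unfold Rsqr in SC. nra. }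
  assert (Hs : v * v <= sin (PI * v) * sin (PI * v)).
  { pose proof PI_RGT_0. destruct (Rle_dec 0 v) as [P | P].
    - pose proof (sin_lower (PI * v)). replace (PI * v / PI) with v in H1 by (field; lra).
      assert (v <= sin (PI * v)) by (apply H1; nra). nra.
    - pose proof (sin_lower (PI * - v)). replace (PI * - v / PI) with (- v) in H1 by (field; lra).
      assert (- v <= sin (PI * - v)) by (apply H1; nra).
      replace (PI * - v) with (- (PI * v)) in H2 by ring. rewrite sin_neg in H2. nra. }
  rewrite <- MT.
  pose proof (Cmod_ge_0 T). pose proof (Cmod_ge_0 (1 - cexp (Ci * (2 * PI * v)%R))).
  assert (Hprod : 4 * (sin (PI * v) * sin (PI * v)) * Cmod T ^ 2 <= 4).
  { rewrite <- ME. replace 4 with (2 ^ 2) by ring. rewrite <- Rpow_mult_distr. apply pow_incr. split; auto. nra. }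
  assert (v * v * Cmod T ^ 2 <= 1).
  { assert (v * v * Cmod T ^ 2 <= sin (PI * v) * sin (PI * v) * Cmod T ^ 2); [| lra].
    apply Rmult_le_compat_r; auto. apply pow2_ge_0. }
  nra.
Qed.

Lemma CI_rsum (f : R -> C) (h : nat -> R -> R) L a b : a <= b -> Cci f a b ->
  (forall i, Cci (fun v => RtoC (h i v)) a b) ->
  CI (fun v => f v * RtoC (rsum (fun i => h i v) L))%C a b = csum (fun i => CI (fun v => f v * h i v)%C a b) L
  /\ Cci (fun v => RtoC (rsum (fun i => h i v) L)) a b.
Proof.
  intros Hab Hf Hh. induction L as [| i L [IH1 IH2]]; cbn [rsum csum fold_right].
  - split; [| intros x _; apply Cc_const].
    rewrite (CI_ext _ (fun v => 0 * f v)%C) by (intros; ring). rewrite CI_scal by auto. ring.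
  - split.
    + rewrite (CI_ext _ (fun v => f v * h i v + f v * RtoC (rsum (fun i => h i v) L))%C).
      * rewrite CI_plus; auto; [| apply Cci_mult; auto ..]. rewrite IH1. reflexivity.
      * intros v _. rewrite RtoC_plus. unfold rsum. ring.
    + intros x Hx. destruct (Hh i x Hx) as [A1 A2]. destruct (IH2 x Hx) as [B1 B2]. split.
      * apply (continuity_pt_plus (fun v => h i v) (fun v => rsum (fun i => h i v) L)); auto.
      * apply continuity_pt_const. intros ? ?; reflexivity.
Qed.

Lemma climA_csum (F : nat -> R -> C) (l : nat -> C) L : (forall i, climA (F i) (l i)) ->
  climA (fun b => csum (fun i => F i b) L) (csum l L).
Proof.
  intros H. induction L as [| i L IH]; cbn [csum fold_right].
  - intros eps He. exists 0. intros b _. replace (RtoC 0 - RtoC 0)%C with (RtoC 0) by ring. rewrite Cmod_0; auto.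
  - apply (climA_plus (F i) (fun b => csum (fun i => F i b) L)); auto.
Qed.

Lemma climA_unique F l1 l2 : climA F l1 -> climA F l2 -> l1 = l2.
Proof.
  intros H1 H2. assert (E : Cmod (l1 - l2) <= 0).
  { apply le_epsilon. intros e He. destruct (H1 (e / 2)) as [B1 K1]; [lra |]. destruct (H2 (e / 2)) as [B2 K2]; [lra |].
    pose proof (Rmax_l B1 B2); pose proof (Rmax_r B1 B2). set (b := Rmax B1 B2) in *.
    specialize (K1 b ltac:(lra)). specialize (K2 b ltac:(lra)).
    replace (l1 - l2)%C with (- (F b - l1) + (F b - l2))%C by ring.
    eapply Rle_trans; [apply Cmod_triangle |]. rewrite Cmod_opp. lra. }
  assert (E2 : Cmod (l1 - l2) = 0) by (pose proof (Cmod_ge_0 (l1 - l2)); lra).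
  apply Cmod_eq_0 in E2. replace l1 with ((l1 - l2) + l2)%C by ring. rewrite E2; ring.
Qed.

Lemma cesaro (u : nat -> C) l :
  (forall eps, 0 < eps -> exists N, forall n, (N <= n)%nat -> Cmod (u n - l) < eps) ->
  forall eps, 0 < eps -> exists N, (1 <= N)%nat /\ forall n, (N <= n)%nat ->
    Cmod (/ INR n * csum u (seq 0 n) - l) < eps.
Proof.
  intros H eps He. destruct (H (eps / 2)) as [N0 H0]; [lra |].
  set (M := rsum (fun n => Cmod (u n - l)) (seq 0 N0)).
  assert (HM : 0 <= M) by (apply rsum_pos; intros; apply Cmod_ge_0).
  destruct (INR_unbounded (2 * M / eps)) as [N1 H1].
  exists (max 1 (max N0 (S N1))). split; [lia |]. intros n Hn.
  assert (Hn0 : 0 < INR n) by (apply lt_0_INR; lia).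
  assert (K : rsum (fun n => Cmod (u n - l)) (seq 0 n) <= M + INR n * (eps / 2)).
  { replace n with (N0 + (n - N0))%nat by lia. rewrite seq_app, rsum_app. fold M.
    apply Rplus_le_compat_l.
    eapply Rle_trans; [apply rsum_le with (g2 := fun _ => eps / 2) |].
    - intros t Ht. apply in_seq in Ht. left; apply H0; lia.
    - rewrite rsum_const, length_seq. apply Rmult_le_compat_r; [lra |]. apply le_INR; lia. }
  assert (E : (/ INR n * csum u (seq 0 n) - l = RtoC (/ INR n) * csum (fun k => u k - l) (seq 0 n))%C).
  { unfold Cminus. rewrite csum_plus, csum_const, length_seq, RtoC_inv by lra. field.
    intros K0. apply RtoC_inj in K0. lra. }
  rewrite E, Cmod_RM by (left; apply Rinv_0_lt_compat; auto).
  apply Rle_lt_trans with (/ INR n * (M + INR n * (eps / 2))).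
  - apply Rmult_le_compat_l; [left; apply Rinv_0_lt_compat; auto |].
    eapply Rle_trans; [apply csum_le; intros; apply Rle_refl | apply K].
  - apply Rmult_lt_reg_l with (INR n); auto. rewrite <- Rmult_assoc, Rinv_r by lra.
    assert (INR (S N1) <= INR n) by (apply le_INR; lia). rewrite S_INR in H2.
    assert (2 * M < INR n * eps).
    { replace (2 * M) with (2 * M / eps * eps) by (field; lra). apply Rmult_lt_compat_r; lra. }
    lra.
Qed.

Lemma CI_shift g m a b : a <= b -> Cci g (m + a) (m + b) -> CI g (m + a) (m + b) = CI (fun v => g (m + v)) a b.
Proof.
  intros Hab H. destruct (Cci_ex g (m + a) (m + b)) as [E1 E2]; [lra | auto |].
  pose proof (RInt_comp_lin (V := R_CompleteNormedModule) (fun t => Re (g t)) 1 m a b) as K1.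
  pose proof (RInt_comp_lin (V := R_CompleteNormedModule) (fun t => Im (g t)) 1 m a b) as K2.
  replace (1 * a + m) with (m + a) in * by ring. replace (1 * b + m) with (m + b) in * by ring.
  unfold CI. rewrite <- K1, <- K2; auto. f_equal; apply RInt_ext; intros x _; unfold scal; simpl; unfold mult; simpl;
  rewrite Rmult_1_l; do 2 f_equal; ring.
Qed.

Lemma CI_zr g B : (forall a b, Cci g a b) ->
  CI g (- (INR B + / 2)) (INR B + / 2) = csum (fun m => CI (fun v => g (IZR m + v)) (- / 2) (/ 2)) (zr B).
Proof.
  intros H. induction B.
  - change (zr 0) with (0%Z :: nil). cbn [csum fold_right]. rewrite Cplus_0_r. rewrite <- CI_shift; auto; [| lra].
    simpl INR. f_equal; ring.
  - rewrite zr_S. cbn [csum fold_right]. fold (csum (fun m => CI (fun v => g (IZR m + v)) (- / 2) (/ 2)) (zr B ++ Z.of_nat (S B) :: nil)).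
    rewrite csum_app. cbn [csum fold_right].
    rewrite <- IHB, <- !CI_shift by (auto; lra).
    rewrite opp_IZR, <- INR_IZR_INZ, S_INR. pose proof (pos_INR B).
    rewrite <- (CI_Chasles g (- (INR B + 1 + / 2)) (- (INR B + / 2)) (INR B + 1 + / 2)) by (auto; lra).
    rewrite <- (CI_Chasles g (- (INR B + / 2)) (INR B + / 2) (INR B + 1 + / 2)) by (auto; lra).
    rewrite Cplus_0_r. f_equal; [f_equal; field |]. f_equal. f_equal; field.
Qed.

Lemma cos_int_shift i (m : Z) v : cos (2 * PI * INR i * (IZR m + v)) = cos (2 * PI * INR i * v).
Proof.
  assert (P : forall (n : nat) x, cos (2 * PI * INR i * (INR n + x)) = cos (2 * PI * INR i * x)).
  { intros n x. rewrite <- (cos_period (2 * PI * INR i * x) (i * n)). f_equal. rewrite mult_INR. ring. }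
  destruct (Z_le_gt_dec 0 m) as [H | H].
  - rewrite <- (Z2Nat.id m) by auto. rewrite <- INR_IZR_INZ. apply P.
  - replace m with (- Z.of_nat (Z.to_nat (- m)))%Z by lia. rewrite opp_IZR, <- INR_IZR_INZ.
    set (n := Z.to_nat (- m)). rewrite <- (P n (- INR n + v)). f_equal. ring.
Qed.

Lemma Fj_shift N (m : Z) v : Fj N (IZR m + v) = Fj N v.
Proof.
  unfold Fj. f_equal. apply rsum_ext_in. intros n _. unfold Dk. do 2 f_equal.
  apply rsum_ext_in. intros i _. apply cos_int_shift.
Qed.

Lemma Cci_Dk n a b : a <= b -> Cci (fun v => RtoC (Dk n v)) a b.
Proof.
  intros Hab x Hx. unfold Dk.
  destruct (CI_rsum (fun _ => 1) (fun i v => cos (2 * PI * INR i * v)) (seq 1 n) a b Hab (fun y _ => Cc_const _ y)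
    (fun i => Cci_cos _ a b)) as [_ K]. destruct (K x Hx) as [K1 K2]. split; simpl in *.
  - apply continuity_pt_plus; [apply continuity_pt_const; intros ? ?; auto |].
    apply continuity_pt_mult; [apply continuity_pt_const; intros ? ?; auto | auto].
  - auto.
Qed.

Lemma Cci_Fj N a b : a <= b -> Cci (fun v => RtoC (Fj N v)) a b.
Proof.
  intros Hab x Hx. unfold Fj.
  destruct (CI_rsum (fun _ => 1) Dk (seq 0 N) a b Hab (fun y _ => Cc_const _ y)
    (fun i => Cci_Dk _ a b Hab)) as [_ K]. destruct (K x Hx) as [K1 K2]. split; simpl in *.
  - apply continuity_pt_mult; [apply continuity_pt_const; intros ? ?; auto | auto].
  - auto.
Qed.

Lemma CI_Dk f n a b : a <= b -> Cci f a b ->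
  CI (fun v => f v * Dk n v)%C a b =
  (CI (fun v => f v * cos (2 * PI * INR 0 * v))%C a b + 2 * csum (fun i => CI (fun v => f v * cos (2 * PI * INR i * v))%C a b) (seq 1 n))%C.
Proof.
  intros Hab Hf.
  destruct (CI_rsum f (fun i v => cos (2 * PI * INR i * v)) (seq 1 n) a b Hab Hf (fun i => Cci_cos _ a b)) as [E HC].
  rewrite <- E, <- CI_scal; auto; [| apply Cci_mult; auto].
  rewrite <- CI_plus; auto.
  - apply CI_ext. intros v _. unfold Dk. rewrite RtoC_plus, RtoC_mult.
    replace (2 * PI * INR 0 * v) with 0 by (simpl; ring). rewrite cos_0. ring.
  - apply Cci_mult; auto. apply Cci_cos.
  - intros x Hx. apply Cc_mult; [apply Cc_const |]. apply Cc_mult; [apply Hf | apply HC]; auto.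
Qed.

Lemma CI_Fj f N a b : a <= b -> Cci f a b ->
  CI (fun v => f v * Fj N v)%C a b = (RtoC (/ INR N) * csum (fun n => CI (fun v => f v * Dk n v) a b) (seq 0 N))%C.
Proof.
  intros Hab Hf.
  destruct (CI_rsum f Dk (seq 0 N) a b Hab Hf (fun i => Cci_Dk _ a b Hab)) as [E HC].
  rewrite <- E, <- CI_scal; auto; [| apply Cci_mult; auto].
  apply CI_ext. intros v _. unfold Fj. rewrite RtoC_mult. ring.
Qed.

Lemma CI_one_cos i : (1 <= i)%nat -> CI (fun v => 1 * cos (2 * PI * INR i * v))%C (- / 2) (/ 2) = 0.
Proof.
  intros Hi. assert (Hi0 : 0 < INR i) by (apply lt_0_INR; lia). pose proof PI_RGT_0.
  rewrite (CI_ext _ (fun v => RtoC (cos (2 * PI * INR i * v)))) by (intros; ring).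
  rewrite (CI_FTC (fun v => RtoC (sin (2 * PI * INR i * v) / (2 * PI * INR i)))).
  - replace (2 * PI * INR i * / 2) with (INR i * PI) by field.
    replace (2 * PI * INR i * - / 2) with (- (INR i * PI)) by field.
    rewrite sin_neg. rewrite (sin_eq_0_1 (INR i * PI)) by (exists (Z.of_nat i); rewrite INR_IZR_INZ; auto).
    rewrite Ropp_0. ring.
  - lra.
  - intros x _. apply Dc_R. auto_derive; auto. field. split; lra.
  - apply Cci_cos.
Qed.

Lemma CI_one_Fj N : (1 <= N)%nat -> CI (fun v => 1 * Fj N v)%C (- / 2) (/ 2) = 1.
Proof.
  intros HN. rewrite CI_Fj; [| lra | intros x _; apply Cc_const].
  rewrite (csum_ext_in _ (fun _ => RtoC 1)).
  - rewrite csum_const, length_seq, Cmult_1_r, <- RtoC_mult, Rinv_l; auto.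
    apply not_0_INR; lia.
  - intros n _. rewrite CI_Dk; [| lra | intros x _; apply Cc_const].
    rewrite (csum_ext_in _ (fun _ => RtoC 0)).
    + rewrite (csum_zero (fun _ => RtoC 0)) by auto.
      rewrite (CI_ext _ (fun _ => RtoC 1)).
      * unfold CI. rewrite !RInt_const. unfold scal; simpl; unfold mult; simpl. apply C_eq; cri; simpl; field.
      * intros v _. replace (2 * PI * INR 0 * v) with 0 by (simpl; ring). rewrite cos_0. ring.
    + intros i Hi. apply CI_one_cos. apply in_seq in Hi. lia.
Qed.

Lemma RInt_Fj N : (1 <= N)%nat -> RInt (Fj N) (- / 2) (/ 2) = 1.
Proof.
  intros HN. assert (H : Re (CI (fun v => 1 * Fj N v)%C (- / 2) (/ 2)) = 1) by (rewrite CI_one_Fj by auto; reflexivity).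
  rewrite <- H. change (RInt (Fj N) (- / 2) (/ 2) = RInt (fun v => Re (1 * Fj N v)%C) (- / 2) (/ 2)).
  apply RInt_ext. intros x _. symmetry. rewrite Re_RM, Re_R. apply Rmult_1_l.
Qed.

(** Integrate L |v| against the kernel with |v| <= eta + v^2/eta: the first part has mass eta, the
    second is at most 1/(eta N) by [fejer_bound]. The parameter eta is balanced against N in
    [theta_inversion]. *)
Lemma fejer_lip (g : R -> C) N L eta : (1 <= N)%nat -> 0 < eta -> 0 <= L -> Cci g (- / 2) (/ 2) ->
  (forall v, - / 2 <= v <= / 2 -> Cmod (g v - g 0) <= L * Rabs v) ->
  Cmod (CI (fun v => g v * Fj N v)%C (- / 2) (/ 2) - g 0) <= L * (eta + / (eta * INR N)).
Proof.
  intros HN He HL Hc Hg. assert (HN' : 0 < INR N) by (apply lt_0_INR; lia).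
  assert (HC : Cci (fun v => RtoC (Fj N v)) (- / 2) (/ 2)) by (apply Cci_Fj; lra).
  replace (g 0) with (g 0 * CI (fun v => 1 * Fj N v)%C (- / 2) (/ 2))%C at 1 by (rewrite CI_one_Fj by auto; ring).
  assert (HC1 : Cci (fun v => 1 * Fj N v)%C (- / 2) (/ 2)) by (apply Cci_mult; auto; intros x _; apply Cc_const).
  replace (CI (fun v => g v * Fj N v)%C (- / 2) (/ 2) - g 0 * CI (fun v => 1 * Fj N v)%C (- / 2) (/ 2))%C
    with (CI (fun v => (g v - g 0) * Fj N v)%C (- / 2) (/ 2)).
  - assert (Hex : ex_RInt (Fj N) (- / 2) (/ 2)).
    { apply cont_ex_RInt; [lra |]. intros x Hx. apply (HC x Hx). }
    eapply Rle_trans.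
    + apply CI_bound with (g := fun v => L * (eta * Fj N v + / (eta * INR N))).
      * lra.
      * apply (Cci_mult (fun v => g v - g 0)%C); auto. intros x Hx. apply (Cc_plus g); [auto | apply Cc_const].
      * apply (ex_RInt_scal (V := R_NormedModule)). apply (ex_RInt_plus (V := R_NormedModule)); [| apply ex_RInt_const].
        apply (ex_RInt_scal (V := R_NormedModule)); auto.
      * intros v Hv. destruct (fejer_bound N v HN Hv) as [F0 F1].
        rewrite Cmod_mult, Cmod_R, (Rabs_pos_eq (Fj N v)) by auto.
        apply Rle_trans with (L * (Rabs v * Fj N v)).
        -- rewrite <- Rmult_assoc. apply Rmult_le_compat_r; auto.
        -- apply Rmult_le_compat_l; auto.
           assert (Rabs v <= eta + v * v / eta).
           { destruct (Rle_dec (Rabs v) eta) as [Q | Q].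
             - assert (0 <= v * v / eta); [| lra]. apply Rmult_le_pos; [nra | left; apply Rinv_0_lt_compat; auto].
             - assert (Rabs v <= v * v / eta); [| lra].
               assert (E : v * v = Rabs v * Rabs v) by (rewrite <- Rabs_mult, Rabs_pos_eq; nra). rewrite E.
               apply Rmult_le_reg_r with eta; auto. unfold Rdiv. rewrite Rmult_assoc, Rinv_l by lra.
               rewrite Rmult_1_r. apply Rmult_le_compat_l; lra. }
           apply Rle_trans with ((eta + v * v / eta) * Fj N v); [apply Rmult_le_compat_r; auto |].
           rewrite Rmult_plus_distr_r. apply Rplus_le_compat_l.
           rewrite Rinv_mult. replace (v * v / eta * Fj N v) with (/ eta * (v * v * Fj N v)) by (unfold Rdiv; ring).
           apply Rmult_le_compat_l; auto. left; apply Rinv_0_lt_compat; auto.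
    + right. rewrite (RInt_scal (V := R_CompleteNormedModule)).
      * rewrite (RInt_plus (V := R_CompleteNormedModule)); [| apply (ex_RInt_scal (V := R_NormedModule)); auto | apply ex_RInt_const].
        rewrite (RInt_scal (V := R_CompleteNormedModule)) by auto.
        rewrite RInt_Fj, RInt_const by auto. unfold scal, plus; simpl; unfold mult; simpl. field. lra.
      * apply (ex_RInt_plus (V := R_NormedModule)); [| apply ex_RInt_const].
        apply (ex_RInt_scal (V := R_NormedModule)); auto.
  - unfold Cminus.
    replace (- (g 0 * CI (fun v => 1 * Fj N v)%C (- / 2) (/ 2)))%C with ((- g 0) * CI (fun v => 1 * Fj N v)%C (- / 2) (/ 2))%C by ring.
    rewrite <- CI_scal, <- CI_plus; auto; try lra.
    + apply CI_ext. intros; ring.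
    + apply Cci_mult; auto.
    + apply Cci_mult; auto. intros x _; apply Cc_const.
Qed.

(** For |u| <= 1/2 one has (m + u)^2 >= m^2/2 - 1/4, so the derivative on the cell around m keeps
    Gaussian decay in m and the Lipschitz constants are summable over the cells. *)
Lemma ge_lip z (m v : R) : 0 < Re z -> - / 2 <= v <= / 2 ->
  Cmod (gexp z (m + v) - gexp z m) <=
  2 * Cmod z * exp (Re z / 4) * ((Rabs m + 1) * exp (- (Re z / 2 * (m * m)))) * Rabs v.
Proof.
  intros Hz Hv. set (L := 2 * Cmod z * exp (Re z / 4) * ((Rabs m + 1) * exp (- (Re z / 2 * (m * m))))).
  assert (Hd : forall u, - / 2 <= u <= / 2 -> Cmod (- (2 * z * (m + u)%R) * gexp z (m + u)) <= L).
  { intros u Hu. rewrite Cmod_mult, Cmod_opp, !Cmod_mult, !Cmod_R, Cmod_ge, (Rabs_pos_eq 2) by lra.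
    assert (A : Rabs (m + u) <= Rabs m + 1).
    { eapply Rle_trans; [apply Rabs_triang |]. apply Rplus_le_compat_l. apply Rabs_le. lra. }
    assert (B : exp (- (Re z * ((m + u) * (m + u)))) <= exp (Re z / 4) * exp (- (Re z / 2 * (m * m)))).
    { rewrite <- exp_plus. apply exp_le. pose proof (Rle_0_sqr (m + 2 * u)) as Q. unfold Rsqr in Q.
      assert (Q1 : u * u <= / 4).
      { replace (/ 4) with (/ 2 * / 2) by field. replace (u * u) with (Rabs u * Rabs u) by (rewrite <- Rabs_mult, Rabs_pos_eq; [auto | apply Rle_0_sqr]).
        assert (Rabs u <= / 2) by (apply Rabs_le; lra). apply Rmult_le_compat; auto; apply Rabs_pos. }
      assert (Q2 : 0 <= Re z * ((m + u) * (m + u) - m * m / 2 + / 4)) by (apply Rmult_le_pos; lra). lra. }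
    pose proof (Cmod_ge_0 z). unfold L.
    replace (2 * Cmod z * exp (Re z / 4) * ((Rabs m + 1) * exp (- (Re z / 2 * (m * m)))))
      with (2 * Cmod z * (Rabs m + 1) * (exp (Re z / 4) * exp (- (Re z / 2 * (m * m))))) by ring.
    apply Rmult_le_compat; auto; [| left; apply exp_pos |].
    - apply Rmult_le_pos; [lra | apply Rabs_pos].
    - apply Rmult_le_compat_l; lra. }
  assert (Hm : forall a b, a <= b -> (forall u, a <= u <= b -> - / 2 <= u <= / 2) ->
    Cmod (gexp z (m + b) - gexp z (m + a)) <= (b - a) * L).
  { intros a b Hab Hin. apply (CI_mvt (fun u => gexp z (m + u)) (fun u => (- (2 * z * (m + u)%R) * gexp z (m + u))%C)); auto.
    - intros u. destruct (Dc_ge z (m + u)) as [D1 D2]. split.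
      + rewrite <- (Rmult_1_l (Re _)). apply (is_derive_comp (V := R_NormedModule) (fun t => Re (gexp z t)) (fun u => m + u)); auto.
        auto_derive; auto.
      + rewrite <- (Rmult_1_l (Im _)). apply (is_derive_comp (V := R_NormedModule) (fun t => Im (gexp z t)) (fun u => m + u)); auto.
        auto_derive; auto.
    - intros u _. apply (Cc_mult (fun u => - (2 * z * (m + u)%R))%C (fun u => gexp z (m + u))).
      + apply (Dc_Cc _ u (- (2 * z * 1))%C). apply Dc_opp.
        eapply Dc_eq; [| apply Dc_mult; [apply Dc_const | apply (Dc_R (fun u => m + u) u 1); auto_derive; auto]].
        cbv beta. ring.
      + destruct (Dc_Cc _ _ _ (Dc_ge z (m + u))) as [C1 C2]. split.
        * apply (continuity_pt_comp (fun u => m + u) (fun t => Re (gexp z t))); auto.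
          apply derivable_continuous_pt. apply ex_derive_Reals_0. auto_derive; auto.
        * apply (continuity_pt_comp (fun u => m + u) (fun t => Im (gexp z t))); auto.
          apply derivable_continuous_pt. apply ex_derive_Reals_0. auto_derive; auto. }
  destruct (Rle_dec 0 v) as [P | P].
  - specialize (Hm 0 v P). rewrite Rplus_0_r in Hm. rewrite (Rabs_pos_eq v) by auto.
    replace (L * v) with ((v - 0) * L) by ring. apply Hm. intros; lra.
  - specialize (Hm v 0 ltac:(lra)). rewrite Rplus_0_r in Hm. rewrite (Rabs_left v) by lra.
    replace (gexp z (m + v) - gexp z m)%C with (- (gexp z m - gexp z (m + v)))%C by ring. rewrite Cmod_opp.
    replace (L * - v) with ((0 - v) * L) by ring. apply Hm. intros; lra.
Qed.

Section Theta.
Variable G : R.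
Hypothesis HG : climA (fun b => CI (fun v => gk 0 v) (- b) b) G.
Variable c : C.
Hypothesis Hc : Rabs (Im c) < Re c.

(** [phi i] is the Fourier transform of the Gaussian at the integer frequency i, and [An n] is the
    n-th symmetric partial sum of the dual theta series, written over i >= 0 by evenness. *)
Let phi (i : nat) : C := (G / c * cexp (- ((2 * PI * INR i * (2 * PI * INR i) / 4)%R / (c * c))))%C.
Let An (n : nat) : C := (phi 0 + 2 * csum phi (seq 1 n))%C.

Lemma fejer_lim N :
  climA (fun b => CI (fun v => gexp (c * c) v * Fj N v)%C (- b) b) (RtoC (/ INR N) * csum An (seq 0 N))%C.
Proof.
  apply (climA_ext (fun b => RtoC (/ INR N) * csum (fun n => CI (fun v => gexp (c * c) v * cos (2 * PI * INR 0 * v)%R)%C (- b) b +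
    2 * csum (fun i => CI (fun v => gexp (c * c) v * cos (2 * PI * INR i * v)%R)%C (- b) b) (seq 1 n)) (seq 0 N))%C).
  - intros b Hb. rewrite CI_Fj; [| lra | apply Cci_ge]. f_equal. apply csum_ext_in. intros n _.
    rewrite CI_Dk; [reflexivity | lra | apply Cci_ge].
  - apply climA_scal. apply (climA_csum (fun n b => CI (fun v => gexp (c * c) v * cos (2 * PI * INR 0 * v)%R)%C (- b) b +
    2 * csum (fun i => CI (fun v => gexp (c * c) v * cos (2 * PI * INR i * v)%R)%C (- b) b) (seq 1 n))%C An).
    intros n. apply climA_plus; [apply (gauss_fourier G HG c Hc) |].
    apply climA_scal. apply (climA_csum (fun i b => CI (fun v => gexp (c * c) v * cos (2 * PI * INR i * v)%R)%C (- b) b) phi).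
    intros i. apply (gauss_fourier G HG c Hc).
Qed.

Lemma An_zr n : An n = csum (fun m : Z => G / c * gexp ((PI * PI)%R / (c * c)) (IZR m))%C (zr n).
Proof.
  pose proof (cone_neq_0 c Hc) as Hc0.
  assert (E : forall (m : Z) i, IZR m * IZR m = INR i * INR i -> (G / c * gexp ((PI * PI)%R / (c * c)) (IZR m))%C = phi i).
  { intros m i H. unfold phi, gexp. rewrite H. do 3 f_equal. rewrite <- (Cmult_comm (INR i * INR i)%R).
    unfold Cdiv. rewrite Cmult_assoc, <- RtoC_mult. do 2 f_equal. field. }
  induction n.
  - unfold An. simpl. rewrite (E 0%Z 0%nat) by (simpl; ring). ring.
  - rewrite zr_S. cbn [csum fold_right].
    fold (csum (fun m : Z => G / c * gexp ((PI * PI)%R / (c * c)) (IZR m))%C (zr n ++ Z.of_nat (S n) :: nil)).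
    rewrite csum_app. cbn [csum fold_right]. rewrite <- IHn.
    rewrite (E (- Z.of_nat (S n))%Z (S n)), (E (Z.of_nat (S n)) (S n)).
    + unfold An. rewrite seq_S, csum_app. cbn [Nat.add csum fold_right]. ring.
    + rewrite <- INR_IZR_INZ; ring.
    + rewrite opp_IZR, <- INR_IZR_INZ; ring.
Qed.

(** The integral of the Gaussian against [Fj N] over the line is computed twice: expanding the
    kernel gives the Cesaro mean of the dual partial sums, cutting into unit cells gives th up to
    the Fejer error. Letting N grow identifies the two. *)
Lemma theta_inversion th th' :
  hs (fun m : Z => gexp (c * c) (IZR m)) th ->
  hs (fun m : Z => gexp ((PI * PI)%R / (c * c)) (IZR m)) th' ->
  th = (G / c * th')%C.
Proof.
  intros H1 H2.
  pose proof (cone_re_sq c Hc) as Hz. set (z := (c * c)%C) in *.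
  set (Lm := fun m : Z => 2 * Cmod z * exp (Re z / 4) * ((Rabs (IZR m) + 1) * exp (- (Re z / 2 * (IZR m * IZR m))))).
  assert (HL : smb Lm).
  { apply smb_scal; [| apply smb_gauss_Z; lra].
    pose proof (Cmod_ge_0 z). apply Rmult_le_pos; [lra | left; apply exp_pos]. }
  destruct HL as [La [HL0 HL]].
  assert (HLa : 0 <= La) by (specialize (HL nil (NoDup_nil _)); simpl in HL; auto).
  assert (K1 : forall N eta, (1 <= N)%nat -> 0 < eta ->
    Cmod (RtoC (/ INR N) * csum An (seq 0 N) - th) <= La * (eta + / (eta * INR N))).
  { intros N eta HN Heta. assert (HN' : 0 < INR N) by (apply lt_0_INR; lia).
    assert (Hpos : 0 <= eta + / (eta * INR N)).
    { assert (0 < / (eta * INR N)) by (apply Rinv_0_lt_compat; nra). lra. }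
    apply le_epsilon. intros e He.
    destruct (fejer_lim N (e / 2)) as [B1 F1]; [lra |].
    destruct (hs_Z_lim _ _ H1 (e / 2)) as [N2 F2]; [lra |].
    destruct (INR_unbounded B1) as [N1 HN1].
    set (B := max N1 N2). specialize (F2 B ltac:(lia)).
    assert (INR N1 <= INR B) by (apply le_INR; lia).
    specialize (F1 (INR B + / 2) ltac:(lra)). fold z in F1.
    rewrite CI_zr in F1.
    2:{ intros a b x Hx. apply Cc_mult; [eapply (Cci_ge z a b); eauto | eapply (Cci_Fj N a b); [lra | eauto]]. }
    set (S1 := csum _ (zr B)) in F1. set (S2 := csum _ (zr B)) in F2.
    assert (F3 : Cmod (S1 - S2) <= La * (eta + / (eta * INR N))).
    { unfold S1, S2. unfold Cminus.
      replace (- csum (fun m : Z => gexp z (IZR m)) (zr B))%C with (csum (fun m : Z => (-(1)) * gexp z (IZR m))%C (zr B))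
        by (rewrite csum_scal; ring).
      rewrite <- csum_plus.
      eapply Rle_trans; [apply csum_le with (g := fun m => (eta + / (eta * INR N)) * Lm m) |].
      - intros m _. rewrite (CI_ext _ (fun v => gexp z (IZR m + v) * Fj N v)%C) by (intros; rewrite Fj_shift; auto).
        replace (CI (fun v => gexp z (IZR m + v) * Fj N v)%C (- / 2) (/ 2) + (-(1)) * gexp z (IZR m))%C
          with (CI (fun v => gexp z (IZR m + v) * Fj N v)%C (- / 2) (/ 2) - gexp z (IZR m + 0))%C
          by (rewrite Rplus_0_r; ring).
        rewrite Rmult_comm. apply (fejer_lip (fun v => gexp z (IZR m + v))); auto.
        + intros u _. destruct (Dc_Cc _ _ _ (Dc_ge z (IZR m + u))) as [C1 C2]. split.
          * apply (continuity_pt_comp (fun u => IZR m + u) (fun t => Re (gexp z t))); auto.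
            apply derivable_continuous_pt. apply ex_derive_Reals_0. auto_derive; auto.
          * apply (continuity_pt_comp (fun u => IZR m + u) (fun t => Im (gexp z t))); auto.
            apply derivable_continuous_pt. apply ex_derive_Reals_0. auto_derive; auto.
        + intros v Hv. rewrite Rplus_0_r. apply ge_lip; auto.
      - rewrite rsum_scal, Rmult_comm. apply Rmult_le_compat_r; auto. apply HL, zr_nd. }
    replace (RtoC (/ INR N) * csum An (seq 0 N) - th)%C with
      (- (S1 - RtoC (/ INR N) * csum An (seq 0 N)) + ((S1 - S2) + (S2 - th)))%C by ring.
    eapply Rle_trans; [apply Cmod_triangle |]. rewrite Cmod_opp.
    pose proof (Cmod_triangle (S1 - S2) (S2 - th)). lra. }
  assert (K2 : forall eps, 0 < eps -> exists N, forall n, (N <= n)%nat -> Cmod (An n - G / c * th') < eps).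
  { intros eps He. destruct (hs_Z_lim _ _ (hs_scal (G / c)%C _ _ H2) eps He) as [N HN].
    exists N. intros n Hn. rewrite An_zr. apply HN; auto. }
  assert (E : Cmod (th - G / c * th') <= 0).
  { apply le_epsilon. intros e He.
    destruct (cesaro An _ K2 (e / 2)) as [N0 [HN0 F1]]; [lra |].
    (* N is taken above 1/eta^2, so the two Fejer errors eta and 1/(eta N) are both at most eta. *)
    set (eta := e / (4 * (La + 1))).
    assert (Heta : 0 < eta) by (apply Rdiv_lt_0_compat; lra).
    destruct (INR_unbounded (/ (eta * eta))) as [N1 HN1].
    set (N := max N0 (S N1)).
    assert (HN : (1 <= N)%nat) by lia.
    assert (HN2 : / (eta * eta) < INR N).
    { eapply Rlt_le_trans; [apply HN1 | apply le_INR; lia]. }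
    specialize (K1 N eta HN Heta). specialize (F1 N ltac:(lia)).
    assert (HN' : 0 < INR N) by (apply lt_0_INR; lia).
    assert (Q : / (eta * INR N) <= eta).
    { apply Rmult_le_reg_l with (eta * INR N); [nra |]. rewrite Rinv_r by nra.
      assert (1 < eta * eta * INR N); [| nra].
      replace 1 with (eta * eta * / (eta * eta)) by (field; lra). apply Rmult_lt_compat_l; nra. }
    assert (Q2 : La * (eta + / (eta * INR N)) <= e / 2).
    { apply Rle_trans with ((La + 1) * (eta + eta)); [assert (0 < / (eta * INR N)) by (apply Rinv_0_lt_compat; nra); apply Rmult_le_compat; lra |].
      unfold eta. right. field. lra. }
    rewrite RtoC_inv in K1 by lra.
    replace (th - G / c * th')%C with (- (/ INR N * csum An (seq 0 N) - th) + (/ INR N * csum An (seq 0 N) - G / c * th'))%C by ring.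
    eapply Rle_trans; [apply Cmod_triangle |]. rewrite Cmod_opp. lra. }
  assert (E2 : Cmod (th - G / c * th') = 0) by (pose proof (Cmod_ge_0 (th - G / c * th')); lra).
  apply Cmod_eq_0 in E2. replace th with ((th - G / c * th') + G / c * th')%C at 1 by ring. rewrite E2; ring.
Qed.

End Theta.

(** * Theta series of the lattice *)

Definition n2 (v : list Z) : nat := fold_right (fun a acc => (Z.to_nat (a * a) + acc)%nat) 0%nat v.

Lemma INR_sqZ (a : Z) : INR (Z.to_nat (a * a)) = IZR a * IZR a.
Proof. rewrite INR_IZR_INZ, Z2Nat.id, mult_IZR by nia. reflexivity. Qed.

Lemma vnorm_n2 v : vnorm v = sqrt (INR (n2 v)).
Proof.
  unfold vnorm. f_equal. induction v as [| a v IH]; [reflexivity |].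
  cbn [fold_right n2]. fold (n2 v). rewrite plus_INR, INR_sqZ, IH. ring.
Qed.

Lemma box_in n N v : In v (box n N) <-> length v = n /\ forall a, In a v -> (Z.abs a <= Z.of_nat N)%Z.
Proof.
  revert v. induction n as [| n IH]; intros v; simpl.
  - split.
    + intros [<- | []]. split; auto. intros a [].
    + intros [H _]. destruct v; [auto | discriminate].
  - rewrite in_flat_map. split.
    + intros [a [Ha Hv]]. apply in_map_iff in Hv. destruct Hv as [w [<- Hw]]. apply IH in Hw.
      destruct Hw as [Hl Hw]. apply in_map_iff in Ha. destruct Ha as [k [<- Hk]]. apply in_seq in Hk.
      split; [simpl; auto |]. intros b [<- | Hb]; [lia | auto].
    + intros [Hl Hv]. destruct v as [| a v]; [discriminate |].
      exists a. split.
      * apply in_map_iff. exists (Z.to_nat (a + Z.of_nat N)). specialize (Hv a (or_introl eq_refl)).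
        split; [lia | apply in_seq; lia].
      * apply in_map, IH. split; [simpl in Hl; lia |]. intros b Hb; apply Hv; simpl; auto.
Qed.

Lemma box_nd n N : NoDup (box n N).
Proof.
  induction n as [| n IH]; [repeat constructor; auto |].
  cbn [box].
  assert (H : NoDup (map (fun k => (Z.of_nat k - Z.of_nat N)%Z) (seq 0 (2 * N + 1)))).
  { apply FinFun.Injective_map_NoDup; [intros x y; lia | apply seq_NoDup]. }
  induction H as [| a l Ha Hl IHl]; simpl; [constructor |].
  apply NoDup_app; auto.
  - apply FinFun.Injective_map_NoDup; auto. intros x y E; congruence.
  - intros v H1 H2. apply in_map_iff in H1. destruct H1 as [w [<- Hw]].
    apply in_flat_map in H2. destruct H2 as [b [Hb H2]]. apply in_map_iff in H2. destruct H2 as [w' [E _]].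
    injection E as -> _. contradiction.
Qed.

(** The sphere of squared radius n: its coordinates are at most n in absolute value, so the box of
    size n contains it. The count [rr nu n] is r(n) in dimension nu. *)
Definition Vn (nu n : nat) : list (list Z) := filter (fun v => Nat.eqb (n2 v) n) (box nu n).
Definition rr (nu n : nat) : nat := length (Vn nu n).

Lemma n2_coord v a : In a v -> (Z.abs a <= Z.of_nat (n2 v))%Z.
Proof.
  induction v as [| b v IH]; [intros [] |]. cbn [n2 fold_right]. fold (n2 v).
  intros [<- | Ha]; [nia |]. specialize (IH Ha). lia.
Qed.

Lemma Vn_in nu n v : In v (Vn nu n) <-> length v = nu /\ n2 v = n.
Proof.
  unfold Vn. rewrite filter_In, box_in, Nat.eqb_eq. split.
  - intros [[H1 _] H2]; auto.
  - intros [H1 H2]. subst. repeat split; auto. apply n2_coord.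
Qed.

Lemma Vn_nd nu n : NoDup (Vn nu n).
Proof. apply NoDup_filter, box_nd. Qed.

(** Z^nu sits inside the type of all lists as the lists of length nu; functions on it are extended
    by [f0] to the other lengths. *)
Definition onlen {X : Type} (nu : nat) (f0 : X) (f : list Z -> X) (v : list Z) : X :=
  if Nat.eqb (length v) nu then f v else f0.

Lemma onlen_eq {X : Type} nu (f0 : X) f v : length v = nu -> onlen nu f0 f v = f v.
Proof. intros <-. unfold onlen. rewrite Nat.eqb_refl; auto. Qed.

Lemma smb_vec (g : Z -> R) nu : smb g ->
  smb (onlen nu 0 (fun v => fold_right (fun a acc => g a * acc) 1 v)).
Proof.
  intros Hg. assert (Hp : forall a, 0 <= g a) by (destruct Hg as [B [Hp _]]; auto).
  assert (Hq : forall v, 0 <= fold_right (fun a acc => g a * acc) 1 v).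
  { induction v; simpl; [lra | apply Rmult_le_pos; auto]. }
  induction nu as [| nu IH].
  - exists 1. split.
    + intros v. unfold onlen. destruct (Nat.eqb (length v) 0); [apply Hq | lra].
    + intros L HL. apply Rle_trans with (rsum (onlen 0 0 (fun v => fold_right (fun a acc => g a * acc) 1 v)) (nil :: diffl L (nil :: nil))).
      * apply rsum_incl; auto.
        -- intros v. unfold onlen. destruct (Nat.eqb (length v) 0); [apply Hq | lra].
        -- intros v Hv. destruct (eqd v nil); [subst; left; auto | right; apply diffl_in; split; auto].
           intros [|[]]; auto.
      * simpl. rewrite rsum_zero; [unfold onlen; simpl; lra |].
        intros v Hv. apply diffl_in in Hv. destruct Hv as [_ Hv]. unfold onlen.
        destruct v; [exfalso; apply Hv; simpl; auto | auto].
  - apply (smb_push (fun v : list Z => (hd 0%Z v, tl v))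
      (fun av => g (fst av) * onlen nu 0 (fun v => fold_right (fun a acc => g a * acc) 1 v) (snd av))).
    + intros v. unfold onlen. destruct (Nat.eqb (length v) (S nu)); [apply Hq | lra].
    + intros v Hv. unfold onlen in *. destruct v as [| a v]; simpl in *; [contradiction |].
      destruct (Nat.eqb (length v) nu); [lra | contradiction].
    + intros v v' Hv Hv' E. unfold onlen in *. destruct v as [| a v], v' as [| a' v']; simpl in *; try contradiction.
      congruence.
    + apply smb_prod; auto.
Qed.

Lemma group_by_norm nu (phi : nat -> C) l :
  smb (onlen nu 0 (fun v => Cmod (phi (n2 v)))) ->
  hs (onlen nu (RtoC 0) (fun v => phi (n2 v))) l ->
  hs (fun n => INR (rr nu n) * phi n)%C l /\ smb (fun n => INR (rr nu n) * Cmod (phi n)).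
Proof.
  intros Hs Hh.
  assert (Hd : forall v, Cmod (onlen nu (RtoC 0) (fun v => phi (n2 v)) v) <= onlen nu 0 (fun v => Cmod (phi (n2 v))) v).
  { intros v. unfold onlen. destruct (Nat.eqb (length v) nu); [lra | rewrite Cmod_0; lra]. }
  assert (Hf : forall n, hs (onfib n2 n (onlen nu (RtoC 0) (fun v => phi (n2 v)))) (INR (rr nu n) * phi n)%C).
  { intros n. replace (INR (rr nu n) * phi n)%C with (csum (onfib n2 n (onlen nu (RtoC 0) (fun v => phi (n2 v)))) (Vn nu n)).
    - apply hs_finite; [apply Vn_nd |]. intros v Hv. unfold onfib, onlen.
      destruct (eqd (n2 v) n) as [E | E]; auto.
      destruct (Nat.eqb_spec (length v) nu) as [E' | E']; auto. exfalso. apply Hv, Vn_in; auto.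
    - rewrite (csum_ext_in _ (fun _ => phi n)).
      + rewrite csum_const. reflexivity.
      + intros v Hv. apply Vn_in in Hv. destruct Hv as [E1 E2]. unfold onfib, onlen.
        destruct (eqd (n2 v) n); [| contradiction]. rewrite E1, Nat.eqb_refl, E2. auto. }
  split.
  - apply (hs_fiber n2 _ _ Hd _ Hf _ Hs Hh).
  - apply (smb_le _ (fun n => Cmod (INR (rr nu n) * phi n))).
    + intros n. rewrite Cmod_RM by apply pos_INR. split; [| lra].
      apply Rmult_le_pos; [apply pos_INR | apply Cmod_ge_0].
    + apply (smb_fiber n2 _ _ Hd _ Hf Hs).
Qed.

Definition gn (z : C) (n : nat) : C := cexp (- (z * INR n)).

Lemma Cmod_gn z n : Cmod (gn z n) = exp (- (Re z * INR n)).
Proof. unfold gn. rewrite Cmod_cexp. cri. f_equal. ring. Qed.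

Lemma gn_cons z a v : gn z (n2 (a :: v)) = (gexp z (IZR a) * gn z (n2 v))%C.
Proof.
  unfold gn, gexp. rewrite <- cexp_plus. f_equal. cbn [n2 fold_right]. fold (n2 v).
  rewrite plus_INR, INR_sqZ, RtoC_plus. ring.
Qed.

Lemma gexp_smb x : 0 < x -> smb (fun m : Z => exp (- (x * (IZR m * IZR m)))).
Proof.
  intros Hx. eapply smb_le; [| apply (smb_gauss_Z x Hx)].
  intros m. cbv beta. pose proof (Rabs_pos (IZR m)). pose proof (exp_pos (- (x * (IZR m * IZR m)))). split; nra.
Qed.

Lemma vec_exp_smb nu x : 0 < x -> smb (onlen nu 0 (fun v => exp (- (x * INR (n2 v))))).
Proof.
  intros Hx.
  eapply smb_le; [| apply (smb_vec _ nu (gexp_smb x Hx))].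
  intros v. unfold onlen. destruct (Nat.eqb (length v) nu); [| lra]. split; [left; apply exp_pos | right].
  induction v as [| a v IH]; [simpl; rewrite Rmult_0_r, Ropp_0, exp_0; auto |].
  cbn [fold_right n2]. fold (n2 v). rewrite <- IH, <- exp_plus. f_equal. rewrite plus_INR, INR_sqZ. ring.
Qed.

(** Induction on the dimension: the head coordinate splits off through the product sum [hs_pair],
    followed by the reindexing (a, v) -> a :: v. *)
Lemma theta_pow nu z th : 0 < Re z -> hs (fun m : Z => gexp z (IZR m)) th ->
  hs (onlen nu (RtoC 0) (fun v => gn z (n2 v))) (th ^ nu)%C.
Proof.
  intros Hz Hth. induction nu as [| nu IH].
  - assert (E : onlen 0 (RtoC 0) (fun v => gn z (n2 v)) nil = RtoC 1).
    { unfold onlen, gn. simpl. rewrite Cmult_0_r, Copp_0, cexp_0. auto. }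
    simpl Cpow. rewrite <- E. apply hs_single. intros v Hv. unfold onlen. destruct v; [contradiction | auto].
  - rewrite Cpow_S.
    assert (D1 : forall m : Z, Cmod (gexp z (IZR m)) <= exp (- (Re z * (IZR m * IZR m)))) by (intros; rewrite Cmod_ge; lra).
    assert (D2 : forall v, Cmod (onlen nu (RtoC 0) (fun v => gn z (n2 v)) v) <= onlen nu 0 (fun v => exp (- (Re z * INR (n2 v)))) v).
    { intros v. unfold onlen. destruct (Nat.eqb (length v) nu); [rewrite Cmod_gn; lra | rewrite Cmod_0; lra]. }
    pose proof (hs_pair _ _ _ _ _ _ D1 D2 (gexp_smb _ Hz) (vec_exp_smb nu _ Hz) Hth IH) as HP.
    set (F := fun ab : Z * list Z => (gexp z (IZR (fst ab)) * onlen nu (RtoC 0) (fun v => gn z (n2 v)) (snd ab))%C) in HP.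
    assert (D3 : forall ab, Cmod (F ab) <= exp (- (Re z * (IZR (fst ab) * IZR (fst ab)))) * onlen nu 0 (fun v => exp (- (Re z * INR (n2 v)))) (snd ab)).
    { intros ab. unfold F. rewrite Cmod_mult. apply Rmult_le_compat; auto; apply Cmod_ge_0. }
    assert (NZ : forall a v, F (a, v) <> 0 -> length v = nu).
    { intros a v H. unfold F, onlen in H. simpl in H. destruct (Nat.eqb_spec (length v) nu); auto.
      exfalso. apply H. ring. }
    apply (hs_fiber (fun ab : Z * list Z => fst ab :: snd ab) F _ D3 _) with (l := (th * th ^ nu)%C); auto.
    + apply fibers_reindex.
      * intros [a v] [a' v'] _ _ E. simpl in E. congruence.
      * intros [a v] H. apply NZ in H. unfold F. simpl fst. simpl snd.
        rewrite !onlen_eq by (simpl; auto). apply gn_cons.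
      * intros v H. destruct v as [| a v]; [exfalso; apply H; reflexivity |].
        assert (Hl : length v = nu).
        { unfold onlen in H. destruct (Nat.eqb_spec (length (a :: v)) (S nu)); [simpl in e; lia | contradiction]. }
        exists (a, v). split; auto. unfold F. simpl fst. simpl snd. rewrite onlen_eq in * by (simpl; auto).
        rewrite <- gn_cons. auto.
    + apply (smb_prod _ _ (gexp_smb _ Hz) (vec_exp_smb nu _ Hz)).
Qed.

Lemma theta_series nu z th : 0 < Re z -> hs (fun m : Z => gexp z (IZR m)) th ->
  hs (fun n => INR (rr nu n) * gn z n)%C (th ^ nu)%C.
Proof.
  intros Hz Hth. apply group_by_norm; [| apply theta_pow; auto].
  eapply smb_le; [| apply (vec_exp_smb nu _ Hz)].
  intros v. unfold onlen. destruct (Nat.eqb (length v) nu); [rewrite Cmod_gn; split; [left; apply exp_pos | lra] | lra].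
Qed.

Lemma rr_exp_smb nu x : 0 < x -> smb (fun n => INR (rr nu n) * exp (- (x * INR n))).
Proof.
  intros Hx.
  assert (D1 : forall m : Z, Cmod (gexp x (IZR m)) <= exp (- (x * (IZR m * IZR m)))) by (intros; rewrite Cmod_ge; cri; lra).
  destruct (hs_exists _ _ D1 (gexp_smb x Hx)) as [th Hth].
  assert (K : smb (fun n => INR (rr nu n) * Cmod (gn x n))).
  { apply (group_by_norm nu (gn x) (th ^ nu)%C); [| apply theta_pow; auto].
    eapply smb_le; [| apply (vec_exp_smb nu _ Hx)].
    intros v. unfold onlen. destruct (Nat.eqb (length v) nu); [rewrite Cmod_gn; cri; split; [left; apply exp_pos | lra] | lra]. }
  eapply smb_le; [| apply K]. intros n. cbv beta. rewrite Cmod_gn. cri. split; [| lra].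
  apply Rmult_le_pos; [apply pos_INR | left; apply exp_pos].
Qed.

(** * Exponentials as superpositions of Gaussians, and the formula for Theta *)

Lemma exder_cont (u : R -> R) x : ex_derive u x -> continuity_pt u x.
Proof. intros H. apply continuity_pt_filterlim, (ex_derive_continuous (V := R_NormedModule) u); auto. Qed.

(** The principal square root by half-angle formulas. For Re z > 0 it lies in the sector |Im| < Re
    in which Gaussian integrals can be rotated. *)
Definition csqrt (z : C) : C :=
  (sqrt ((Cmod z + Re z) / 2), Im z / (2 * sqrt ((Cmod z + Re z) / 2))).

Lemma Cmod_sq (z : C) : Cmod z * Cmod z = Re z * Re z + Im z * Im z.
Proof.
  unfold Cmod. rewrite sqrt_sqrt; [unfold Re, Im; simpl; ring |].
  apply Rplus_le_le_0_compat; apply pow2_ge_0.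
Qed.

Lemma csqrt_spec z : 0 < Re z -> (csqrt z * csqrt z)%C = z /\ Rabs (Im (csqrt z)) < Re (csqrt z).
Proof.
  intros Hz. set (p := sqrt ((Cmod z + Re z) / 2)).
  pose proof (Cmod_ge_0 z). pose proof (Cmod_sq z) as Q.
  assert (Hp : 0 < p) by (apply sqrt_lt_R0; lra).
  assert (Hp2 : p * p = (Cmod z + Re z) / 2) by (apply sqrt_sqrt; lra).
  assert (Hq2 : Im z / (2 * p) * (Im z / (2 * p)) = (Cmod z - Re z) / 2).
  { replace (Im z / (2 * p) * (Im z / (2 * p))) with (Im z * Im z / (4 * (p * p))) by (field; lra).
    rewrite Hp2. replace (Im z * Im z) with (Cmod z * Cmod z - Re z * Re z) by lra. field. lra. }
  split.
  - apply C_eq; cri; unfold csqrt; simpl; fold p.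
    + rewrite Hp2, Hq2. field.
    + field. lra.
  - unfold csqrt; simpl; fold p.
    apply Rnot_le_lt. intros K.
    assert (p * p <= Rabs (Im z / (2 * p)) * Rabs (Im z / (2 * p))) by (apply Rmult_le_compat; lra).
    rewrite <- Rabs_mult, Rabs_pos_eq in H0 by apply Rle_0_sqr. rewrite Hq2, Hp2 in H0. lra.
Qed.

Lemma CI_comp (f : R -> C) (g dg : R -> R) a b : a <= b ->
  (forall x, a <= x <= b -> Cc f (g x)) ->
  (forall x, a <= x <= b -> is_derive g x (dg x)) ->
  (forall x, a <= x <= b -> continuity_pt dg x) ->
  CI (fun w => RtoC (dg w) * f (g w))%C a b = CI f (g a) (g b).
Proof.
  intros Hab Hf Hg Hdg. unfold CI.
  rewrite <- (RInt_comp (V := R_CompleteNormedModule) (fun t => Re (f t)) g dg a b).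
  - rewrite <- (RInt_comp (V := R_CompleteNormedModule) (fun t => Im (f t)) g dg a b).
    + f_equal; apply RInt_ext; intros x _; [apply Re_RM | apply Im_RM].
    + rewrite Rmin_left, Rmax_right by auto. intros x Hx. apply continuity_pt_filterlim, Hf; auto.
    + rewrite Rmin_left, Rmax_right by auto. intros x Hx. split; [auto | apply continuity_pt_filterlim; auto].
  - rewrite Rmin_left, Rmax_right by auto. intros x Hx. apply continuity_pt_filterlim, Hf; auto.
  - rewrite Rmin_left, Rmax_right by auto. intros x Hx. split; [auto | apply continuity_pt_filterlim; auto].
Qed.

Lemma CI_swap f a b : a <= b -> Cci f a b -> CI f b a = (- CI f a b)%C.
Proof.
  intros Hab Hf. destruct (Cci_ex f a b Hab Hf) as [E1 E2].
  apply C_eq; [rewrite Re_opp | rewrite Im_opp]; symmetry.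
  - apply (opp_RInt_swap (V := R_CompleteNormedModule)). exact E1.
  - apply (opp_RInt_swap (V := R_CompleteNormedModule)). exact E2.
Qed.

Lemma ge_even z v : gexp z (- v) = gexp z v.
Proof. unfold gexp. rewrite Rmult_opp_opp. reflexivity. Qed.

Lemma CI_ge_even z b : 0 <= b -> CI (gexp z) (- b) b = (2 * CI (gexp z) 0 b)%C.
Proof.
  intros Hb. rewrite <- (CI_Chasles (gexp z) (- b) 0 b); try lra; [| apply Cci_ge].
  replace (CI (gexp z) (- b) 0) with (CI (gexp z) 0 b); [ring |].
  pose proof (CI_comp (gexp z) (fun w => - w) (fun _ => -1) 0 b Hb) as K.
  cbv beta in K; rewrite Ropp_0 in K.
  assert (K2 : CI (fun w => RtoC (-1) * gexp z (- w))%C 0 b = CI (gexp z) 0 (- b)).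
  { apply K; intros.
    - apply (Cci_ge z (- x) (- x)); lra.
    - auto_derive; auto.
    - apply continuity_pt_const; intros ? ?; auto. }
  rewrite (CI_swap (gexp z) (- b) 0) in K2 by (try lra; apply Cci_ge).
  rewrite (CI_ext _ (fun w => RtoC (-1) * gexp z w)%C) in K2 by (intros; rewrite ge_even; auto).
  rewrite CI_scal in K2 by (auto; apply Cci_ge).
  replace (RtoC (-1)) with (- RtoC 1)%C in K2 by (rewrite <- RtoC_opp; auto).
  replace (CI (gexp z) 0 b) with (- (- RtoC 1 * CI (gexp z) 0 b))%C by ring. rewrite K2. ring.
Qed.

Lemma exp_int_bound M k p q : 0 <= M -> 0 < k -> 0 <= p <= q ->
  ex_RInt (fun w => M * exp (- (k * w))) p q /\ RInt (fun w => M * exp (- (k * w))) p q <= M / k.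
Proof.
  intros HM Hk Hpq.
  assert (E : is_RInt (fun w => M * exp (- (k * w))) p q (minus (- (M / k) * exp (- (k * q))) (- (M / k) * exp (- (k * p))))).
  { apply (is_RInt_derive (V := R_CompleteNormedModule) (fun w => - (M / k) * exp (- (k * w)))).
    - intros x _. auto_derive; auto. field. lra.
    - intros x _. apply (ex_derive_continuous (V := R_NormedModule)). auto_derive; auto. }
  split; [eexists; apply E |]. rewrite (is_RInt_unique _ _ _ _ E). unfold minus, plus, opp; simpl.
  assert (0 <= M / k) by (apply Rmult_le_pos; [auto | left; apply Rinv_0_lt_compat; auto]).
  pose proof (exp_pos (- (k * q))).
  assert (exp (- (k * p)) <= 1) by (rewrite <- exp_0; apply exp_le; nra).
  nra.
Qed.

(** In terms of t = sqrt y w the integrand is y^(-k/2) t^k exp(-t^2), majorised by a multiple of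
    y^(-k/2) exp(-t); integrating in w yields the last factor y^(-1/2), uniformly in the
    interval. *)
Lemma gauss_int_bound k : exists M, 0 < M /\ forall y p q, 0 < y -> 0 <= p <= q ->
  ex_RInt (fun w => w ^ k * exp (- (y * (w * w)))) p q /\
  RInt (fun w => w ^ k * exp (- (y * (w * w)))) p q <= M * / sqrt y ^ (k + 1).
Proof.
  destruct (pow_le_exp k) as [M [HM HP]].
  exists (M * exp 1). pose proof (exp_pos 1). split; [apply Rmult_lt_0_compat; lra |].
  intros y p q Hy Hpq. assert (Hs : 0 < sqrt y) by (apply sqrt_lt_R0; auto).
  assert (Hex : ex_RInt (fun w => w ^ k * exp (- (y * (w * w)))) p q).
  { apply cont_ex_RInt; [lra |]. intros x _. apply exder_cont.
    auto_derive; auto. }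
  split; auto.
  destruct (exp_int_bound (M * exp 1 * / sqrt y ^ k) (sqrt y) p q) as [E1 E2]; auto.
  { apply Rmult_le_pos; [apply Rmult_le_pos; lra | left; apply Rinv_0_lt_compat, pow_lt; auto]. }
  eapply Rle_trans; [apply RInt_le with (g := fun w => M * exp 1 * / sqrt y ^ k * exp (- (sqrt y * w))); auto; [lra |] |].
  - intros w Hw. set (t := sqrt y * w). assert (Ht : 0 <= t) by (apply Rmult_le_pos; lra).
    replace (w ^ k) with (t ^ k * / sqrt y ^ k).
    + replace (y * (w * w)) with (t * t).
      * specialize (HP t Ht).
        assert (t ^ k * exp (- (t * t)) <= M * exp 1 * exp (- t)).
        { apply Rle_trans with (M * exp t * exp (- (t * t))).
          - apply Rmult_le_compat_r; [left; apply exp_pos | auto].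
          - rewrite !Rmult_assoc, <- !exp_plus. apply Rmult_le_compat_l; [lra |]. apply exp_le.
            pose proof (Rle_0_sqr (t - 1)) as Q. unfold Rsqr in Q. lra. }
        replace (t ^ k * / sqrt y ^ k * exp (- (t * t))) with (t ^ k * exp (- (t * t)) * / sqrt y ^ k) by ring.
        replace (M * exp 1 * / sqrt y ^ k * exp (- t)) with (M * exp 1 * exp (- t) * / sqrt y ^ k) by ring.
        apply Rmult_le_compat_r; auto. left; apply Rinv_0_lt_compat, pow_lt; auto.
      * unfold t. rewrite <- (sqrt_sqrt y) at 3 by lra. ring.
    + unfold t. rewrite Rpow_mult_distr. field. apply pow_nonzero. lra.
  - eapply Rle_trans; [apply E2 |]. right. rewrite pow_add. simpl. field. split; [lra | apply pow_nonzero; lra].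
Qed.

(** The partial sums of a dominated series with sum 0 are uniformly small, hence so are their
    integrals. It is applied to the difference of the two sides of an identity. *)
Lemma hs_CI_zero (F : nat -> R -> C) (bd : nat -> R) a b : a <= b ->
  (forall n, Cci (F n) a b) -> (forall n w, a <= w <= b -> Cmod (F n w) <= bd n) -> smb bd ->
  (forall w, a <= w <= b -> hs (fun n => F n w) 0) ->
  hs (fun n => CI (F n) a b) 0.
Proof.
  intros Hab HC Hb Hs H0.
  assert (Hd : forall n, Cmod (CI (F n) a b) <= (b - a) * bd n) by (intros n; apply CI_bound_const; auto).
  destruct (hs_exists _ _ Hd (smb_scal (b - a) _ ltac:(lra) Hs)) as [l Hl].
  assert (E : Cmod l <= 0).
  { apply le_epsilon. intros e He.
    destruct (hs_nat_lim _ _ Hl (e / 2)) as [N1 F1]; [lra |].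
    destruct (smb_tail bd Hs (e / (2 * (b - a + 1)))) as [L0 [HL0 Ht]]; [apply Rdiv_lt_0_compat; lra |].
    set (N := max N1 (S (fold_right max 0%nat L0))).
    assert (HN : forall n, In n L0 -> (n < N)%nat).
    { intros n Hn. assert (n <= fold_right max 0%nat L0)%nat; [| lia]. clear - Hn.
      induction L0 as [| m L IH]; simpl in *; [tauto |]. destruct Hn as [-> | Hn]; [lia |]. specialize (IH Hn). lia. }
    specialize (F1 N ltac:(lia)).
    assert (K : csum (fun n => CI (F n) a b) (seq 0 N) = CI (fun w => csum (fun n => F n w) (seq 0 N)) a b).
    { symmetry. apply (CI_csum F); auto. }
    assert (K2 : Cmod (csum (fun n => CI (F n) a b) (seq 0 N)) <= e / 2).
    { rewrite K. apply Rle_trans with ((b - a) * (e / (2 * (b - a + 1)))).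
      - apply CI_bound_const; auto.
        + intros x Hx. apply (Cc_csum F). intros t; apply HC; auto.
        + intros w Hw.
          assert (HF : hs (fun n => if in_dec eqd n (seq 0 N) then F n w else 0) (csum (fun n => F n w) (seq 0 N))).
          { replace (csum (fun n => F n w) (seq 0 N)) with (csum (fun n => if in_dec eqd n (seq 0 N) then F n w else 0) (seq 0 N)).
            - apply hs_finite; [apply seq_NoDup |]. intros t Ht0. destruct (in_dec eqd t (seq 0 N)); [contradiction | auto].
            - apply csum_ext_in. intros t Ht0. destruct (in_dec eqd t (seq 0 N)); [auto | contradiction]. }
          pose proof (hs_minus _ _ _ _ HF (H0 w Hw)) as HM.
          replace (csum (fun n => F n w) (seq 0 N) - 0)%C with (csum (fun n => F n w) (seq 0 N)) in HM by ring.
          apply (hs_bound _ (fun n => if in_dec eqd n (seq 0 N) then 0 else bd n) _ _ HM).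
          * intros n. destruct (in_dec eqd n (seq 0 N)).
            -- replace (F n w - F n w)%C with (RtoC 0) by ring. rewrite Cmod_0; lra.
            -- replace (0 - F n w)%C with (- F n w)%C by ring. rewrite Cmod_opp; auto.
          * intros L HL.
            replace (rsum (fun n => if in_dec eqd n (seq 0 N) then 0 else bd n) L)
              with (rsum bd (diffl L (seq 0 N))).
            -- left. apply Ht; [apply NoDup_filter; auto |].
               intros n Hn Hn0. apply diffl_in in Hn. destruct Hn as [_ Hn]. apply Hn, in_seq.
               specialize (HN n Hn0). lia.
            -- unfold diffl. clear. induction L as [| n L IH]; simpl; auto.
               destruct (in_dec eqd n (seq 0 N)); simpl; rewrite IH; ring.
      - apply Rle_trans with ((b - a + 1) * (e / (2 * (b - a + 1)))).
        + apply Rmult_le_compat_r; [left; apply Rdiv_lt_0_compat; lra | lra].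
        + right. field. lra. }
    pose proof (Cmod_dist l (csum (fun n => CI (F n) a b) (seq 0 N))) as D.
    replace (l - csum (fun n => CI (F n) a b) (seq 0 N))%C with (- (csum (fun n => CI (F n) a b) (seq 0 N) - l))%C in D by ring.
    rewrite Cmod_opp in D. lra. }
  assert (E2 : Cmod l = 0) by (pose proof (Cmod_ge_0 l); lra).
  apply Cmod_eq_0 in E2. rewrite E2 in Hl. auto.
Qed.

Section Schloemilch.
Variable G : R.
Hypothesis HG : climA (fun b => CI (fun v => gk 0 v) (- b) b) G.
Variable c : C.
Hypothesis Hc : Rabs (Im c) < Re c.
Let s := (c * c)%C.

(** For fixed w this is a Gaussian in x. Since w^2/4 + x^2/w^2 = (w/2 - x/w)^2 + x, its integral
    over w > 0 is a multiple of exp(-s x) by a constant independent of x >= 0. *)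
Definition Hx (s : C) (x w : R) : C := cexp (- (s * (w * w / 4 + x * x / (w * w))%R)).

Lemma Cmod_Hx z x w : Cmod (Hx z x w) = exp (- (Re z * (w * w / 4 + x * x / (w * w)))).
Proof. unfold Hx. rewrite Cmod_cexp. cri. f_equal. ring. Qed.

Lemma Cc_Hx z x w : 0 < w -> Cc (Hx z x) w.
Proof.
  intros Hw. unfold Hx. eapply Dc_Cc. apply Dc_cexp, Dc_opp, Dc_mult; [apply Dc_const |].
  apply (Dc_R _ w (w / 2 - 2 * (x * x) / (w * w * w))). auto_derive; [nra |]. field. lra.
Qed.

Lemma Cmod_Hx_le1 z x w : 0 <= Re z -> 0 < w -> Cmod (Hx z x w) <= 1.
Proof.
  intros Hz Hw. rewrite Cmod_Hx, <- exp_0. apply exp_le.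
  assert (0 <= w * w / 4 + x * x / (w * w)).
  { apply Rplus_le_le_0_compat; [nra |]. apply Rmult_le_pos; [nra | left; apply Rinv_0_lt_compat; nra]. }
  nra.
Qed.

Lemma gauss_base : climA (fun b => CI (gexp s) (- b) b) (G / c)%C.
Proof.
  pose proof (gauss_fourier G HG c Hc 0) as H.
  replace (G / c * cexp (- ((0 * 0 / 4)%R / (c * c))))%C with (G / c)%C in H.
  - eapply climA_ext; [| apply H]. intros b _. apply CI_ext. intros v _.
    rewrite Rmult_0_l, cos_0. unfold s. ring.
  - replace (0 * 0 / 4) with 0 by field. replace (- (0 / (c * c)))%C with (RtoC 0) by (unfold Cdiv; ring).
    rewrite cexp_0. ring.
Qed.

(** Cauchy-Schloemilch substitution: the involution w -> 2 x/w preserves [2 x/A, A] and changes the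
    sign of F(w) = w/2 - x/w. Averaging the integral with its image replaces dw by dF, as F' = 1/2 +
    x/w^2. *)
Lemma schloemilch_pos x A : 0 < x -> 1 <= A -> 2 * x <= A ->
  CI (Hx s x) (2 * x / A) A = (cexp (- (s * x)) * CI (gexp s) (- (A / 2 - x / A)) (A / 2 - x / A))%C.
Proof.
  intros Hx0 HA HA2. set (a := 2 * x / A).
  assert (Ha : 0 < a) by (apply Rdiv_lt_0_compat; lra).
  assert (HaA : a <= A). { apply Rle_trans with 1; [| auto]. unfold a. apply Rmult_le_reg_r with A; [lra |]. unfold Rdiv. rewrite Rmult_assoc, Rinv_l by lra. lra. }
  set (F := fun w => w / 2 - x / w).
  assert (HF : forall w, 0 < w -> Hx s x w = (cexp (- (s * x)) * gexp s (F w))%C).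
  { intros w Hw. unfold Hx, gexp. rewrite <- cexp_plus. f_equal.
    replace (F w * F w) with (w * w / 4 + x * x / (w * w) - x) by (unfold F; field; lra).
    rewrite RtoC_minus. ring. }
  assert (CF : Cci (fun w => gexp s (F w)) a A).
  { intros w Hw. unfold gexp. eapply Dc_Cc. apply Dc_cexp, Dc_opp, Dc_mult; [apply Dc_const |].
    apply (Dc_R _ w (2 * F w * (1 / 2 + x / (w * w)))). unfold F. auto_derive; [lra |]. field. lra. }
  rewrite (CI_ext _ (fun w => cexp (- (s * x)) * gexp s (F w))%C).
  2:{ intros w Hw. rewrite Rmin_left in Hw by auto. apply HF; lra. }
  rewrite CI_scal by auto. f_equal.
  set (I := CI (fun w => gexp s (F w)) a A).
  assert (Fa : F a = - (A / 2 - x / A)) by (unfold F, a; field; lra).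
  assert (FA : F A = A / 2 - x / A) by reflexivity.
  rewrite <- Fa, <- FA.
  rewrite <- (CI_comp (gexp s) F (fun w => 1 / 2 + x / (w * w)) a A); auto.
  2:{ intros w Hw. eapply (Cci_ge s); split; apply Rle_refl. }
  2:{ intros w Hw. unfold F. auto_derive; [lra |]. field. lra. }
  2:{ intros w Hw. apply exder_cont. auto_derive. nra. }
  pose proof (CI_comp (fun w => gexp s (F w)) (fun w => 2 * x / w) (fun w => - (2 * x / (w * w))) a A HaA) as K.
  assert (R1 : 2 * x / a = A) by (unfold a; field; lra).
  cbv beta in K. rewrite R1 in K. fold a in K.
  assert (CK : Cci (fun w => RtoC (- (2 * x / (w * w))) * gexp s (F w))%C a A).
  { intros w Hw. apply Cc_mult; [| apply CF; auto]. eapply Dc_Cc. apply Dc_R with (l := 4 * x / (w * w * w)). auto_derive; [nra |]. field. lra. }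
  assert (K2 : CI (fun w => RtoC (- (2 * x / (w * w))) * gexp s (F w))%C a A = (- I)%C).
  { unfold I. rewrite <- CI_swap by auto. rewrite <- K.
    - apply CI_ext. intros w Hw. rewrite Rmin_left in Hw by auto. f_equal. rewrite <- ge_even. f_equal. unfold F. field. lra.
    - intros w Hw. apply CF. split.
      + unfold a, Rdiv. apply Rmult_le_compat_l; [lra |]. apply Rinv_le_contravar; lra.
      + rewrite <- R1. unfold Rdiv. apply Rmult_le_compat_l; [lra |]. apply Rinv_le_contravar; lra.
    - intros w Hw. auto_derive; [lra |]. field. lra.
    - intros w Hw. apply exder_cont. auto_derive. nra. }
  rewrite (CI_ext _ (fun w => / 2 * gexp s (F w) + (- / 2) * (RtoC (- (2 * x / (w * w))) * gexp s (F w)))%C).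
  - rewrite CI_plus, !CI_scal, K2; auto.
    + fold I. assert (H2 : (2 : C) <> 0) by (intros Q; apply RtoC_inj in Q; lra). field. auto.
    + intros w Hw. apply Cc_mult; [apply Cc_const | auto].
    + intros w Hw. apply Cc_mult; [apply Cc_const | auto].
  - intros w Hw. rewrite Rmin_left in Hw by auto.
    rewrite <- RtoC_inv by lra. rewrite <- RtoC_opp, Cmult_assoc, <- RtoC_mult, <- Cmult_plus_distr_r, <- RtoC_plus.
    do 2 f_equal. field. lra.
Qed.

(** The interval invariant under the involution begins at 2 x/A; replacing this end by 1/A, common
    to all x, costs O(1/A). At x = 0 the involution degenerates, and the integral is an ordinary
    half-line Gaussian. *)
Lemma schloemilch x : 0 <= x -> climA (fun A => CI (Hx s x) (/ A) A) (G / c * cexp (- (s * x)))%C.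
Proof.
  intros Hx0. pose proof (cone_re_sq c Hc) as Hs. fold s in Hs.
  assert (CH : forall a b, 0 < a -> Cci (Hx s x) a b) by (intros a b Ha w Hw; apply Cc_Hx; lra).
  destruct (Req_dec x 0) as [-> | Hne].
  - replace (G / c * cexp (- (s * 0)))%C with (G / c)%C by (rewrite Cmult_0_r, Copp_0, cexp_0; ring).
    assert (E : forall A, 1 <= A -> CI (fun w => gexp s (w / 2)) 0 A = CI (gexp s) (- (A / 2)) (A / 2)).
    { intros A HA. rewrite CI_ge_even by lra.
      pose proof (CI_comp (gexp s) (fun w => w / 2) (fun _ => / 2) 0 A ltac:(lra)) as K. cbv beta in K.
      replace (0 / 2) with 0 in K by field. rewrite <- K.
      - rewrite CI_scal; [| lra |].
        + rewrite RtoC_inv by lra. assert (H2 : (2 : C) <> 0) by (intros Q; apply RtoC_inj in Q; lra). field. auto.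
        + intros w _. unfold gexp. eapply Dc_Cc. apply Dc_cexp, Dc_opp, Dc_mult; [apply Dc_const |].
          apply (Dc_R _ w (w / 2)). auto_derive; auto. field.
      - intros w Hw. eapply (Cci_ge s); split; apply Rle_refl.
      - intros w Hw. auto_derive; auto. field.
      - intros w Hw. apply continuity_pt_const; intros ? ?; auto. }
    assert (C0 : forall a b, Cci (fun w => gexp s (w / 2)) a b).
    { intros a b w _. unfold gexp. eapply Dc_Cc. apply Dc_cexp, Dc_opp, Dc_mult; [apply Dc_const |].
      apply (Dc_R _ w (w / 2)). auto_derive; auto. field. }
    apply (climA_close (fun A => CI (gexp s) (- (A / 2)) (A / 2))).
    + intros e He. destruct (gauss_base e He) as [B HB]. exists (2 * B). intros b Hb. apply HB. lra.
    + intros e He. exists (Rmax 1 (2 / e)). intros A HA.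
      pose proof (Rmax_l 1 (2 / e)). pose proof (Rmax_r 1 (2 / e)).
      assert (HA1 : 1 <= A) by lra. rewrite <- E by auto.
      assert (Hi : 0 < / A) by (apply Rinv_0_lt_compat; lra).
      assert (Hi1 : / A <= 1) by (rewrite <- Rinv_1; apply Rinv_le_contravar; lra).
      rewrite (CI_ext (Hx s 0) (fun w => gexp s (w / 2))).
      * rewrite <- (CI_Chasles (fun w => gexp s (w / 2)) 0 (/ A) A) by (auto; lra).
        match goal with |- Cmod (?u - (?v + ?u)) < _ => replace (u - (v + u))%C with (- v)%C by ring end.
        rewrite Cmod_opp. apply Rle_lt_trans with ((/ A - 0) * 1).
        -- apply CI_bound_const; auto; [lra |]. intros w _. rewrite Cmod_ge, <- exp_0. apply exp_le.
           pose proof (Rle_0_sqr (w / 2)) as Q. unfold Rsqr in Q. nra.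
        -- apply Rmult_lt_reg_l with A; [lra |].
           replace (A * ((/ A - 0) * 1)) with 1 by (field; lra).
           apply Rlt_le_trans with (2 / e * e); [replace (2 / e * e) with 2 by (field; lra); lra |].
           apply Rmult_le_compat_r; lra.
      * intros w Hw. rewrite Rmin_left in Hw by lra. unfold Hx, gexp. do 4 f_equal. field. lra.
  - assert (Hx1 : 0 < x) by lra.
    apply (climA_close (fun A => cexp (- (s * x)) * CI (gexp s) (- (A / 2 - x / A)) (A / 2 - x / A))%C).
    + replace (G / c * cexp (- (s * x)))%C with (cexp (- (s * x)) * (G / c))%C by ring.
      apply climA_scal. intros e He. destruct (gauss_base e He) as [B HB].
      exists (Rmax (Rmax 1 x) (2 * (B + 1))). intros A HA.
      pose proof (Rmax_l (Rmax 1 x) (2 * (B + 1))). pose proof (Rmax_r (Rmax 1 x) (2 * (B + 1))).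
      pose proof (Rmax_l 1 x). pose proof (Rmax_r 1 x).
      apply HB. assert (x / A <= 1); [| lra].
      apply Rmult_le_reg_r with A; [lra |]. unfold Rdiv. rewrite Rmult_assoc, Rinv_l by lra. lra.
    + intros e He. exists (Rmax (Rmax 1 (2 * x)) ((2 * x + 2) / e)). intros A HA.
      pose proof (Rmax_l (Rmax 1 (2 * x)) ((2 * x + 2) / e)). pose proof (Rmax_r (Rmax 1 (2 * x)) ((2 * x + 2) / e)).
      pose proof (Rmax_l 1 (2 * x)). pose proof (Rmax_r 1 (2 * x)).
      assert (HA1 : 1 <= A) by lra. assert (HA2 : 2 * x <= A) by lra.
      rewrite <- schloemilch_pos by auto.
      assert (Hi : 0 < / A) by (apply Rinv_0_lt_compat; lra).
      assert (Hi1 : / A <= 1) by (rewrite <- Rinv_1; apply Rinv_le_contravar; lra).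
      assert (Ha : 0 < 2 * x / A) by (apply Rdiv_lt_0_compat; lra).
      assert (HaA : 2 * x / A <= 1).
      { apply Rmult_le_reg_r with A; [lra |]. unfold Rdiv. rewrite Rmult_assoc, Rinv_l by lra. lra. }
      assert (Hsmall : (2 * x + 1) * / A < e).
      { apply Rmult_lt_reg_l with A; [lra |].
        replace (A * ((2 * x + 1) * / A)) with (2 * x + 1) by (field; lra).
        apply Rlt_le_trans with ((2 * x + 2) / e * e); [replace ((2 * x + 2) / e * e) with (2 * x + 2) by (field; lra); lra |].
        apply Rmult_le_compat_r; lra. }
      destruct (Rle_dec (/ A) (2 * x / A)) as [Q | Q].
      * rewrite <- (CI_Chasles (Hx s x) (/ A) (2 * x / A) A) by (auto; lra).
        match goal with |- Cmod (?u + ?v - ?v) < _ => replace (u + v - v)%C with u by ring end.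
        eapply Rle_lt_trans; [apply (CI_bound_const _ 1); auto |].
        -- intros w Hw. apply Cmod_Hx_le1; lra.
        -- unfold Rdiv. lra.
      * rewrite <- (CI_Chasles (Hx s x) (2 * x / A) (/ A) A) by (auto; lra).
        match goal with |- Cmod (?u - (?v + ?u)) < _ => replace (u - (v + u))%C with (- v)%C by ring end.
        rewrite Cmod_opp. eapply Rle_lt_trans; [apply (CI_bound_const _ 1); [lra | auto |] |].
        -- intros w Hw. apply Cmod_Hx_le1; lra.
        -- unfold Rdiv in *. nra.
Qed.

End Schloemilch.

Lemma Re_Cinv_pos (s : C) : 0 < Re s -> 0 < Re (/ s).
Proof.
  intros H. destruct s as [x y]. unfold Cinv; simpl in *.
  apply Rdiv_lt_0_compat; auto. nra.
Qed.

(** This is (s^2 + 4 pi^2 n)/(4 s), the coefficient of w^2 in the exponent after Poisson summation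
    over the lattice. *)
Definition zn (s : C) (n : nat) : C := (s / 4 + (PI * PI * INR n)%R * / s)%C.

Lemma Re_zn s n : Re (zn s n) = Re s / 4 + PI * PI * INR n * Re (/ s).
Proof.
  unfold zn. rewrite Re_plus, Re_RM. f_equal. unfold Cdiv. rewrite <- RtoC_inv by lra.
  rewrite Cmult_comm, Re_RM. unfold Rdiv. ring.
Qed.

Lemma Re_zn_low s : 0 < Re s -> exists k, 0 < k /\ forall n, k * (INR n + 1) <= Re (zn s n).
Proof.
  intros Hs. pose proof (Re_Cinv_pos s Hs). pose proof PI_RGT_0.
  assert (0 < PI * PI * Re (/ s)) by (apply Rmult_lt_0_compat; nra).
  exists (Rmin (Re s / 4) (PI * PI * Re (/ s))). split; [apply Rmin_glb_lt; lra |].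
  intros n. rewrite Re_zn. pose proof (pos_INR n).
  pose proof (Rmin_l (Re s / 4) (PI * PI * Re (/ s))). pose proof (Rmin_r (Re s / 4) (PI * PI * Re (/ s))).
  set (m := Rmin _ _) in *. nra.
Qed.

(** (n + 1)^(-(nu+1)/2), the decay in n of the dual terms; up to constants it majorises both sides
    of the formula for Theta. *)
Definition poly_wt (nu n : nat) : R := / sqrt (INR n + 1) ^ (nu + 1).

Lemma poly_wt_pos nu n : 0 < poly_wt nu n.
Proof.
  apply Rinv_0_lt_compat, pow_lt, sqrt_lt_R0. pose proof (pos_INR n); lra.
Qed.

Lemma exp_sqrt_wt nu y : 0 < y -> exists M, 0 < M /\ forall n, exp (- (y * sqrt (INR n))) <= M * poly_wt nu n.
Proof.
  intros Hy. destruct (pow_le_exp (nu + 1)) as [M [HM HP]].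
  assert (Hyk : 0 < / y ^ (nu + 1)) by (apply Rinv_0_lt_compat, pow_lt; auto).
  exists (exp y * M * / y ^ (nu + 1)). split.
  { apply Rmult_lt_0_compat; auto. apply Rmult_lt_0_compat; auto. apply exp_pos. }
  intros n. pose proof (pos_INR n). set (r := sqrt (INR n + 1)).
  assert (Hr : 0 < r) by (apply sqrt_lt_R0; lra).
  assert (Hrs : r <= sqrt (INR n) + 1).
  { apply Rsqr_incr_0_var; [| pose proof (sqrt_pos (INR n)); lra]. unfold Rsqr, r. rewrite sqrt_sqrt by lra.
    pose proof (sqrt_pos (INR n)). pose proof (sqrt_sqrt (INR n) ltac:(lra)). nra. }
  specialize (HP (y * r) ltac:(nra)). rewrite Rpow_mult_distr in HP.
  unfold poly_wt. fold r.
  apply Rle_trans with (exp y * exp (- (y * r))).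
  - rewrite <- exp_plus. apply exp_le. nra.
  - rewrite !Rmult_assoc. apply Rmult_le_compat_l; [left; apply exp_pos |].
    assert (0 < y ^ (nu + 1)) by (apply pow_lt; auto). assert (0 < r ^ (nu + 1)) by (apply pow_lt; auto).
    apply Rmult_le_reg_l with (y ^ (nu + 1) * r ^ (nu + 1)); [nra |].
    replace (y ^ (nu + 1) * r ^ (nu + 1) * (M * (/ y ^ (nu + 1) * / r ^ (nu + 1)))) with M by (field; split; lra).
    replace M with (M * exp (y * r) * exp (- (y * r))).
    + apply Rmult_le_compat_r; [left; apply exp_pos | lra].
    + rewrite Rmult_assoc, <- exp_plus, Rplus_opp_r, exp_0; ring.
Qed.

Section ThetaFormula.
Variables (nu : nat) (G Gk : R).
Hypothesis HG : climA (fun b => CI (fun v => gk 0 v) (- b) b) G.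
Hypothesis HGk : climA (fun b => CI (fun v => gk nu v) 0 b) Gk.
Hypothesis Hr : smb (fun n => INR (rr nu n) * poly_wt nu n).
Variable c : C.
Hypothesis Hc : Rabs (Im c) < Re c.
Let s := (c * c)%C.

Let F (n : nat) (w : R) : C := (INR (rr nu n) * (Hx s (sqrt (INR n)) w - (G / c) ^ nu * (RtoC (w ^ nu) * gexp (zn s n) w)))%C.

(** At fixed w this is theta inversion for c/w, raised to the power nu and multiplied by exp(-s
    w^2/4). *)
Lemma theta_pointwise w : 0 < w -> hs (fun n => F n w) 0.
Proof.
  intros Hw. pose proof (cone_neq_0 c Hc) as Hc0. pose proof (cone_re_sq c Hc) as Hs. fold s in Hs.
  assert (Hw0 : RtoC w <> 0) by (intros K; apply RtoC_inj in K; lra).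
  assert (Hi : 0 < / w) by (apply Rinv_0_lt_compat; auto).
  set (cw := (RtoC (/ w) * c)%C).
  assert (Hcw : Rabs (Im cw) < Re cw).
  { unfold cw. rewrite Re_RM, Im_RM, Rabs_mult, (Rabs_pos_eq (/ w)) by lra. apply Rmult_lt_compat_l; auto. }
  pose proof (cone_neq_0 cw Hcw) as Hcw0.
  pose proof (cone_re_sq cw Hcw) as Hz1.
  set (z2 := ((PI * PI)%R / (cw * cw))%C).
  assert (Ez2 : z2 = ((PI * PI * (w * w))%R * / s)%C).
  { unfold z2, cw, s. rewrite !RtoC_mult, RtoC_inv by lra. field. auto. }
  assert (Hz2 : 0 < Re z2).
  { rewrite Ez2, Re_RM. pose proof PI_RGT_0. apply Rmult_lt_0_compat; [| apply Re_Cinv_pos; auto].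
    apply Rmult_lt_0_compat; nra. }
  assert (D : forall z : C, 0 < Re z -> exists th, hs (fun m : Z => gexp z (IZR m)) th).
  { intros z Hz. apply hs_exists with (fun m : Z => exp (- (Re z * (IZR m * IZR m)))); [| apply gexp_smb; auto].
    intros; rewrite Cmod_ge; lra. }
  destruct (D _ Hz1) as [th Hth]. destruct (D _ Hz2) as [th' Hth'].
  pose proof (theta_inversion G HG cw Hcw th th' Hth Hth') as E.
  pose proof (theta_series nu _ _ Hz1 Hth) as S1. pose proof (theta_series nu _ _ Hz2 Hth') as S2.
  set (e := cexp (- (s * (w * w / 4)%R))).
  assert (K : hs (fun n => e * (INR (rr nu n) * gn (cw * cw) n) - (G / c) ^ nu * RtoC (w ^ nu) * e * (INR (rr nu n) * gn z2 n))%C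
    (e * th ^ nu - (G / c) ^ nu * RtoC (w ^ nu) * e * th' ^ nu)%C).
  { apply hs_minus; apply hs_scal; auto. }
  replace (e * th ^ nu - (G / c) ^ nu * RtoC (w ^ nu) * e * th' ^ nu)%C with (RtoC 0) in K.
  - eapply hs_ext; [| apply K]. intros n. cbv beta.
    assert (E1 : Hx s (sqrt (INR n)) w = (e * gn (cw * cw) n)%C).
    { unfold Hx, e, gn. rewrite <- cexp_plus. f_equal. rewrite sqrt_sqrt by apply pos_INR.
      unfold cw, s. rewrite RtoC_plus. unfold Rdiv at 2. rewrite !RtoC_mult, Rinv_mult, RtoC_mult. ring. }
    assert (E2 : gexp (zn s n) w = (e * gn z2 n)%C).
    { unfold gexp, e, gn. rewrite <- cexp_plus. f_equal. rewrite Ez2. unfold zn, Rdiv, Cdiv. rewrite !RtoC_mult, RtoC_inv by lra. ring. }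
    unfold F. rewrite E1, E2. ring.
  - rewrite E. rewrite Cpow_mult_l.
    replace (G / cw)%C with (RtoC w * (G / c))%C.
    + rewrite Cpow_mult_l, RtoC_pow. ring.
    + unfold cw. rewrite RtoC_inv by lra. field. auto.
Qed.

Lemma Cci_F n a b : 0 < a -> Cci (F n) a b.
Proof.
  intros Ha w Hw. unfold F. apply Cc_mult; [apply Cc_const |].
  apply (Cc_plus (Hx s (sqrt (INR n)))); [apply Cc_Hx; lra |].
  eapply Dc_Cc. apply Dc_opp, Dc_mult; [apply Dc_const |]. apply Dc_mult; [| apply Dc_ge].
  apply (Dc_R _ w (INR nu * w ^ pred nu)). auto_derive; auto. ring.
Qed.

Lemma Cci_wge n a b : Cci (fun w => RtoC (w ^ nu) * gexp (zn s n) w)%C a b.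
Proof.
  intros w Hw. eapply Dc_Cc. apply Dc_mult; [| apply Dc_ge].
  apply (Dc_R _ w (INR nu * w ^ pred nu)). auto_derive; auto. ring.
Qed.

Lemma theta_truncated A : 1 <= A ->
  hs (fun n => INR (rr nu n) * CI (Hx s (sqrt (INR n))) (/ A) A -
      (G / c) ^ nu * (INR (rr nu n) * CI (fun w => RtoC (w ^ nu) * gexp (zn s n) w)%C (/ A) A))%C 0.
Proof.
  intros HA. pose proof (cone_re_sq c Hc) as Hs. fold s in Hs.
  assert (Hi : 0 < / A) by (apply Rinv_0_lt_compat; lra).
  assert (Hi1 : / A <= 1) by (rewrite <- Rinv_1; apply Rinv_le_contravar; lra).
  pose proof (Re_Cinv_pos s Hs) as Hsi. pose proof PI_RGT_0 as HPI.
  set (x1 := Re s / (A * A)). assert (Hx1 : 0 < x1) by (apply Rdiv_lt_0_compat; nra).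
  set (x2 := PI * PI * Re (/ s) * (/ A * / A)). assert (Hx2 : 0 < x2) by (apply Rmult_lt_0_compat; [apply Rmult_lt_0_compat; [nra | auto] | nra]).
  set (K := Cmod ((G / c) ^ nu) * A ^ nu).
  assert (HK : 0 <= K) by (apply Rmult_le_pos; [apply Cmod_ge_0 | apply pow_le; lra]).
  assert (H0 : hs (fun n => CI (F n) (/ A) A) 0).
  { apply (hs_CI_zero F (fun n => INR (rr nu n) * exp (- (x1 * INR n)) + K * (INR (rr nu n) * exp (- (x2 * INR n))))).
    - lra.
    - intros n. apply Cci_F; auto.
    - intros n w Hw. unfold F. rewrite Cmod_RM by apply pos_INR.
      replace (INR (rr nu n) * exp (- (x1 * INR n)) + K * (INR (rr nu n) * exp (- (x2 * INR n))))
        with (INR (rr nu n) * (exp (- (x1 * INR n)) + K * exp (- (x2 * INR n)))) by ring.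
      apply Rmult_le_compat_l; [apply pos_INR |].
      eapply Rle_trans; [apply Cmod_triangle |]. rewrite Cmod_opp. pose proof (pos_INR n) as Hn.
      apply Rplus_le_compat.
      + rewrite Cmod_Hx. apply exp_le. rewrite sqrt_sqrt by auto.
        assert (INR n / (A * A) <= INR n / (w * w)).
        { apply Rmult_le_compat_l; auto. apply Rinv_le_contravar; nra. }
        unfold x1. replace (Re s / (A * A) * INR n) with (Re s * (INR n / (A * A))) by (unfold Rdiv; ring).
        assert (0 <= w * w) by nra. nra.
      + rewrite Cmod_mult. unfold K. rewrite !Rmult_assoc. apply Rmult_le_compat_l; [apply Cmod_ge_0 |].
        rewrite Cmod_RM by (apply pow_le; lra). apply Rmult_le_compat.
        * apply pow_le; lra.
        * apply Cmod_ge_0.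
        * apply pow_incr; lra.
        * rewrite Cmod_ge. apply exp_le. rewrite Re_zn. unfold x2.
          assert (/ A * / A <= w * w) by nra.
          assert (0 <= PI * PI * INR n * Re (/ s)) by (apply Rmult_le_pos; nra).
          replace (PI * PI * Re (/ s) * (/ A * / A) * INR n) with (PI * PI * INR n * Re (/ s) * (/ A * / A)) by ring.
          nra.
    - apply smb_plus; [apply rr_exp_smb; auto |]. apply smb_scal; auto. apply rr_exp_smb; auto.
    - intros w Hw. apply theta_pointwise. lra. }
  eapply hs_ext; [| apply H0]. intros n. cbv beta. unfold F.
  assert (C1 : Cci (Hx s (sqrt (INR n))) (/ A) A) by (intros w Hw; apply Cc_Hx; lra).
  assert (C2 : Cci (fun w => - (G / c) ^ nu * (RtoC (w ^ nu) * gexp (zn s n) w))%C (/ A) A).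
  { intros w Hw. apply Cc_mult; [apply Cc_const | eapply Cci_wge; eauto]. }
  rewrite (CI_ext _ (fun w => INR (rr nu n) * (Hx s (sqrt (INR n)) w + - (G / c) ^ nu * (RtoC (w ^ nu) * gexp (zn s n) w)))%C)
    by (intros; ring).
  rewrite CI_scal, CI_plus, CI_scal; auto; try lra.
  - ring.
  - apply Cci_wge.
  - intros w Hw. apply Cc_plus; auto.
Qed.

(** The pointwise identity is integrated over [1/A, A] and A tends to infinity under domination by
    [poly_wt]. One side becomes Theta through [schloemilch], the other a series of Gaussian moments
    with parameters [zn s n]. *)
Lemma theta_formula_aux Th :
  hs (fun n => INR (rr nu n) * cexp (- (s * sqrt (INR n))))%C Th ->
  exists Sg, hs (fun n => INR (rr nu n) * / csqrt (zn s n) ^ (nu + 1))%C Sg /\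
    smb (fun n => INR (rr nu n) * Cmod (/ csqrt (zn s n) ^ (nu + 1))) /\
    (G / c * Th = (G / c) ^ nu * (Gk * Sg))%C.
Proof.
  intros HTh. pose proof (cone_re_sq c Hc) as Hs. fold s in Hs.
  destruct (Re_zn_low s Hs) as [k [Hk Hzn]].
  assert (Hznp : forall n, 0 < Re (zn s n)).
  { intros n. eapply Rlt_le_trans; [| apply Hzn]. pose proof (pos_INR n). nra. }
  destruct (gauss_int_bound nu) as [M1 [HM1 B1]].
  destruct (gauss_int_bound 0) as [M0 [HM0 B0]].
  destruct (exp_sqrt_wt nu (Re s / 2)) as [M2 [HM2 B2]]; [lra |].
  set (A := fun j : nat => INR j + 1).
  assert (HA : forall j, 1 <= A j) by (intros j; unfold A; pose proof (pos_INR j); lra).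
  assert (HAi : forall j, 0 < / A j <= A j).
  { intros j. specialize (HA j). split; [apply Rinv_0_lt_compat; lra |].
    apply Rle_trans with 1; [rewrite <- Rinv_1; apply Rinv_le_contravar; lra | auto]. }
  set (sk := sqrt k). assert (Hsk : 0 < sk) by (apply sqrt_lt_R0; auto).
  set (X := fun j n => (INR (rr nu n) * CI (Hx s (sqrt (INR n))) (/ A j) (A j))%C).
  set (Y := fun j n => (INR (rr nu n) * CI (fun w => RtoC (w ^ nu) * gexp (zn s n) w)%C (/ A j) (A j))%C).
  set (K1 := M2 * (M0 * / sqrt (Re s / 8) ^ (0 + 1))).
  set (K2 := M1 * / sk ^ (nu + 1)).
  assert (Hs8 : 0 < sqrt (Re s / 8)) by (apply sqrt_lt_R0; lra).
  assert (HK1 : 0 <= K1).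
  { unfold K1. apply Rmult_le_pos; [lra |]. apply Rmult_le_pos; [lra |]. left; apply Rinv_0_lt_compat, pow_lt; auto. }
  assert (HK2 : 0 <= K2).
  { unfold K2. apply Rmult_le_pos; [lra |]. left; apply Rinv_0_lt_compat, pow_lt; auto. }
  (* The inequality w^2/4 + n/w^2 >= w^2/8 + sqrt n / 2 splits off exponential decay in sqrt n and
     leaves an integrable Gaussian in w, uniformly in the truncation. *)
  assert (DX : forall j n, Cmod (X j n) <= K1 * (INR (rr nu n) * poly_wt nu n)).
  { intros j n. unfold X. rewrite Cmod_RM by apply pos_INR.
    replace (K1 * (INR (rr nu n) * poly_wt nu n)) with (INR (rr nu n) * (M2 * poly_wt nu n * (M0 * / sqrt (Re s / 8) ^ (0 + 1)))) by (unfold K1; ring).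
    apply Rmult_le_compat_l; [apply pos_INR |].
    destruct (HAi j) as [Hi1 Hi2]. destruct (B0 (Re s / 8) (/ A j) (A j)) as [E1 E2]; [lra | lra |].
    eapply Rle_trans; [apply CI_bound with (g := fun w => exp (- (Re s / 2 * sqrt (INR n))) * (w ^ 0 * exp (- (Re s / 8 * (w * w))))); auto |].
    - intros w Hw. apply Cc_Hx. lra.
    - apply (ex_RInt_scal (V := R_NormedModule)); auto.
    - intros w Hw. rewrite Cmod_Hx, pow_O, Rmult_1_l, <- exp_plus. apply exp_le.
      set (y := sqrt (INR n)). assert (Hw0 : 0 < w) by lra.
      replace (y * y / (w * w)) with (y / w * (y / w)) by (field; lra).
      assert (Ey : y = w * (y / w)) by (field; lra). rewrite Ey at 3. set (q := y / w).
      pose proof (Rle_0_sqr (w / 4 - q)) as Q. unfold Rsqr in Q.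
      assert (0 <= Re s * (w * w / 8 + q * q - w * q / 2)) by (apply Rmult_le_pos; nra). lra.
    - rewrite (RInt_scal (V := R_CompleteNormedModule)) by auto. unfold scal; simpl; unfold mult; simpl.
      apply Rmult_le_compat; auto.
      + left; apply exp_pos.
      + apply RInt_ge_0; auto. intros w Hw. rewrite Rmult_1_l. left; apply exp_pos. }
  assert (DY : forall j n, Cmod (Y j n) <= K2 * (INR (rr nu n) * poly_wt nu n)).
  { intros j n. unfold Y. rewrite Cmod_RM by apply pos_INR.
    replace (K2 * (INR (rr nu n) * poly_wt nu n)) with (INR (rr nu n) * (K2 * poly_wt nu n)) by ring.
    apply Rmult_le_compat_l; [apply pos_INR |].
    destruct (HAi j) as [Hi1 Hi2]. destruct (B1 (Re (zn s n)) (/ A j) (A j) (Hznp n)) as [E1 E2]; [lra |].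
    eapply Rle_trans; [apply CI_bound with (g := fun w => w ^ nu * exp (- (Re (zn s n) * (w * w)))); auto |].
    - apply Cci_wge.
    - intros w Hw. rewrite Cmod_RM by (apply pow_le; lra). rewrite Cmod_ge. lra.
    - eapply Rle_trans; [apply E2 |]. unfold K2, poly_wt. rewrite Rmult_assoc. apply Rmult_le_compat_l; [lra |].
      rewrite <- Rinv_mult, <- Rpow_mult_distr. pose proof (pos_INR n).
      apply Rinv_le_contravar; [apply pow_lt, Rmult_lt_0_compat; auto; apply sqrt_lt_R0; lra |].
      apply pow_incr. split; [apply Rmult_le_pos; apply sqrt_pos |].
      unfold sk. rewrite <- sqrt_mult by lra. apply sqrt_le_1_alt, Hzn. }
  assert (SX := smb_scal K1 _ HK1 Hr). assert (SY := smb_scal K2 _ HK2 Hr).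
  assert (EX : forall j, exists l, hs (X j) l) by (intros j; apply (hs_exists (X j) _ (DX j) SX)).
  assert (LX : forall n, climA (fun a => CI (Hx s (sqrt (INR n))) (/ a) a) (G / c * cexp (- (s * sqrt (INR n))))%C).
  { intros n. apply (schloemilch G HG c Hc). apply sqrt_pos. }
  assert (LY : forall n, climA (fun a => CI (fun w => RtoC (w ^ nu) * gexp (zn s n) w)%C (/ a) a) (Gk / csqrt (zn s n) ^ (nu + 1))%C).
  { intros n. destruct (csqrt_spec _ (Hznp n)) as [Q1 Q2].
    pose proof (gauss_moment_c nu Gk (csqrt (zn s n)) HGk Q2) as L. rewrite Q1 in L.
    eapply climA_close; [apply L |]. intros e He.
    exists (Rmax 1 (2 / e)). intros a Ha. pose proof (Rmax_l 1 (2 / e)). pose proof (Rmax_r 1 (2 / e)).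
    assert (Hi : 0 < / a) by (apply Rinv_0_lt_compat; lra).
    assert (Hi1 : / a <= 1) by (rewrite <- Rinv_1; apply Rinv_le_contravar; lra).
    rewrite <- (CI_Chasles (fun w => RtoC (w ^ nu) * gexp (zn s n) w)%C 0 (/ a) a); try lra; [| apply Cci_wge].
    match goal with |- Cmod (?u - (?v + ?u)) < _ => replace (u - (v + u))%C with (- v)%C by ring end.
    rewrite Cmod_opp. apply Rle_lt_trans with ((/ a - 0) * 1).
    - apply CI_bound_const; [lra | apply Cci_wge |]. intros w Hw. rewrite Cmod_RM by (apply pow_le; lra).
      replace 1 with (1 * 1) by ring. apply Rmult_le_compat; [apply pow_le; lra | apply Cmod_ge_0 | |].
      + replace 1 with (1 ^ nu) by apply pow1. apply pow_incr; lra.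
      + rewrite Cmod_ge, <- exp_0. apply exp_le. specialize (Hznp n). nra.
    - apply Rmult_lt_reg_l with a; [lra |].
      replace (a * ((/ a - 0) * 1)) with 1 by (field; lra).
      apply Rlt_le_trans with (2 / e * e); [replace (2 / e * e) with 2 by (field; lra); lra |].
      apply Rmult_le_compat_r; lra. }
  assert (toA : forall (Fc : R -> C) l, climA Fc l -> forall e, 0 < e -> exists N, forall j, (N <= j)%nat -> Cmod (Fc (A j) - l) < e).
  { intros Fc l HF e He. destruct (HF e He) as [B HB]. destruct (INR_unbounded B) as [N HN].
    exists N. intros j Hj. apply HB. unfold A. assert (INR N <= INR j) by (apply le_INR; lia). lra. }
  set (fX := fun n => (INR (rr nu n) * (G / c * cexp (- (s * sqrt (INR n)))))%C).
  set (fY := fun n => (INR (rr nu n) * (Gk / csqrt (zn s n) ^ (nu + 1)))%C).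
  assert (PX : forall n e, 0 < e -> exists N, forall j, (N <= j)%nat -> Cmod (X j n - fX n) < e).
  { intros n. apply (toA (fun a => (INR (rr nu n) * CI (Hx s (sqrt (INR n))) (/ a) a)%C)). apply climA_scal, LX. }
  assert (PY : forall n e, 0 < e -> exists N, forall j, (N <= j)%nat -> Cmod (Y j n - fY n) < e).
  { intros n. apply (toA (fun a => (INR (rr nu n) * CI (fun w => RtoC (w ^ nu) * gexp (zn s n) w)%C (/ a) a)%C)). apply climA_scal, LY. }
  assert (DfY : forall n, Cmod (fY n) <= K2 * (INR (rr nu n) * poly_wt nu n)).
  { intros n. apply le_epsilon. intros e He. destruct (PY n e He) as [N HN]. specialize (HN N (Nat.le_refl _)).
    specialize (DY N n). pose proof (Cmod_dist (fY n) (Y N n)) as Q.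
    replace (fY n - Y N n)%C with (- (Y N n - fY n))%C in Q by ring. rewrite Cmod_opp in Q. lra. }
  assert (HfX : hs fX (G / c * Th)%C).
  { eapply hs_ext; [| apply (hs_scal (G / c)%C _ _ HTh)]. intros n. unfold fX. ring. }
  destruct (hs_exists _ _ DfY SY) as [lY HfY].
  assert (Gk0 : Gk <> 0).
  { intros E. destruct (gauss_moment nu) as [g [Hg Lg]]. pose proof (climA_unique _ _ _ HGk Lg) as Q.
    apply RtoC_inj in Q. lra. }
  assert (GkC : RtoC Gk <> 0) by (intros Q; apply RtoC_inj in Q; auto).
  exists (/ Gk * lY)%C. split; [| split].
  - eapply hs_ext; [| apply (hs_scal (/ Gk)%C _ _ HfY)]. intros n. unfold fY.
    destruct (csqrt_spec _ (Hznp n)) as [_ Q2]. pose proof (cone_neq_0 _ Q2). field. split; auto. apply Cpow_nz; auto.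
  - apply (smb_le _ (fun n => / Rabs Gk * (K2 * (INR (rr nu n) * poly_wt nu n)))).
    + intros n. split; [apply Rmult_le_pos; [apply pos_INR | apply Cmod_ge_0] |].
      specialize (DfY n). unfold fY in DfY. rewrite Cmod_RM in DfY by apply pos_INR.
      unfold Cdiv in DfY. rewrite Cmod_mult, Cmod_R in DfY.
      assert (0 < Rabs Gk) by (apply Rabs_pos_lt; auto).
      apply Rmult_le_reg_l with (Rabs Gk); auto. rewrite <- Rmult_assoc with (r2 := / Rabs Gk), Rinv_r by lra. lra.
    + apply smb_scal; auto. left; apply Rinv_0_lt_compat, Rabs_pos_lt; auto.
  - assert (Q : Cmod (G / c * Th - (G / c) ^ nu * lY) <= 0).
    { apply le_epsilon. intros e He.
      assert (KX := fun l (Hl : forall j, hs (X j) (l j)) => hs_tannery X fX _ l _ DX SX PX Hl HfX).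
      assert (KY := fun l (Hl : forall j, hs (Y j) (l j)) => hs_tannery Y fY _ l _ DY SY PY Hl HfY).
      pose proof (fun j => constructive_indefinite_description _ (EX j)) as EX'.
      set (lX := fun j => proj1_sig (EX' j)).
      assert (HlX : forall j, hs (X j) (lX j)) by (intros j; apply (proj2_sig (EX' j))).
      assert (EY : forall j, exists l, hs (Y j) l) by (intros j; apply (hs_exists (Y j) _ (DY j) SY)).
      pose proof (fun j => constructive_indefinite_description _ (EY j)) as EY'.
      set (lYj := fun j => proj1_sig (EY' j)).
      assert (HlY : forall j, hs (Y j) (lYj j)) by (intros j; apply (proj2_sig (EY' j))).
      assert (Eq : forall j, lX j = ((G / c) ^ nu * lYj j)%C).
      { intros j. pose proof (hs_minus _ _ _ _ (HlX j) (hs_scal ((G / c) ^ nu)%C _ _ (HlY j))) as H1.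
        pose proof (theta_truncated (A j) (HA j)) as H2.
        assert (H3 := hs_unique _ _ _ H1 H2). replace (lX j) with (lX j - (G / c) ^ nu * lYj j + (G / c) ^ nu * lYj j)%C by ring.
        rewrite H3. ring. }
      pose proof (Cmod_ge_0 ((G / c) ^ nu)) as Hg.
      destruct (KX lX HlX (e / 2)) as [N1 F1]; [lra |].
      destruct (KY lYj HlY (e / (2 * (Cmod ((G / c) ^ nu) + 1)))) as [N2 F2]; [apply Rdiv_lt_0_compat; lra |].
      specialize (F1 (max N1 N2) ltac:(lia)). specialize (F2 (max N1 N2) ltac:(lia)). rewrite Eq in F1.
      set (y := lYj (max N1 N2)) in *. set (g := ((G / c) ^ nu)%C) in *.
      replace (G / c * Th - g * lY)%C with (- (g * y - G / c * Th) + g * (y - lY))%C by ring.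
      eapply Rle_trans; [apply Cmod_triangle |]. rewrite Cmod_opp, Cmod_mult.
      assert (Cmod g * Cmod (y - lY) <= e / 2); [| lra].
      apply Rle_trans with ((Cmod g + 1) * (e / (2 * (Cmod g + 1)))).
      - apply Rmult_le_compat; try lra; try apply Cmod_ge_0.
      - right. field. lra. }
    assert (Q2 : Cmod (G / c * Th - (G / c) ^ nu * lY) = 0) by (pose proof (Cmod_ge_0 (G / c * Th - (G / c) ^ nu * lY)); lra).
    apply Cmod_eq_0 in Q2. replace (Gk * (/ Gk * lY))%C with lY by (field; auto).
    replace (G / c * Th)%C with (G / c * Th - (G / c) ^ nu * lY + (G / c) ^ nu * lY)%C by ring. rewrite Q2. ring.
Qed.

End ThetaFormula.

(** * The coefficients of log zeta *)

Definition isprime (p : nat) : Prop := (2 <= p)%nat /\ forall d, Nat.divide d p -> d = 1%nat \/ d = p.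

Lemma prime_divisor n : (2 <= n)%nat -> exists p, isprime p /\ Nat.divide p n.
Proof.
  induction n as [n IH] using (well_founded_induction lt_wf). intros Hn.
  destruct (classic (isprime n)) as [H | H].
  - exists n. split; auto. apply Nat.divide_refl.
  - apply NNPP. intros Hno. apply H. split; auto. intros d Hd.
    destruct (Nat.eq_dec d 1); auto. destruct (Nat.eq_dec d n); auto. exfalso.
    assert (d <= n)%nat by (apply Nat.divide_pos_le; auto; lia).
    assert (d <> 0)%nat. { intros ->. destruct Hd as [k Hk]. lia. }
    destruct (IH d) as [p [Hp Hpd]]; try lia.
    apply Hno. exists p. split; auto. eapply Nat.divide_trans; eauto.
Qed.

Lemma prime_coprime p a : isprime p -> ~ Nat.divide p a -> Nat.gcd p a = 1%nat.
Proof.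
  intros [_ Hp] Ha. destruct (Hp (Nat.gcd p a) (Nat.gcd_divide_l _ _)) as [E | E]; auto.
  exfalso. apply Ha. rewrite <- E. apply Nat.gcd_divide_r.
Qed.

Lemma prime_euclid p a b : isprime p -> Nat.divide p (a * b) -> Nat.divide p a \/ Nat.divide p b.
Proof.
  intros Hp H. destruct (classic (Nat.divide p a)); auto. right.
  apply (Nat.gauss p a b); auto. apply prime_coprime; auto.
Qed.

Lemma divide_fact d n : (1 <= d <= n)%nat -> Nat.divide d (fact n).
Proof.
  induction n as [| n IH]; [lia |]. intros H. simpl fact.
  destruct (Nat.eq_dec d (S n)) as [-> | E].
  - exists (fact n). simpl. lia.
  - replace (fact n + n * fact n)%nat with (S n * fact n)%nat by (simpl; lia).
    apply Nat.divide_mul_r, IH. lia.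
Qed.

Lemma prime_above N : exists p, isprime p /\ (N < p)%nat.
Proof.
  destruct (prime_divisor (fact N + 1)) as [p [Hp Hd]].
  { pose proof (lt_O_fact N). lia. }
  exists p. split; auto. destruct (Nat.lt_ge_cases N p); auto. exfalso.
  assert (Nat.divide p (fact N)) by (apply divide_fact; destruct Hp; lia).
  assert (Nat.divide p 1) by (apply (Nat.divide_add_cancel_r p (fact N) 1); auto).
  apply Nat.divide_1_r in H1. destruct Hp; lia.
Qed.

(** The local factor of [cf], equal to 1 off the prime divisors of k. Thus [cf] is multiplicative
    with value (1 - p)/p^a at p^a: it is the Dirichlet convolution of the Moebius function with
    1/n. *)
Definition pf (k p : nat) : R :=
  if ClassicalEpsilon.excluded_middle_informative (isprime p /\ Nat.divide p k) then 1 - INR p else 1.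

Definition rprod (f : nat -> R) (L : list nat) : R := fold_right (fun t a => f t * a) 1 L.

(* Chosen so that summing cf over the divisors of g gives 1/g. *)
Definition cf (k : nat) : R := / INR k * rprod (pf k) (seq 1 k).

Lemma rprod_mult f g L : rprod (fun t => f t * g t) L = rprod f L * rprod g L.
Proof. induction L; simpl; [ring | rewrite IHL; ring]. Qed.

Lemma rprod_ext f g L : (forall t, In t L -> f t = g t) -> rprod f L = rprod g L.
Proof. induction L; simpl; intros H; auto. rewrite H, IHL; auto. Qed.

Lemma rprod_one f L : (forall t, In t L -> f t = 1) -> rprod f L = 1.
Proof. induction L; simpl; intros H; auto. rewrite H, IHL; auto. ring. Qed.

Lemma rprod_app f L1 L2 : rprod f (L1 ++ L2) = rprod f L1 * rprod f L2.
Proof. induction L1; simpl; [ring | rewrite IHL1; ring]. Qed.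

Lemma pf_big k p : (1 <= k)%nat -> (k < p)%nat -> pf k p = 1.
Proof.
  intros Hk H. unfold pf. destruct (ClassicalEpsilon.excluded_middle_informative _) as [[_ D] |]; auto.
  apply Nat.divide_pos_le in D; lia.
Qed.

Lemma cf_range k N : (1 <= k)%nat -> (k <= N)%nat -> cf k = / INR k * rprod (pf k) (seq 1 N).
Proof.
  intros Hk HN. unfold cf. f_equal. replace N with (k + (N - k))%nat by lia.
  rewrite seq_app, rprod_app, (rprod_one _ (seq (1 + k) (N - k))); [ring |].
  intros t Ht. apply in_seq in Ht. apply pf_big; lia.
Qed.

Lemma rprod_single (a : R) p L : NoDup L -> In p L ->
  rprod (fun t => if Nat.eqb t p then a else 1) L = a.
Proof.
  induction L as [| b L IH]; simpl; [tauto |]. intros Hn Hin. inversion Hn; subst.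
  destruct (Nat.eqb_spec b p) as [-> | E].
  - rewrite rprod_one; [ring |]. intros t Ht. destruct (Nat.eqb_spec t p); auto. subst; contradiction.
  - rewrite IH; auto; [ring | tauto].
Qed.

Lemma cf_mul_div p k : isprime p -> (1 <= k)%nat -> Nat.divide p k -> cf (p * k) = cf k / INR p.
Proof.
  intros Hp Hk Hd. assert (2 <= p)%nat by apply Hp. assert (k <= p * k)%nat by nia.
  assert (0 < INR p) by (apply lt_0_INR; lia). assert (0 < INR k) by (apply lt_0_INR; lia).
  rewrite (cf_range k (p * k)) by auto. unfold cf. rewrite mult_INR.
  rewrite (rprod_ext (pf (p * k)) (pf k)); [field; lra |].
  intros q _. unfold pf.
  destruct (ClassicalEpsilon.excluded_middle_informative _) as [[A B] | A];
    destruct (ClassicalEpsilon.excluded_middle_informative _) as [[A' B'] | A']; auto; exfalso.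
  - apply A'. split; auto. destruct (prime_euclid q p k A B) as [D | D]; auto.
    destruct Hp as [_ Hp]. destruct (Hp q D) as [-> | ->]; auto. destruct A; lia.
  - apply A. split; auto. apply Nat.divide_mul_r; auto.
Qed.

Lemma cf_mul_ndiv p k : isprime p -> (1 <= k)%nat -> ~ Nat.divide p k ->
  cf (p * k) = cf k * ((1 - INR p) / INR p).
Proof.
  intros Hp Hk Hd. assert (2 <= p)%nat by apply Hp. assert (k <= p * k)%nat by nia.
  assert (0 < INR p) by (apply lt_0_INR; lia). assert (0 < INR k) by (apply lt_0_INR; lia).
  rewrite (cf_range k (p * k)) by auto. unfold cf. rewrite mult_INR.
  rewrite (rprod_ext (pf (p * k)) (fun q => pf k q * (if Nat.eqb q p then 1 - INR p else 1))).
  - rewrite rprod_mult, rprod_single; [field; lra | apply seq_NoDup | apply in_seq; nia].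
  - intros q _. unfold pf.
    destruct (Nat.eqb_spec q p) as [-> | E];
    destruct (ClassicalEpsilon.excluded_middle_informative _) as [[A B] | A];
    destruct (ClassicalEpsilon.excluded_middle_informative _) as [[A' B'] | A']; try ring; exfalso.
    + contradiction.
    + apply A. split; auto. apply Nat.divide_factor_l.
    + apply A. split; auto. apply Nat.divide_factor_l.
    + destruct (prime_euclid q p k A B) as [D | D]; auto.
      destruct Hp as [_ Hp]. destruct (Hp q D) as [-> | ->]; auto. destruct A; lia.
    + apply A. split; auto. apply Nat.divide_mul_r; auto.
Qed.

Lemma cf_1 : cf 1 = 1.
Proof. unfold cf. simpl.
  unfold pf. destruct (ClassicalEpsilon.excluded_middle_informative _) as [[[A _] _] | _]; [lia | simpl; field].
Qed.

Lemma prime_induction (P : nat -> Prop) : P 1%nat ->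
  (forall p k, isprime p -> (1 <= k)%nat -> P k -> P (p * k)%nat) -> forall n, (1 <= n)%nat -> P n.
Proof.
  intros H1 HS n. induction n as [n IH] using (well_founded_induction lt_wf). intros Hn.
  destruct (Nat.eq_dec n 1) as [-> | E]; auto.
  destruct (prime_divisor n) as [p [Hp [k Hk]]]; [lia |]. subst n. rewrite Nat.mul_comm.
  assert (2 <= p)%nat by apply Hp. apply HS; auto; [nia |]. apply IH; nia.
Qed.

Lemma cf_step p k : isprime p -> (1 <= k)%nat -> exists r, Rabs r <= 1 /\ r <> 0 /\ cf (p * k) = cf k * r.
Proof.
  intros Hp Hk. assert (2 <= INR p) by (change 2 with (INR 2); apply le_INR, Hp).
  assert (Hi : 0 < / INR p) by (apply Rinv_0_lt_compat; lra).
  assert (Hi1 : / INR p <= / 2) by (apply Rinv_le_contravar; lra).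
  destruct (classic (Nat.divide p k)) as [D | D].
  - exists (/ INR p). rewrite cf_mul_div by auto. split; [rewrite Rabs_pos_eq; lra |]. split; [lra | reflexivity].
  - exists ((1 - INR p) / INR p). rewrite cf_mul_ndiv by auto.
    replace ((1 - INR p) / INR p) with (/ INR p - 1) by (field; lra).
    split; [rewrite Rabs_left; lra |]. split; [lra | reflexivity].
Qed.

(** Each further prime multiplies the value by 1/p or by (1 - p)/p, both of modulus at most 1. *)
Lemma cf_mono b : (1 <= b)%nat -> forall j, (1 <= j)%nat -> Rabs (cf (b * j)) <= Rabs (cf b).
Proof.
  intros Hb. apply prime_induction; [rewrite Nat.mul_1_r; lra |].
  intros p k Hp Hk IH. replace (b * (p * k))%nat with (p * (b * k))%nat by lia.
  destruct (cf_step p (b * k) Hp) as [r [Hr [_ E]]]; [nia |]. rewrite E, Rabs_mult.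
  pose proof (Rabs_pos (cf (b * k))). nra.
Qed.

Lemma cf_le1 k : (1 <= k)%nat -> Rabs (cf k) <= 1.
Proof.
  intros Hk. pose proof (cf_mono 1 (Nat.le_refl _) k Hk) as H. rewrite Nat.mul_1_l, cf_1, Rabs_R1 in H. auto.
Qed.

Lemma cf_neq_0 k : (1 <= k)%nat -> cf k <> 0.
Proof.
  revert k. apply (prime_induction (fun k => cf k <> 0)); [rewrite cf_1; lra |].
  intros p k Hp Hk IH. destruct (cf_step p k Hp Hk) as [r [_ [Hr ->]]]. apply Rmult_integral_contrapositive; auto.
Qed.

(** A prime that already divides the argument contributes only 1/p. Hence the values at b j keep the
    sign of cf b when j is composed of primes of b; this is the source of positivity in the
    resonance sums. *)
Lemma cf_smooth b : (1 <= b)%nat -> forall j, (1 <= j)%nat ->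
  (forall p, isprime p -> Nat.divide p j -> Nat.divide p b) -> cf (b * j) = cf b / INR j.
Proof.
  intros Hb. apply (prime_induction (fun j => (forall p, isprime p -> Nat.divide p j -> Nat.divide p b) -> cf (b * j) = cf b / INR j)).
  - intros _. rewrite Nat.mul_1_r. simpl. field.
  - intros p k Hp Hk IH H. replace (b * (p * k))%nat with (p * (b * k))%nat by lia.
    assert (0 < INR p) by (apply lt_0_INR; destruct Hp; lia). assert (0 < INR k) by (apply lt_0_INR; lia).
    rewrite cf_mul_div; auto; [| nia |].
    + rewrite IH, mult_INR.
      * field. lra.
      * intros q Hq Hd. apply H; auto. apply Nat.divide_mul_r; auto.
    + apply Nat.divide_mul_l. apply H; auto. apply Nat.divide_factor_l.
Qed.

Definition divs (g : nat) : list nat := filter (fun d => Nat.eqb (g mod d) 0) (seq 1 g).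

Lemma divs_in g d : (1 <= g)%nat -> In d (divs g) <-> Nat.divide d g.
Proof.
  intros Hg. unfold divs. rewrite filter_In, in_seq, Nat.eqb_eq. split.
  - intros [H1 H2]. apply Nat.Lcm0.mod_divide; auto.
  - intros H. assert (d <> 0)%nat by (intros ->; destruct H; lia).
    pose proof (Nat.divide_pos_le d g ltac:(lia) H). split; [lia |]. apply Nat.Lcm0.mod_divide; auto.
Qed.

Lemma divs_nd g : NoDup (divs g).
Proof. apply NoDup_filter, seq_NoDup. Qed.

(** The divisors of p g are the p d with d | g, together with those d | g prime to p. For each d, cf
    (p d), plus cf d when p does not divide d, equals cf d / p, so the sum is divided by p. *)
Lemma cf_divisor_sum g : (1 <= g)%nat -> rsum cf (divs g) = / INR g.
Proof.
  revert g. apply prime_induction.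
  - unfold divs. simpl. rewrite cf_1. field.
  - intros p g Hp Hg IH. assert (H2 : (2 <= p)%nat) by apply Hp.
    assert (0 < INR p) by (apply lt_0_INR; lia). assert (0 < INR g) by (apply lt_0_INR; lia).
    set (np := fun d => if ClassicalEpsilon.excluded_middle_informative (Nat.divide p d) then false else true).
    assert (Hnp : forall d, np d = true <-> ~ Nat.divide p d).
    { intros d. unfold np. destruct (ClassicalEpsilon.excluded_middle_informative _); split; intros; auto; try discriminate; contradiction. }
    assert (P : Permutation (divs (p * g)) (filter np (divs g) ++ map (Nat.mul p) (divs g))).
    { apply NoDup_Permutation; [apply divs_nd | |].
      - apply NoDup_app.
        + apply NoDup_filter, divs_nd.
        + apply FinFun.Injective_map_NoDup; [intros x y E; nia | apply divs_nd].
        + intros d Hd Hd2. apply filter_In in Hd. destruct Hd as [_ Hd]. apply Hnp in Hd. apply Hd.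
          apply in_map_iff in Hd2. destruct Hd2 as [e [<- _]]. apply Nat.divide_factor_l.
      - intros d. rewrite in_app_iff, filter_In, in_map_iff, Hnp, !divs_in by nia. split.
        + intros Hd. destruct (classic (Nat.divide p d)) as [[e He] | Hpd].
          * right. exists e. split; [lia |]. apply divs_in; auto. subst d.
            apply (Nat.mul_divide_cancel_l e g p); [lia |]. rewrite Nat.mul_comm. auto.
          * left. split; auto. apply (Nat.gauss d p g); auto. rewrite Nat.gcd_comm. apply prime_coprime; auto.
        + intros [[Hd _] | [e [<- He]]].
          * apply Nat.divide_mul_r; auto.
          * apply divs_in in He; auto. apply Nat.mul_divide_mono_l; auto. }
    rewrite (rsum_perm _ _ _ P), rsum_app.
    assert (E1 : rsum cf (filter np (divs g)) = rsum (fun d => if np d then cf d else 0) (divs g)).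
    { clear. induction (divs g) as [| d l IHl]; simpl; auto. destruct (np d); simpl; rewrite IHl; ring. }
    assert (E2 : rsum cf (map (Nat.mul p) (divs g)) = rsum (fun d => / INR p * cf d + (- (1)) * (if np d then cf d else 0)) (divs g)).
    { assert (K : forall l, (forall d, In d l -> (1 <= d)%nat) ->
        rsum cf (map (Nat.mul p) l) = rsum (fun d => / INR p * cf d + (- (1)) * (if np d then cf d else 0)) l).
      { induction l as [| d l IHl]; intros Hl; [reflexivity |]. cbn [map rsum fold_right].
        change (cf (p * d) + rsum cf (map (Nat.mul p) l) =
          / INR p * cf d + - (1) * (if np d then cf d else 0) + rsum (fun d => / INR p * cf d + (- (1)) * (if np d then cf d else 0)) l).
        rewrite IHl by (intros; apply Hl; simpl; auto). f_equal.
        specialize (Hl d (or_introl eq_refl)).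
        destruct (np d) eqn:En.
        - apply Hnp in En. rewrite cf_mul_ndiv by auto. field; lra.
        - assert (Nat.divide p d). { apply NNPP. intros Q. apply Hnp in Q. congruence. }
          rewrite cf_mul_div by auto. field; lra. }
      apply K. intros d Hd. unfold divs in Hd. apply filter_In in Hd. destruct Hd as [Hd _]. apply in_seq in Hd. lia. }
    rewrite E1, E2, rsum_plus, !rsum_scal, IH, mult_INR. field. lra.
Qed.

(** * Numbers of representations as sums of squares *)

Lemma length_le2 {T : Type} (L : list T) : NoDup L ->
  (forall a b c, In a L -> In b L -> In c L -> a = b \/ a = c \/ b = c) -> (length L <= 2)%nat.
Proof.
  intros Hn H. destruct L as [| a [| b [| c L]]]; simpl; try lia. exfalso.
  inversion Hn as [| ? ? N1 N2]; subst. inversion N2 as [| ? ? N3 N4]; subst.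
  destruct (H a b c) as [-> | [-> | ->]]; simpl in *; tauto.
Qed.

Lemma filter_split_length {T : Type} (f : T -> bool) L :
  length L = (length (filter f L) + length (filter (fun t => negb (f t)) L))%nat.
Proof. induction L; simpl; auto. destruct (f a); simpl; lia. Qed.

Lemma fibers_le2 {T : Type} (L : list T) (key : T -> Z) (K : list Z) : NoDup L ->
  (forall a, In a L -> In (key a) K) ->
  (forall a b c, In a L -> In b L -> In c L -> key a = key b -> key a = key c -> a = b \/ a = c \/ b = c) ->
  (length L <= 2 * length K)%nat.
Proof.
  revert L. induction K as [| k K IH]; intros L Hn Hk H3.
  - destruct L; simpl; [lia | destruct (Hk t); simpl; auto].
  - rewrite (filter_split_length (fun a => Z.eqb (key a) k) L). simpl length.
    assert (length (filter (fun a => Z.eqb (key a) k) L) <= 2)%nat.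
    { apply length_le2; [apply NoDup_filter; auto |]. intros a b c Ha Hb Hc.
      apply filter_In in Ha, Hb, Hc. apply H3; try tauto; lia. }
    assert (length (filter (fun t => negb (Z.eqb (key t) k)) L) <= 2 * length K)%nat; [| lia].
    apply IH; [apply NoDup_filter; auto | |].
    + intros a Ha. apply filter_In in Ha. destruct Ha as [Ha Hb].
      destruct (Hk a Ha) as [E | E]; auto. subst k. rewrite Z.eqb_refl in Hb. discriminate.
    + intros a b c Ha Hb Hc. apply filter_In in Ha, Hb, Hc. apply H3; tauto.
Qed.

(** If D were a nonzero integer, then 4 N <= 4 N D^2 = U V W <= 8 h^6 < 4 N. Hence D = 0, and the
    same identity makes one side vanish. *)
Lemma triangle_on_circle (N h x1 y1 x2 y2 x3 y3 : Z) : (0 < h)%Z -> (2 * h ^ 6 < N)%Z ->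
  (x1 * x1 + y1 * y1 = N)%Z -> (x2 * x2 + y2 * y2 = N)%Z -> (x3 * x3 + y3 * y3 = N)%Z ->
  (Z.abs (x2 - x1) <= h)%Z -> (Z.abs (y2 - y1) <= h)%Z ->
  (Z.abs (x3 - x1) <= h)%Z -> (Z.abs (y3 - y1) <= h)%Z ->
  (Z.abs (x3 - x2) <= h)%Z -> (Z.abs (y3 - y2) <= h)%Z ->
  (x1 = x2 /\ y1 = y2) \/ (x1 = x3 /\ y1 = y3) \/ (x2 = x3 /\ y2 = y3).
Proof.
  intros Hh HN E1 E2 E3 A1 A2 A3 A4 A5 A6.
  set (D := ((x2 - x1) * (y3 - y1) - (y2 - y1) * (x3 - x1))%Z).
  set (U := ((x2 - x1) * (x2 - x1) + (y2 - y1) * (y2 - y1))%Z).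
  set (V := ((x3 - x1) * (x3 - x1) + (y3 - y1) * (y3 - y1))%Z).
  set (W := ((x3 - x2) * (x3 - x2) + (y3 - y2) * (y3 - y2))%Z).
  assert (Sq : forall t, (Z.abs t <= h -> t * t <= h * h)%Z) by (intros t Ht; nia).
  assert (B2 : forall s t, (Z.abs s <= h -> Z.abs t <= h -> 0 <= s * s + t * t <= 2 * (h * h))%Z).
  { intros s t Hs Ht. pose proof (Sq s Hs). pose proof (Sq t Ht).
    pose proof (Z.square_nonneg s). pose proof (Z.square_nonneg t). lia. }
  pose proof (B2 _ _ A1 A2 : (0 <= U <= 2 * (h * h))%Z) as HU.
  pose proof (B2 _ _ A3 A4 : (0 <= V <= 2 * (h * h))%Z) as HV.
  pose proof (B2 _ _ A5 A6 : (0 <= W <= 2 * (h * h))%Z) as HW.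
  (* abc = 4 R Area for a lattice triangle of squared sides U, V, W, doubled area D and R^2 = N. *)
  assert (Key : (4 * N * (D * D) = U * V * W)%Z).
  { assert (F1 : (2 * (x1 * (x2 - x1) + y1 * (y2 - y1)) = - U)%Z) by (unfold U; lia).
    assert (F2 : (2 * (x1 * (x3 - x1) + y1 * (y3 - y1)) = - V)%Z) by (unfold V; lia).
    assert (G1 : (2 * D * x1 = - U * (y3 - y1) + V * (y2 - y1))%Z).
    { replace (- U)%Z with (2 * (x1 * (x2 - x1) + y1 * (y2 - y1)))%Z by lia.
      replace V with (- (2 * (x1 * (x3 - x1) + y1 * (y3 - y1))))%Z by lia. unfold D. ring. }
    assert (G2 : (2 * D * y1 = U * (x3 - x1) - V * (x2 - x1))%Z).
    { replace U with (- (2 * (x1 * (x2 - x1) + y1 * (y2 - y1))))%Z by lia.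
      replace V with (- (2 * (x1 * (x3 - x1) + y1 * (y3 - y1))))%Z by lia. unfold D. ring. }
    transitivity ((2 * D * x1) * (2 * D * x1) + (2 * D * y1) * (2 * D * y1))%Z.
    - rewrite <- E1. ring.
    - rewrite G1, G2. unfold U, V, W. ring. }
  assert (P : forall s t : Z, (s * s + t * t = 0)%Z -> s = 0%Z /\ t = 0%Z) by (clear; intros s t Q; nia).
  assert (HD : D = 0%Z).
  { clearbody D U V W. clear - Key HU HV HW HN Hh.
    destruct (Z.eq_dec D 0) as [|Hne]; auto. exfalso.
    assert (1 <= D * D)%Z by (clear - Hne; nia).
    assert (U * V * W <= 8 * h ^ 6)%Z.
    { replace (8 * h ^ 6)%Z with (2 * (h * h) * (2 * (h * h)) * (2 * (h * h)))%Z by ring.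
      apply Z.mul_le_mono_nonneg; [apply Z.mul_nonneg_nonneg; lia | apply Z.mul_le_mono_nonneg; lia | lia | lia]. }
    assert (0 <= h ^ 6)%Z by (apply Z.pow_nonneg; lia).
    assert (4 * N * 1 <= 4 * N * (D * D))%Z by (apply Z.mul_le_mono_nonneg_l; lia). lia. }
  rewrite HD in Key.
  assert (Z0 : (U * V * W = 0)%Z) by lia.
  apply Z.mul_eq_0 in Z0. destruct Z0 as [Z0 | Z0].
  - apply Z.mul_eq_0 in Z0. destruct Z0 as [Z0 | Z0]; apply P in Z0.
    + left; lia.
    + right; left; lia.
  - apply P in Z0. right; right; lia.
Qed.

(** The possible values of x / h: from N <= 2 (h+1)^6 follows |x| <= 2 (h+1)^3 <= 16 h^3. The number
    of cells is O(h^2), which is O(N^(1/3)). *)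
Definition keys (h : Z) : list Z := zr (Z.to_nat (16 * (h * h) + 1)).

Lemma key_range h x N : (1 <= h)%Z -> (N <= 2 * (h + 1) ^ 6)%Z -> (x * x <= N)%Z -> In (x / h)%Z (keys h).
Proof.
  intros Hh HN Hx. apply zr_in. rewrite Z2Nat.id by nia.
  assert (B : (Z.abs x <= 2 * (h + 1) ^ 3)%Z).
  { assert (0 <= (h + 1) ^ 3)%Z by (apply Z.pow_nonneg; lia).
    assert ((h + 1) ^ 6 = (h + 1) ^ 3 * (h + 1) ^ 3)%Z by ring. nia. }
  assert (B2 : ((h + 1) ^ 3 <= 8 * (h * h) * h)%Z).
  { replace ((h + 1) ^ 3)%Z with ((h + 1) * (h + 1) * (h + 1))%Z by ring.
    replace (8 * (h * h) * h)%Z with ((2 * h) * (2 * h) * (2 * h))%Z by ring.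
    apply Z.mul_le_mono_nonneg; [apply Z.mul_nonneg_nonneg; lia | apply Z.mul_le_mono_nonneg; lia | lia | lia]. }
  assert (- (16 * (h * h)) <= x / h)%Z by (apply Z.div_le_lower_bound; nia).
  assert (x / h <= 16 * (h * h))%Z by (apply Z.div_le_upper_bound; nia). lia.
Qed.

Lemma same_cell h x x' : (0 < h)%Z -> (x / h = x' / h)%Z -> (Z.abs (x' - x) <= h)%Z.
Proof.
  intros Hh E. pose proof (Z.div_mod x h ltac:(lia)). pose proof (Z.div_mod x' h ltac:(lia)).
  pose proof (Z.mod_pos_bound x h Hh). pose proof (Z.mod_pos_bound x' h Hh). rewrite E in H. lia.
Qed.

(** On the arc |x| <= y the slope is at most 1: (y' - y)(y' + y) = -(x' - x)(x' + x) with |x' + x|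
    <= y' + y. Points in one column of width h are therefore within h in both coordinates. *)
Lemma arc_diff N x y x' y' : (1 <= N)%Z -> (x * x + y * y = N)%Z -> (x' * x' + y' * y' = N)%Z ->
  (Z.abs x <= y)%Z -> (Z.abs x' <= y')%Z -> (Z.abs (y' - y) <= Z.abs (x' - x))%Z.
Proof.
  intros HN E E' H H'. assert (0 < y + y')%Z by nia.
  assert (Q : (Z.abs (y' - y) * (y' + y) = Z.abs (x' - x) * Z.abs (x' + x))%Z).
  { rewrite <- (Z.abs_eq (y' + y)) by lia. rewrite <- !Z.abs_mul.
    replace ((y' - y) * (y' + y))%Z with (- ((x' - x) * (x' + x)))%Z by nia. apply Z.abs_opp. }
  assert (Z.abs (x' + x) <= y' + y)%Z by lia.
  apply (Z.mul_le_mono_pos_r _ _ (y' + y)%Z); [lia |]. rewrite Q. apply Z.mul_le_mono_nonneg_l; lia.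
Qed.

Definition pt2 (v : list Z) : Z * Z := match v with x :: y :: nil => (x, y) | _ => (0, 0)%Z end.

Lemma n2_two x y : Z.of_nat (n2 (x :: y :: nil)) = (x * x + y * y)%Z.
Proof. cbn [n2 fold_right]. rewrite !Nat2Z.inj_add, !Z2Nat.id by nia. simpl. ring. Qed.

(* One octant pair of the circle, described through a signed coordinate change (X, Y) with |X| <= Y. *)
Lemma arc_count n h (X Y : list Z -> Z) : (1 <= h)%Z -> (2 * h ^ 6 < Z.of_nat n)%Z -> (Z.of_nat n <= 2 * (h + 1) ^ 6)%Z ->
  (forall v, In v (Vn 2 n) -> (X v * X v + Y v * Y v = Z.of_nat n)%Z) ->
  (forall v w, In v (Vn 2 n) -> In w (Vn 2 n) -> X v = X w -> Y v = Y w -> v = w) ->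
  (length (filter (fun v => Z.leb (Z.abs (X v)) (Y v)) (Vn 2 n)) <= 2 * length (keys h))%nat.
Proof.
  intros Hh H1 H2 HE Hinj. assert (Hn1 : (1 <= Z.of_nat n)%Z).
  { assert (0 <= h ^ 6)%Z by (apply Z.pow_nonneg; lia). lia. }
  apply fibers_le2 with (key := fun v => (X v / h)%Z).
  - apply NoDup_filter, Vn_nd.
  - intros v Hv. apply filter_In in Hv. destruct Hv as [Hv _]. pose proof (HE v Hv).
    apply key_range with (N := Z.of_nat n); auto. nia.
  - intros a b c Ha Hb Hc Eab Eac. apply filter_In in Ha, Hb, Hc.
    destruct Ha as [Ha Ha'], Hb as [Hb Hb'], Hc as [Hc Hc']. apply Z.leb_le in Ha', Hb', Hc'.
    assert (Ebc : (X b / h = X c / h)%Z) by lia.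
    pose proof (same_cell h _ _ ltac:(lia) Eab). pose proof (same_cell h _ _ ltac:(lia) Eac).
    pose proof (same_cell h _ _ ltac:(lia) Ebc).
    pose proof (arc_diff _ _ _ _ _ Hn1 (HE a Ha) (HE b Hb) Ha' Hb').
    pose proof (arc_diff _ _ _ _ _ Hn1 (HE a Ha) (HE c Hc) Ha' Hc').
    pose proof (arc_diff _ _ _ _ _ Hn1 (HE b Hb) (HE c Hc) Hb' Hc').
    destruct (triangle_on_circle (Z.of_nat n) h (X a) (Y a) (X b) (Y b) (X c) (Y c)) as [[P Q] | [[P Q] | [P Q]]];
      auto; try lia.
Qed.

Lemma circle_h n : (3 <= n)%nat -> exists h, (1 <= h)%Z /\ (2 * h ^ 6 < Z.of_nat n <= 2 * (h + 1) ^ 6)%Z.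
Proof.
  intros Hn.
  assert (K : forall m : nat, (exists h, (1 <= h)%Z /\ (2 * h ^ 6 < Z.of_nat n <= 2 * (h + 1) ^ 6)%Z) \/
    (2 * (Z.of_nat m + 1) ^ 6 < Z.of_nat n)%Z).
  { induction m as [| m [IH | IH]]; [right; simpl; lia | left; auto |].
    destruct (Z_lt_ge_dec (2 * (Z.of_nat (S m) + 1) ^ 6) (Z.of_nat n)) as [C | C]; [right; auto |].
    left. exists (Z.of_nat m + 1)%Z. split; [lia |]. split; auto.
    replace (Z.of_nat m + 1)%Z with (Z.of_nat (S m)) by lia. lia. }
  destruct (K n) as [H | H]; auto. exfalso.
  assert (Z.of_nat n + 1 <= (Z.of_nat n + 1) ^ 6)%Z; [| lia].
  replace ((Z.of_nat n + 1) ^ 6)%Z with ((Z.of_nat n + 1) * (Z.of_nat n + 1) ^ 5)%Z by ring.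
  assert (1 <= (Z.of_nat n + 1) ^ 5)%Z by (apply (Z.pow_le_mono_l 1 (Z.of_nat n + 1) 5); lia). nia.
Qed.

(** Four arcs cover the circle, each with at most two points in each of 32 h^2 + 3 cells, and 8 (32
    h^2 + 3) <= 280 h^2. *)
Lemma rr2_bound_h n h : (1 <= h)%Z -> (2 * h ^ 6 < Z.of_nat n <= 2 * (h + 1) ^ 6)%Z ->
  (Z.of_nat (rr 2 n) <= 280 * (h * h))%Z.
Proof.
  intros Hh [H1 H2].
  set (x := fun v => fst (pt2 v)). set (y := fun v => snd (pt2 v)).
  assert (HE : forall v, In v (Vn 2 n) -> (x v * x v + y v * y v = Z.of_nat n)%Z).
  { intros v Hv. apply Vn_in in Hv. destruct Hv as [Hl Hv].
    destruct v as [| a [| b [| ? ?]]]; try discriminate. rewrite <- Hv, n2_two. reflexivity. }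
  assert (Hinj : forall v w, In v (Vn 2 n) -> In w (Vn 2 n) -> x v = x w -> y v = y w -> v = w).
  { intros v w Hv Hw. apply Vn_in in Hv, Hw. destruct Hv as [Hl _], Hw as [Hl' _].
    destruct v as [| a [| b [| ? ?]]]; try discriminate. destruct w as [| a' [| b' [| ? ?]]]; try discriminate.
    unfold x, y; simpl. congruence. }
  pose proof (arc_count n h x y Hh H1 H2 HE Hinj) as C1.
  pose proof (arc_count n h x (fun v => - y v)%Z Hh H1 H2 ltac:(intros v Hv; rewrite <- (HE v Hv); ring) ltac:(intros v w Hv Hw Q1 Q2; cbv beta in *; apply Hinj; auto; lia)) as C2.
  pose proof (arc_count n h y x Hh H1 H2 ltac:(intros v Hv; rewrite <- (HE v Hv); ring) ltac:(intros v w Hv Hw Q1 Q2; cbv beta in *; apply Hinj; auto; lia)) as C3.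
  pose proof (arc_count n h y (fun v => - x v)%Z Hh H1 H2 ltac:(intros v Hv; rewrite <- (HE v Hv); ring) ltac:(intros v w Hv Hw Q1 Q2; cbv beta in *; apply Hinj; auto; lia)) as C4.
  assert (Hk : Z.of_nat (length (keys h)) = (32 * (h * h) + 3)%Z).
  { unfold keys, zr. rewrite length_map, length_seq. nia. }
  assert (T : (rr 2 n <= length (filter (fun v => Z.leb (Z.abs (x v)) (y v)) (Vn 2 n)) +
    length (filter (fun v => Z.leb (Z.abs (x v)) (- y v)) (Vn 2 n)) +
    length (filter (fun v => Z.leb (Z.abs (y v)) (x v)) (Vn 2 n)) +
    length (filter (fun v => Z.leb (Z.abs (y v)) (- x v)) (Vn 2 n)))%nat).
  { unfold rr. clear. induction (Vn 2 n) as [| v l IH]; [simpl; lia |]. cbn [filter length].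
    destruct (Z.leb_spec (Z.abs (x v)) (y v)), (Z.leb_spec (Z.abs (x v)) (- y v)),
      (Z.leb_spec (Z.abs (y v)) (x v)), (Z.leb_spec (Z.abs (y v)) (- x v)); cbn [length]; lia. }
  nia.
Qed.

Lemma Rpower_ge1 x a : 1 <= x -> 0 <= a -> 1 <= Rpower x a.
Proof.
  intros Hx Ha. rewrite <- (Rpower_O x) by lra. apply Rle_Rpower; auto.
Qed.

Lemma rr_crude nu n : (rr nu n <= (2 * n + 1) ^ nu)%nat.
Proof.
  unfold rr. eapply Nat.le_trans; [apply NoDup_incl_length with (l' := box nu n); [apply Vn_nd |] |].
  - intros v Hv. apply filter_In in Hv. tauto.
  - assert (forall N m, length (box m N) = (2 * N + 1) ^ m)%nat; [| rewrite H; auto].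
    intros N m. induction m as [| m IH]; auto. cbn [box Nat.pow].
    rewrite <- IH. generalize (box m N) as B. intros B.
    replace (2 * N + 1)%nat with (length (map (fun k => (Z.of_nat k - Z.of_nat N)%Z) (seq 0 (2 * N + 1)))) at 2
      by (rewrite length_map, length_seq; auto).
    generalize (map (fun k => (Z.of_nat k - Z.of_nat N)%Z) (seq 0 (2 * N + 1))). intros L.
    induction L as [| a L IHL]; simpl; auto. rewrite length_app, length_map, IHL. lia.
Qed.

Lemma rr2_bound : exists M, 0 < M /\ forall n, INR (rr 2 n) <= M * Rpower (INR n + 1) (/ 3).
Proof.
  exists 280. split; [lra |]. intros n. pose proof (pos_INR n) as Hn0.
  destruct (le_lt_dec 3 n) as [Hn | Hn].
  - destruct (circle_h n Hn) as [h [Hh Hb]]. pose proof (rr2_bound_h n h Hh Hb) as H.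
    apply IZR_le in H. rewrite <- INR_IZR_INZ, mult_IZR in H.
    eapply Rle_trans; [apply H |]. apply Rmult_le_compat_l; [lra |].
    assert (Hr : 1 <= IZR h) by (apply (IZR_le 1); auto).
    assert (E : IZR (h * h) = Rpower (IZR h ^ 6) (/ 3)).
    { rewrite <- Rpower_pow by lra. rewrite Rpower_mult.
      replace (INR 6 * / 3) with (INR 2) by (simpl; field). rewrite Rpower_pow by lra. rewrite mult_IZR. simpl. ring. }
    rewrite E. apply Rle_Rpower_l; [lra |]. split; [apply pow_lt; lra |].
    assert (K : (h ^ 6 <= Z.of_nat n)%Z) by (assert (0 <= h ^ 6)%Z by (apply Z.pow_nonneg; lia); lia).
    apply IZR_le in K. rewrite <- INR_IZR_INZ in K. replace 6%Z with (Z.of_nat 6) in K by auto. rewrite <- pow_IZR in K. lra.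
  - pose proof (rr_crude 2 n) as H. assert (rr 2 n <= 25)%nat.
    { eapply Nat.le_trans; [apply H |]. destruct n as [| [| [| n]]]; simpl; lia. }
    apply le_INR in H0. simpl in H0. pose proof (Rpower_ge1 (INR n + 1) (/ 3)). lra.
Qed.

Lemma rr_S_bound nu n M : (forall m, (m <= n)%nat -> INR (rr nu m) <= M) ->
  INR (rr (S nu) n) <= 3 * sqrt (INR n + 1) * M.
Proof.
  intros HM. set (s := Nat.sqrt n).
  assert (Hs : (s * s <= n < S s * S s)%nat) by (apply Nat.sqrt_spec; lia).
  set (sqn := fun a : Z => Z.to_nat (a * a)).
  assert (I : incl (Vn (S nu) n) (flat_map (fun a => map (cons a) (Vn nu (n - sqn a))) (zr s))).
  { intros v Hv. apply Vn_in in Hv. destruct Hv as [Hl Hv]. destruct v as [| a v]; [discriminate |].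
    cbn [n2 fold_right] in Hv. fold (n2 v) in Hv. fold (sqn a) in Hv.
    apply in_flat_map. exists a. split.
    - apply zr_in. assert (a * a <= Z.of_nat n)%Z by (unfold sqn in Hv; lia). nia.
    - apply in_map, Vn_in. split; [simpl in Hl; lia | lia]. }
  apply NoDup_incl_length in I; [| apply Vn_nd]. fold (rr (S nu) n) in I. apply le_INR in I.
  eapply Rle_trans; [apply I |].
  assert (H0 : 0 <= M) by (eapply Rle_trans; [apply pos_INR | apply (HM 0%nat); lia]).
  assert (B : forall L, INR (length (flat_map (fun a => map (cons a) (Vn nu (n - sqn a))) L)) <= INR (length L) * M).
  { induction L as [| a L IH]; [simpl; lra |]. cbn [flat_map]. rewrite length_app, plus_INR, length_map.
    assert (INR (rr nu (n - sqn a)) <= M) by (apply HM; lia). unfold rr in H.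
    change (length (a :: L)) with (S (length L)). rewrite S_INR. lra. }
  eapply Rle_trans; [apply B |]. apply Rmult_le_compat_r; auto.
  unfold zr. rewrite length_map, length_seq, plus_INR, mult_INR. simpl (INR 2). simpl (INR 1).
  assert (INR s <= sqrt (INR n + 1)).
  { apply Rsqr_incr_0_var; [| apply sqrt_pos]. unfold Rsqr. pose proof (pos_INR n). rewrite sqrt_sqrt by lra.
    rewrite <- mult_INR. assert (INR (s * s) <= INR n) by (apply le_INR; lia). lra. }
  assert (1 <= sqrt (INR n + 1)).
  { rewrite <- sqrt_1 at 1. apply sqrt_le_1_alt. pose proof (pos_INR n). lra. }
  lra.
Qed.

(** In dimension d = nu + 2 the exponent is d/2 - 2/3: it starts from 1/3 for the circle, and each
    new coordinate takes O(sqrt n) values. *)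
Lemma rr_bound nu : exists M, 0 < M /\ forall n, INR (rr (S (S nu)) n) <= M * Rpower (INR n + 1) (INR nu / 2 + / 3).
Proof.
  induction nu as [| nu [M [HM IH]]].
  - destruct rr2_bound as [M [HM H]]. exists M. split; auto. intros n. simpl (INR 0). replace (0 / 2 + / 3) with (/ 3) by field. auto.
  - exists (3 * M). split; [lra |]. intros n. pose proof (pos_INR n).
    eapply Rle_trans; [apply (rr_S_bound _ _ (M * Rpower (INR n + 1) (INR nu / 2 + / 3))) |].
    + intros m Hm. eapply Rle_trans; [apply IH |]. apply Rmult_le_compat_l; [lra |].
      pose proof (pos_INR nu). pose proof (pos_INR m). apply le_INR in Hm.
      apply Rle_Rpower_l; [lra |]. lra.
    + rewrite <- Rpower_sqrt by lra.
      replace (3 * Rpower (INR n + 1) (/ 2) * (M * Rpower (INR n + 1) (INR nu / 2 + / 3)))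
        with (3 * M * (Rpower (INR n + 1) (/ 2) * Rpower (INR n + 1) (INR nu / 2 + / 3))) by ring.
      rewrite <- Rpower_plus. right. do 2 f_equal. rewrite S_INR. field.
Qed.

Lemma smb_power d : 0 < d -> smb (fun n => Rpower (INR n + 1) (- (1 + d))).
Proof.
  intros Hd. set (K := Rpower 2 (1 + d) / d).
  assert (HK : 0 < K) by (apply Rdiv_lt_0_compat; auto; apply exp_pos).
  apply (smb_telescope _ (fun n => K * Rpower (INR n + 1) (- d))).
  - intros; left; apply exp_pos.
  - intros; apply Rmult_le_pos; [lra | left; apply exp_pos].
  - intros n. pose proof (pos_INR n). rewrite S_INR.
    destruct (MVT_gen (fun x => Rpower x (- d)) (INR n + 1) (INR n + 1 + 1) (fun x => - d * Rpower x (- d - 1))) as [x [Hx E]].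
    + rewrite Rmin_left, Rmax_right by lra. intros x Hx. apply is_derive_Reals, derivable_pt_lim_power. lra.
    + rewrite Rmin_left, Rmax_right by lra. intros x Hx. apply derivable_continuous_pt.
      exists (- d * Rpower x (- d - 1)). apply derivable_pt_lim_power. lra.
    + rewrite Rmin_left, Rmax_right in Hx by lra. cbv beta in E.
      replace (K * Rpower (INR n + 1) (- d) - K * Rpower (INR n + 1 + 1) (- d))
        with (- K * (Rpower (INR n + 1 + 1) (- d) - Rpower (INR n + 1) (- d))) by ring.
      rewrite E.
      replace (- K * (- d * Rpower x (- d - 1) * (INR n + 1 + 1 - (INR n + 1)))) with (K * d * Rpower x (- d - 1)) by ring.
      replace (K * d) with (Rpower 2 (1 + d)) by (unfold K; field; lra).
      apply Rle_trans with (Rpower 2 (1 + d) * Rpower (2 * (INR n + 1)) (- (1 + d))).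
      * rewrite (Rpower_Ropp (INR n + 1)), (Rpower_Ropp (2 * (INR n + 1))).
        rewrite <- Rpower_mult_distr by lra. right.
        assert (0 < Rpower 2 (1 + d)) by apply exp_pos. assert (0 < Rpower (INR n + 1) (1 + d)) by apply exp_pos. field. lra.
      * apply Rmult_le_compat_l; [left; apply exp_pos |].
        replace (- d - 1) with (- (1 + d)) by ring. rewrite !Rpower_Ropp. apply Rinv_le_contravar; [apply exp_pos |].
        apply Rle_Rpower_l; lra.
Qed.

Lemma poly_wt_Rpower nu n : poly_wt nu n = Rpower (INR n + 1) (- ((INR nu + 1) / 2)).
Proof.
  unfold poly_wt. pose proof (pos_INR n). rewrite Rpower_Ropp. f_equal.
  rewrite <- Rpower_sqrt by lra. rewrite <- Rpower_pow by apply exp_pos. rewrite Rpower_mult. f_equal.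
  rewrite plus_INR. simpl. field.
Qed.

(** The bound n^(nu/2 - 2/3) against n^(-(nu+1)/2) leaves n^(-7/6); the trivial exponent 1/2 for the
    circle would leave the divergent n^(-1). *)
Lemma rr_wt_smb nu : (2 <= nu)%nat -> smb (fun n => INR (rr nu n) * poly_wt nu n).
Proof.
  intros Hnu. destruct nu as [| [| nu]]; try lia. destruct (rr_bound nu) as [M [HM H]].
  apply (smb_le _ (fun n => M * Rpower (INR n + 1) (- (1 + / 6)))).
  - intros n. split; [apply Rmult_le_pos; [apply pos_INR | left; apply poly_wt_pos] |].
    eapply Rle_trans; [apply Rmult_le_compat_r; [left; apply poly_wt_pos | apply H] |].
    rewrite poly_wt_Rpower, Rmult_assoc, <- Rpower_plus. right. do 2 f_equal. rewrite !S_INR. field.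
  - apply smb_scal; [lra |]. apply smb_power. lra.
Qed.

Lemma rr_double nu m : (forall v, In v (Vn nu (4 * m)) -> forall a, In a v -> Z.Even a) ->
  rr nu (4 * m) = rr nu m.
Proof.
  intros H. unfold rr. rewrite <- (length_map (map (Z.mul 2)) (Vn nu m)).
  assert (E2 : forall w, n2 (map (Z.mul 2) w) = (4 * n2 w)%nat).
  { induction w as [| a w IH]; auto. cbn [map n2 fold_right]. fold (n2 w). fold (n2 (map (Z.mul 2) w)). rewrite IH. nia. }
  apply Permutation_length, NoDup_Permutation.
  - apply Vn_nd.
  - apply FinFun.Injective_map_NoDup; [| apply Vn_nd]. intros v w E.
    revert w E. induction v as [| a v IH]; intros [| b w] E; try discriminate; auto. cbn [map] in E.
    pose proof (f_equal (hd 0%Z) E) as E1. pose proof (f_equal (@tl Z) E) as E3. cbn [hd tl] in E1, E3.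
    f_equal; [lia | auto].
  - intros v. rewrite in_map_iff. split.
    + intros Hv. pose proof (H v Hv) as He. apply Vn_in in Hv. destruct Hv as [Hl Hn].
      exists (map (fun a => (a / 2)%Z) v).
      assert (Ev : map (Z.mul 2) (map (fun a => (a / 2)%Z) v) = v).
      { rewrite map_map. rewrite <- (map_id v) at 2. apply map_ext_in. intros a Ha.
        destruct (He a Ha) as [k ->]. rewrite (Z.mul_comm 2 k), Z.div_mul by lia. lia. }
      split; auto. apply Vn_in. rewrite length_map. split; auto.
      rewrite <- Ev, E2 in Hn. lia.
    + intros [w [<- Hw]]. apply Vn_in in Hw. destruct Hw as [Hl Hn]. apply Vn_in. rewrite length_map, E2. lia.
Qed.

Lemma n2_Z v : Z.of_nat (n2 v) = fold_right (fun a acc => (a * a + acc)%Z) 0%Z v.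
Proof.
  induction v as [| a v IH]; auto. cbn [n2 fold_right]. fold (n2 v). rewrite Nat2Z.inj_add, Z2Nat.id by nia. lia.
Qed.

Lemma sq_parity (a : Z) : (Z.Even a /\ exists k, a * a = 4 * k)%Z \/ (exists k, a * a = 8 * k + 1)%Z.
Proof.
  destruct (Z.Even_or_Odd a) as [[k Hk] | [k Hk]].
  - left. split; [exists k; auto | exists (k * k)%Z; subst; ring].
  - right. destruct (Z.Even_or_Odd k) as [[l Hl] | [l Hl]]; subst.
    + exists (2 * l * l + l)%Z. ring.
    + exists (2 * l * l + 3 * l + 1)%Z. ring.
Qed.

(** Squares are 0 mod 4 or 1 mod 8, so two squares whose sum is divisible by 4 are both even, and
    halving is a bijection. *)
Lemma rr2_16 n : rr 2 (16 * n) = rr 2 (4 * n).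
Proof.
  replace (16 * n)%nat with (4 * (4 * n))%nat by lia. apply rr_double.
  intros v Hv. apply Vn_in in Hv. destruct Hv as [Hl Hn]. apply (f_equal Z.of_nat) in Hn. rewrite n2_Z in Hn.
  destruct v as [| a [| b [| ? ?]]]; try discriminate. cbn [fold_right] in Hn.
  intros x Hx. destruct (sq_parity a) as [[Pa [ka Qa]] | [ka Qa]], (sq_parity b) as [[Pb [kb Qb]] | [kb Qb]]; try (exfalso; lia).
  destruct Hx as [<- | [<- | []]]; auto.
Qed.

(** A sum of four squares divisible by 4 has no or four odd terms; four odd squares add up to 4 mod
    8, which is impossible for 16 n. *)
Lemma rr4_16 n : rr 4 (16 * n) = rr 4 (4 * n).
Proof.
  replace (16 * n)%nat with (4 * (4 * n))%nat by lia. apply rr_double.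
  intros v Hv. apply Vn_in in Hv. destruct Hv as [Hl Hn]. apply (f_equal Z.of_nat) in Hn. rewrite n2_Z in Hn.
  destruct v as [| a [| b [| c [| d [| ? ?]]]]]; try discriminate. cbn [fold_right] in Hn.
  intros x Hx. destruct (sq_parity a) as [[Pa [ka Qa]] | [ka Qa]], (sq_parity b) as [[Pb [kb Qb]] | [kb Qb]],
   (sq_parity c) as [[Pc [kc Qc]] | [kc Qc]], (sq_parity d) as [[Pd [kd Qd]] | [kd Qd]]; try (exfalso; lia).
  destruct Hx as [<- | [<- | [<- | [<- | []]]]]; auto.
Qed.

(** * The bound r(n) = O(n^3) for eight squares *)

Definition indic (P : Prop) : R := if ClassicalEpsilon.excluded_middle_informative P then 1 else 0.

Lemma indic_true P : P -> indic P = 1.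
Proof. intros H. unfold indic. destruct (ClassicalEpsilon.excluded_middle_informative P); auto; contradiction. Qed.
Lemma indic_false P : ~ P -> indic P = 0.
Proof. intros H. unfold indic. destruct (ClassicalEpsilon.excluded_middle_informative P); auto; contradiction. Qed.
Lemma indic_range P : 0 <= indic P <= 1.
Proof. unfold indic. destruct (ClassicalEpsilon.excluded_middle_informative P); lra. Qed.
Lemma rsum_prod_nested {A B : Type} (f : A * B -> R) LA LB :
  rsum f (list_prod LA LB) = rsum (fun a => rsum (fun b => f (a, b)) LB) LA.
Proof.
  induction LA as [| a LA IH]; auto. cbn [list_prod]. rewrite rsum_app, IH. cbn [rsum fold_right]. f_equal.
  clear. induction LB; simpl; auto. rewrite IHLB. auto.
Qed.

Lemma rsum_map {A B : Type} (s : A -> B) f L : rsum f (map s L) = rsum (fun a => f (s a)) L.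
Proof. induction L; simpl; auto. rewrite IHL; auto. Qed.

Lemma rsum_indic_count {T : Type} (P : T -> Prop) L K : NoDup L ->
  (exists K0 (key : T -> Z), length K0 = K /\ (forall t, In t L -> P t -> In (key t) K0) /\
    (forall t t', In t L -> In t' L -> P t -> P t' -> key t = key t' -> t = t')) ->
  rsum (fun t => indic (P t)) L <= INR K.
Proof.
  intros Hn [K0 [key [<- [H1 H2]]]].
  set (L' := filter (fun t => if ClassicalEpsilon.excluded_middle_informative (P t) then true else false) L).
  assert (E : rsum (fun t => indic (P t)) L = INR (length L')).
  { unfold L'. clear. induction L as [| t L IH]; auto. cbn [rsum fold_right filter].
    change (indic (P t) + rsum (fun t => indic (P t)) L = INR (length (if (if ClassicalEpsilon.excluded_middle_informative (P t) then true else false) then t :: filter (fun t => if ClassicalEpsilon.excluded_middle_informative (P t) then true else false) L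
      else filter (fun t => if ClassicalEpsilon.excluded_middle_informative (P t) then true else false) L))).
    rewrite IH. unfold indic. destruct (ClassicalEpsilon.excluded_middle_informative (P t)); [| lra].
    cbn [length]. rewrite S_INR. ring. }
  assert (HL' : forall t, In t L' -> In t L /\ P t).
  { intros t Ht. apply filter_In in Ht. destruct Ht as [A B]. split; auto.
    destruct (ClassicalEpsilon.excluded_middle_informative (P t)); [auto | discriminate]. }
  assert (HN : NoDup L') by (apply NoDup_filter; auto).
  rewrite E. apply le_INR. rewrite <- (length_map key L'). apply NoDup_incl_length.
  - clearbody L'. clear E. induction L' as [| t l IH]; simpl; constructor.
    + inversion HN; subst. intros Hin. apply in_map_iff in Hin. destruct Hin as [t' [Ek Ht']].
      destruct (HL' t (or_introl eq_refl)), (HL' t' (or_intror Ht')).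
      assert (t = t') by (apply H2; auto). subst; contradiction.
    + inversion HN; subst. apply IH; auto. intros; apply HL'; simpl; auto.
  - intros k Hk. apply in_map_iff in Hk. destruct Hk as [t [<- Ht]]. apply HL' in Ht. apply H1; tauto.
Qed.

(** Solutions exist only if g = gcd(a, m) divides b, and then lie in one class modulo m' = m/g, so
    that y / m' separates them. The count 2 (R/m' + 1) + 1 is at most 5 R/m' because m' <= m <=
    R. *)
Lemma congruence_count (Rn : nat) (a b m : Z) : (1 <= m <= Z.of_nat Rn)%Z ->
  rsum (fun y => indic (Z.divide m (a * y + b))) (zr Rn) <=
  5 * INR Rn * IZR (Z.gcd a m) / IZR m * indic (Z.divide (Z.gcd a m) b).
Proof.
  intros Hm. set (g := Z.gcd a m).
  assert (Hg : (1 <= g)%Z).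
  { assert (0 <= g)%Z by apply Z.gcd_nonneg. assert (g <> 0)%Z; [| lia]. intros E. apply Z.gcd_eq_0_r in E. lia. }
  assert (Hgm : Z.divide g m) by apply Z.gcd_divide_r. assert (Hga : Z.divide g a) by apply Z.gcd_divide_l.
  destruct (classic (Z.divide g b)) as [Hb | Hb].
  2:{ rewrite (rsum_zero (fun y => indic (Z.divide m (a * y + b)))).
      - rewrite indic_false by auto. lra.
      - intros y _. apply indic_false. intros D. apply Hb.
        replace b with ((a * y + b) - a * y)%Z by ring. apply Z.divide_sub_r.
        + exact (Z.divide_trans _ _ _ Hgm D).
        + apply Z.divide_mul_l; auto. }
  rewrite indic_true, Rmult_1_r by auto.
  destruct Hgm as [m' Em]. assert (Hm' : (1 <= m')%Z) by nia.
  set (K := (Z.to_nat (Z.of_nat Rn / m') + 1)%nat).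
  eapply Rle_trans; [apply (rsum_indic_count _ _ (2 * K + 1) (zr_nd Rn)) |].
  - exists (zr K), (fun y => (y / m')%Z). split; [unfold zr; rewrite length_map, length_seq; auto |]. split.
    + intros y Hy _. apply zr_in in Hy. apply zr_in. unfold K.
      rewrite Nat2Z.inj_add, Z2Nat.id by (apply Z.div_pos; lia).
      pose proof (Z.div_mod (Z.of_nat Rn) m' ltac:(lia)). pose proof (Z.mod_pos_bound (Z.of_nat Rn) m' ltac:(lia)).
      pose proof (Z.div_mod y m' ltac:(lia)). pose proof (Z.mod_pos_bound y m' ltac:(lia)).
      set (q := (Z.of_nat Rn / m')%Z) in *. set (t := (y / m')%Z) in *.
      assert (t <= q)%Z by nia. assert (- (q + 1) <= t)%Z by nia. simpl Z.of_nat. lia.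
    + intros y y' _ _ D D' E.
      assert (Dm : Z.divide m' (y - y')).
      { assert (D2 : Z.divide m (a * (y - y'))).
        { replace (a * (y - y'))%Z with ((a * y + b) - (a * y' + b))%Z by ring. apply Z.divide_sub_r; auto. }
        destruct Hga as [a' Ea].
        assert (D3 : Z.divide m' (a' * (y - y'))).
        { destruct D2 as [k Hk]. exists k. apply (Z.mul_reg_l _ _ g); [lia |]. rewrite Em, Ea in Hk. lia. }
        apply (Z.gauss m' a'); auto.
        assert (Hgg : (Z.gcd a m = Z.gcd a' m' * g)%Z) by (rewrite Ea, Em, Z.gcd_mul_mono_r, (Z.abs_eq g) by lia; auto).
        fold g in Hgg. rewrite Z.gcd_comm. nia. }
      destruct Dm as [k Hk].
      pose proof (Z.div_mod y m' ltac:(lia)). pose proof (Z.mod_pos_bound y m' ltac:(lia)).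
      pose proof (Z.div_mod y' m' ltac:(lia)). pose proof (Z.mod_pos_bound y' m' ltac:(lia)).
      rewrite E in H. assert (k = 0)%Z by nia. subst k. lia.
  - assert (Hm'R : 0 < IZR m') by (apply (IZR_lt 0); lia).
    assert (Em2 : IZR m = IZR m' * IZR g) by (rewrite Em, mult_IZR; auto).
    assert (Hg2 : 0 < IZR g) by (apply (IZR_lt 0); lia).
    replace (5 * INR Rn * IZR g / IZR m) with (5 * (INR Rn / IZR m')) by (rewrite Em2; field; lra).
    unfold K. rewrite plus_INR, mult_INR, plus_INR. simpl (INR 2). simpl (INR 1).
    assert (A1 : INR (Z.to_nat (Z.of_nat Rn / m')) <= INR Rn / IZR m').
    { rewrite INR_IZR_INZ, Z2Nat.id by (apply Z.div_pos; lia).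
      apply Rmult_le_reg_r with (IZR m'); auto. unfold Rdiv. rewrite Rmult_assoc, Rinv_l, Rmult_1_r by lra.
      rewrite <- mult_IZR, INR_IZR_INZ. apply IZR_le. rewrite Z.mul_comm. apply Z.mul_div_le; lia. }
    assert (A2 : 1 <= INR Rn / IZR m').
    { apply Rmult_le_reg_r with (IZR m'); auto. unfold Rdiv. rewrite Rmult_assoc, Rinv_l, Rmult_1_r, Rmult_1_l by lra.
      rewrite INR_IZR_INZ. apply IZR_le. nia. }
    lra.
Qed.

Lemma NoDup_list_prod {A B : Type} (LA : list A) (LB : list B) : NoDup LA -> NoDup LB -> NoDup (list_prod LA LB).
Proof.
  intros HA HB. induction HA as [| a LA Ha HA IH]; simpl; [constructor |].
  apply NoDup_app; auto.
  - apply FinFun.Injective_map_NoDup; auto. intros x y E; congruence.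
  - intros [a' b] H1 H2. apply in_map_iff in H1. destruct H1 as [b' [E _]]. injection E as -> ->.
    apply in_prod_iff in H2. tauto.
Qed.

Lemma rsum_swap {A B : Type} (f : A -> B -> R) LA LB :
  rsum (fun a => rsum (fun b => f a b) LB) LA = rsum (fun b => rsum (fun a => f a b) LA) LB.
Proof.
  induction LA as [| a LA IH]; cbn [rsum fold_right].
  - symmetry. apply rsum_zero. auto.
  - change (rsum (fun b => f a b) LB + rsum (fun a => rsum (fun b => f a b) LB) LA =
      rsum (fun b => f a b + rsum (fun a => f a b) LA) LB).
    rewrite IH, rsum_plus. auto.
Qed.

Definition XX (Rn : nat) := list_prod (zr Rn) (list_prod (zr Rn) (list_prod (zr Rn) (zr Rn))).
Definition Om (Rn : nat) := list_prod (XX Rn) (XX Rn).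

Notation quad := (Z * (Z * (Z * Z)))%type.

(* x = (x4, (x1, (x2, x3))) and y = (y1, (y2, (y3, y4))): the coordinate x4 is singled out as
   the largest one, and y4 is summed first. *)
Definition dot (p : quad * quad) : Z :=
  match p with ((a, (b, (c, e))), (y1, (y2, (y3, y4)))) => (b * y1 + c * y2 + e * y3 + a * y4)%Z end.

Definition maxcond (x : quad) : Prop :=
  match x with (a, (b, (c, e))) => (1 <= Z.abs a /\ Z.abs b <= Z.abs a /\ Z.abs c <= Z.abs a /\ Z.abs e <= Z.abs a)%Z end.

Definition dgcd (x : quad) : Z :=
  match x with (a, (b, (c, e))) => Z.gcd b (Z.gcd c (Z.gcd e (Z.abs a))) end.

Lemma XX_nd Rn : NoDup (XX Rn).
Proof. repeat apply NoDup_list_prod; apply zr_nd. Qed.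

(** The last coordinate y4 is determined by the others, subject to divisibility by |a|. Counting y3,
    y2, y1 in turn, each congruence hands its solvability condition, modulo the gcd so far, to the
    next variable; the ratios of gcds telescope to dgcd x / |a|. *)
Lemma orth_count Rn (x : quad) : (Z.abs (fst x) <= Z.of_nat Rn)%Z -> (1 <= Z.abs (fst x))%Z ->
  rsum (fun y => indic (dot (x, y) = 0%Z)) (XX Rn) <= 125 * INR Rn ^ 3 * IZR (dgcd x) / IZR (Z.abs (fst x)).
Proof.
  destruct x as [a [b [c e]]]. simpl fst. intros HR Ha. set (M := Z.abs a) in *.
  set (d3 := Z.gcd e M). set (d2 := Z.gcd c d3). set (d1 := Z.gcd b d2).
  assert (P : forall u w, (1 <= w <= Z.of_nat Rn)%Z -> (1 <= Z.gcd u w <= Z.of_nat Rn)%Z).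
  { intros u w Hw. assert (0 <= Z.gcd u w)%Z by apply Z.gcd_nonneg.
    assert (Z.gcd u w <> 0)%Z by (intros E; apply Z.gcd_eq_0_r in E; lia).
    assert (Z.gcd u w <= w)%Z by (apply Z.divide_pos_le; [lia | apply Z.gcd_divide_r]). lia. }
  assert (HM : (1 <= M <= Z.of_nat Rn)%Z) by lia.
  assert (H3 := P e M HM). fold d3 in H3. assert (H2 := P c d3 H3). fold d2 in H2. assert (H1 := P b d2 H2). fold d1 in H1.
  pose proof (pos_INR Rn) as HRn.
  assert (PM : 0 < IZR M) by (apply (IZR_lt 0); lia). assert (P3 : 0 < IZR d3) by (apply (IZR_lt 0); lia).
  assert (P2 : 0 < IZR d2) by (apply (IZR_lt 0); lia). assert (P1 : 0 < IZR d1) by (apply (IZR_lt 0); lia).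
  unfold XX. rewrite rsum_prod_nested.
  apply Rle_trans with (rsum (fun y1 => 25 * INR Rn ^ 2 * IZR d2 / IZR M * indic (Z.divide d2 (b * y1 + 0))) (zr Rn)).
  - apply rsum_le. intros y1 _. rewrite rsum_prod_nested.
    apply Rle_trans with (rsum (fun y2 => 5 * INR Rn * IZR d3 / IZR M * indic (Z.divide d3 (c * y2 + b * y1))) (zr Rn)).
    + apply rsum_le. intros y2 _. rewrite rsum_prod_nested.
      apply Rle_trans with (rsum (fun y3 => indic (Z.divide M (e * y3 + (c * y2 + b * y1)))) (zr Rn)).
      * apply rsum_le. intros y3 _.
        destruct (classic (Z.divide M (e * y3 + (c * y2 + b * y1)))) as [D | D].
        -- rewrite (indic_true (Z.divide _ _)) by auto. replace 1 with (INR 1) by reflexivity.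
           apply rsum_indic_count; [apply zr_nd |]. exists (0%Z :: nil), (fun _ => 0%Z). split; [auto |]. split.
           ++ intros; simpl; auto.
           ++ intros t t' _ _ E E' _. unfold dot in E, E'. assert (a * (t - t') = 0)%Z by lia.
              apply Z.mul_eq_0 in H. destruct H; [lia | lia].
        -- rewrite indic_false by auto. right. apply rsum_zero. intros y4 _. apply indic_false.
           intros E. apply D. unfold dot in E. apply Z.divide_abs_l.
           exists (- y4)%Z. lia.
      * eapply Rle_trans; [apply congruence_count; auto |]. fold d3. right; reflexivity.
    + rewrite rsum_scal.
      eapply Rle_trans; [apply Rmult_le_compat_l; [| apply congruence_count; auto] |].
      * apply Rmult_le_pos; [nra | left; apply Rinv_0_lt_compat; auto].
      * fold d2. right. rewrite Z.add_0_r. field. lra.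
  - rewrite rsum_scal.
    eapply Rle_trans; [apply Rmult_le_compat_l; [| apply congruence_count; auto] |].
    + apply Rmult_le_pos; [apply Rmult_le_pos; [nra | lra] | left; apply Rinv_0_lt_compat; auto].
    + unfold dgcd. fold M d3 d2 d1. rewrite (indic_true (Z.divide d1 0)) by apply Z.divide_0_r. right. field. lra.
Qed.

Lemma multiples_count Rn (d B : Z) : (1 <= d <= B)%Z ->
  rsum (fun b => indic (Z.divide d b /\ (Z.abs b <= B)%Z)) (zr Rn) <= 3 * IZR B / IZR d.
Proof.
  intros Hd. set (K := Z.to_nat (B / d)).
  eapply Rle_trans; [apply (rsum_indic_count _ _ (2 * K + 1) (zr_nd Rn)) |].
  - exists (zr K), (fun y => (y / d)%Z). split; [unfold zr; rewrite length_map, length_seq; auto |]. split.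
    + intros y _ [[k ->] Hy]. rewrite Z.div_mul by lia. apply zr_in. unfold K.
      rewrite Z2Nat.id by (apply Z.div_pos; lia). apply Z.div_le_lower_bound; [lia |].
      rewrite Z.abs_mul, (Z.abs_eq d) in Hy by lia. lia.
    + intros y y' _ _ [[k ->] _] [[k' ->] _] E. rewrite !Z.div_mul in E by lia. congruence.
  - assert (0 < IZR d) by (apply (IZR_lt 0); lia).
    rewrite plus_INR, mult_INR. unfold K. rewrite INR_IZR_INZ with (n := Z.to_nat (B / d)), Z2Nat.id by (apply Z.div_pos; lia).
    simpl (INR 2). simpl (INR 1).
    apply Rmult_le_reg_r with (IZR d); auto. replace (3 * IZR B / IZR d * IZR d) with (3 * IZR B) by (field; lra).
    assert (A1 : IZR (B / d) * IZR d <= IZR B).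
    { rewrite <- mult_IZR. apply IZR_le. rewrite Z.mul_comm. apply Z.mul_div_le; lia. }
    assert (IZR d <= IZR B) by (apply IZR_le; lia). lra.
Qed.

Lemma sum_inv_sq N : rsum (fun d => / (INR d * INR d)) (seq 1 N) <= 2.
Proof.
  assert (K : forall N, (1 <= N)%nat -> rsum (fun d => / (INR d * INR d)) (seq 1 N) <= 2 - / INR N).
  { induction N0 as [| n IH]; [lia |]. intros _. destruct n as [| n].
    - simpl. lra.
    - rewrite seq_S, rsum_app. specialize (IH ltac:(lia)). cbn [rsum fold_right].
      replace (1 + S n)%nat with (S (S n)) by lia. rewrite (S_INR (S n)).
      assert (0 < INR (S n)) by (apply lt_0_INR; lia). set (x := INR (S n)) in *.
      assert (/ ((x + 1) * (x + 1)) <= / x - / (x + 1)).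
      { replace (/ x - / (x + 1)) with (/ (x * (x + 1))) by (field; lra). apply Rinv_le_contravar; nra. }
      lra. }
  destruct N as [| N]; [simpl; lra |]. specialize (K (S N) ltac:(lia)).
  assert (0 < / INR (S N)) by (apply Rinv_0_lt_compat, lt_0_INR; lia). lra.
Qed.

(** The gcd is majorised by the sum of all d dividing every coordinate. For given d and a there are
    at most 3|a|/d choices for each of b, c, e, which leaves 27 a^2/d^2; summing over multiples a of
    d gives 81 R^3/d^3, and the sum of 1/d^2 is at most 2. *)
Lemma gcd_sum Rn : (1 <= Rn)%nat ->
  rsum (fun x => indic (maxcond x) * (IZR (dgcd x) / IZR (Z.abs (fst x)))) (XX Rn) <= 162 * INR Rn ^ 3.
Proof.
  intros HR. assert (HRp : 0 < INR Rn) by (apply lt_0_INR; lia).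
  set (al := fun (d : nat) (a b : Z) => indic (Z.divide (Z.of_nat d) b /\ (Z.abs b <= Z.abs a)%Z)).
  set (be := fun (d : nat) (a : Z) => indic (Z.divide (Z.of_nat d) a /\ (1 <= Z.abs a)%Z) * (INR d / IZR (Z.abs a))).
  assert (Hbe : forall d a, 0 <= be d a).
  { intros d a. unfold be. destruct (classic (Z.divide (Z.of_nat d) a /\ (1 <= Z.abs a)%Z)) as [Q | Q].
    - rewrite indic_true, Rmult_1_l by auto. apply Rmult_le_pos; [apply pos_INR |].
      left; apply Rinv_0_lt_compat. apply (IZR_lt 0); lia.
    - rewrite indic_false by auto. lra. }
  apply Rle_trans with (rsum (fun x => rsum (fun d => match x with (a, (b, (c, e))) => be d a * (al d a b * (al d a c * al d a e)) end) (seq 1 Rn)) (XX Rn)).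
  - apply rsum_le. intros [a [b [c e]]] Hx. simpl fst.
    unfold XX in Hx. apply in_prod_iff in Hx. destruct Hx as [Ha _]. apply zr_in in Ha.
    assert (Hnn : forall d, 0 <= be d a * (al d a b * (al d a c * al d a e))).
    { intros d. apply Rmult_le_pos; [apply Hbe |]. apply Rmult_le_pos; [apply indic_range |]. apply Rmult_le_pos; apply indic_range. }
    destruct (classic (maxcond (a, (b, (c, e))))) as [C | C].
    + rewrite indic_true, Rmult_1_l by auto. destruct C as [C1 [C2 [C3 C4]]].
      set (g := dgcd (a, (b, (c, e)))). unfold dgcd in g.
      assert (D1 : Z.divide g b) by apply Z.gcd_divide_l.
      assert (G1 : Z.divide g (Z.gcd c (Z.gcd e (Z.abs a)))) by apply Z.gcd_divide_r.
      assert (D2 : Z.divide g c) by (eapply Z.divide_trans; [apply G1 | apply Z.gcd_divide_l]).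
      assert (G2 : Z.divide g (Z.gcd e (Z.abs a))) by (eapply Z.divide_trans; [apply G1 | apply Z.gcd_divide_r]).
      assert (D3 : Z.divide g e) by (eapply Z.divide_trans; [apply G2 | apply Z.gcd_divide_l]).
      assert (G3 : Z.divide g (Z.abs a)) by (eapply Z.divide_trans; [apply G2 | apply Z.gcd_divide_r]).
      assert (D4 : Z.divide g a) by (apply Z.divide_abs_r; auto).
      assert (0 <= g)%Z by apply Z.gcd_nonneg.
      assert (g <> 0)%Z. { intros E. rewrite E in G3. destruct G3 as [k Hk]. lia. }
      assert (g <= Z.abs a)%Z by (apply Z.divide_pos_le; [lia | auto]).
      apply Rle_trans with (rsum (fun d => be d a * (al d a b * (al d a c * al d a e))) (Z.to_nat g :: nil)).
      * cbn [rsum fold_right]. unfold be, al. rewrite Z2Nat.id by lia.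
        rewrite !indic_true by auto. rewrite INR_IZR_INZ, Z2Nat.id by lia. lra.
      * apply rsum_incl; auto; [repeat constructor; auto |]. intros t [<- | []]. apply in_seq. lia.
    + rewrite indic_false by auto. rewrite Rmult_0_l. apply rsum_pos; auto.
  - rewrite rsum_swap.
    apply Rle_trans with (rsum (fun d => 81 * INR Rn ^ 3 * / (INR d * INR d)) (seq 1 Rn)).
    2:{ rewrite rsum_scal. pose proof (sum_inv_sq Rn). assert (0 < INR Rn ^ 3) by (apply pow_lt; auto). nra. }
    apply rsum_le. intros d Hd. apply in_seq in Hd. assert (Hd0 : 1 <= INR d) by (apply (le_INR 1); lia).
    unfold XX. rewrite rsum_prod_nested.
    apply Rle_trans with (rsum (fun a => 27 * INR Rn ^ 2 / INR d ^ 2 * indic (Z.divide (Z.of_nat d) a /\ (Z.abs a <= Z.of_nat Rn)%Z)) (zr Rn)).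
    + apply rsum_le. intros a Ha. apply zr_in in Ha.
      replace (rsum (fun b => match b with (b0, (c, e)) => be d a * (al d a b0 * (al d a c * al d a e)) end) (list_prod (zr Rn) (list_prod (zr Rn) (zr Rn))))
        with (be d a * (rsum (al d a) (zr Rn) * (rsum (al d a) (zr Rn) * rsum (al d a) (zr Rn)))).
      * destruct (classic (Z.divide (Z.of_nat d) a /\ (1 <= Z.abs a)%Z)) as [Q | Q].
        -- assert (Hda : (1 <= Z.of_nat d <= Z.abs a)%Z).
           { split; [lia |]. apply Z.divide_pos_le; [lia |]. apply Z.divide_abs_r; tauto. }
           pose proof (multiples_count Rn (Z.of_nat d) (Z.abs a) Hda) as MC. fold (al d a) in MC.
           rewrite <- INR_IZR_INZ in MC. unfold be. rewrite !indic_true by tauto.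
           set (A := IZR (Z.abs a)) in *. assert (HA : 1 <= A) by (apply (IZR_le 1); lia).
           assert (HAR : A <= INR Rn) by (rewrite INR_IZR_INZ; apply IZR_le; lia).
           set (S := rsum (al d a) (zr Rn)) in *. assert (HS : 0 <= S) by (apply rsum_pos; intros; apply indic_range).
           apply Rle_trans with (1 * (INR d / A) * (3 * A / INR d * (3 * A / INR d * (3 * A / INR d)))).
           ++ assert (0 <= INR d / A) by (apply Rmult_le_pos; [lra | left; apply Rinv_0_lt_compat; lra]).
              apply Rmult_le_compat_l; [lra |]. repeat (apply Rmult_le_compat; auto; try nra).
           ++ replace (1 * (INR d / A) * (3 * A / INR d * (3 * A / INR d * (3 * A / INR d)))) with (27 * / INR d ^ 2 * A ^ 2) by (field; lra).
              replace (27 * INR Rn ^ 2 / INR d ^ 2 * 1) with (27 * / INR d ^ 2 * INR Rn ^ 2) by (unfold Rdiv; ring).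
              apply Rmult_le_compat_l; [| apply pow_incr; lra].
              apply Rmult_le_pos; [lra | left; apply Rinv_0_lt_compat, pow_lt; lra].
        -- unfold be. rewrite (indic_false (Z.divide (Z.of_nat d) a /\ (1 <= Z.abs a)%Z)) by auto. rewrite !Rmult_0_l.
           apply Rmult_le_pos; [| apply indic_range]. apply Rmult_le_pos; [nra | left; apply Rinv_0_lt_compat, pow_lt; lra].
      * rewrite rsum_prod_nested. symmetry.
        transitivity (rsum (fun b => be d a * rsum (al d a) (zr Rn) * rsum (al d a) (zr Rn) * al d a b) (zr Rn)).
        -- apply rsum_ext_in. intros b _. rewrite rsum_prod_nested.
           transitivity (rsum (fun c => be d a * al d a b * rsum (al d a) (zr Rn) * al d a c) (zr Rn)).
           ++ apply rsum_ext_in. intros c _.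
              transitivity (rsum (fun e => be d a * al d a b * al d a c * al d a e) (zr Rn)).
              ** apply rsum_ext_in. intros e _. ring.
              ** rewrite rsum_scal. unfold al; ring.
           ++ rewrite rsum_scal. unfold al; ring.
        -- rewrite rsum_scal. unfold al; ring.
    + rewrite rsum_scal. pose proof (multiples_count Rn (Z.of_nat d) (Z.of_nat Rn) ltac:(lia)) as MC.
      rewrite <- !INR_IZR_INZ in MC.
      assert (Hc : 0 <= 27 * INR Rn ^ 2 / INR d ^ 2).
      { apply Rmult_le_pos; [nra | left; apply Rinv_0_lt_compat, pow_lt; lra]. }
      eapply Rle_trans; [apply Rmult_le_compat_l; [apply Hc | apply MC] |].
      replace (27 * INR Rn ^ 2 / INR d ^ 2 * (3 * INR Rn / INR d)) with (81 * INR Rn ^ 3 * / (INR d * INR d) * / INR d) by (field; lra).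
      rewrite <- (Rmult_1_r (81 * INR Rn ^ 3 * / (INR d * INR d))) at 2. apply Rmult_le_compat_l.
      * apply Rmult_le_pos; [assert (0 < INR Rn ^ 3) by (apply pow_lt; auto); lra | left; apply Rinv_0_lt_compat; nra].
      * rewrite <- Rinv_1. apply Rinv_le_contravar; lra.
Qed.

Lemma swap_invariant Rn (s : quad * quad -> quad * quad) (f : quad * quad -> R) :
  (forall p, s (s p) = p) -> (forall p, In p (Om Rn) -> In (s p) (Om Rn)) ->
  rsum (fun p => f (s p)) (Om Rn) = rsum f (Om Rn).
Proof.
  intros Hs Hi. rewrite <- rsum_map. apply rsum_perm.
  assert (N : NoDup (Om Rn)) by (apply NoDup_list_prod; apply XX_nd).
  apply NoDup_Permutation; auto.
  - apply FinFun.Injective_map_NoDup; auto. intros p q E. rewrite <- (Hs p), <- (Hs q). congruence.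
  - intros p. rewrite in_map_iff. split.
    + intros [q [<- Hq]]; auto.
    + intros Hp. exists (s p). split; auto.
Qed.

(** These involutions exchange the singled-out coordinate of x with another one and move the partner
    coordinates of y along. They preserve [dot], so the largest coordinate of x may be assumed to
    come first. *)
Definition sw1 (p : quad * quad) : quad * quad :=
  match p with ((a, (b, (c, e))), (y1, (y2, (y3, y4)))) => ((b, (a, (c, e))), (y4, (y2, (y3, y1)))) end.
Definition sw2 (p : quad * quad) : quad * quad :=
  match p with ((a, (b, (c, e))), (y1, (y2, (y3, y4)))) => ((c, (b, (a, e))), (y1, (y4, (y3, y2)))) end.
Definition sw3 (p : quad * quad) : quad * quad :=
  match p with ((a, (b, (c, e))), (y1, (y2, (y3, y4)))) => ((e, (b, (c, a))), (y1, (y2, (y4, y3)))) end.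

(** Either x = 0, with at most 81 R^4 pairs, or one of the four coordinates is largest; each such
    case is bounded by 125 R^3 times 162 R^3, and 81 + 4 * 20250 = 81081. *)
Lemma orth_pairs_bound Rn : (1 <= Rn)%nat ->
  rsum (fun p => indic (dot p = 0%Z)) (Om Rn) <= 81081 * INR Rn ^ 6.
Proof.
  intros HR. assert (HRp : 1 <= INR Rn) by (apply (le_INR 1); auto).
  set (fm := fun p : quad * quad => indic (maxcond (fst p) /\ dot p = 0%Z)).
  set (f0 := fun p : quad * quad => indic (fst p = (0, (0, (0, 0)))%Z)).
  assert (Dec : rsum (fun p => indic (dot p = 0%Z)) (Om Rn) <=
    rsum (fun p => f0 p + (fm p + (fm (sw1 p) + (fm (sw2 p) + fm (sw3 p))))) (Om Rn)).
  { apply rsum_le. intros [[a [b [c e]]] [y1 [y2 [y3 y4]]]] _. unfold f0, fm, sw1, sw2, sw3, maxcond, dot, fst.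
    destruct (classic ((b * y1 + c * y2 + e * y3 + a * y4)%Z = 0%Z)) as [E | E].
    2:{ rewrite indic_false by auto. repeat apply Rplus_le_le_0_compat; apply indic_range. }
    rewrite indic_true by auto.
    assert (I : forall P : Prop, P -> 1 <= indic P) by (intros P HP; rewrite indic_true by auto; lra).
    pose proof (indic_range ((a, (b, (c, e))) = (0, (0, (0, 0)))%Z)) as R0.
    match goal with |- 1 <= indic _ + (indic ?A + (indic ?B + (indic ?C0 + indic ?D))) =>
      pose proof (indic_range A) as R1; pose proof (indic_range B) as R2; pose proof (indic_range C0) as R3; pose proof (indic_range D) as R4 end.
    assert (Ca : (Z.abs a = 0 /\ Z.abs b = 0 /\ Z.abs c = 0 /\ Z.abs e = 0)%Z \/
      (1 <= Z.abs a /\ Z.abs b <= Z.abs a /\ Z.abs c <= Z.abs a /\ Z.abs e <= Z.abs a)%Z \/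
      (1 <= Z.abs b /\ Z.abs a <= Z.abs b /\ Z.abs c <= Z.abs b /\ Z.abs e <= Z.abs b)%Z \/
      (1 <= Z.abs c /\ Z.abs b <= Z.abs c /\ Z.abs a <= Z.abs c /\ Z.abs e <= Z.abs c)%Z \/
      (1 <= Z.abs e /\ Z.abs b <= Z.abs e /\ Z.abs c <= Z.abs e /\ Z.abs a <= Z.abs e)%Z) by lia.
    destruct Ca as [Ca | [Ca | [Ca | [Ca | Ca]]]].
    - assert (1 <= indic ((a, (b, (c, e))) = (0, (0, (0, 0)))%Z)); [| lra].
      apply I. replace a with 0%Z by lia. replace b with 0%Z by lia. replace c with 0%Z by lia. replace e with 0%Z by lia. auto.
    - match goal with |- 1 <= indic _ + (indic ?A + (indic ?B + (indic ?C0 + indic ?D))) => assert (1 <= indic A); [apply I; split; [tauto | lia] | lra] end.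
    - match goal with |- 1 <= indic _ + (indic ?A + (indic ?B + (indic ?C0 + indic ?D))) => assert (1 <= indic B); [apply I; split; [tauto | lia] | lra] end.
    - match goal with |- 1 <= indic _ + (indic ?A + (indic ?B + (indic ?C0 + indic ?D))) => assert (1 <= indic C0); [apply I; split; [tauto | lia] | lra] end.
    - match goal with |- 1 <= indic _ + (indic ?A + (indic ?B + (indic ?C0 + indic ?D))) => assert (1 <= indic D); [apply I; split; [tauto | lia] | lra] end. }
  rewrite !rsum_plus in Dec.
  assert (InOm : forall a b c e y1 y2 y3 y4, In ((a, (b, (c, e))), (y1, (y2, (y3, y4)))) (Om Rn) <->
    (In a (zr Rn) /\ In b (zr Rn) /\ In c (zr Rn) /\ In e (zr Rn)) /\ (In y1 (zr Rn) /\ In y2 (zr Rn) /\ In y3 (zr Rn) /\ In y4 (zr Rn))).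
  { intros. unfold Om, XX. rewrite !in_prod_iff. tauto. }
  rewrite (swap_invariant Rn sw1 fm) in Dec.
  2:{ intros [[a [b [c e]]] [y1 [y2 [y3 y4]]]]; reflexivity. }
  2:{ intros [[a [b [c e]]] [y1 [y2 [y3 y4]]]]. unfold sw1. rewrite !InOm. tauto. }
  rewrite (swap_invariant Rn sw2 fm) in Dec.
  2:{ intros [[a [b [c e]]] [y1 [y2 [y3 y4]]]]; reflexivity. }
  2:{ intros [[a [b [c e]]] [y1 [y2 [y3 y4]]]]. unfold sw2. rewrite !InOm. tauto. }
  rewrite (swap_invariant Rn sw3 fm) in Dec.
  2:{ intros [[a [b [c e]]] [y1 [y2 [y3 y4]]]]; reflexivity. }
  2:{ intros [[a [b [c e]]] [y1 [y2 [y3 y4]]]]. unfold sw3. rewrite !InOm. tauto. }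
  assert (B0 : rsum f0 (Om Rn) <= 81 * INR Rn ^ 4).
  { unfold Om. rewrite rsum_prod_nested. unfold f0, fst.
    rewrite (rsum_ext_in _ (fun a => INR (length (XX Rn)) * indic (a = (0, (0, (0, 0)))%Z))) by (intros; apply rsum_const).
    rewrite rsum_scal.
    assert (L : INR (length (XX Rn)) <= 81 * INR Rn ^ 4).
    { unfold XX, zr. rewrite !length_prod, !length_map, !length_seq, !mult_INR, plus_INR, mult_INR. simpl (INR 2). simpl (INR 1).
      replace (81 * INR Rn ^ 4) with (3 * INR Rn * (3 * INR Rn * (3 * INR Rn * (3 * INR Rn)))) by ring.
      assert (2 * INR Rn + 1 <= 3 * INR Rn) by lra. assert (0 <= 2 * INR Rn + 1) by lra.
      repeat (apply Rmult_le_compat; auto; try nra). }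
    assert (O : rsum (fun a : quad => indic (a = (0, (0, (0, 0)))%Z)) (XX Rn) <= 1).
    { replace 1 with (INR 1) by reflexivity. apply rsum_indic_count; [apply XX_nd |].
      exists (0%Z :: nil), (fun _ => 0%Z). split; [auto |]. split; [intros; simpl; auto |]. intros; congruence. }
    assert (0 <= rsum (fun a : quad => indic (a = (0, (0, (0, 0)))%Z)) (XX Rn)) by (apply rsum_pos; intros; apply indic_range).
    pose proof (pos_INR (length (XX Rn))). nra. }
  assert (Bm : rsum fm (Om Rn) <= 20250 * INR Rn ^ 6).
  { unfold Om. rewrite rsum_prod_nested. unfold fm.
    apply Rle_trans with (rsum (fun x => 125 * INR Rn ^ 3 * (indic (maxcond x) * (IZR (dgcd x) / IZR (Z.abs (fst x))))) (XX Rn)).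
    - apply rsum_le. intros x Hx.
      destruct (classic (maxcond x)) as [C | C].
      + rewrite (rsum_ext_in _ (fun y => indic (dot (x, y) = 0%Z))).
        * rewrite indic_true by auto. eapply Rle_trans; [apply orth_count |].
          -- unfold XX in Hx. destruct x as [a x]. apply in_prod_iff in Hx. destruct Hx as [Ha _]. apply zr_in in Ha. auto.
          -- destruct x as [a [b [c e]]]. apply C.
          -- right. unfold Rdiv. ring.
        * intros y _. unfold fst. destruct (classic (dot (x, y) = 0%Z)); [rewrite !indic_true by tauto | rewrite !indic_false by tauto]; auto.
      + rewrite (rsum_zero (fun b => indic (maxcond (fst (x, b)) /\ dot (x, b) = 0%Z))).
        * rewrite indic_false by auto. lra.
        * intros y _. apply indic_false. simpl. tauto.
    - rewrite rsum_scal. pose proof (gcd_sum Rn HR).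
      assert (0 < INR Rn ^ 3) by (apply pow_lt; lra).
      replace (20250 * INR Rn ^ 6) with (125 * INR Rn ^ 3 * (162 * INR Rn ^ 3)) by ring.
      apply Rmult_le_compat_l; auto. lra. }
  assert (INR Rn ^ 4 <= INR Rn ^ 6) by (apply Rle_pow; auto; lia). lra.
Qed.

Lemma NoDup_flat_map {A B : Type} (f : A -> list B) L : NoDup L -> (forall a, In a L -> NoDup (f a)) ->
  (forall a a' b, In a L -> In a' L -> In b (f a) -> In b (f a') -> a = a') -> NoDup (flat_map f L).
Proof.
  intros HL. induction HL as [| a L Ha HL IH]; intros Hf Hd; simpl; [constructor |].
  apply NoDup_app.
  - apply Hf; simpl; auto.
  - apply IH; intros; [apply Hf | eapply Hd]; simpl; eauto.
  - intros b H1 H2. apply in_flat_map in H2. destruct H2 as [a' [Ha' H2]].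
    assert (a = a') by (eapply Hd; simpl; eauto). subst; contradiction.
Qed.

Lemma length_flat_map {A B : Type} (f : A -> list B) L :
  INR (length (flat_map f L)) = rsum (fun a => INR (length (f a))) L.
Proof.
  induction L as [| a L IH]; [reflexivity |]. cbn [flat_map rsum fold_right]. rewrite length_app, plus_INR, IH. reflexivity.
Qed.

Lemma count_le_indic {T : Type} (P : T -> Prop) L L' : NoDup L' -> (forall t, In t L' -> In t L /\ P t) ->
  INR (length L') <= rsum (fun t => indic (P t)) L.
Proof.
  intros Hn H. apply Rle_trans with (rsum (fun t => indic (P t)) L').
  - right. rewrite (rsum_ext_in _ (fun _ => 1)).
    + rewrite rsum_const. ring.
    + intros t Ht. apply indic_true, H; auto.
  - apply rsum_incl; auto; [intros; apply indic_range |]. intros t Ht. apply H; auto.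
Qed.

Lemma n2_app u v : n2 (u ++ v) = (n2 u + n2 v)%nat.
Proof.
  induction u as [| a u IH]; auto. cbn [app n2 fold_right]. fold (n2 (u ++ v)). fold (n2 u). lia.
Qed.

Lemma rr_split a b N :
  INR (rr (a + b) N) <= rsum (fun i => INR (rr a i) * INR (rr b (N - i))) (seq 0 (S N)).
Proof.
  assert (I : incl (Vn (a + b) N) (flat_map (fun i => map (fun uv => fst uv ++ snd uv) (list_prod (Vn a i) (Vn b (N - i)))) (seq 0 (S N)))).
  { intros v Hv. apply Vn_in in Hv. destruct Hv as [Hl Hn].
    rewrite <- (firstn_skipn a v) in Hn. rewrite n2_app in Hn.
    apply in_flat_map. exists (n2 (firstn a v)). split; [apply in_seq; lia |].
    apply in_map_iff. exists (firstn a v, skipn a v). split; [apply firstn_skipn |].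
    apply in_prod; apply Vn_in; rewrite ?length_firstn, ?length_skipn; split; lia. }
  apply NoDup_incl_length in I; [| apply Vn_nd]. apply le_INR in I. fold (rr (a + b) N) in I.
  eapply Rle_trans; [apply I |]. rewrite length_flat_map. right. apply rsum_ext_in. intros i _.
  rewrite length_map, length_prod, mult_INR. reflexivity.
Qed.

(** r_8(N) is at most the sum of r_4(i) r_4(N - i); the inequality 2 x y <= x^2 + y^2 and the
    reflection i -> N - i turn it into a sum of squares. *)
Lemma rr8_le_squares N : INR (rr 8 N) <= rsum (fun i => INR (rr 4 i) * INR (rr 4 i)) (seq 0 (S N)).
Proof.
  eapply Rle_trans; [apply (rr_split 4 4 N) |].
  assert (E : rsum (fun i => INR (rr 4 (N - i)) * INR (rr 4 (N - i))) (seq 0 (S N)) = rsum (fun i => INR (rr 4 i) * INR (rr 4 i)) (seq 0 (S N))).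
  { rewrite <- (rsum_map (fun i => (N - i)%nat) (fun i => INR (rr 4 i) * INR (rr 4 i))).
    apply rsum_perm. apply NoDup_Permutation_bis.
    - assert (H : forall L, NoDup L -> (forall i, In i L -> (i <= N)%nat) -> NoDup (map (fun i => (N - i)%nat) L)).
      { induction 1 as [| i L Hi HL IH]; intros Hle; simpl; constructor.
        - intros Hin. apply in_map_iff in Hin. destruct Hin as [k [Ek Hk]].
          pose proof (Hle i (or_introl eq_refl)). pose proof (Hle k (or_intror Hk)).
          assert (k = i) by lia. subst; contradiction.
        - apply IH. intros; apply Hle; simpl; auto. }
      apply H; [apply seq_NoDup |]. intros i Hi. apply in_seq in Hi. lia.
    - rewrite length_map. auto.
    - intros k Hk. apply in_map_iff in Hk. destruct Hk as [i [<- Hi]]. apply in_seq in Hi. apply in_seq. lia. }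
  apply Rle_trans with (rsum (fun i => / 2 * (INR (rr 4 i) * INR (rr 4 i)) + / 2 * (INR (rr 4 (N - i)) * INR (rr 4 (N - i)))) (seq 0 (S N))).
  - apply rsum_le. intros i _. pose proof (Rle_0_sqr (INR (rr 4 i) - INR (rr 4 (N - i)))) as Q. unfold Rsqr in Q. lra.
  - rewrite rsum_plus, !rsum_scal, E. lra.
Qed.

(** The map (u, v) -> (u + v, u - v), with the last coordinate of u + v placed first to match [dot].
    Equal norms of u and v mean that the images are orthogonal; the default branch is for lists of
    other lengths. *)
Definition q4 (uv : list Z * list Z) : quad * quad :=
  match uv with
  | (a :: b :: c :: e :: nil, a' :: b' :: c' :: e' :: nil) =>
      ((e + e', (a + a', (b + b', c + c'))), (a - a', (b - b', (c - c', e - e'))))%Z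
  | _ => ((0, (0, (0, 0))), (0, (0, (0, 0))))%Z
  end.

(** The left side counts pairs of vectors of equal squared norm up to N; [q4] embeds them into
    orthogonal pairs with entries at most 2 sqrt N. *)
Lemma rr4_squares N : (1 <= N)%nat ->
  rsum (fun i => INR (rr 4 i) * INR (rr 4 i)) (seq 0 (S N)) <= 81081 * INR (2 * Nat.sqrt N) ^ 6.
Proof.
  intros HN. set (s := Nat.sqrt N).
  assert (Hs : (s * s <= N < S s * S s)%nat) by (apply Nat.sqrt_spec; lia).
  set (PL := flat_map (fun i => list_prod (Vn 4 i) (Vn 4 i)) (seq 0 (S N))).
  assert (HPL : forall u v, In (u, v) PL -> length u = 4%nat /\ length v = 4%nat /\ n2 u = n2 v /\ (n2 u <= N)%nat).
  { intros u v H. apply in_flat_map in H. destruct H as [i [Hi H]]. apply in_prod_iff in H. destruct H as [Hu Hv].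
    apply Vn_in in Hu, Hv. apply in_seq in Hi. destruct Hu, Hv. repeat split; auto; lia. }
  assert (NPL : NoDup PL).
  { apply NoDup_flat_map; [apply seq_NoDup | |].
    - intros; apply NoDup_list_prod; apply Vn_nd.
    - intros i i' [u v] _ _ H1 H2. apply in_prod_iff in H1, H2. destruct H1 as [H1 _], H2 as [H2 _].
      apply Vn_in in H1, H2. lia. }
  assert (L4 : forall u : list Z, length u = 4%nat -> exists a b c e, u = a :: b :: c :: e :: nil).
  { intros u Hu. destruct u as [| a [| b [| c [| e [| ? ?]]]]]; try discriminate. eauto. }
  replace (rsum (fun i => INR (rr 4 i) * INR (rr 4 i)) (seq 0 (S N))) with (INR (length PL)).
  2:{ unfold PL. rewrite length_flat_map. apply rsum_ext_in. intros i _. rewrite length_prod, mult_INR. reflexivity. }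
  rewrite <- (length_map q4 PL).
  eapply Rle_trans; [| apply (orth_pairs_bound (2 * s))].
  2:{ assert (s <> 0)%nat by (intros E; rewrite E in Hs; lia). lia. }
  apply count_le_indic.
  - clear -NPL HPL L4. induction PL as [| [u v] L IH]; simpl; constructor.
    + inversion NPL; subst. intros Hin. apply in_map_iff in Hin. destruct Hin as [[u' v'] [E Hin]].
      destruct (HPL u v (or_introl eq_refl)) as [A1 [A2 _]]. destruct (HPL u' v' (or_intror Hin)) as [A3 [A4 _]].
      destruct (L4 u A1) as [a [b [c [e ->]]]]. destruct (L4 v A2) as [a' [b' [c' [e' ->]]]].
      destruct (L4 u' A3) as [p [q [r [t ->]]]]. destruct (L4 v' A4) as [p' [q' [r' [t' ->]]]].
      cbn [q4] in E. injection E as E1 E2 E3 E4 E5 E6 E7 E8.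
      apply H1. replace a with p by lia. replace b with q by lia. replace c with r by lia. replace e with t by lia.
      replace a' with p' by lia. replace b' with q' by lia. replace c' with r' by lia. replace e' with t' by lia. auto.
    + inversion NPL; subst. apply IH; auto. intros; apply HPL; simpl; auto.
  - intros t Ht. apply in_map_iff in Ht. destruct Ht as [[u v] [<- Huv]].
    destruct (HPL u v Huv) as [A1 [A2 [A3 A4]]].
    assert (Bd : forall w x, length w = 4%nat -> n2 w = n2 u -> In x w -> (Z.abs x <= Z.of_nat s)%Z).
    { intros w x _ Hw Hx. assert (x * x <= Z.of_nat (n2 w))%Z.
      { clear - Hx. induction w as [| y w IH]; [destruct Hx |]. cbn [n2 fold_right]. fold (n2 w).
        rewrite Nat2Z.inj_add, Z2Nat.id by nia. destruct Hx as [-> | Hx]; [lia | specialize (IH Hx); nia]. }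
      assert (x * x <= Z.of_nat N)%Z by lia. nia. }
    destruct (L4 u A1) as [a [b [c [e ->]]]]. destruct (L4 v A2) as [a' [b' [c' [e' ->]]]].
    pose proof (fun x => Bd _ x A1 eq_refl) as Bu. pose proof (fun x => Bd _ x A2 (eq_sym A3)) as Bv. clear Bd.
    pose proof (Bu a ltac:(simpl; auto)). pose proof (Bu b ltac:(simpl; auto)). pose proof (Bu c ltac:(simpl; auto)). pose proof (Bu e ltac:(simpl; auto)).
    pose proof (Bv a' ltac:(simpl; auto)). pose proof (Bv b' ltac:(simpl; auto)). pose proof (Bv c' ltac:(simpl; auto)). pose proof (Bv e' ltac:(simpl; auto)).
    clear Bu Bv.
    cbn [q4]. split.
    + unfold Om, XX. rewrite !in_prod_iff, !zr_in. rewrite Nat2Z.inj_mul. simpl (Z.of_nat 2). repeat split; lia.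
    + apply (f_equal Z.of_nat) in A3. rewrite !n2_Z in A3. cbn [fold_right] in A3. unfold dot. lia.
Qed.

Lemma rr8_bound : exists M, 0 < M /\ forall N, (1 <= N)%nat -> INR (rr 8 N) <= M * INR N ^ 3.
Proof.
  exists (81081 * 64). split; [lra |]. intros N HN.
  eapply Rle_trans; [apply rr8_le_squares |]. eapply Rle_trans; [apply rr4_squares; auto |].
  assert (Hs : (Nat.sqrt N * Nat.sqrt N <= N)%nat) by (apply Nat.sqrt_spec; lia).
  apply le_INR in Hs. rewrite mult_INR in Hs. rewrite mult_INR. simpl (INR 2).
  set (s := INR (Nat.sqrt N)) in *. assert (0 <= s) by apply pos_INR.
  replace ((2 * s) ^ 6) with (64 * (s * s) ^ 3) by ring.
  assert ((s * s) ^ 3 <= INR N ^ 3) by (apply pow_incr; nra). lra.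
Qed.

(** * Radii with many representations by eight squares *)

Lemma box_length n N : length (box n N) = ((2 * N + 1) ^ n)%nat.
Proof.
  induction n as [| m IH]; auto. cbn [box Nat.pow].
  rewrite <- IH. generalize (box m N) as B. intros B.
  replace (2 * N + 1)%nat with (length (map (fun k => (Z.of_nat k - Z.of_nat N)%Z) (seq 0 (2 * N + 1)))) at 2
    by (rewrite length_map, length_seq; auto).
  generalize (map (fun k => (Z.of_nat k - Z.of_nat N)%Z) (seq 0 (2 * N + 1))). intros L.
  induction L as [| a L IHL]; simpl; auto. rewrite length_app, length_map, IHL. lia.
Qed.

Lemma n2_box n N v : In v (box n N) -> INR (n2 v) <= INR n * (INR N * INR N).
Proof.
  intros H. apply box_in in H. destruct H as [Hl Hv]. subst n.
  induction v as [| a v IH]; [simpl; lra |].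
  cbn [n2 fold_right length]. fold (n2 v). rewrite plus_INR, INR_sqZ, S_INR.
  specialize (IH (fun b Hb => Hv b (or_intror Hb))).
  assert (IZR a * IZR a <= INR N * INR N).
  { rewrite INR_IZR_INZ, <- !mult_IZR. apply IZR_le. specialize (Hv a (or_introl eq_refl)). nia. }
  lra.
Qed.

(* The sum of rr 8 over a range of norms is at least the number of lattice points in
   {alpha b <= m_1 <= alpha1 b} x [-E, E]^7. *)
Lemma shell_count al be : 0 < al < be -> exists c0 B0, 0 < c0 /\ forall b : R, B0 <= b ->
  exists I : list nat, NoDup I /\ (forall n, In n I -> (al * b) ^ 2 <= INR n <= (be * b) ^ 2) /\
    c0 * b ^ 8 <= rsum (fun n => INR (rr 8 n)) I.
Proof.
  (* From be = a1 + 3 ep follows be^2 >= a1^2 + 9 ep^2, so seven further coordinates of size at most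
     ep b still fit under (be b)^2. *)
  intros Hab. set (a1 := (al + be) / 2). set (ep := (be - a1) / 3).
  assert (Ha1 : al < a1 < be) by (unfold a1; lra). assert (Hep : 0 < ep) by (unfold ep; lra).
  exists ((a1 - al) / 2 * ep ^ 7), (Rmax (4 / (a1 - al)) (1 / ep)).
  split; [apply Rmult_lt_0_compat; [lra | apply pow_lt; auto] |].
  intros b Hb. pose proof (Rmax_l (4 / (a1 - al)) (1 / ep)). pose proof (Rmax_r (4 / (a1 - al)) (1 / ep)).
  assert (H4 : 0 < 4 / (a1 - al)) by (apply Rdiv_lt_0_compat; lra).
  assert (Hb0 : 0 < b) by lra.
  assert (Hb1 : 4 <= (a1 - al) * b).
  { replace 4 with ((a1 - al) * (4 / (a1 - al))) by (field; lra). apply Rmult_le_compat_l; lra. }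
  assert (Hb2 : 1 <= ep * b).
  { replace 1 with (ep * (1 / ep)) by (field; lra). apply Rmult_le_compat_l; lra. }
  destruct (nfloor_ex (al * b)) as [k0 Hk0]; [nra |].
  destruct (nfloor_ex ((a1 - al) * b - 1)) as [len Hlen]; [lra |].
  destruct (nfloor_ex (ep * b)) as [E HE]; [lra |].
  set (Lv := flat_map (fun k => map (cons (Z.of_nat (k0 + 1 + k))) (box 7 E)) (seq 0 len)).
  set (I := nodup Nat.eq_dec (map n2 Lv)).
  exists I. split; [apply NoDup_nodup |].
  assert (HLv : forall v, In v Lv -> length v = 8%nat /\ (al * b) ^ 2 <= INR (n2 v) <= (be * b) ^ 2).
  { intros v Hv. apply in_flat_map in Hv. destruct Hv as [k [Hk Hv]]. apply in_map_iff in Hv. destruct Hv as [w [<- Hw]].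
    apply in_seq in Hk. pose proof (n2_box _ _ _ Hw) as Hn. apply box_in in Hw. destruct Hw as [Hl _].
    split; [simpl; auto |]. cbn [n2 fold_right]. fold (n2 w). rewrite plus_INR, INR_sqZ, <- INR_IZR_INZ, !plus_INR.
    simpl (INR 1). pose proof (pos_INR (n2 w)). pose proof (pos_INR k).
    assert (INR k + 1 <= INR len) by (rewrite <- S_INR; apply le_INR; lia).
    set (x := INR k0 + 1 + INR k) in *.
    assert (X1 : al * b <= x) by (unfold x; lra). assert (X2 : x <= a1 * b) by (unfold x; lra).
    assert (X3 : 0 <= al * b) by nra.
    split; [simpl; nra |].
    assert (Y : INR (n2 w) <= 7 * (ep * b) ^ 2).
    { eapply Rle_trans; [apply Hn |]. replace (INR 7) with 7 by (simpl; ring). pose proof (pos_INR E). simpl. nra. }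
    assert (Z1 : x * x <= (a1 * b) ^ 2) by (simpl; nra).
    assert (Z2 : 7 * ep ^ 2 + a1 ^ 2 <= be ^ 2) by (unfold ep; nra).
    assert (0 <= b ^ 2) by (apply pow_le; lra).
    replace ((be * b) ^ 2) with (be ^ 2 * b ^ 2) by ring.
    replace ((a1 * b) ^ 2) with (a1 ^ 2 * b ^ 2) in Z1 by ring.
    replace (7 * (ep * b) ^ 2) with (7 * ep ^ 2 * b ^ 2) in Y by ring. nra. }
  split.
  - intros n Hn. apply nodup_In, in_map_iff in Hn. destruct Hn as [v [<- Hv]]. apply HLv; auto.
  - assert (NLv : NoDup Lv).
    { apply NoDup_flat_map; [apply seq_NoDup | |].
      - intros k _. apply FinFun.Injective_map_NoDup; [intros x y Q; congruence | apply box_nd].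
      - intros k k' v _ _ H1 H2. apply in_map_iff in H1, H2. destruct H1 as [w [<- _]], H2 as [w' [Q _]].
        injection Q as Q _. lia. }
    assert (Cnt : INR (length Lv) <= rsum (fun n => INR (rr 8 n)) I).
    { unfold rr. rewrite <- (length_flat_map (fun n => Vn 8 n) I). apply le_INR. apply NoDup_incl_length; auto.
      intros v Hv. apply in_flat_map. exists (n2 v). split.
      - apply nodup_In, in_map; auto.
      - apply Vn_in. split; auto. apply HLv; auto. }
    eapply Rle_trans; [| apply Cnt]. unfold Lv. rewrite length_flat_map.
    rewrite (rsum_ext_in _ (fun _ => INR (length (box 7 E)))) by (intros; rewrite length_map; auto).
    rewrite rsum_const, length_seq, box_length, pow_INR, plus_INR, mult_INR. simpl (INR 2). simpl (INR 1).
    replace ((a1 - al) / 2 * ep ^ 7 * b ^ 8) with (((a1 - al) / 2 * b) * (ep * b) ^ 7) by ring.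
    apply Rmult_le_compat; [nra | apply pow_le; lra | lra |].
    apply pow_incr. split; lra.
Qed.

Lemma tail_inv_sq D0 N : (1 <= D0)%nat -> rsum (fun d => / (INR d * INR d)) (seq (S D0) N) <= / INR D0.
Proof.
  intros HD.
  assert (K : rsum (fun d => / (INR d * INR d)) (seq (S D0) N) <= / INR D0 - / INR (D0 + N)).
  { induction N as [| N IH]; [rewrite Nat.add_0_r; simpl; lra |].
    rewrite seq_S, rsum_app. cbn [rsum fold_right].
    replace (S D0 + N)%nat with (S (D0 + N)) by lia. replace (D0 + S N)%nat with (S (D0 + N)) by lia. rewrite S_INR.
    assert (0 < INR (D0 + N)) by (apply lt_0_INR; lia). set (x := INR (D0 + N)) in *.
    assert (/ ((x + 1) * (x + 1)) <= / x - / (x + 1)).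
    { replace (/ x - / (x + 1)) with (/ (x * (x + 1))) by (field; lra). apply Rinv_le_contravar; nra. }
    lra. }
  assert (0 < / INR (D0 + N)) by (apply Rinv_0_lt_compat, lt_0_INR; lia). lra.
Qed.

(** Pigeonhole with X = (be b)^2. If no n in the shell were suitable, each would have r(n) below
    (c1/(4 be^8)) X^3 or a square divisor beyond D0^2. The former account for at most c1 b^8/4 in
    total; the latter number at most X/D0 and account for less than c1 b^8/4 by r(n) <= M n^3 and
    the choice of D0. This contradicts the total c1 b^8. Bounded square divisors keep the reduction
    of sqrt n over a denominator to lowest terms under control. *)
Lemma exists_rich al be : 0 < al < be -> exists c0 B0 D0, 0 < c0 /\ (1 <= D0)%nat /\ forall b : R, B0 <= b ->
  exists n, (al * b) ^ 2 <= INR n <= (be * b) ^ 2 /\ c0 * INR n ^ 3 <= INR (rr 8 n) /\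
    forall D, Nat.divide (D * D) n -> (D <= D0)%nat.
Proof.
  intros Hab. destruct (shell_count al be Hab) as [c1 [B1 [Hc1 HS]]].
  destruct rr8_bound as [M [HM HR]].
  destruct (INR_unbounded (4 * M * be ^ 8 / c1)) as [D1 HD1].
  set (D0 := S D1).
  exists (c1 / (4 * be ^ 8)), (Rmax B1 (1 / al)), D0.
  assert (Hbe : 0 < be ^ 8) by (apply pow_lt; lra).
  split; [apply Rdiv_lt_0_compat; lra |]. split; [unfold D0; lia |].
  intros b Hb. pose proof (Rmax_l B1 (1 / al)). pose proof (Rmax_r B1 (1 / al)).
  assert (H1a : 0 < 1 / al) by (apply Rdiv_lt_0_compat; lra). assert (Hb0 : 0 < b) by lra.
  assert (Hab1 : 1 <= al * b).
  { replace 1 with (al * (1 / al)) by (field; lra). apply Rmult_le_compat_l; lra. }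
  destruct (HS b ltac:(lra)) as [I [NI [HI HIsum]]].
  set (X := (be * b) ^ 2). assert (HX : 0 < X) by (apply pow_lt; nra).
  apply NNPP. intros Hno.
  set (bad := fun n => exists D, Nat.divide (D * D) n /\ (D0 < D)%nat).
  assert (HI1 : forall n, In n I -> (1 <= n)%nat).
  { intros n Hn. apply HI in Hn. apply INR_le. simpl (INR 1). assert (1 <= (al * b) ^ 2) by (simpl; nra). lra. }
  assert (Hn : forall n, In n I -> INR (rr 8 n) <= c1 / (4 * be ^ 8) * X ^ 3 + M * X ^ 3 * indic (bad n)).
  { intros n Hn. pose proof (HI n Hn) as Hr. pose proof (HI1 n Hn) as Hn1. fold X in Hr.
    assert (Hp3 : INR n ^ 3 <= X ^ 3) by (apply pow_incr; split; [apply pos_INR | tauto]).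
    assert (0 < X ^ 3) by (apply pow_lt; auto). assert (0 < c1 / (4 * be ^ 8)) by (apply Rdiv_lt_0_compat; lra).
    destruct (classic (bad n)) as [C | C].
    - rewrite indic_true by auto. specialize (HR n Hn1). nra.
    - rewrite indic_false by auto.
      destruct (Rle_dec (c1 / (4 * be ^ 8) * INR n ^ 3) (INR (rr 8 n))) as [Q | Q]; [| nra].
      exfalso. apply Hno. exists n. split; auto. split; auto. intros D HD.
      destruct (le_lt_dec D D0); auto. exfalso. apply C. exists D; auto. }
  apply rsum_le in Hn. rewrite rsum_plus, rsum_const, rsum_scal in Hn.
  destruct (nfloor_ex X) as [nX HnX]; [lra |].
  assert (HlenI : INR (length I) <= X).
  { assert (length I <= length (seq 1 nX))%nat.
    { apply NoDup_incl_length; auto. intros n Hn'. apply in_seq. pose proof (HI1 n Hn'). apply HI in Hn'. fold X in Hn'.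
      assert (n < nX + 1)%nat; [| lia]. apply INR_lt. rewrite plus_INR. simpl (INR 1). lra. }
    rewrite length_seq in H1. apply le_INR in H1. lra. }
  assert (Hbad : rsum (fun n => indic (bad n)) I <= X / INR D0).
  { assert (HD0 : 0 < INR D0) by (apply lt_0_INR; unfold D0; lia).
    apply Rle_trans with (rsum (fun n => rsum (fun d => indic (Nat.divide (d * d) n)) (seq (S D0) nX)) I).
    - apply rsum_le. intros n Hn'. destruct (classic (bad n)) as [[D [C1 C2]] | C].
      + rewrite indic_true by (exists D; auto).
        apply Rle_trans with (rsum (fun d => indic (Nat.divide (d * d) n)) (D :: nil)).
        * cbn [rsum fold_right]. rewrite indic_true by auto. lra.
        * apply rsum_incl; [intros; apply indic_range | repeat constructor; auto |]. intros t [<- | []].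
          apply in_seq. pose proof (HI1 n Hn'). apply Nat.divide_pos_le in C1; [| lia].
          apply HI in Hn'. fold X in Hn'. assert (n < nX + 1)%nat by (apply INR_lt; rewrite plus_INR; simpl (INR 1); lra). nia.
      + rewrite indic_false by auto. apply rsum_pos. intros; apply indic_range.
    - rewrite rsum_swap. apply Rle_trans with (rsum (fun d => X * / (INR d * INR d)) (seq (S D0) nX)).
      + apply rsum_le. intros d Hd. apply in_seq in Hd.
        assert (Hd0 : 0 < INR d) by (apply lt_0_INR; lia).
        eapply Rle_trans; [apply (rsum_indic_count _ _ (nX / (d * d)) NI) |].
        * exists (map Z.of_nat (seq 1 (nX / (d * d)))), (fun n => Z.of_nat (n / (d * d))).
          split; [rewrite length_map, length_seq; auto |]. split.
          -- intros n Hn' [k Hk]. apply in_map, in_seq. pose proof (HI1 n Hn'). apply HI in Hn'. fold X in Hn'.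
             assert (n < nX + 1)%nat by (apply INR_lt; rewrite plus_INR; simpl (INR 1); lra).
             subst n. rewrite Nat.div_mul by nia.
             assert (k <= nX / (d * d))%nat by (apply Nat.div_le_lower_bound; nia). nia.
          -- intros n n' _ _ [k ->] [k' ->] Q. rewrite !Nat.div_mul in Q by nia. assert (k = k') by lia. subst; auto.
        * apply Rmult_le_reg_r with (INR d * INR d); [nra |]. rewrite Rmult_assoc, Rinv_l, Rmult_1_r by nra.
          rewrite <- mult_INR, <- mult_INR. apply Rle_trans with (INR nX); [| lra]. apply le_INR.
          rewrite Nat.mul_comm. apply Nat.Div0.mul_div_le.
      + rewrite rsum_scal. pose proof (tail_inv_sq D0 nX ltac:(unfold D0; lia)). unfold Rdiv. nra. }
  assert (E1 : c1 / (4 * be ^ 8) * X ^ 4 = c1 * b ^ 8 / 4) by (unfold X; field; lra).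
  assert (Hb8 : 0 < b ^ 8) by (apply pow_lt; auto).
  assert (E2 : M * X ^ 3 * (X / INR D0) < c1 * b ^ 8 / 4).
  { assert (HD0 : 0 < INR D0) by (apply lt_0_INR; unfold D0; lia).
    replace (M * X ^ 3 * (X / INR D0)) with (M * be ^ 8 * b ^ 8 / INR D0) by (unfold X; field; lra).
    apply Rmult_lt_reg_r with (INR D0); auto. replace (M * be ^ 8 * b ^ 8 / INR D0 * INR D0) with (M * be ^ 8 * b ^ 8) by (field; lra).
    assert (4 * M * be ^ 8 < c1 * INR D0).
    { replace (4 * M * be ^ 8) with (c1 * (4 * M * be ^ 8 / c1)) by (field; lra). apply Rmult_lt_compat_l; auto.
      unfold D0. rewrite S_INR. lra. }
    nra. }
  assert (0 < X ^ 3) by (apply pow_lt; auto).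
  assert (F1 : INR (length I) * (c1 / (4 * be ^ 8) * X ^ 3) <= c1 * b ^ 8 / 4).
  { rewrite <- E1. replace (c1 / (4 * be ^ 8) * X ^ 4) with (X * (c1 / (4 * be ^ 8) * X ^ 3)) by ring.
    apply Rmult_le_compat_r; auto. apply Rmult_le_pos; [left; apply Rdiv_lt_0_compat; lra | lra]. }
  assert (F2 : M * X ^ 3 * rsum (fun n => indic (bad n)) I <= M * X ^ 3 * (X / INR D0)) by (apply Rmult_le_compat_l; [nra | auto]).
  nra.
Qed.

(** * Resonances of prescribed sign *)

(* The resonance of n with k^2 q^2, q = sqrt n0 / b, occurs exactly for k = b j, n = n0 j^2, and
   contributes tm j. *)
Definition tm (nu n0 b j : nat) : R := cf (b * j) * / INR (b * j) ^ nu * INR (rr nu (n0 * (j * j))).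

(** q = sqrt n0 / b lies in the window, only multiples of b resonate, and the resonance sum has the
    sign sg. The last clause bounds all long partial sums, because the sum over k is truncated in
    [blow_up]. *)
Definition resonant (nu n0 b : nat) (al be sg : R) : Prop :=
  (1 <= n0)%nat /\ (1 <= b)%nat /\ al < sqrt (INR n0) / INR b < be /\
  (forall k, Nat.divide (b * b) (k * k * n0) -> Nat.divide b k) /\
  exists d J0, 0 < d /\ forall J, (J0 <= J)%nat -> d <= sg * rsum (tm nu n0 b) (seq 1 J).

(** Write k = g k1 and b = g b1 with g their gcd. Then b1^2 divides k1^2 n0 and b1 is prime to k1,
    hence b1^2 divides n0 and b1 = 1. *)
Lemma square_div_gen b n0 : (1 <= b)%nat -> (forall b1, Nat.divide b1 b -> Nat.divide (b1 * b1) n0 -> b1 = 1%nat) ->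
  forall k, Nat.divide (b * b) (k * k * n0) -> Nat.divide b k.
Proof.
  intros Hb H k [t Hk]. set (g := Nat.gcd k b).
  assert (Hg : g <> 0%nat) by (intros E; apply Nat.gcd_eq_0_r in E; lia).
  destruct (Nat.gcd_divide_l k b) as [k1 Ek]. destruct (Nat.gcd_divide_r k b) as [b1 Eb]. fold g in Ek, Eb.
  assert (C : Nat.gcd b1 k1 = 1%nat).
  { rewrite Nat.gcd_comm. pose proof (Nat.gcd_mul_mono_r k1 b1 g) as Q. rewrite <- Ek, <- Eb in Q. fold g in Q. nia. }
  assert (D : Nat.divide (b1 * b1) (k1 * (k1 * n0))).
  { exists t. rewrite Ek, Eb in Hk. apply (Nat.mul_cancel_l _ _ (g * g)); nia. }
  assert (Cop : forall x y, Nat.gcd x k1 = 1%nat -> Nat.gcd y k1 = 1%nat -> Nat.gcd (x * y) k1 = 1%nat).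
  { intros x y Hx Hy. set (h := Nat.gcd (x * y) k1).
    assert (h1 : Nat.divide h (x * y)) by apply Nat.gcd_divide_l. assert (h2 : Nat.divide h k1) by apply Nat.gcd_divide_r.
    apply Nat.divide_1_r. rewrite <- Hy. apply Nat.gcd_greatest; auto.
    apply (Nat.gauss h x y); auto. apply Nat.divide_1_r. rewrite <- Hx. apply Nat.gcd_greatest; [apply Nat.gcd_divide_r |].
    eapply Nat.divide_trans; [apply Nat.gcd_divide_l | auto]. }
  apply Nat.gauss in D; [| apply Cop; auto]. apply Nat.gauss in D; [| apply Cop; auto].
  assert (E : b1 = 1%nat) by (apply H; auto; exists g; lia).
  subst b1. exists k1. lia.
Qed.

(** A prime not dividing B0 multiplies [cf] by (1 - p)/p < 0. The lower bound N lets the caller keep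
    p odd. *)
Lemma sign_fix B0 N sg : (1 <= B0)%nat -> sg = 1 \/ sg = -1 ->
  exists p, (p = 1%nat \/ (isprime p /\ (N < p)%nat)) /\ 0 < sg * cf (p * B0).
Proof.
  intros HB Hsg. pose proof (cf_neq_0 B0 HB) as Hnz.
  destruct (Rlt_dec 0 (sg * cf B0)) as [H | H].
  - exists 1%nat. rewrite Nat.mul_1_l. auto.
  - destruct (prime_above (max N B0)) as [p [Hp HpN]]. exists p. split; [right; split; auto; lia |].
    assert (2 <= INR p) by (apply (le_INR 2), Hp).
    rewrite cf_mul_ndiv; auto.
    + assert (sg * cf B0 < 0) by (destruct Hsg; subst; nra).
      assert ((1 - INR p) / INR p < 0).
      { replace ((1 - INR p) / INR p) with (- ((INR p - 1) / INR p)) by (field; lra).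
        assert (0 < (INR p - 1) / INR p) by (apply Rdiv_lt_0_compat; lra). lra. }
      nra.
    + intros D. apply Nat.divide_pos_le in D; lia.
Qed.

(** One term D is kept, the other nonnegative terms up to P are dropped, and everything beyond P
    costs at most tau. *)
Lemma lower_sum (u w : nat -> R) D P tau : (1 <= D <= P)%nat ->
  (forall j, (1 <= j <= P)%nat -> 0 <= u j) -> (forall j, (P < j)%nat -> - w j <= u j) ->
  (forall j, 0 <= w j) -> (forall J, rsum w (seq (S P) J) <= tau) ->
  forall J, (D <= J)%nat -> u D - tau <= rsum u (seq 1 J).
Proof.
  intros HD Hu Hw Hw0 Ht J HJ.
  apply Rle_trans with (rsum (fun j => (if Nat.eq_dec j D then u D else 0) + (- (1)) * (if le_lt_dec j P then 0 else w j)) (seq 1 J)).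
  - rewrite rsum_plus, rsum_scal.
    assert (E1 : u D <= rsum (fun j => if Nat.eq_dec j D then u D else 0) (seq 1 J)).
    { apply Rle_trans with (rsum (fun j => if Nat.eq_dec j D then u D else 0) (D :: nil)).
      - simpl. destruct (Nat.eq_dec D D); [lra | contradiction].
      - apply rsum_incl; [| repeat constructor; auto |].
        + intros j. destruct (Nat.eq_dec j D); [apply Hu; lia | lra].
        + intros t [<- | []]. apply in_seq. lia. }
    assert (E2 : rsum (fun j => if le_lt_dec j P then 0 else w j) (seq 1 J) <= tau).
    { apply Rle_trans with (rsum w (filter (fun j => Nat.ltb P j) (seq 1 J))).
      - right. clear. induction (seq 1 J) as [| j l IH]; auto. cbn [rsum fold_right filter].
        change ((if le_lt_dec j P then 0 else w j) + rsum (fun j => if le_lt_dec j P then 0 else w j) l =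
          rsum w (if Nat.ltb P j then j :: filter (fun j => Nat.ltb P j) l else filter (fun j => Nat.ltb P j) l)).
        rewrite IH. destruct (le_lt_dec j P), (Nat.ltb_spec P j); try lia; cbn [rsum fold_right]; unfold rsum; ring.
      - eapply Rle_trans; [| apply (Ht J)]. apply rsum_incl; auto.
        + apply NoDup_filter, seq_NoDup.
        + intros j Hj. apply filter_In in Hj. destruct Hj as [H1 H2]. apply in_seq in H1. apply Nat.ltb_lt in H2. apply in_seq. lia. }
    lra.
  - apply rsum_le. intros j Hj. apply in_seq in Hj.
    destruct (Nat.eq_dec j D) as [-> | E], (le_lt_dec _ P); try lia; try lra.
    + specialize (Hu j ltac:(lia)). lra.
    + specialize (Hw j ltac:(lia)). lra.
Qed.

(** Square divisors are bounded, so a largest D^2 exists; a square b1^2 > 1 dividing n/D^2 would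
    enlarge it. *)
Lemma max_square_divisor n D0 : (1 <= n)%nat -> (forall D, Nat.divide (D * D) n -> (D <= D0)%nat) ->
  exists D n0, (1 <= D <= D0)%nat /\ n = (D * D * n0)%nat /\ (1 <= n0)%nat /\
    forall b1, (1 <= b1)%nat -> Nat.divide (b1 * b1) n0 -> b1 = 1%nat.
Proof.
  intros Hn H.
  assert (K : forall m, (exists D, Nat.divide (D * D) n /\ (1 <= D)%nat /\ forall D', Nat.divide (D' * D') n -> (D' <= D)%nat) \/
    (forall D, Nat.divide (D * D) n -> (D + m <= D0)%nat)).
  { induction m as [| m [IH | IH]]; auto; [right; intros; rewrite Nat.add_0_r; auto |].
    destruct (classic (exists D, Nat.divide (D * D) n /\ (D + m = D0)%nat)) as [[D [HD E]] | Hno].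
    - left. exists D. split; auto. split.
      + destruct D; [| lia]. destruct HD as [t Ht]. lia.
      + intros D' HD'. specialize (IH D' HD'). lia.
    - right. intros D HD. specialize (IH D HD). assert (D + m <> D0)%nat by (intros E; apply Hno; eauto). lia. }
  destruct (K (S D0)) as [[D [[n0 HD] [HD1 Hmax]]] | Hno].
  - exists D, n0. split; [split; auto; apply H; exists n0; auto |]. split; [lia |]. split; [nia |].
    intros b1 Hb1 [t Ht]. assert (D * b1 <= D)%nat; [| nia]. apply Hmax. exists t. subst n0. nia.
  - exfalso. specialize (Hno 1%nat (Nat.divide_1_l _)). lia.
Qed.

Lemma pow_unbounded_nat B (x : R) : (2 <= B)%nat -> exists e, (2 <= e)%nat /\ x <= INR (B ^ e).
Proof.
  intros HB. destruct (INR_unbounded x) as [N HN]. exists (N + 2)%nat. split; [lia |].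
  left. eapply Rlt_le_trans; [apply HN |]. apply le_INR. pose proof (Nat.pow_gt_lin_r B (N + 2) ltac:(lia)). lia.
Qed.

Lemma cf_ratio_bound b j : (1 <= b)%nat -> (1 <= j)%nat -> -1 <= cf (b * j) / cf b <= 1.
Proof.
  intros Hb Hj. pose proof (cf_mono b Hb j Hj). pose proof (cf_neq_0 b Hb).
  assert (0 < Rabs (cf b)) by (apply Rabs_pos_lt; auto).
  apply Rabs_le_between. unfold Rdiv. rewrite Rabs_mult, Rabs_inv.
  apply Rmult_le_reg_r with (Rabs (cf b)); auto. rewrite Rmult_assoc, Rinv_l by lra. lra.
Qed.

Definition um (nu n0 b j : nat) : R := cf (b * j) / cf b * (INR (rr nu (n0 * (j * j))) * / INR j ^ nu).

Lemma tm_um nu n0 b j : (1 <= b)%nat -> (1 <= j)%nat -> tm nu n0 b j = cf b * / INR b ^ nu * um nu n0 b j.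
Proof.
  intros Hb Hj. unfold tm, um. rewrite mult_INR, Rpow_mult_distr, Rinv_mult.
  field. split; [| split]; try (apply pow_nonzero; apply not_0_INR; lia). apply cf_neq_0; auto.
Qed.

Lemma tm_sum nu n0 b J : (1 <= b)%nat -> rsum (tm nu n0 b) (seq 1 J) = cf b * / INR b ^ nu * rsum (um nu n0 b) (seq 1 J).
Proof.
  intros Hb. rewrite <- rsum_scal. apply rsum_ext_in. intros j Hj. apply in_seq in Hj. apply tm_um; lia.
Qed.

Lemma um_abs nu n0 b j : (1 <= b)%nat -> (1 <= j)%nat -> Rabs (um nu n0 b j) <= INR (rr nu (n0 * (j * j))) * / INR j ^ nu.
Proof.
  intros Hb Hj. unfold um. rewrite Rabs_mult.
  assert (Rabs (cf (b * j) / cf b) <= 1) by (apply Rabs_le, cf_ratio_bound; auto).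
  assert (0 <= INR (rr nu (n0 * (j * j))) * / INR j ^ nu).
  { apply Rmult_le_pos; [apply pos_INR | left; apply Rinv_0_lt_compat, pow_lt, lt_0_INR; lia]. }
  rewrite (Rabs_pos_eq (_ * _)) by auto. pose proof (Rabs_pos (cf (b * j) / cf b)). nra.
Qed.

Lemma um_smooth nu n0 b j : (1 <= b)%nat -> (1 <= j)%nat ->
  (forall p, isprime p -> Nat.divide p j -> Nat.divide p b) ->
  um nu n0 b j = / INR j * (INR (rr nu (n0 * (j * j))) * / INR j ^ nu).
Proof.
  intros Hb Hj H. unfold um. rewrite cf_smooth by auto. f_equal. field.
  split; [apply not_0_INR; lia | apply cf_neq_0; auto].
Qed.

Lemma um_smooth_pos nu n0 b j : (1 <= b)%nat -> (1 <= j)%nat ->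
  (forall p, isprime p -> Nat.divide p j -> Nat.divide p b) -> 0 <= um nu n0 b j.
Proof.
  intros Hb Hj H. rewrite um_smooth by auto.
  assert (0 < INR j) by (apply lt_0_INR; lia).
  apply Rmult_le_pos; [left; apply Rinv_0_lt_compat; auto |].
  apply Rmult_le_pos; [apply pos_INR | left; apply Rinv_0_lt_compat, pow_lt; auto].
Qed.

(** A rich n is found for the scale B^e, where B contains all primes up to P. With n = D^2 n0, q =
    sqrt n / B^e = sqrt n0 / b for b = B^e / D. The term j = D sees n0 D^2 = n and, in the
    normalisation [um], is at least c0 n0^3/D0^9; terms with j <= P are nonnegative, and those
    beyond add up to at most M n0^3/P. *)
Lemma resonance_8 al be sg : 0 < al < be -> sg = 1 \/ sg = -1 -> exists n0 b, resonant 8 n0 b al be sg.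
Proof.
  intros Hab Hsg.
  set (al' := al + (be - al) / 3). set (be' := be - (be - al) / 3).
  assert (Hab' : 0 < al' < be') by (unfold al', be'; lra).
  destruct (exists_rich al' be' Hab') as [c0 [B0 [D0 [Hc0 [HD0 HR]]]]].
  destruct rr8_bound as [M [HM H8]].
  (* This threshold makes the tail M n0^3/P smaller than the lower bound c0 n0^3/D0^9 for the term j
     = D. *)
  destruct (INR_unbounded (M * INR D0 ^ 9 / c0)) as [P0 HP0].
  set (P := max 2 (max D0 (S P0))).
  assert (HPD : 0 < INR P) by (apply lt_0_INR; lia).
  destruct (sign_fix (fact P) 0 sg) as [p [Hp Hpos]]; auto.
  { pose proof (lt_O_fact P). lia. }
  assert (Hp1 : (1 <= p)%nat) by (destruct Hp as [-> | [[Q _] _]]; lia).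
  set (B := (p * fact P)%nat).
  assert (HB2 : (2 <= B)%nat).
  { assert (2 <= fact P)%nat; [| unfold B; nia]. apply Nat.divide_pos_le; [pose proof (lt_O_fact P); lia |].
    apply divide_fact. lia. }
  destruct (pow_unbounded_nat B (Rmax B0 (/ al')) HB2) as [e [He2 HBe]].
  assert (HB0 : B0 <= INR (B ^ e)) by (eapply Rle_trans; [apply Rmax_l | apply HBe]).
  assert (Hal : / al' <= INR (B ^ e)) by (eapply Rle_trans; [apply Rmax_r | apply HBe]).
  assert (HBep : 0 < INR (B ^ e)).
  { apply lt_0_INR. apply Nat.neq_0_lt_0, Nat.pow_nonzero. lia. }
  destruct (HR _ HB0) as [n [Hn [Hrich Hsq]]].
  assert (Hn1 : (1 <= n)%nat).
  { apply INR_le. simpl (INR 1). assert (1 <= al' * INR (B ^ e)).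
    { replace 1 with (al' * / al') by (field; lra). apply Rmult_le_compat_l; lra. }
    assert (1 <= (al' * INR (B ^ e)) ^ 2) by (simpl; nra). lra. }
  destruct (max_square_divisor n D0 Hn1 Hsq) as [D [n0 [HD [En [Hn0 Hsf]]]]].
  assert (HDB : Nat.divide D B).
  { unfold B. apply Nat.divide_mul_r, divide_fact. lia. }
  destruct HDB as [B' HB']. assert (HB'1 : (1 <= B')%nat) by nia.
  set (b := (B' * B ^ (e - 1))%nat).
  assert (EB : (B ^ e = D * b)%nat).
  { unfold b. replace e with (S (e - 1)) at 1 by lia. rewrite Nat.pow_succ_r', HB' at 1. lia. }
  assert (HBe1 : (1 <= B ^ (e - 1))%nat) by (apply Nat.neq_0_lt_0, Nat.pow_nonzero; lia).
  assert (Hb1 : (1 <= b)%nat) by (unfold b; nia).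
  set (j0 := (B' * B ^ (e - 2))%nat).
  assert (Ebj : b = (B * j0)%nat).
  { unfold b, j0. replace (e - 1)%nat with (S (e - 2)) by lia. rewrite Nat.pow_succ_r'. lia. }
  assert (Hj0 : (1 <= j0)%nat).
  { unfold j0. assert (1 <= B ^ (e - 2))%nat by (apply Nat.neq_0_lt_0, Nat.pow_nonzero; lia). nia. }
  assert (HB'B : Nat.divide B' B) by (exists D; lia).
  assert (Hprim : forall q k, isprime q -> Nat.divide q (B ^ k) -> Nat.divide q B).
  { intros q k Hq. induction k as [| k IH]; intros Hd.
    - simpl in Hd. apply Nat.divide_1_r in Hd. destruct Hq; lia.
    - rewrite Nat.pow_succ_r' in Hd. apply prime_euclid in Hd; auto. destruct Hd; auto. }
  assert (Ecf : cf b = cf B / INR j0).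
  { rewrite Ebj. apply cf_smooth; [lia | auto |]. intros q Hq Hd. unfold j0 in Hd.
    apply prime_euclid in Hd; auto. destruct Hd as [Hd | Hd]; [eapply Nat.divide_trans; eauto | eapply Hprim; eauto]. }
  assert (Hj0R : 0 < INR j0) by (apply lt_0_INR; lia).
  assert (HsgB : 0 < sg * cf b).
  { rewrite Ecf. unfold Rdiv. rewrite <- Rmult_assoc. apply Rmult_lt_0_compat; [auto | apply Rinv_0_lt_compat; auto]. }
  assert (HDR : 0 < INR D) by (apply lt_0_INR; lia).
  assert (HbR : 0 < INR b) by (apply lt_0_INR; lia).
  assert (Hn0R : 1 <= INR n0) by (apply (le_INR 1); auto).
  exists n0, b. split; [auto |]. split; [auto |]. split; [| split].
  - assert (Eq : sqrt (INR n0) / INR b = sqrt (INR n) / INR (B ^ e)).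
    { rewrite En, EB, !mult_INR. rewrite sqrt_mult by nra. rewrite sqrt_square by lra. field. lra. }
    rewrite Eq. destruct Hn as [N1 N2].
    assert (Q1 : al' * INR (B ^ e) <= sqrt (INR n)).
    { rewrite <- (sqrt_Rsqr (al' * INR (B ^ e))) by nra. apply sqrt_le_1_alt. unfold Rsqr. simpl in N1. lra. }
    assert (Q2 : sqrt (INR n) <= be' * INR (B ^ e)).
    { rewrite <- (sqrt_Rsqr (be' * INR (B ^ e))) by nra. apply sqrt_le_1_alt. unfold Rsqr. simpl in N2. lra. }
    split.
    + apply Rlt_le_trans with al'; [unfold al'; lra |].
      apply Rmult_le_reg_r with (INR (B ^ e)); auto. unfold Rdiv. rewrite Rmult_assoc, Rinv_l by lra. lra.
    + apply Rle_lt_trans with be'; [| unfold be'; lra].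
      apply Rmult_le_reg_r with (INR (B ^ e)); auto. unfold Rdiv. rewrite Rmult_assoc, Rinv_l by lra. lra.
  - apply square_div_gen; auto. intros b1 Hb1' Hd. apply Hsf; auto.
    destruct b1; [| lia]. destruct Hb1' as [t Ht]. lia.
  - set (tau := M * INR n0 ^ 3 * / INR P).
    assert (Hn3 : 0 < INR n0 ^ 3) by (apply pow_lt; lra).
    exists (sg * cf b * / INR b ^ 8 * (um 8 n0 b D - tau)), D. split.
    + apply Rmult_lt_0_compat; [apply Rmult_lt_0_compat; auto; apply Rinv_0_lt_compat, pow_lt; auto |].
      assert (HuD : INR n0 ^ 3 * (c0 * / INR D0 ^ 9) <= um 8 n0 b D).
      { rewrite um_smooth by (first [lia | intros q Hq Hd; rewrite Ebj; apply Nat.divide_mul_l; eapply Nat.divide_trans; [apply Hd |]; exists B'; lia]).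
        replace (n0 * (D * D))%nat with n by lia.
        apply Rle_trans with (/ INR D * (c0 * INR n0 ^ 3 * / INR D ^ 8)).
        - replace (/ INR D * (c0 * INR n0 ^ 3 * / INR D ^ 8)) with (INR n0 ^ 3 * (c0 * / INR D ^ 9)) by (field; lra).
          apply Rmult_le_compat_l; [lra |]. apply Rmult_le_compat_l; [lra |].
          apply Rinv_le_contravar; [apply pow_lt; auto |]. apply pow_incr. split; [lra | apply le_INR; lia].
        - apply Rmult_le_compat_l; [left; apply Rinv_0_lt_compat; auto |].
          apply Rmult_le_compat_r; [left; apply Rinv_0_lt_compat, pow_lt; auto |].
          eapply Rle_trans; [| apply Hrich]. apply Rmult_le_compat_l; [lra |]. apply pow_incr.
          split; [lra |]. apply le_INR. rewrite En. clear - HD. assert (1 <= D * D)%nat by (apply (Nat.mul_le_mono 1 _ 1); lia). destruct (D * D)%nat; [lia | simpl; lia]. }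
      assert (Ht : tau < INR n0 ^ 3 * (c0 * / INR D0 ^ 9)); [| lra].
      unfold tau. assert (HD0R : 0 < INR D0 ^ 9) by (apply pow_lt, lt_0_INR; lia).
      assert (HD0r : INR D0 <> 0) by (apply not_0_INR; lia).
      assert (M * / INR P < c0 * / INR D0 ^ 9); [| nra].
      apply Rmult_lt_reg_r with (INR P * INR D0 ^ 9); [nra |].
      replace (M * / INR P * (INR P * INR D0 ^ 9)) with (M * INR D0 ^ 9) by (field; lra).
      replace (c0 * / INR D0 ^ 9 * (INR P * INR D0 ^ 9)) with (c0 * INR P) by (field; auto).
      apply Rlt_le_trans with (c0 * INR (S P0)); [| apply Rmult_le_compat_l; [lra | apply le_INR; lia]].
      replace (M * INR D0 ^ 9) with (c0 * (M * INR D0 ^ 9 / c0)) by (field; lra).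
      apply Rmult_lt_compat_l; auto. rewrite S_INR. lra.
    + intros J HJ. rewrite tm_sum by auto.
      replace (sg * (cf b * / INR b ^ 8 * rsum (um 8 n0 b) (seq 1 J))) with (sg * cf b * / INR b ^ 8 * rsum (um 8 n0 b) (seq 1 J)) by ring.
      apply Rmult_le_compat_l.
      * apply Rmult_le_pos; [lra | left; apply Rinv_0_lt_compat, pow_lt; auto].
      * apply (lower_sum (um 8 n0 b) (fun j => M * INR n0 ^ 3 * / (INR j * INR j)) D P tau); auto; [lia | | | |].
        -- intros j Hj. apply um_smooth_pos; auto; [lia |]. intros q Hq Hd.
           rewrite Ebj. apply Nat.divide_mul_l. unfold B. apply Nat.divide_mul_r, divide_fact.
           destruct Hq as [Hq _]. apply Nat.divide_pos_le in Hd; lia.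
        -- intros j Hj. assert (HjR : 0 < INR j) by (apply lt_0_INR; lia).
           pose proof (um_abs 8 n0 b j Hb1 ltac:(lia)) as Q.
           assert (INR (rr 8 (n0 * (j * j))) * / INR j ^ 8 <= M * INR n0 ^ 3 * / (INR j * INR j)).
           { apply Rle_trans with (M * INR (n0 * (j * j)) ^ 3 * / INR j ^ 8).
             - apply Rmult_le_compat_r; [left; apply Rinv_0_lt_compat, pow_lt; lra |]. apply H8. nia.
             - rewrite !mult_INR. right. field. lra. }
           pose proof (Rle_abs (- um 8 n0 b j)) as Q2. rewrite Rabs_Ropp in Q2. lra.
        -- intros j. destruct j as [| j].
           ++ simpl. rewrite Rmult_0_l, Rinv_0. lra.
           ++ assert (0 < INR (S j)) by (apply lt_0_INR; lia). apply Rmult_le_pos; [nra | left; apply Rinv_0_lt_compat; nra].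
        -- intros J'. rewrite rsum_scal. unfold tau. apply Rmult_le_compat_l; [nra |]. apply tail_inv_sq. lia.
Qed.

(** * Resonances in dimensions two and four *)

Lemma smb_tail_seq (w : nat -> R) eps : smb w -> 0 < eps ->
  exists P, forall a n, (P <= a)%nat -> rsum w (seq a n) <= eps.
Proof.
  intros Hw He. destruct (smb_tail w Hw eps He) as [L0 [_ HL]].
  exists (S (list_max L0)). intros a n Ha. left. apply HL; [apply seq_NoDup |].
  intros t Ht Hin. apply in_seq in Ht. pose proof (list_max_le L0 (list_max L0)) as [Q _].
  rewrite Forall_forall in Q. specialize (Q ltac:(lia) t Hin). lia.
Qed.

Fixpoint oddfact (P : nat) : nat := match P with O => 1 | S k => (2 * k + 1) * oddfact k end.

Lemma oddfact_odd P : Nat.odd (oddfact P) = true.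
Proof.
  induction P as [| P IH]; auto. cbn [oddfact]. rewrite Nat.odd_mul, IH, Nat.odd_add, Nat.odd_mul. reflexivity.
Qed.

Lemma oddfact_divide P i : (i < P)%nat -> Nat.divide (2 * i + 1) (oddfact P).
Proof.
  induction P as [| P IH]; intros H; [lia |]. cbn [oddfact].
  destruct (Nat.eq_dec i P) as [-> | E]; [apply Nat.divide_factor_l |].
  apply Nat.divide_mul_r, IH. lia.
Qed.

Lemma odd_not_div2 n : Nat.odd n = true <-> ~ Nat.divide 2 n.
Proof.
  split.
  - intros H [t Ht]. subst. rewrite Nat.odd_mul, Bool.andb_false_r in H. discriminate.
  - intros H. destruct (Nat.odd n) eqn:E; auto. exfalso. apply H.
    apply (f_equal negb) in E. rewrite Nat.negb_odd in E. apply Nat.even_spec in E. destruct E as [t Ht]. exists t. lia.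
Qed.

(** A step of ratio rho cannot jump over the window: the first power that brings the value below be
    leaves it at least rho be > al. *)
Lemma geom_hit al be rho v : 0 < al -> al < be -> 0 < rho < 1 -> al < rho * be -> be <= v ->
  exists i, al < v * rho ^ i < be.
Proof.
  intros Ha Hb Hr Hab Hv.
  assert (HN : exists N, v * rho ^ N < be).
  { destruct (pow_lt_1_zero rho ltac:(rewrite Rabs_pos_eq; lra) (be / v) ltac:(apply Rdiv_lt_0_compat; lra)) as [N H].
    exists N. specialize (H N (le_n _)). rewrite Rabs_pos_eq in H by (apply pow_le; lra).
    apply Rmult_lt_compat_l with (r := v) in H; [| lra]. replace (v * (be / v)) with be in H by (field; lra). auto. }
  destruct HN as [N HN]. induction N as [| N IH]; [simpl in HN; lra |].
  destruct (Rlt_le_dec (v * rho ^ N) be) as [H | H]; auto.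
  exists (S N). split; auto. simpl. replace (v * (rho * rho ^ N)) with (rho * (v * rho ^ N)) by ring. nra.
Qed.

Lemma isprime_2 : isprime 2.
Proof.
  split; auto. intros d [t Ht]. destruct d as [| [| [| d]]]; auto; exfalso; destruct t as [| [| t]]; lia.
Qed.

Lemma odd_square_free_pow4 b x : Nat.odd b = true -> forall b1, Nat.divide b1 b -> Nat.divide (b1 * b1) (4 ^ x) -> b1 = 1%nat.
Proof.
  intros Hb b1 H1 H2. destruct (Nat.lt_ge_cases b1 2) as [L | L].
  - destruct b1 as [| [| b1]]; auto; [| lia]. destruct H1 as [t Ht]. rewrite Nat.mul_0_r in Ht. subst. discriminate.
  - exfalso. destruct (prime_divisor b1 L) as [p [Hp Hd]].
    assert (H4 : Nat.divide p (4 ^ x)).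
    { eapply Nat.divide_trans; [| apply H2]. apply Nat.divide_mul_l; auto. }
    assert (E : p = 2%nat).
    { clear - Hp H4. induction x as [| x IH].
      - simpl in H4. apply Nat.divide_1_r in H4. destruct Hp; lia.
      - rewrite Nat.pow_succ_r' in H4. apply prime_euclid in H4; auto. destruct H4 as [H | H]; auto.
        change 4%nat with (2 * 2)%nat in H. apply prime_euclid in H; auto.
        assert (H' : Nat.divide p 2) by tauto. destruct isprime_2 as [_ Q]. apply Q in H'. destruct Hp; lia. }
    subst p. apply odd_not_div2 in Hb. apply Hb. eapply Nat.divide_trans; eauto.
Qed.

Lemma rr_pow4 nu : (forall n, rr nu (16 * n) = rr nu (4 * n)) -> forall x n, rr nu (4 ^ S x * n) = rr nu (4 * n).
Proof.
  intros H x n. induction x as [| x IH]; [simpl; f_equal; lia |].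
  rewrite <- IH. rewrite Nat.pow_succ_r'. rewrite Nat.pow_succ_r' at 1.
  replace (4 * (4 * 4 ^ x) * n)%nat with (16 * (4 ^ x * n))%nat by lia. rewrite H. f_equal. rewrite Nat.pow_succ_r'. lia.
Qed.

(** r(4 j^2) = O(j^(nu - 4/3)), so the weights decay like j^(-4/3). *)
Lemma rr_weight nu : (2 <= nu)%nat -> exists w, smb w /\
  forall j, (1 <= j)%nat -> INR (rr nu (4 * (j * j))) * / INR j ^ nu <= w j.
Proof.
  intros Hnu. destruct nu as [| [| k]]; try lia. destruct (rr_bound k) as [M [HM H]].
  set (e := INR k / 2 + / 3).
  exists (fun j => M * Rpower 4 e * 2 ^ S (S k) * Rpower (INR j + 1) (- (1 + / 3))). split.
  - apply smb_scal; [| apply smb_power; lra].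
    apply Rmult_le_pos; [apply Rmult_le_pos; [lra | left; apply exp_pos] | apply pow_le; lra].
  - intros j Hj. assert (Hj1 : 1 <= INR j) by (apply (le_INR 1); auto).
    assert (He : 0 <= e) by (unfold e; pose proof (pos_INR k); lra).
    assert (B1 : INR (rr (S (S k)) (4 * (j * j))) <= M * (Rpower 4 e * Rpower (INR j + 1) (e + e))).
    { eapply Rle_trans; [apply H |]. apply Rmult_le_compat_l; [lra |]. fold e.
      rewrite Rpower_plus.
      rewrite !Rpower_mult_distr by (try apply Rmult_lt_0_compat; lra).
      apply Rle_Rpower_l; auto. rewrite !mult_INR. simpl (INR 4). split; nra. }
    assert (B2 : / INR j ^ S (S k) <= 2 ^ S (S k) * Rpower (INR j + 1) (- INR (S (S k)))).
    { rewrite Rpower_Ropp, Rpower_pow by lra.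
      replace (2 ^ S (S k) * / (INR j + 1) ^ S (S k)) with (/ ((INR j + 1) / 2) ^ S (S k)).
      - apply Rinv_le_contravar; [apply pow_lt; lra |]. apply pow_incr. lra.
      - unfold Rdiv. rewrite Rpow_mult_distr, Rinv_mult, pow_inv, Rinv_inv. apply Rmult_comm. }
    eapply Rle_trans.
    + apply Rmult_le_compat; [apply pos_INR | left; apply Rinv_0_lt_compat, pow_lt; lra | apply B1 | apply B2].
    + right. replace (- (1 + / 3)) with ((e + e) + - INR (S (S k))) by (unfold e; rewrite !S_INR; field).
      rewrite (Rpower_plus (e + e)). generalize (2 ^ S (S k)). intros. ring.
Qed.

Lemma rsum_snoc (f : nat -> R) n : rsum f (seq 1 (S n)) = rsum f (seq 1 n) + f (S n).
Proof. rewrite seq_S, rsum_app. unfold rsum at 2. cbn [fold_right]. rewrite Rplus_0_r. reflexivity. Qed.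

Section EvenTrick.
Variables (u w : nat -> R) (la : R).
Hypothesis Hla : 0 <= la <= / 8.
Hypothesis Hodd : forall j, (1 <= j)%nat -> Nat.odd j = true -> u (2 * j)%nat = - la * u j.
Hypothesis Heven : forall j, (1 <= j)%nat -> Nat.odd j = false -> u (2 * j)%nat = la * u j.
Hypothesis Hw : smb w.
Hypothesis Huw : forall j, (1 <= j)%nat -> Rabs (u j) <= w j.

Let o j := if Nat.odd j then u j else 0.

(* The even terms repeat the whole sum with the factor la = 2^(-nu-1), up to the sign on odd j; hence
   T = O (1 - 2 la) / (1 - la) for the sum T over all j and the sum O over odd j. *)
Lemma even_split J : rsum u (seq 1 (2 * J)) = rsum o (seq 1 (2 * J)) + la * (rsum u (seq 1 J) - 2 * rsum o (seq 1 J)).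
Proof.
  induction J as [| J IH]; [simpl; ring |].
  replace (2 * S J)%nat with (S (S (2 * J))) by lia. rewrite !rsum_snoc, IH.
  assert (O1 : o (S (S (2 * J))) = 0).
  { unfold o. replace (S (S (2 * J))) with (2 * S J)%nat by lia. rewrite Nat.odd_mul. reflexivity. }
  assert (O2 : o (S (2 * J)) = u (S (2 * J))).
  { unfold o. replace (S (2 * J)) with (2 * J + 1)%nat by lia. rewrite Nat.odd_add, Nat.odd_mul. reflexivity. }
  rewrite O1, O2. replace (S (S (2 * J))) with (2 * S J)%nat by lia.
  assert (O3 : o (S J) = if Nat.odd (S J) then u (S J) else 0) by reflexivity. rewrite O3.
  destruct (Nat.odd (S J)) eqn:E.
  - rewrite (Hodd (S J)) by (auto; lia). ring.
  - rewrite (Heven (S J)) by (auto; lia). ring.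
Qed.

Lemma seq_diff (f : nat -> R) eps P : (forall j, (1 <= j)%nat -> Rabs (f j) <= w j) ->
  (forall a n, (P <= a)%nat -> rsum w (seq a n) <= eps) -> forall J n, (P <= S J)%nat ->
  Rabs (rsum f (seq 1 (J + n)) - rsum f (seq 1 J)) <= eps.
Proof.
  intros Hf HP J n HJ. rewrite seq_app, rsum_app. replace (_ + _ - _) with (rsum f (seq (1 + J) n)) by ring.
  eapply Rle_trans; [| apply (HP (1 + J)%nat n); lia].
  clear HP. generalize (1 + J)%nat as a, (ltac:(lia) : (1 <= 1 + J)%nat). induction n as [| n IH]; intros a Ha.
  - simpl. rewrite Rabs_R0. lra.
  - cbn [seq rsum fold_right]. eapply Rle_trans; [apply Rabs_triang |]. apply Rplus_le_compat; [apply Hf; lia | apply IH; lia].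
Qed.

(** Beyond P the partial sums T and O move by at most o0/16 between J and 2 J, so [even_split]
    becomes T >= (3/4) O + la T - o0/8 at J. With O >= o0 this gives T >= (5/8) o0 + la T, which
    excludes T < 0 because la <= 1/8, and yields T >= o0/2 otherwise. *)
Lemma even_trick o0 J1 : 0 < o0 -> (forall J, (J1 <= J)%nat -> o0 <= rsum o (seq 1 J)) ->
  exists J0, forall J, (J0 <= J)%nat -> o0 / 2 <= rsum u (seq 1 J).
Proof.
  intros Ho H. destruct (smb_tail_seq w (o0 / 16) Hw ltac:(lra)) as [P HP].
  exists (max P J1). intros J HJ.
  pose proof (even_split J) as E.
  pose proof (seq_diff u _ P Huw HP J J ltac:(lia)) as D1.
  assert (Ho' : forall j, (1 <= j)%nat -> Rabs (o j) <= w j).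
  { intros j Hj. unfold o. destruct (Nat.odd j); auto. rewrite Rabs_R0. destruct Hw as [B [Q _]]. auto. }
  pose proof (seq_diff o _ P Ho' HP J J ltac:(lia)) as D2.
  replace (J + J)%nat with (2 * J)%nat in D1, D2 by lia.
  apply Rabs_le_between in D1. apply Rabs_le_between in D2.
  specialize (H J ltac:(lia)).
  assert (la * rsum o (seq 1 J) <= / 8 * rsum o (seq 1 J)) by (apply Rmult_le_compat_r; lra).
  destruct (Rle_lt_dec 0 (rsum u (seq 1 J))) as [Q | Q].
  - assert (0 <= la * rsum u (seq 1 J)) by (apply Rmult_le_pos; lra). lra.
  - assert (/ 8 * rsum u (seq 1 J) <= la * rsum u (seq 1 J)) by nra. lra.
Qed.
End EvenTrick.

Lemma INR_pow (a n : nat) : INR (a ^ n) = INR a ^ n.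
Proof. induction n as [| n IH]; [reflexivity |]. rewrite Nat.pow_succ_r', mult_INR, IH. reflexivity. Qed.

Lemma odd_prime p : isprime p -> (2 < p)%nat -> Nat.odd p = true.
Proof.
  intros [_ Hp] H2. apply odd_not_div2. intros D. apply Hp in D. lia.
Qed.

(** Raising i by 1 and the exponent of 2 by z multiplies the quotient by 2^z/(2^z + 1), a ratio
    close enough to 1 for [geom_hit]; the initial power of 2 starts above the window. *)
Lemma hit_power al be B z : 0 < al < be -> (1 <= B)%nat -> al < 2 ^ z * (be - al) ->
  exists x i, al < 2 ^ S x / (INR B * (2 ^ z + 1) ^ i) < be.
Proof.
  intros Hab HB Hz. assert (HBR : 0 < INR B) by (apply lt_0_INR; lia).
  assert (Hz0 : 0 < 2 ^ z) by (apply pow_lt; lra).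
  destruct (Pow_x_infinity 2 ltac:(rewrite Rabs_pos_eq; lra) (INR B * be)) as [x0 Hx0].
  specialize (Hx0 (S x0) ltac:(lia)). rewrite Rabs_pos_eq in Hx0 by (apply pow_le; lra).
  destruct (geom_hit al be (2 ^ z / (2 ^ z + 1)) (2 ^ S x0 / INR B)) as [i Hi]; try lra.
  - split; [apply Rdiv_lt_0_compat; lra |]. apply Rmult_lt_reg_r with (2 ^ z + 1); [lra |].
    unfold Rdiv. rewrite Rmult_assoc, Rinv_l by lra. lra.
  - apply Rmult_lt_reg_r with (2 ^ z + 1); [lra |].
    replace (2 ^ z / (2 ^ z + 1) * be * (2 ^ z + 1)) with (2 ^ z * be) by (field; lra). lra.
  - apply Rmult_le_reg_r with (INR B); auto. unfold Rdiv. rewrite Rmult_assoc, Rinv_l by lra. lra.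
  - exists (z * i + x0)%nat, i.
    replace (2 ^ S (z * i + x0) / (INR B * (2 ^ z + 1) ^ i)) with (2 ^ S x0 / INR B * (2 ^ z / (2 ^ z + 1)) ^ i); auto.
    unfold Rdiv at 2. rewrite Rpow_mult_distr, pow_inv, <- pow_mult.
    replace (S (z * i + x0)) with (S x0 + z * i)%nat by lia. rewrite pow_add. field.
    split; [apply pow_nonzero; lra | lra].
Qed.

(** With n0 = 4^(x+1) the counts r(n0 j^2) = r(4 j^2) do not depend on x, so P and B are fixed
    before x and i are chosen to place q. As b is odd, the positivity argument covers odd j, and
    [even_trick] brings in the even ones. *)
Lemma resonance_24 nu al be sg : (2 <= nu)%nat -> (forall n, rr nu (16 * n) = rr nu (4 * n)) -> (1 <= rr nu 4)%nat ->
  0 < al < be -> sg = 1 \/ sg = -1 -> exists n0 b, resonant nu n0 b al be sg.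
Proof.
  intros Hnu H16 H4 Hab Hsg.
  destruct (rr_weight nu Hnu) as [w [Hw Hrw]].
  (* The normalised term j = 1 is at least 1, so a tail of at most 1/2 leaves 1/2 for the sum over
     odd j. *)
  destruct (smb_tail_seq w (/ 2) Hw ltac:(lra)) as [P0 HP0].
  set (P := S P0).
  destruct (Pow_x_infinity 2 ltac:(rewrite Rabs_pos_eq; lra) (al / (be - al) + 1)) as [z0 Hz0].
  set (z := S z0). assert (Hz : al / (be - al) + 1 <= 2 ^ z).
  { specialize (Hz0 z ltac:(unfold z; lia)). rewrite Rabs_pos_eq in Hz0 by (apply pow_le; lra). lra. }
  clear Hz0. assert (Hz' : al < 2 ^ z * (be - al)).
  { replace al with (al / (be - al) * (be - al)) at 1 by (field; lra). apply Rmult_lt_compat_r; lra. }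
  (* Powers of this odd number in the denominator steer q into the window. One factor [th] is put
     into B from the start, so the further powers leave the sign of [cf] unchanged by
     [cf_smooth]. *)
  set (th := (2 ^ z + 1)%nat).
  assert (Hth : Nat.odd th = true).
  { unfold th, z. rewrite Nat.pow_succ_r', Nat.odd_add, Nat.odd_mul. reflexivity. }
  assert (Hth1 : (1 <= th)%nat) by (unfold th; lia).
  assert (Hof : (1 <= oddfact P)%nat).
  { pose proof (oddfact_odd P). destruct (oddfact P); [discriminate | lia]. }
  destruct (sign_fix (th * oddfact P) 2 sg) as [p [Hp Hpos]]; auto; [nia |].
  assert (Hpo : Nat.odd p = true) by (destruct Hp as [-> | [Q1 Q2]]; auto; apply odd_prime; auto).
  set (B := (p * (th * oddfact P))%nat) in *.
  assert (HBo : Nat.odd B = true) by (unfold B; rewrite !Nat.odd_mul, Hpo, Hth, oddfact_odd; auto).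
  assert (HB1 : (1 <= B)%nat) by (destruct B; [discriminate | lia]).
  assert (HthB : Nat.divide th B) by (exists (p * oddfact P)%nat; unfold B; lia).
  assert (HofB : Nat.divide (oddfact P) B) by (exists (p * th)%nat; unfold B; lia).
  destruct (hit_power al be B z Hab HB1 Hz') as [x [i Hq]].
  clearbody B.
  set (b := (B * th ^ i)%nat).
  assert (Hthi : Nat.odd (th ^ i) = true).
  { clear - Hth. induction i as [| i IH]; auto. rewrite Nat.pow_succ_r', Nat.odd_mul, Hth, IH. auto. }
  assert (Hbo : Nat.odd b = true) by (unfold b; rewrite Nat.odd_mul, HBo, Hthi; auto).
  assert (Hb1 : (1 <= b)%nat) by (destruct b; [discriminate | lia]).
  assert (Hthi1 : (1 <= th ^ i)%nat) by (destruct (th ^ i)%nat; [discriminate | lia]).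
  assert (Ecf : cf b = cf B / INR (th ^ i)).
  { apply cf_smooth; auto. intros q Hpr Hd. eapply Nat.divide_trans; [| apply HthB].
    clear - Hpr Hd. induction i as [| i IH].
    - simpl in Hd. apply Nat.divide_1_r in Hd. destruct Hpr; lia.
    - rewrite Nat.pow_succ_r' in Hd. apply prime_euclid in Hd; auto. tauto. }
  assert (Hcfb : 0 < sg * cf b).
  { rewrite Ecf. unfold Rdiv. rewrite <- Rmult_assoc. apply Rmult_lt_0_compat; auto.
    apply Rinv_0_lt_compat, lt_0_INR. lia. }
  set (n0 := (4 ^ S x)%nat).
  assert (HG : forall j, rr nu (n0 * (j * j)) = rr nu (4 * (j * j))) by (intros; apply rr_pow4; auto).
  assert (HbR : 0 < INR b) by (apply lt_0_INR; lia).
  exists n0, b. split; [apply Nat.neq_0_lt_0, Nat.pow_nonzero; lia |]. split; [auto |].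
  split; [| split].
  - assert (E : sqrt (INR n0) / INR b = 2 ^ S x / (INR B * (2 ^ z + 1) ^ i)); [| rewrite E; auto].
    unfold n0, b. rewrite mult_INR, !INR_pow. unfold th. rewrite plus_INR, INR_pow.
    replace (INR 2) with 2 by reflexivity. replace (INR 1) with 1 by reflexivity.
    f_equal. replace (INR 4) with (2 * 2) by (simpl; ring). rewrite Rpow_mult_distr. apply sqrt_square, pow_le. lra.
  - apply square_div_gen; auto. apply odd_square_free_pow4; auto.
  - set (u := um nu n0 b).
    assert (Huw : forall j, (1 <= j)%nat -> Rabs (u j) <= w j).
    { intros j Hj. eapply Rle_trans; [apply um_abs; auto |]. rewrite HG. auto. }
    set (la := / 2 ^ S nu).
    assert (Hla : 0 <= la <= / 8).
    { split; [left; apply Rinv_0_lt_compat, pow_lt; lra |]. unfold la. apply Rinv_le_contravar; [lra |].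
      replace 8 with (2 ^ 3) by ring. apply Rle_pow; [lra | lia]. }
    assert (H2j : forall j, (1 <= j)%nat -> INR (rr nu (n0 * (2 * j * (2 * j)))) * / INR (2 * j) ^ nu =
      / 2 ^ nu * (INR (rr nu (n0 * (j * j))) * / INR j ^ nu)).
    { intros j Hj. rewrite !HG. replace (4 * (2 * j * (2 * j)))%nat with (16 * (j * j))%nat by lia. rewrite H16.
      rewrite mult_INR, Rpow_mult_distr, Rinv_mult. replace (INR 2) with 2 by reflexivity. ring. }
    assert (Hdiv2 : forall j, Nat.odd j = false -> Nat.divide 2 j).
    { intros j Hj. destruct (classic (Nat.divide 2 j)) as [D | D]; auto.
      apply odd_not_div2 in D. congruence. }
    assert (Hodd : forall j, (1 <= j)%nat -> Nat.odd j = true -> u (2 * j)%nat = - la * u j).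
    { intros j Hj Ho. unfold u, um. rewrite H2j by auto. replace (b * (2 * j))%nat with (2 * (b * j))%nat by lia.
      rewrite cf_mul_ndiv; [| apply isprime_2 | nia |].
      - unfold la. simpl (2 ^ S nu). rewrite Rinv_mult. replace (INR 2) with 2 by reflexivity.
        generalize (/ 2 ^ nu). intros. field. split; [apply pow_nonzero, not_0_INR; lia | apply cf_neq_0; auto].
      - apply odd_not_div2. rewrite Nat.odd_mul, Hbo, Ho. auto. }
    assert (Heven : forall j, (1 <= j)%nat -> Nat.odd j = false -> u (2 * j)%nat = la * u j).
    { intros j Hj Ho. unfold u, um. rewrite H2j by auto. replace (b * (2 * j))%nat with (2 * (b * j))%nat by lia.
      rewrite cf_mul_div; [| apply isprime_2 | nia | apply Nat.divide_mul_r; auto].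
      unfold la. simpl (2 ^ S nu). rewrite Rinv_mult. replace (INR 2) with 2 by reflexivity.
      generalize (/ 2 ^ nu). intros. field. split; [apply pow_nonzero, not_0_INR; lia | apply cf_neq_0; auto]. }
    assert (Hu1 : 1 <= u 1%nat).
    { unfold u, um. rewrite HG. rewrite Nat.mul_1_r. simpl (4 * (1 * 1))%nat. simpl (INR 1). rewrite pow1, Rinv_1, Rmult_1_r.
      unfold Rdiv. rewrite Rinv_r, Rmult_1_l by (apply cf_neq_0; auto). apply (le_INR 1); auto. }
    assert (Hlow : forall J, (1 <= J)%nat -> / 2 <= rsum (fun j => if Nat.odd j then u j else 0) (seq 1 J)).
    { intros J HJ. eapply Rle_trans; [| apply (lower_sum _ w 1 P (/ 2)); auto].
      - simpl. lra.
      - unfold P; lia.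
      - intros j Hj. destruct (Nat.odd j) eqn:E; [| lra].
        apply um_smooth_pos; auto; [lia |]. intros q Hpr Hd.
        apply Nat.divide_mul_l. eapply Nat.divide_trans; [| apply HofB].
        assert (Hqo : Nat.odd q = true).
        { apply odd_not_div2. intros D. apply odd_not_div2 in E. apply E. eapply Nat.divide_trans; eauto. }
        apply Nat.divide_pos_le in Hd; [| lia].
        rewrite (Nat.div2_odd q), Hqo. simpl Nat.b2n. destruct Hpr as [Hpr _].
        apply oddfact_divide. pose proof (Nat.div2_odd q) as Q. rewrite Hqo in Q. simpl Nat.b2n in Q. lia.
      - intros j Hj. destruct Hw as [Bw [Hw0 _]]. destruct (Nat.odd j).
        + specialize (Huw j ltac:(lia)). apply Rabs_le_between in Huw. lra.
        + specialize (Hw0 j). lra.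
      - destruct Hw as [Bw [Hw0 _]]. auto.
      - intros J'. apply HP0. unfold P. lia. }
    destruct (even_trick u w la Hla Hodd Heven Hw Huw (/ 2) 1 ltac:(lra) Hlow) as [J0 HJ0].
    exists (sg * cf b * / INR b ^ nu * (/ 2 / 2)), J0. split.
    + apply Rmult_lt_0_compat; [| lra]. apply Rmult_lt_0_compat; auto. apply Rinv_0_lt_compat, pow_lt; auto.
    + intros J HJ. rewrite tm_sum by auto. fold u.
      replace (sg * (cf b * / INR b ^ nu * rsum u (seq 1 J))) with (sg * cf b * / INR b ^ nu * rsum u (seq 1 J)) by ring.
      apply Rmult_le_compat_l; auto.
      apply Rmult_le_pos; [lra | left; apply Rinv_0_lt_compat, pow_lt; auto].
Qed.

Lemma rr_4_pos nu : (1 <= nu)%nat -> (1 <= rr nu 4)%nat.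
Proof.
  intros Hnu. assert (In (2%Z :: repeat 0%Z (nu - 1)) (Vn nu 4)).
  { apply Vn_in. split; [simpl; rewrite repeat_length; lia |].
    apply Nat2Z.inj. rewrite n2_Z. simpl fold_right.
    assert (E : fold_right (fun a acc => (a * a + acc)%Z) 0%Z (repeat 0%Z (nu - 1)) = 0%Z).
    { induction (nu - 1)%nat; simpl; auto. }
    rewrite E. reflexivity. }
  unfold rr. destruct (Vn nu 4); [contradiction | apply le_n_S, Nat.le_0_l].
Qed.

Lemma resonance_exists nu al be sg : nu = 2%nat \/ nu = 4%nat \/ nu = 8%nat ->
  0 < al < be -> sg = 1 \/ sg = -1 -> exists n0 b, resonant nu n0 b al be sg.
Proof.
  intros [-> | [-> | ->]] Hab Hsg.
  - apply resonance_24; auto; [apply rr2_16 | apply rr_4_pos; lia].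
  - apply resonance_24; auto; [apply rr4_16 | apply rr_4_pos; lia].
  - apply resonance_8; auto.
Qed.

(** * The logarithm of zeta *)

Lemma Dc_csum {T : Type} (F f : T -> R -> C) (L : list T) x : (forall t, Dc (F t) x (f t x)) ->
  Dc (fun w => csum (fun t => F t w) L) x (csum (fun t => f t x) L).
Proof.
  intros H. induction L as [| t L IH]; [apply (Dc_const 0) |].
  apply (Dc_plus (F t) (fun w => csum (fun t => F t w) L) x (f t x) (csum (fun t => f t x) L)); auto.
Qed.

Lemma cexp_near_1 (z : C) : Cmod (cexp z - 1) <= Cmod z * exp (Cmod z).
Proof.
  pose proof (CI_mvt (fun t => cexp (RtoC t * z)) (fun t => (1 * z + RtoC t * 0) * cexp (RtoC t * z))%C (Cmod z * exp (Cmod z)) 0 1 ltac:(lra)) as H.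
  cbv beta in H. replace (1 * z)%C with z in H by ring. rewrite Cmult_0_l, cexp_0 in H.
  replace ((1 - 0) * (Cmod z * exp (Cmod z))) with (Cmod z * exp (Cmod z)) in H by ring. apply H.
  - intros x. eapply Dc_eq; [| apply Dc_cexp, Dc_mult; [apply Dc_id | apply Dc_const]]. cbv beta. ring.
  - intros x _. apply Cc_mult; [apply (Dc_Cc _ _ (0 + (1 * 0 + RtoC x * 0))%C) |].
    + eapply Dc_eq; [| apply (Dc_plus (fun _ => z) (fun t => RtoC t * 0)%C); [apply Dc_const | apply Dc_mult; [apply Dc_id | apply Dc_const]]]. cbv beta. ring.
    + eapply Dc_Cc, Dc_cexp, Dc_mult; [apply Dc_id | apply Dc_const].
  - intros x Hx. rewrite Cmod_mult, Cmod_cexp. replace (z + RtoC x * 0)%C with z by ring.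
    apply Rmult_le_compat_l; [apply Cmod_ge_0 |]. apply exp_le. rewrite Re_RM.
    pose proof (Cmod_Re_le z). pose proof (Cmod_ge_0 z). nra.
Qed.

Lemma geom_csum (q : C) n : ((1 - q) * csum (fun j => q ^ j) (seq 0 n) = 1 - q ^ n)%C.
Proof.
  induction n as [| n IH]; [unfold csum; simpl; ring |].
  rewrite seq_S, csum_app, Cmult_plus_distr_l, IH. unfold csum. cbn [fold_right Nat.add]. rewrite Cpow_S. ring.
Qed.

(** The terms of -log (1 - w), indexed from 0. *)
Definition lterm (w : C) (j : nat) : C := (RtoC (/ INR (S j)) * w ^ S j)%C.

Lemma lterm_bound w j : Cmod (lterm w j) <= Cmod w ^ S j.
Proof.
  unfold lterm. assert (1 <= INR (S j)) by (apply (le_INR 1); lia).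
  assert (0 < / INR (S j) <= 1).
  { split; [apply Rinv_0_lt_compat; lra |]. rewrite <- Rinv_1. apply Rinv_le_contravar; lra. }
  rewrite Cmod_RM, Cmod_pow by lra. pose proof (pow_le (Cmod w) (S j) (Cmod_ge_0 w)). nra.
Qed.

(** Along t in [0, 1] the function (1 - t w) exp(P(t)) has derivative -w (t w)^n exp(P(t)), since
    the geometric sum cancels all but one power; the mean value inequality then applies. No branch
    of the logarithm enters. *)
Lemma lterm_partial w n : Cmod w < 1 ->
  Cmod ((1 - w) * cexp (csum (lterm w) (seq 0 n)) - 1) <= Cmod w ^ S n * exp (Cmod w / (1 - Cmod w)).
Proof.
  intros Hw. pose proof (Cmod_ge_0 w) as Hw0.
  set (P := fun t : R => csum (fun j => lterm (RtoC t * w) j) (seq 0 n)).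
  assert (DP : forall t, Dc P t (w * csum (fun j => (RtoC t * w) ^ j) (seq 0 n))%C).
  { intros t. rewrite <- csum_scal. apply (Dc_csum (fun j u => lterm (RtoC u * w) j) (fun j u => w * (RtoC u * w) ^ j)%C).
    intros j. unfold lterm. eapply Dc_eq; [| apply Dc_mult; [apply Dc_const | apply Dc_pow, Dc_mult; [apply Dc_id | apply Dc_const]]].
    cbv beta. replace (S j - 1)%nat with j by lia. rewrite RtoC_inv by (apply not_0_INR; lia).
    field. intros K. apply RtoC_inj in K. revert K. apply not_0_INR. lia. }
  assert (EP : P 1 = csum (lterm w) (seq 0 n)).
  { unfold P. f_equal. replace (RtoC 1 * w)%C with w by ring. reflexivity. }
  pose proof (CI_mvt (fun t => (1 - RtoC t * w) * cexp (P t))%C (fun t => - w * (RtoC t * w) ^ n * cexp (P t))%C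
    (Cmod w ^ S n * exp (Cmod w / (1 - Cmod w))) 0 1 ltac:(lra)) as H.
  cbv beta in H. rewrite EP in H. replace (1 * w)%C with w in H by ring.
  assert (E0 : P 0 = 0).
  { unfold P. apply csum_zero. intros j _. unfold lterm. rewrite Cmult_0_l, Cpow_S. ring. }
  rewrite E0, cexp_0 in H. replace ((1 - 0 * w) * 1)%C with (RtoC 1) in H by ring.
  rewrite Rminus_0_r, Rmult_1_l in H. apply H.
  - intros x. eapply Dc_eq; [| apply (Dc_mult (fun t => 1 - RtoC t * w)%C);
      [apply (Dc_plus (fun _ => RtoC 1) (fun t => - (RtoC t * w))%C); [apply Dc_const | apply Dc_opp, Dc_mult; [apply Dc_id | apply Dc_const]] | apply Dc_cexp, DP]].
    cbv beta.
    replace (_ + _)%C with (cexp (P x) * (w * ((1 - RtoC x * w) * csum (fun j => (RtoC x * w) ^ j)%C (seq 0 n)) - w))%C by ring.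
    rewrite geom_csum. ring.
  - intros x _. apply Cc_mult; [| eapply Dc_Cc, Dc_cexp, DP].
    apply Cc_mult; [apply Cc_const |]. eapply Dc_Cc, Dc_pow, Dc_mult; [apply Dc_id | apply Dc_const].
  - intros x Hx. rewrite !Cmod_mult, Cmod_opp, Cmod_cexp, Cmod_pow.
    assert (Hxw : Cmod (RtoC x * w) <= Cmod w) by (rewrite Cmod_RM by lra; nra).
    simpl pow. apply Rmult_le_compat; [apply Rmult_le_pos; auto; apply pow_le, Cmod_ge_0 | left; apply exp_pos | |].
    + apply Rmult_le_compat_l; auto. apply pow_incr. split; [apply Cmod_ge_0 | auto].
    + apply exp_le. eapply Rle_trans; [apply Cmod_Re_le |]. unfold P.
      eapply Rle_trans; [apply (csum_le _ (fun j => Cmod w ^ S j)) |].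
      * intros j _. eapply Rle_trans; [apply lterm_bound |]. apply pow_incr. split; [apply Cmod_ge_0 | auto].
      * assert (K : forall m, rsum (fun j => Cmod w ^ S j) (seq 0 m) <= Cmod w / (1 - Cmod w) * (1 - Cmod w ^ m)).
        { induction m as [| m IH]; [unfold rsum; simpl; lra |].
          rewrite seq_S, rsum_app. unfold rsum at 2. cbn [fold_right Nat.add].
          eapply Rle_trans; [apply Rplus_le_compat_r, IH |]. right. simpl. field. lra. }
        eapply Rle_trans; [apply K |].
        assert (0 <= Cmod w / (1 - Cmod w)) by (apply Rmult_le_pos; auto; left; apply Rinv_0_lt_compat; lra).
        pose proof (pow_le (Cmod w) n Hw0). nra.
Qed.

Lemma lterm_smb w : Cmod w < 1 -> smb (fun j => Cmod w ^ S j).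
Proof.
  intros Hw. pose proof (Cmod_ge_0 w). apply (smb_inj S (fun j => Cmod w ^ j)); [auto |]. apply smb_geom. lra.
Qed.

Lemma Cmod_small_eq (a b : C) : (forall eps, 0 < eps -> Cmod (a - b) <= eps) -> a = b.
Proof.
  intros H. assert (E : (a - b)%C = 0).
  { apply Cmod_eq_0. destruct (Rle_lt_or_eq_dec _ _ (Cmod_ge_0 (a - b))) as [Q | Q]; auto.
    specialize (H (Cmod (a - b) / 2) ltac:(lra)). lra. }
  replace a with (a - b + b)%C by ring. rewrite E. ring.
Qed.

Lemma log_factor w L : Cmod w < 1 -> hs (lterm w) L -> (/ (1 - w) = cexp L)%C.
Proof.
  intros Hw HL. pose proof (Cmod_ge_0 w) as Hw0.
  assert (Hnz : (1 - w)%C <> 0).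
  { intros K. assert (Cmod w = 1); [| lra]. replace w with (RtoC 1 - (1 - w))%C by ring. rewrite K.
    replace (1 - 0)%C with (RtoC 1) by ring. apply Cmod_1. }
  assert (E : ((1 - w) * cexp L)%C = 1).
  { apply Cmod_small_eq. intros eps He.
    set (M := exp (Cmod w / (1 - Cmod w))). assert (HM : 0 < M) by apply exp_pos.
    destruct (pow_lt_1_zero (Cmod w) ltac:(rewrite Rabs_pos_eq; lra) (eps / 2 / M)) as [N1 H1].
    { apply Rdiv_lt_0_compat; lra. }
    set (M2 := Cmod ((1 - w) * cexp L) * exp 1).
    assert (HM2 : 0 <= M2) by (apply Rmult_le_pos; [apply Cmod_ge_0 | left; apply exp_pos]).
    set (d := Rmin 1 (eps / 2 / (M2 + 1))).
    assert (Hd : 0 < d) by (apply Rmin_glb_lt; [lra | apply Rdiv_lt_0_compat; lra]).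
    destruct (hs_nat_lim _ _ HL d Hd) as [N2 H2].
    set (n := max N1 N2). specialize (H1 (S n) ltac:(lia)). specialize (H2 n ltac:(lia)).
    pose proof (lterm_partial w n Hw) as H3. fold M in H3.
    rewrite Rabs_pos_eq in H1 by (apply pow_le; auto).
    set (x := (csum (lterm w) (seq 0 n) - L)%C) in *.
    assert (E1 : cexp (csum (lterm w) (seq 0 n)) = (cexp L * cexp x)%C).
    { rewrite <- cexp_plus. f_equal. unfold x. ring. }
    rewrite E1 in H3.
    replace ((1 - w) * cexp L - 1)%C with (((1 - w) * (cexp L * cexp x) - 1) - (1 - w) * cexp L * (cexp x - 1))%C by ring.
    eapply Rle_trans; [apply Cmod_triangle |]. rewrite Cmod_opp, (Cmod_mult ((1 - w) * cexp L)).
    pose proof (cexp_near_1 x) as H4.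
    assert (B1 : Cmod w ^ S n * M <= eps / 2).
    { left. apply Rmult_lt_compat_r with (r := M) in H1; auto. replace (eps / 2 / M * M) with (eps / 2) in H1 by (field; lra). auto. }
    assert (Hx1 : Cmod x <= 1) by (left; eapply Rlt_le_trans; [apply H2 | apply Rmin_l]).
    assert (Hx2 : Cmod x * (M2 + 1) <= eps / 2).
    { left. apply Rlt_le_trans with (eps / 2 / (M2 + 1) * (M2 + 1)).
      - apply Rmult_lt_compat_r; [lra |]. eapply Rlt_le_trans; [apply H2 | apply Rmin_r].
      - right. field. lra. }
    assert (B2 : Cmod ((1 - w) * cexp L) * Cmod (cexp x - 1) <= eps / 2).
    { eapply Rle_trans; [| apply Hx2]. apply Rle_trans with (Cmod ((1 - w) * cexp L) * (Cmod x * exp 1)).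
      - apply Rmult_le_compat_l; [apply Cmod_ge_0 |]. eapply Rle_trans; [apply H4 |].
        apply Rmult_le_compat_l; [apply Cmod_ge_0 | apply exp_le; auto].
      - pose proof (Cmod_ge_0 x). unfold M2 in *. nra. }
    lra. }
  assert (E2 : (cexp L = / (1 - w) * ((1 - w) * cexp L))%C) by (field; auto).
  rewrite E2, E. ring.
Qed.

(** * Exponential sums over lattice vectors *)

Lemma rsum_flat_map {A B : Type} (h : A -> list B) (f : B -> R) L :
  rsum f (flat_map h L) = rsum (fun a => rsum f (h a)) L.
Proof. induction L as [| a L IH]; [reflexivity |]. cbn [flat_map]. rewrite rsum_app, IH. reflexivity. Qed.

Lemma csum_map {A B : Type} (s : A -> B) (f : B -> C) L : csum f (map s L) = csum (fun a => f (s a)) L.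
Proof. induction L as [| a L IH]; [reflexivity |]. cbn [map]. unfold csum in *. cbn [fold_right]. rewrite IH. reflexivity. Qed.

Definition zseq (N : nat) : list Z := map (fun k => (Z.of_nat k - Z.of_nat N)%Z) (seq 0 (2 * N + 1)).

Lemma rsum_box_prod (g : Z -> R) nu N :
  rsum (fun v => fold_right (fun a acc => g a * acc) 1 v) (box nu N) = rsum g (zseq N) ^ nu.
Proof.
  induction nu as [| nu IH]; [unfold rsum; simpl; ring |].
  cbn [box pow]. fold (zseq N). rewrite rsum_flat_map, <- IH, Rmult_comm, <- rsum_scal.
  apply rsum_ext_in. intros a _. rewrite rsum_map. cbn [fold_right].
  rewrite (rsum_scal (g a) (fun v => fold_right (fun a acc => g a * acc) 1 v)). apply Rmult_comm.
Qed.

Lemma geom_rsum q n : 0 <= q < 1 -> rsum (fun j => q ^ j) (seq 0 n) <= / (1 - q).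
Proof.
  intros Hq. assert (K : rsum (fun j => q ^ j) (seq 0 n) = (1 - q ^ n) / (1 - q)).
  { induction n as [| n IH]; [unfold rsum; simpl; field; lra |].
    rewrite seq_S, rsum_app, IH. unfold rsum. simpl. field. lra. }
  rewrite K. unfold Rdiv. rewrite <- (Rmult_1_l (/ (1 - q))) at 2.
  apply Rmult_le_compat_r; [left; apply Rinv_0_lt_compat; lra |]. pose proof (pow_le q n). lra.
Qed.

Lemma two_sided_geom q N : 0 <= q < 1 -> rsum (fun a => q ^ Z.abs_nat a) (zseq N) <= 2 / (1 - q).
Proof.
  intros Hq. unfold zseq. replace (2 * N + 1)%nat with (N + S N)%nat by lia.
  rewrite seq_app, map_app, rsum_app. replace (2 / (1 - q)) with (/ (1 - q) + / (1 - q)) by (unfold Rdiv; ring).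
  apply Rplus_le_compat.
  - rewrite rsum_map. eapply Rle_trans; [| apply (geom_rsum q (S N) Hq)].
    rewrite <- (rsum_ext_in (fun k => q ^ (N - k))).
    + rewrite <- (rsum_map (fun k => (N - k)%nat) (fun j => q ^ j)). apply rsum_incl.
      * intros; apply pow_le; lra.
      * apply NoDup_map_NoDup_ForallPairs; [| apply seq_NoDup].
        intros x y Hx Hy. apply in_seq in Hx, Hy. lia.
      * intros x Hx. apply in_map_iff in Hx. destruct Hx as [k [<- Hk]]. apply in_seq. apply in_seq in Hk. lia.
    + intros k Hk. apply in_seq in Hk. f_equal. lia.
  - rewrite rsum_map. eapply Rle_trans; [| apply (geom_rsum q (S N) Hq)].
    rewrite <- (rsum_ext_in (fun k => q ^ (k - N))).
    + rewrite <- (rsum_map (fun k => (k - N)%nat) (fun j => q ^ j)). apply rsum_incl.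
      * intros; apply pow_le; lra.
      * apply NoDup_map_NoDup_ForallPairs; [| apply seq_NoDup].
        intros x y Hx Hy. apply in_seq in Hx, Hy. lia.
      * intros x Hx. apply in_map_iff in Hx. destruct Hx as [k [<- Hk]]. apply in_seq. apply in_seq in Hk. lia.
    + intros k Hk. apply in_seq in Hk. f_equal. lia.
Qed.

Lemma vnorm_coord v a : In a v -> IZR (Z.abs a) <= vnorm v.
Proof.
  intros H. unfold vnorm. rewrite abs_IZR.
  assert (Hp : forall w, 0 <= fold_right (fun a acc => IZR a ^ 2 + acc) 0 w).
  { induction w as [| b w IH]; cbn [fold_right]; [lra |]. pose proof (pow2_ge_0 (IZR b)). lra. }
  rewrite <- sqrt_Rsqr_abs. apply sqrt_le_1_alt. unfold Rsqr.
  induction v as [| b v IH]; [destruct H |]. cbn [fold_right]. destruct H as [-> | H].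
  - specialize (Hp v). assert (E : IZR a * IZR a = IZR a ^ 2) by ring. rewrite E. lra.
  - specialize (IH H). pose proof (pow2_ge_0 (IZR b)). lra.
Qed.

Lemma exp_pow x n : exp (x * INR n) = exp x ^ n.
Proof.
  induction n as [| n IH]; [simpl; rewrite Rmult_0_r; apply exp_0 |].
  rewrite S_INR, Rmult_plus_distr_l, exp_plus, IH, Rmult_1_r. simpl. ring.
Qed.

(** Each coordinate is at most the norm, so the l1 norm is at most nu times the norm, and the
    exponential is majorised by a product of one-variable geometric factors. *)
Lemma exp_vnorm_prod nu x v : (1 <= nu)%nat -> 0 <= x -> length v = nu ->
  exp (- (x * vnorm v)) <= fold_right (fun a acc => exp (- (x / INR nu)) ^ Z.abs_nat a * acc) 1 v.
Proof.
  intros Hnu Hx Hl. assert (HnR : 0 < INR nu) by (apply lt_0_INR; lia).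
  assert (K : forall w, fold_right (fun a acc => exp (- (x / INR nu)) ^ Z.abs_nat a * acc) 1 w =
    exp (- (x / INR nu) * fold_right (fun a acc => IZR (Z.abs a) + acc) 0 w)).
  { induction w as [| a w IH]; [simpl; rewrite Rmult_0_r, exp_0; auto |].
    cbn [fold_right]. rewrite IH, <- exp_pow, <- exp_plus. f_equal.
    assert (E : INR (Z.abs_nat a) = IZR (Z.abs a)) by (rewrite INR_IZR_INZ; f_equal; lia). rewrite E. ring. }
  rewrite K. apply exp_le.
  assert (S : fold_right (fun a acc => IZR (Z.abs a) + acc) 0 v <= INR nu * vnorm v).
  { rewrite <- Hl. assert (Q : forall w, incl w v -> fold_right (fun a acc => IZR (Z.abs a) + acc) 0 w <= INR (length w) * vnorm v).
    { induction w as [| a w IH]; intros Hi; [simpl; lra |].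
      cbn [fold_right length]. rewrite S_INR, Rmult_plus_distr_r, Rmult_1_l, Rplus_comm.
      apply Rplus_le_compat; [apply IH; intros t Ht; apply Hi; simpl; auto | apply vnorm_coord, Hi; simpl; auto]. }
    apply Q. intros t; auto. }
  apply Rmult_le_compat_l with (r := x / INR nu) in S; [| apply Rmult_le_pos; [auto | left; apply Rinv_0_lt_compat; auto]].
  replace (x / INR nu * (INR nu * vnorm v)) with (x * vnorm v) in S by (field; lra). lra.
Qed.

Lemma in_big_box nu (L : list (list Z)) : exists N, forall v, In v L -> length v = nu -> In v (box nu N).
Proof.
  induction L as [| v L [N IH]]; [exists 0%nat; intros v [] |].
  exists (max N (n2 v)). intros w [<- | Hw] Hl; apply box_in; split; auto; intros a Ha.
  - pose proof (n2_coord _ _ Ha). lia.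
  - specialize (IH w Hw Hl). apply box_in in IH. destruct IH as [_ IH]. specialize (IH a Ha). lia.
Qed.

Lemma exp_inv_bound y : 0 < y -> / (1 - exp (- y)) <= (1 + y) / y.
Proof.
  intros Hy. assert (E : exp (- y) <= / (1 + y)).
  { rewrite exp_Ropp. apply Rinv_le_contravar; [lra |]. left. apply exp_ineq1. lra. }
  assert (Q : y / (1 + y) <= 1 - exp (- y)).
  { replace (y / (1 + y)) with (1 - / (1 + y)) by (field; lra). lra. }
  replace ((1 + y) / y) with (/ (y / (1 + y))) by (field; lra).
  apply Rinv_le_contravar; auto. apply Rdiv_lt_0_compat; lra.
Qed.

(** The list is enclosed in a box, where the product majorant sums to the nu-th power of a two-sided
    geometric sum. *)
Lemma all_vec_bound nu x L : (1 <= nu)%nat -> 0 < x -> NoDup L ->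
  rsum (onlen nu 0 (fun v => exp (- (x * vnorm v)))) L <= (2 * (1 + x / INR nu) / (x / INR nu)) ^ nu.
Proof.
  intros Hnu Hx HL. assert (HnR : 0 < INR nu) by (apply lt_0_INR; lia).
  set (y := x / INR nu). assert (Hy : 0 < y) by (apply Rdiv_lt_0_compat; auto).
  assert (Hq : 0 <= exp (- y) < 1).
  { split; [left; apply exp_pos |]. rewrite <- exp_0. apply exp_increasing. lra. }
  set (h := fun v => fold_right (fun a acc => exp (- y) ^ Z.abs_nat a * acc) 1 v).
  assert (Hh : forall v, 0 <= h v).
  { induction v; unfold h; simpl; [lra |]. apply Rmult_le_pos; [apply pow_le; lra | auto]. }
  destruct (in_big_box nu L) as [N HN].
  apply Rle_trans with (rsum h (filter (fun v => Nat.eqb (length v) nu) L)).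
  - clear HL HN. induction L as [| v L IH]; [unfold rsum; simpl; lra |].
    cbn [filter]. unfold rsum at 1. cbn [fold_right]. fold (rsum (onlen nu 0 (fun v => exp (- (x * vnorm v)))) L).
    unfold onlen at 1. destruct (Nat.eqb_spec (length v) nu) as [E | E]; [| lra].
    unfold rsum at 2. cbn [fold_right]. apply Rplus_le_compat; auto. apply exp_vnorm_prod; auto. lra.
  - eapply Rle_trans; [apply (rsum_incl h _ (box nu N)); auto |].
    + apply NoDup_filter; auto.
    + intros v Hv. apply filter_In in Hv. destruct Hv as [H1 H2]. apply Nat.eqb_eq in H2. auto.
    + unfold h. rewrite rsum_box_prod. apply pow_incr. split.
      * apply rsum_pos. intros; apply pow_le; lra.
      * eapply Rle_trans; [apply two_sided_geom; auto |].
        replace (2 * (1 + y) / y) with (2 * ((1 + y) / y)) by (field; lra).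
        unfold Rdiv at 1. apply Rmult_le_compat_l; [lra |]. apply exp_inv_bound; auto.
Qed.

Definition good (nu : nat) (v : list Z) : bool := Nat.eqb (length v) nu && negb (Nat.eqb (n2 v) 0).

Definition W (nu : nat) (x : R) (v : list Z) : R := if good nu v then exp (- (x * vnorm v)) else 0.

Lemma good_spec nu v : good nu v = true <-> length v = nu /\ n2 v <> 0%nat.
Proof.
  unfold good. rewrite Bool.andb_true_iff, Nat.eqb_eq, Bool.negb_true_iff, Nat.eqb_neq. tauto.
Qed.

Lemma W_pos nu x v : 0 <= W nu x v.
Proof. unfold W. destruct (good nu v); [left; apply exp_pos | lra]. Qed.

Lemma good_norm nu v : good nu v = true -> 1 <= vnorm v.
Proof.
  intros H. apply good_spec in H. rewrite vnorm_n2, <- sqrt_1. apply sqrt_le_1_alt, (le_INR 1). lia.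
Qed.

Lemma W_onlen nu x v : W nu x v <= onlen nu 0 (fun v => exp (- (x * vnorm v))) v.
Proof.
  unfold W, onlen, good. pose proof (exp_pos (- (x * vnorm v))).
  destruct (Nat.eqb (length v) nu), (Nat.eqb (n2 v) 0); simpl; lra.
Qed.

(** For x <= 1 the product bound is already O(x^(-nu)). For x > 1 nonzero vectors have norm at least
    1, so exp(-(x - 1)) splits off and beats every power of x. One bound for both ranges can be used
    at every x = k Re s. *)
Lemma theta_star_bound nu : (1 <= nu)%nat -> exists M, 0 < M /\ forall x L, 0 < x -> NoDup L ->
  rsum (W nu x) L <= M * / x ^ nu.
Proof.
  intros Hnu. assert (HnR : 1 <= INR nu) by (apply (le_INR 1); lia).
  destruct (pow_le_exp nu) as [M0 [HM0 HP]].
  set (B := (2 * (INR nu + 1)) ^ nu). assert (HB : 0 < B) by (apply pow_lt; lra).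
  exists (B + B * exp 1 * M0). pose proof (exp_pos 1) as He.
  assert (HBM : 0 < B * exp 1 * M0) by (apply Rmult_lt_0_compat; auto; apply Rmult_lt_0_compat; auto).
  split; [lra |].
  intros x L Hx HL. assert (Hxn : 0 < / x ^ nu) by (apply Rinv_0_lt_compat, pow_lt; auto).
  destruct (Rle_lt_dec x 1) as [H1 | H1].
  - apply Rle_trans with (B * / x ^ nu); [| apply Rmult_le_compat_r; lra].
    eapply Rle_trans; [apply rsum_le; intros v _; apply W_onlen |].
    eapply Rle_trans; [apply all_vec_bound; auto |].
    unfold B. rewrite <- pow_inv, <- Rpow_mult_distr. apply pow_incr. split.
    + apply Rmult_le_pos; [apply Rmult_le_pos; [lra |] |].
      * assert (0 < x / INR nu) by (apply Rdiv_lt_0_compat; lra). lra.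
      * left; apply Rinv_0_lt_compat, Rdiv_lt_0_compat; lra.
    + replace (2 * (1 + x / INR nu) / (x / INR nu)) with (2 * (INR nu + x) * / x) by (field; lra).
      apply Rmult_le_compat_r; [left; apply Rinv_0_lt_compat; auto | lra].
  - apply Rle_trans with (B * exp 1 * M0 * / x ^ nu); [| apply Rmult_le_compat_r; lra].
    apply Rle_trans with (rsum (fun v => exp (- (x - 1)) * onlen nu 0 (fun v => exp (- (1 * vnorm v))) v) L).
    + apply rsum_le. intros v _. unfold W. destruct (good nu v) eqn:E.
      * rewrite onlen_eq by (apply good_spec in E; tauto). rewrite <- exp_plus. apply exp_le.
        pose proof (good_norm _ _ E). nra.
      * apply Rmult_le_pos; [left; apply exp_pos |]. unfold onlen. destruct (Nat.eqb (length v) nu); [left; apply exp_pos | lra].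
    + rewrite rsum_scal. apply Rle_trans with (exp (- (x - 1)) * B).
      * apply Rmult_le_compat_l; [left; apply exp_pos |].
        eapply Rle_trans; [apply all_vec_bound; auto; lra |]. unfold B. right. f_equal. field. lra.
      * replace (- (x - 1)) with (1 + - x) by ring. rewrite exp_plus.
        assert (Q : exp (- x) <= M0 * / x ^ nu).
        { apply Rmult_le_reg_r with (x ^ nu); [apply pow_lt; auto |].
          rewrite Rmult_assoc, Rinv_l by (apply pow_nonzero; lra).
          specialize (HP x ltac:(lra)). apply Rmult_le_compat_l with (r := exp (- x)) in HP; [| left; apply exp_pos].
          replace (exp (- x) * (M0 * exp x)) with (M0 * (exp (- x) * exp x)) in HP by ring.
          rewrite <- exp_plus, Rplus_opp_l, exp_0 in HP. lra. }
        replace (B * exp 1 * M0 * / x ^ nu) with (B * exp 1 * (M0 * / x ^ nu)) by ring.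
        replace (exp 1 * exp (- x) * B) with (B * exp 1 * exp (- x)) by ring.
        apply Rmult_le_compat_l; [left; apply Rmult_lt_0_compat; auto | auto].
Qed.

Lemma W_smb nu x : (1 <= nu)%nat -> 0 < x -> smb (W nu x).
Proof.
  intros Hnu Hx. destruct (theta_star_bound nu Hnu) as [M [HM H]].
  exists (M * / x ^ nu). split; [intros; apply W_pos | auto].
Qed.

Lemma smb_inv_pow nu : (2 <= nu)%nat -> smb (fun k => / INR (S k) ^ nu).
Proof.
  intros Hnu. apply (smb_le _ (fun k => Rpower (INR k + 1) (- (1 + 1)))); [| apply smb_power; lra].
  intros k. rewrite S_INR. pose proof (pos_INR k). split; [left; apply Rinv_0_lt_compat, pow_lt; lra |].
  replace (1 + 1) with (INR 2) by (simpl; ring). rewrite Rpower_Ropp, Rpower_pow by lra.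
  apply Rinv_le_contravar; [apply pow_lt; lra |]. apply Rle_pow; auto. lra.
Qed.

Lemma W_pairs_smb nu x : (2 <= nu)%nat -> 0 < x ->
  smb (fun kv : nat * list Z => W nu (x * INR (S (fst kv))) (snd kv)).
Proof.
  intros Hnu Hx. destruct (theta_star_bound nu) as [M [HM H]]; [lia |].
  apply (smb_rows _ (fun k => M * / (x * INR (S k)) ^ nu)).
  - intros; apply W_pos.
  - intros k L HL. cbn [fst snd]. apply (H (x * INR (S k)) L); auto.
    apply Rmult_lt_0_compat; auto. apply lt_0_INR; lia.
  - apply (smb_le _ (fun k => M * / x ^ nu * / INR (S k) ^ nu)).
    + intros k. assert (0 < INR (S k)) by (apply lt_0_INR; lia). rewrite Rpow_mult_distr, Rinv_mult. split; [| lra].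
      apply Rmult_le_pos; [lra |]. apply Rmult_le_pos; left; apply Rinv_0_lt_compat, pow_lt; auto.
    + apply smb_scal; [| apply smb_inv_pow; auto]. apply Rmult_le_pos; [lra |]. left; apply Rinv_0_lt_compat, pow_lt; auto.
Qed.

(** * Two expansions of log zeta *)

Definition vs (d : Z) (v : list Z) : list Z := map (Z.mul d) v.

Lemma n2_vs d v : n2 (vs d v) = (Z.to_nat (d * d) * n2 v)%nat.
Proof.
  apply Nat2Z.inj. rewrite Nat2Z.inj_mul, !n2_Z, Z2Nat.id by nia.
  induction v as [| a v IH]; [simpl; lia |]. unfold vs in *. cbn [map fold_right]. rewrite IH. ring.
Qed.

Lemma vnorm_vs d v : (0 <= d)%Z -> vnorm (vs d v) = IZR d * vnorm v.
Proof.
  intros Hd. assert (0 <= IZR d) by (apply (IZR_le 0); auto).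
  rewrite !vnorm_n2, n2_vs, mult_INR, INR_sqZ, sqrt_mult by (try apply pos_INR; nra).
  rewrite sqrt_square; auto.
Qed.

Lemma good_vs nu d v : (0 < d)%Z -> good nu (vs d v) = good nu v.
Proof.
  intros Hd. apply Bool.eq_iff_eq_true. rewrite !good_spec. unfold vs at 1. rewrite length_map, n2_vs.
  assert (Z.to_nat (d * d) <> 0)%nat by nia. split; intros [H1 H2]; split; auto; nia.
Qed.

Lemma zgcd_vs d v : (0 <= d)%Z -> zgcd (vs d v) = (d * zgcd v)%Z.
Proof.
  intros Hd. induction v as [| a v IH]; [simpl; lia |].
  unfold vs, zgcd in *. cbn [map fold_right]. rewrite IH. rewrite Z.gcd_mul_mono_l. f_equal. lia.
Qed.

Lemma zgcd_nonneg v : (0 <= zgcd v)%Z.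
Proof. destruct v; [simpl; lia | apply Z.gcd_nonneg]. Qed.

Lemma zgcd_divide v a : In a v -> (zgcd v | a)%Z.
Proof.
  induction v as [| b v IH]; [intros [] |]. unfold zgcd. cbn [fold_right].
  intros [-> | H]; [apply Z.gcd_divide_l |]. eapply Z.divide_trans; [apply Z.gcd_divide_r | apply IH; auto].
Qed.

Lemma zgcd_0 v : zgcd v = 0%Z -> n2 v = 0%nat.
Proof.
  intros H. assert (K : forall a, In a v -> a = 0%Z).
  { intros a Ha. apply zgcd_divide in Ha. rewrite H in Ha. apply Z.divide_0_l in Ha. auto. }
  clear H. induction v as [| a v IH]; auto. cbn [n2 fold_right]. fold (n2 v).
  rewrite IH by (intros b Hb; apply K; simpl; auto). rewrite (K a) by (simpl; auto). reflexivity.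
Qed.

Lemma good_gcd nu v : good nu v = true -> (0 < zgcd v)%Z.
Proof.
  intros H. apply good_spec in H. destruct H as [_ H]. pose proof (zgcd_nonneg v).
  destruct (Z.eq_dec (zgcd v) 0) as [E | E]; [apply zgcd_0 in E; contradiction | lia].
Qed.

Lemma vs_div d v : (d <> 0)%Z -> (forall a, In a v -> (d | a)%Z) -> vs d (map (fun a => (a / d)%Z) v) = v.
Proof.
  intros Hd H. unfold vs. rewrite map_map. rewrite <- (map_id v) at 2. apply map_ext_in.
  intros a Ha. symmetry. apply Z_div_exact_full_2; auto. apply Z.mod_divide; auto.
Qed.

Lemma vs_inj d v v' : (d <> 0)%Z -> vs d v = vs d v' -> v = v'.
Proof.
  intros Hd. revert v'. induction v as [| a v IH]; intros [| a' v'] E; try discriminate; auto.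
  unfold vs in *. cbn [map] in E. injection E as E1 E2. f_equal; [apply Z.mul_reg_l with d; auto | auto].
Qed.

(** The pair (k, v) stands for the multiple (k + 1) v; the shift makes every natural number an
    admissible index. *)
Definition mulv (kv : nat * list Z) : list Z := vs (Z.of_nat (S (fst kv))) (snd kv).

Lemma hs_image {A B : Type} (p : A -> B) (f : B -> C) (g : A -> R) l :
  (forall a a', p a = p a' -> a = a') -> (forall b, f b <> 0 -> exists a, p a = b) ->
  (forall a, Cmod (f (p a)) <= g a) -> smb g -> hs (fun a => f (p a)) l -> hs f l.
Proof.
  intros Hinj Hsurj Hg Hs Hl.
  apply (hs_fiber p (fun a => f (p a)) g Hg f) with (2 := Hs); auto.
  apply fibers_reindex; auto. intros b Hb. destruct (Hsurj b Hb) as [a Ha]. exists a. subst b. auto.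
Qed.

Section LogZeta.
Variables (nu : nat) (s : C).
Hypothesis Hnu : (2 <= nu)%nat.
Hypothesis Hs : 0 < Re s.

Let Es (v : list Z) : C := cexp (- (s * vnorm v)).

Lemma Es_mod x v : 0 <= x -> Cmod (cexp (- (RtoC x * s * vnorm v))) = exp (- (Re s * x * vnorm v)).
Proof.
  intros Hx. rewrite Cmod_cexp. f_equal. rewrite Re_opp, <- Cmult_assoc, Re_RM, Cmult_comm, Re_RM. ring.
Qed.

Lemma Es_pow v j : (Es v ^ j)%C = cexp (- (RtoC (INR j) * s * vnorm v)).
Proof.
  unfold Es. induction j as [| j IH].
  - simpl. rewrite Cmult_0_l, Cmult_0_l, Copp_0, cexp_0. reflexivity.
  - rewrite Cpow_S, IH, <- cexp_plus. f_equal. rewrite S_INR, RtoC_plus. ring.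
Qed.

Lemma Es_scale k v : cexp (- (s * vnorm (mulv (k, v)))) = cexp (- (RtoC (INR (S k)) * s * vnorm v)).
Proof.
  unfold mulv. cbn [fst snd]. rewrite vnorm_vs by lia. f_equal. rewrite <- INR_IZR_INZ, RtoC_mult. ring.
Qed.

(** log zeta is the sum of exp(-j s |p|)/j over primitive p and j >= 1. Each nonzero m equals j p
    exactly once, with j = gcd m, whence the coefficient 1/gcd m. The families [prim_term] and
    [moebius_term] are two refinements of this one along [mulv]. *)
Definition moment_term (v : list Z) : C :=
  if good nu v then (cexp (- (s * vnorm v)) * RtoC (/ IZR (zgcd v)))%C else 0.

Definition moebius_term (kv : nat * list Z) : C :=
  if good nu (snd kv) then (RtoC (cf (S (fst kv))) * cexp (- (RtoC (INR (S (fst kv))) * s * vnorm (snd kv))))%C else 0.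

Definition prim_term (kv : nat * list Z) : C :=
  if (good nu (snd kv) && Defs.primitive (snd kv))%bool then lterm (cexp (- (s * vnorm (snd kv)))) (fst kv) else 0.

Let g (kv : nat * list Z) : R := W nu (Re s * INR (S (fst kv))) (snd kv).

Lemma g_smb : smb g.
Proof. apply W_pairs_smb; auto. Qed.

Lemma moebius_le kv : Cmod (moebius_term kv) <= g kv.
Proof.
  unfold moebius_term, g, W. destruct (good nu (snd kv)); [| rewrite Cmod_0; lra].
  rewrite Cmod_mult, Es_mod, Cmod_R by apply pos_INR.
  pose proof (cf_le1 (S (fst kv)) ltac:(lia)). pose proof (exp_pos (- (Re s * INR (S (fst kv)) * vnorm (snd kv)))). nra.
Qed.

Lemma prim_le kv : Cmod (prim_term kv) <= g kv.
Proof.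
  unfold prim_term, g. destruct (good nu (snd kv)) eqn:E; [| simpl; rewrite Cmod_0; apply W_pos].
  destruct (Defs.primitive (snd kv)); [| simpl; rewrite Cmod_0; apply W_pos].
  simpl andb. cbv iota. eapply Rle_trans; [apply lterm_bound |]. rewrite <- Cmod_pow.
  change (cexp (- (s * vnorm (snd kv)))) with (Es (snd kv)). rewrite Es_pow, Es_mod by apply pos_INR.
  unfold W. rewrite E. lra.
Qed.

Lemma vs_div_in k v m : mulv (k, v) = m -> good nu v = true ->
  (0 < zgcd v)%Z /\ zgcd m = (Z.of_nat (S k) * zgcd v)%Z /\ v = map (fun a => (a / Z.of_nat (S k))%Z) m.
Proof.
  intros H Hg. split; [eapply good_gcd; eauto |]. subst m. split; [unfold mulv; apply zgcd_vs; cbn [fst]; lia |].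
  unfold mulv, vs. cbn [fst snd]. rewrite map_map. rewrite <- (map_id v) at 1. apply map_ext. intros a.
  rewrite Z.mul_comm, Z.div_mul; lia.
Qed.

(** The contributing pairs over m are (d - 1, m/d) with d dividing gcd m, and the exponential is
    constant on them; [cf_divisor_sum] adds up the coefficients. *)
Lemma moebius_fiber m : hs (onfib mulv m moebius_term) (moment_term m).
Proof.
  unfold moment_term. destruct (good nu m) eqn:Em.
  2:{ apply (hs_ext (fun _ => 0)); [| apply hs_zero]. intros [k v]. unfold onfib, moebius_term. cbn [fst snd].
    destruct (eqd (mulv (k, v)) m) as [E | E]; auto. destruct (good nu v) eqn:Ev; auto. exfalso.
    subst m. unfold mulv in Em. rewrite good_vs in Em by (cbn [fst]; lia). cbn [snd] in Em. congruence. }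
  set (G := Z.to_nat (zgcd m)). pose proof (good_gcd _ _ Em) as HG.
  assert (HG1 : (1 <= G)%nat) by (unfold G; lia).
  set (sec := fun d => (pred d, map (fun a => (a / Z.of_nat d)%Z) m)).
  assert (Hsec : forall d, In d (divs G) -> mulv (sec d) = m /\ (1 <= d)%nat).
  { intros d Hd. apply divs_in in Hd; auto. assert (1 <= d)%nat.
    { destruct d; [destruct Hd; lia | lia]. }
    split; auto. unfold sec, mulv. cbn [fst snd]. replace (S (pred d)) with d by lia. apply vs_div; [lia |].
    intros a Ha. apply Z.divide_trans with (zgcd m); [| apply zgcd_divide; auto].
    destruct Hd as [t Ht]. exists (Z.of_nat t). unfold G in Ht. lia. }
  replace (cexp (- (s * vnorm m)) * RtoC (/ IZR (zgcd m)))%C with (csum (onfib mulv m moebius_term) (map sec (divs G))).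
  - apply hs_finite.
    + apply NoDup_map_NoDup_ForallPairs; [| apply divs_nd].
      intros x y Hx Hy E. apply Hsec in Hx, Hy. unfold sec in E. injection E as E _. lia.
    + intros [k v] Hno. unfold onfib, moebius_term. cbn [fst snd].
      destruct (eqd (mulv (k, v)) m) as [E | E]; auto. destruct (good nu v) eqn:Ev; auto. exfalso.
      apply Hno. destruct (vs_div_in k v m E Ev) as [Hp [Hz Hv]]. apply in_map_iff. exists (S k). split.
      * unfold sec. rewrite Hv. reflexivity.
      * apply divs_in; auto. exists (Z.to_nat (zgcd v)). unfold G. rewrite Hz. lia.
  - rewrite csum_map. rewrite (csum_ext_in _ (fun d => cexp (- (s * vnorm m)) * RtoC (cf d))%C).
    + rewrite csum_scal. f_equal.
      assert (Q : forall L, csum (fun d => RtoC (cf d)) L = RtoC (rsum cf L)).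
      { induction L as [| d L IH]; [reflexivity |]. unfold csum, rsum in *. cbn [fold_right]. rewrite IH, RtoC_plus. reflexivity. }
      rewrite Q, cf_divisor_sum by auto. do 2 f_equal. unfold G. rewrite INR_IZR_INZ, Z2Nat.id by lia. reflexivity.
    + intros d Hd. destruct (Hsec d Hd) as [H1 H2]. unfold onfib. destruct (eqd (mulv (sec d)) m); [| contradiction].
      unfold moebius_term. assert (Eg : good nu (snd (sec d)) = true).
      { rewrite <- H1 in Em. unfold mulv in Em. rewrite good_vs in Em by lia. auto. }
      assert (Hk : S (fst (sec d)) = d) by (unfold sec; cbn [fst]; lia).
      rewrite Eg, <- H1. destruct (sec d) as [k v]. cbn [fst snd] in *. rewrite Es_scale, Hk. ring.
Qed.

(** Only d = gcd m leaves a primitive quotient m/d, so each fibre has at most one nonzero term. *)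
Lemma prim_fiber m : hs (onfib mulv m prim_term) (moment_term m).
Proof.
  revert m. assert (Hnz : forall k v, prim_term (k, v) <> 0 -> good nu v = true /\ zgcd v = 1%Z).
  { intros k v H. unfold prim_term in H. cbn [fst snd] in H. destruct (good nu v); [| contradiction].
    split; auto. destruct (Defs.primitive v) eqn:E; [apply Z.eqb_eq, E | contradiction]. }
  apply fibers_reindex.
  - intros [k v] [k' v'] H H' E. apply Hnz in H. apply Hnz in H'. destruct H as [H1 H2], H' as [H3 H4].
    destruct (vs_div_in k v _ eq_refl H1) as [_ [Z1 V1]]. destruct (vs_div_in k' v' _ eq_refl H3) as [_ [Z2 V2]].
    rewrite E in Z1. assert (k = k') by lia. subst k'. f_equal. apply vs_inj in E; auto. lia.
  - intros [k v] H. destruct (Hnz k v H) as [H1 H2]. unfold moment_term, prim_term. cbn [fst snd].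
    rewrite H1. unfold Defs.primitive. rewrite H2. simpl (_ && _)%bool. cbv iota.
    replace (good nu (mulv (k, v))) with true by (unfold mulv; rewrite good_vs by (cbn [fst]; lia); auto).
    rewrite Es_scale. unfold lterm. change (cexp (- (s * vnorm v))) with (Es v). rewrite Es_pow.
    unfold mulv. rewrite zgcd_vs by lia. cbn [fst snd]. rewrite H2, Z.mul_1_r, <- INR_IZR_INZ. ring.
  - intros m Hm. unfold moment_term in Hm. destruct (good nu m) eqn:Em; [| contradiction].
    pose proof (good_gcd _ _ Em) as HG. set (G := zgcd m) in *.
    set (v := map (fun a => (a / G)%Z) m).
    assert (Ev : mulv (pred (Z.to_nat G), v) = m).
    { unfold mulv. cbn [fst snd]. replace (Z.of_nat (S (pred (Z.to_nat G)))) with G by lia.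
      apply vs_div; [lia |]. intros a Ha. apply zgcd_divide; auto. }
    exists (pred (Z.to_nat G), v). split; auto.
    assert (Egv : good nu v = true).
    { rewrite <- Ev in Em. unfold mulv in Em. rewrite good_vs in Em by lia. auto. }
    destruct (vs_div_in _ _ _ Ev Egv) as [_ [Hz _]]. fold G in Hz.
    assert (Hv1 : zgcd v = 1%Z) by nia.
    unfold prim_term. cbn [fst snd]. rewrite Egv. unfold Defs.primitive. rewrite Hv1. simpl (_ && _)%bool. cbv iota.
    unfold lterm. change (cexp (- (s * vnorm v))) with (Es v). rewrite Es_pow.
    apply Cmult_neq_0; [| apply cexp_neq_0]. intros K. apply RtoC_inj in K. revert K.
    apply Rinv_neq_0_compat, not_0_INR. lia.
Qed.
End LogZeta.

Definition logsum (w : C) : C := epsilon (inhabits (RtoC 0)) (hs (lterm w)).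

Lemma logsum_spec w : Cmod w < 1 -> hs (lterm w) (logsum w).
Proof.
  intros Hw. unfold logsum. apply epsilon_spec.
  exact (hs_exists _ (fun j => Cmod w ^ S j) (lterm_bound w) (lterm_smb w Hw)).
Qed.

Lemma cexp_neg_cexp s r : cexp_neg s r = cexp (- (s * r)).
Proof.
  unfold cexp_neg, cexp. rewrite Re_opp, Im_opp, (Cmult_comm s), Re_RM, Im_RM.
  f_equal; f_equal; f_equal; ring.
Qed.

Lemma fold_prod_cexp {T : Type} (f L : T -> C) (l : list T) : (forall t, In t l -> f t = cexp (L t)) ->
  fold_right Cmult 1 (map f l) = cexp (csum L l).
Proof.
  induction l as [| t l IH]; intros H.
  - unfold csum. simpl. rewrite cexp_0. reflexivity.
  - cbn [map fold_right]. rewrite IH by (intros; apply H; simpl; auto). rewrite H by (simpl; auto).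
    rewrite <- cexp_plus. reflexivity.
Qed.

Lemma cexp_close (l : C) eps : 0 < eps -> exists d, 0 < d /\ forall z, Cmod (z - l) < d -> Cmod (cexp z - cexp l) < eps.
Proof.
  intros He. set (M := Cmod (cexp l) * exp 1 + 1).
  assert (HM : 0 < M). { pose proof (Cmod_ge_0 (cexp l)). pose proof (exp_pos 1). unfold M. nra. }
  exists (Rmin 1 (eps / M)). split; [apply Rmin_glb_lt; [lra | apply Rdiv_lt_0_compat; auto] |].
  intros z Hz. set (x := (z - l)%C) in *.
  assert (E : (cexp z - cexp l = cexp l * (cexp x - 1))%C).
  { replace z with (l + x)%C by (unfold x; ring). rewrite cexp_plus. ring. }
  rewrite E, Cmod_mult. pose proof (cexp_near_1 x) as H. pose proof (Cmod_ge_0 x) as Hx0.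
  assert (H1 : Cmod x <= 1) by (left; eapply Rlt_le_trans; [apply Hz | apply Rmin_l]).
  assert (H2 : Cmod x < eps / M) by (eapply Rlt_le_trans; [apply Hz | apply Rmin_r]).
  apply Rle_lt_trans with (Cmod x * M).
  - apply Rle_trans with (Cmod (cexp l) * (Cmod x * exp 1)).
    + apply Rmult_le_compat_l; [apply Cmod_ge_0 |]. eapply Rle_trans; [apply H |].
      apply Rmult_le_compat_l; auto. apply exp_le; auto.
    + unfold M. nra.
  - apply Rmult_lt_compat_r with (r := M) in H2; auto. replace (eps / M * M) with eps in H2 by (field; lra). auto.
Qed.

(** Regrouping the primitive pairs by vector turns each partial product over a box into the
    exponential of a finite sum of [gP]. The boxes exhaust its support, so these sums tend to l, and
    the limit of the products is unique. *)
Lemma zeta_exp nu s (Zs l : C) : (2 <= nu)%nat -> 0 < Re s ->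
  filterlim (partial_prod nu s) eventually (locally Zs) -> hs (moment_term nu s) l -> Zs = cexp l.
Proof.
  intros Hnu Hs HZ Hl.
  pose proof (prim_le nu s) as Hle. pose proof (g_smb nu s Hnu Hs) as Hg.
  destruct (hs_exists _ _ Hle Hg) as [lp Hlp].
  assert (lp = l).
  { eapply hs_unique; [| apply Hl]. apply (hs_fiber mulv _ _ Hle _ (prim_fiber nu s Hnu) _ Hg Hlp). }
  subst lp.
  set (Ev := fun v => cexp (- (s * vnorm v))).
  assert (HEv : forall v, good nu v = true -> Cmod (Ev v) < 1).
  { intros v Hv. unfold Ev. rewrite Cmod_cexp. rewrite <- exp_0. apply exp_increasing.
    rewrite Re_opp, Cmult_comm, Re_RM. apply good_norm in Hv. nra. }
  set (gP := fun v => if (good nu v && Defs.primitive v)%bool then logsum (Ev v) else 0).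
  assert (HgP : hs gP l).
  { apply (hs_fiber snd _ _ Hle gP) with (2 := Hg); auto. intros v.
    apply (hs_image (fun j : nat => (j, v)) _ (fun j => W nu (Re s * INR (S j)) v)).
    - intros a a' E. congruence.
    - intros [j v'] H. unfold onfib in H. cbn [snd] in H. destruct (eqd v' v) as [E | E]; [| contradiction].
      exists j. congruence.
    - intros j. unfold onfib. cbn [snd]. destruct (eqd v v); [apply (Hle (j, v)) | contradiction].
    - apply (smb_inj (fun j : nat => (j, v)) (fun kv => W nu (Re s * INR (S (fst kv))) (snd kv))); auto.
      intros a a' E. congruence.
    - unfold gP. apply (hs_ext (fun j => prim_term nu s (j, v))).
      { intros j. unfold onfib. cbn [snd]. destruct (eqd v v); [auto | contradiction]. }
      unfold prim_term. cbn [fst snd]. destruct (good nu v) eqn:E; [| apply hs_zero].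
      destruct (Defs.primitive v); [| apply hs_zero]. apply (logsum_spec (Ev v)). auto. }
  set (Ln := fun N => filter Defs.primitive (box nu N)).
  assert (Hgood : forall N v, In v (Ln N) -> good nu v = true /\ Defs.primitive v = true).
  { intros N v Hv. apply filter_In in Hv. destruct Hv as [H1 H2]. split; auto. apply box_in in H1.
    apply good_spec. split; [tauto |]. intros E.
    assert (K : zgcd v = 0%Z).
    { assert (Q : forall w, n2 w = 0%nat -> zgcd w = 0%Z).
      { induction w as [| a w IH]; auto. cbn [n2 fold_right]. fold (n2 w). intros E0. unfold zgcd. cbn [fold_right].
        fold (zgcd w). rewrite IH by lia. assert (a = 0%Z) by nia. subst. reflexivity. }
      auto. }
    unfold Defs.primitive in H2. rewrite K in H2. discriminate. }
  assert (Hpp : forall N, partial_prod nu s N = cexp (csum gP (Ln N))).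
  { intros N. apply fold_prod_cexp. intros v Hv. apply Hgood in Hv. destruct Hv as [H1 H2].
    unfold factor. rewrite cexp_neg_cexp. fold (Ev v). unfold gP. rewrite H1, H2. simpl andb. cbv iota.
    apply log_factor; auto. apply logsum_spec; auto. }
  apply Cmod_small_eq. intros eps He.
  destruct (cexp_close l (eps / 2) ltac:(lra)) as [d [Hd Hcl]].
  destruct (hs_lim gP l Ln HgP) with (eps := d) as [N1 HN1]; auto.
  { intros N. apply NoDup_filter, box_nd. }
  { intros v Hv. exists (n2 v). intros N HN. unfold gP in Hv.
    destruct (good nu v) eqn:E1; [| contradiction]. destruct (Defs.primitive v) eqn:E2; [| contradiction].
    apply filter_In. split; auto. apply good_spec in E1. apply box_in. split; [tauto |].
    intros a Ha. pose proof (n2_coord _ _ Ha). lia. }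
  assert (HL : locally Zs (fun z => Cmod (z - Zs) < eps / 2)).
  { exists (mkposreal (eps / 4) ltac:(lra)). intros z [B1 B2]. cbn [pos] in *.
    eapply Rle_lt_trans; [apply Cmod_ReIm |].
    unfold ball in B1, B2. simpl in B1, B2. unfold AbsRing_ball, minus, plus, opp, abs in B1, B2. simpl in B1, B2.
    rewrite Re_minus, Im_minus. unfold Rminus, Re, Im. lra. }
  destruct (HZ _ HL) as [N2 HN2].
  set (N := max N1 N2). specialize (HN1 N ltac:(lia)). specialize (HN2 N ltac:(lia)). cbv beta in HN2.
  apply Hcl in HN1. rewrite <- Hpp in HN1.
  replace (Zs - cexp l)%C with ((partial_prod nu s N - cexp l) - (partial_prod nu s N - Zs))%C by ring.
  eapply Rle_trans; [apply Cmod_triangle |]. rewrite Cmod_opp. lra.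
Qed.

(** The constant 1 is the contribution of the zero vector. *)
Lemma star_series nu z : (2 <= nu)%nat -> 0 < Re z -> exists Th,
  hs (fun n => INR (rr nu n) * cexp (- (z * sqrt (INR n))))%C Th /\
  hs (fun v => if good nu v then cexp (- (z * vnorm v)) else 0) (Th - 1)%C.
Proof.
  intros Hnu Hz.
  set (st := fun v => if good nu v then cexp (- (z * vnorm v)) else RtoC 0).
  assert (Hst : forall v, Cmod (st v) <= W nu (Re z) v).
  { intros v. unfold st, W. destruct (good nu v); [| rewrite Cmod_0; lra].
    rewrite Cmod_cexp, Re_opp, Cmult_comm, Re_RM. right. f_equal. ring. }
  destruct (hs_exists st _ Hst (W_smb nu (Re z) ltac:(lia) Hz)) as [S0 HS0].
  exists (S0 + 1)%C. split.
  2:{ replace (S0 + 1 - 1)%C with S0 by ring. auto. }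
  set (zv := repeat 0%Z nu).
  assert (Hzl : length zv = nu) by apply repeat_length.
  assert (Hz2 : n2 zv = 0%nat) by (unfold zv; clear; induction nu; simpl; auto).
  assert (Huniq : forall v, length v = nu -> n2 v = 0%nat -> v = zv).
  { unfold zv. clear. induction nu as [| nu IH]; intros [| a v] Hl Hn; try discriminate; auto.
    cbn [n2 fold_right] in Hn. fold (n2 v) in Hn. simpl. f_equal; [nia | apply IH; [simpl in Hl; lia | lia]]. }
  set (de := fun v => if eqd v zv then RtoC 1 else RtoC 0).
  assert (Hde : hs de 1).
  { replace (RtoC 1) with (de zv) by (unfold de; destruct (eqd zv zv); [auto | contradiction]).
    apply hs_single. intros v Hv. unfold de. destruct (eqd v zv); [contradiction | auto]. }
  apply (group_by_norm nu (fun n => cexp (- (z * sqrt (INR n))))).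
  - eapply smb_le; [| exists ((2 * (1 + Re z / INR nu) / (Re z / INR nu)) ^ nu); split].
    + instantiate (1 := onlen nu 0 (fun v => exp (- (Re z * vnorm v)))). intros v. unfold onlen.
      destruct (Nat.eqb (length v) nu); [| lra]. rewrite Cmod_cexp, Re_opp, Cmult_comm, Re_RM, vnorm_n2.
      split; [left; apply exp_pos | right; f_equal; ring].
    + intros v. unfold onlen. destruct (Nat.eqb (length v) nu); [left; apply exp_pos | lra].
    + intros L HL. apply all_vec_bound; auto. lia.
  - eapply hs_ext; [| apply hs_plus; [apply HS0 | apply Hde]]. intros v. cbv beta. unfold st, de, onlen, good.
    rewrite vnorm_n2. destruct (Nat.eqb_spec (length v) nu) as [E | E], (Nat.eqb_spec (n2 v) 0) as [E2 | E2]; simpl andb; cbv iota.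
    + destruct (eqd v zv) as [E3 | E3]; [| exfalso; auto]. rewrite E2. change (INR 0) with 0. rewrite sqrt_0, Cmult_0_r, Copp_0, cexp_0. ring.
    + destruct (eqd v zv) as [E3 | E3]; [exfalso; subst v; contradiction | ring].
    + destruct (eqd v zv) as [E3 | E3]; [exfalso; subst v; contradiction | ring].
    + destruct (eqd v zv) as [E3 | E3]; [exfalso; subst v; contradiction | ring].
Qed.

(** [moebius_term] is summed over v first: the inner sum at k is cf (k + 1) (Theta((k + 1) s) - 1),
    so [Th k] is Theta at (k + 1) s. *)
Lemma zeta_log_series nu : (2 <= nu)%nat -> exists M, 0 < M /\ forall s Zs : C, 0 < Re s ->
  filterlim (partial_prod nu s) eventually (locally Zs) ->
  exists (l : C) (Th : nat -> C), Zs = cexp l /\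
    (forall k, hs (fun n => INR (rr nu n) * cexp (- (RtoC (INR (S k)) * s * sqrt (INR n))))%C (Th k)) /\
    (forall k, Cmod (Th k - 1) <= M * / (Re s * INR (S k)) ^ nu) /\
    hs (fun k => RtoC (cf (S k)) * (Th k - 1))%C l.
Proof.
  intros Hnu. destruct (theta_star_bound nu) as [M [HM HB]]; [lia |]. exists M. split; auto.
  intros s Zs Hs HZ.
  assert (Hzk : forall k, 0 < Re (RtoC (INR (S k)) * s)).
  { intros k. rewrite Re_RM. apply Rmult_lt_0_compat; auto. apply lt_0_INR; lia. }
  pose (Th := fun k => epsilon (inhabits (RtoC 0)) (fun T =>
    hs (fun n => INR (rr nu n) * cexp (- (RtoC (INR (S k)) * s * sqrt (INR n))))%C T /\
    hs (fun v => if good nu v then cexp (- (RtoC (INR (S k)) * s * vnorm v)) else 0) (T - 1)%C)).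
  assert (HT : forall k, hs (fun n => INR (rr nu n) * cexp (- (RtoC (INR (S k)) * s * sqrt (INR n))))%C (Th k) /\
    hs (fun v => if good nu v then cexp (- (RtoC (INR (S k)) * s * vnorm v)) else 0) (Th k - 1)%C).
  { intros k. apply (epsilon_spec (inhabits (RtoC 0)) (fun T =>
      hs (fun n => INR (rr nu n) * cexp (- (RtoC (INR (S k)) * s * sqrt (INR n))))%C T /\
      hs (fun v => if good nu v then cexp (- (RtoC (INR (S k)) * s * vnorm v)) else 0) (T - 1)%C)).
    apply star_series; auto. }
  clearbody Th.
  pose proof (moebius_le nu s Hnu) as Hle. pose proof (g_smb nu s Hnu Hs) as Hg.
  destruct (hs_exists _ _ Hle Hg) as [l Hl].
  exists l, Th. split; [| split; [| split]].
  - apply (zeta_exp nu s); auto. apply (hs_fiber mulv _ _ Hle _ (moebius_fiber nu s Hnu) _ Hg Hl).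
  - apply HT.
  - intros k. apply (hs_bound _ (W nu (Re s * INR (S k))) _ _ (proj2 (HT k))).
    + intros v. unfold W. destruct (good nu v); [| rewrite Cmod_0; lra]. rewrite Es_mod by apply pos_INR. lra.
    + intros L HL. apply HB; auto. apply Rmult_lt_0_compat; auto. apply lt_0_INR; lia.
  - apply (hs_fiber fst _ _ Hle) with (2 := Hg) (3 := Hl). intros k.
    apply (hs_image (fun v : list Z => (k, v)) _ (fun v => W nu (Re s * INR (S k)) v)).
    + intros a a' E. congruence.
    + intros [j v'] H. unfold onfib in H. cbn [fst] in H. destruct (eqd j k) as [E | E]; [| contradiction].
      exists v'. congruence.
    + intros v. unfold onfib. cbn [fst]. destruct (eqd k k); [apply (Hle (k, v)) | contradiction].
    + apply W_smb; [lia |]. apply Rmult_lt_0_compat; auto. apply lt_0_INR; lia.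
    + eapply hs_ext; [| apply hs_scal, (proj2 (HT k))]. intros v. unfold onfib, moebius_term. cbn [fst snd].
      destruct (eqd k k); [| contradiction]. destruct (good nu v); ring.
Qed.

(** * Growth at a resonance *)

(** Equal to 2^(nu+1) r(n) z (z^2 + 4 pi^2 n)^(-(nu+1)/2) in a suitable branch when Re z > 0.
    Splitting it into roots of z and of zn z n, both in the right half plane, fixes the branch. *)
Definition theta_term (nu : nat) (z : C) (n : nat) : C :=
  (INR (rr nu n) * / (csqrt z ^ (nu - 1) * csqrt (zn z n) ^ (nu + 1)))%C.

Lemma csqrt_neq_0 z : 0 < Re z -> csqrt z <> 0.
Proof.
  intros Hz K. destruct (csqrt_spec z Hz) as [H _]. rewrite K, Cmult_0_l in H. rewrite <- H in Hz. simpl in Hz. lra.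
Qed.

Lemma Re_zn_pos z n : 0 < Re z -> 0 < Re (zn z n).
Proof.
  intros Hz. rewrite Re_zn. pose proof (Re_Cinv_pos z Hz). pose proof PI_RGT_0. pose proof (pos_INR n).
  assert (0 <= PI * PI * INR n * Re (/ z)) by (apply Rmult_le_pos; [apply Rmult_le_pos; nra | lra]). lra.
Qed.

Lemma theta_formula nu : (2 <= nu)%nat -> exists kap, 0 < kap /\ forall z Th, 0 < Re z ->
  hs (fun n => INR (rr nu n) * cexp (- (z * sqrt (INR n))))%C Th ->
  hs (fun n => RtoC kap * theta_term nu z n)%C Th.
Proof.
  intros Hnu. destruct gauss_constants as [G [HG0 HG]]. destruct (gauss_moment nu) as [Gk [HGk0 HGk]].
  exists (G ^ (nu - 1) * Gk). split; [apply Rmult_lt_0_compat; auto; apply pow_lt; auto |].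
  intros z Th Hz HTh. destruct (csqrt_spec z Hz) as [Hsq Hcone]. pose proof (csqrt_neq_0 z Hz) as Hnz.
  set (c := csqrt z) in *.
  assert (HTh' : hs (fun n => INR (rr nu n) * cexp (- (c * c * sqrt (INR n))))%C Th) by (rewrite Hsq; auto).
  destruct (theta_formula_aux nu G Gk HG HGk (rr_wt_smb nu Hnu) c Hcone Th HTh') as [Sg [H1 [_ H2]]].
  rewrite Hsq in H1.
  assert (HGC : RtoC G <> 0) by (intros K; apply RtoC_inj in K; lra).
  assert (E : Th = (RtoC (G ^ (nu - 1) * Gk) * / c ^ (nu - 1) * Sg)%C).
  { assert (Q : (G / c * Th = G / c * (RtoC (G ^ (nu - 1) * Gk) * / c ^ (nu - 1) * Sg))%C).
    { rewrite H2. replace nu with (S (nu - 1)) at 1 by lia. rewrite Cpow_S. unfold Cdiv at 2.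
      rewrite Cpow_mult_l, Cpow_inv, RtoC_mult, RtoC_pow by auto. ring. }
    assert (HGc : (G / c)%C <> 0).
    { apply Cmult_neq_0; auto. intros K. apply Hnz.
      replace c with (c * (c * / c))%C by (field; auto). rewrite K. ring. }
    replace Th with (/ (G / c) * (G / c * Th))%C by (field; auto). rewrite Q. field. repeat split; auto; apply Cpow_nz; auto. }
  rewrite E. eapply hs_ext; [| apply hs_scal, H1]. intros n. cbv beta. unfold theta_term. fold c.
  pose proof (csqrt_neq_0 _ (Re_zn_pos z n Hz)) as Hn.
  field. split; apply Cpow_nz; auto.
Qed.

Lemma Cmod_csqrt z : 0 < Re z -> Cmod (csqrt z) = sqrt (Cmod z).
Proof.
  intros Hz. destruct (csqrt_spec z Hz) as [H _]. rewrite <- H at 2. rewrite Cmod_mult.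
  symmetry. apply sqrt_square, Cmod_ge_0.
Qed.

Lemma csqrt_scal x z : 0 < x -> 0 < Re z -> csqrt (RtoC x * z) = (RtoC (sqrt x) * csqrt z)%C.
Proof.
  intros Hx Hz. pose proof (Cmod_ge_0 z). unfold csqrt. rewrite Cmod_RM, Re_RM, Im_RM by lra.
  assert (0 < sqrt x) by (apply sqrt_lt_R0; auto).
  replace ((x * Cmod z + x * Re z) / 2) with (x * ((Cmod z + Re z) / 2)) by field.
  rewrite sqrt_mult by lra. assert (0 < sqrt ((Cmod z + Re z) / 2)) by (apply sqrt_lt_R0; lra).
  apply C_eq; cri; unfold Re, Im; simpl; [ring |].
  rewrite <- (sqrt_sqrt x) at 1 by lra. field. split; apply Rgt_not_eq; auto.
Qed.

Lemma theta_term_mod nu z n x : (2 <= nu)%nat -> 0 < Re z -> 0 < x ->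
  x <= Cmod (z * z + RtoC (4 * (PI * PI) * INR n)) ->
  Cmod (theta_term nu z n) <= INR (rr nu n) * (2 ^ (nu + 1) * Cmod z * / sqrt x ^ (nu + 1)).
Proof.
  intros Hnu Hz Hx HQ. pose proof (csqrt_neq_0 z Hz) as H1. pose proof (csqrt_neq_0 _ (Re_zn_pos z n Hz)) as H2.
  assert (Hznz : z <> 0) by (intros K; subst; simpl in Hz; lra).
  assert (HM : 0 < Cmod z) by (apply Cmod_gt_0; auto).
  assert (HzR : RtoC 4 <> 0) by (intros K; apply RtoC_inj in K; lra).
  unfold theta_term. rewrite Cmod_RM by apply pos_INR. apply Rmult_le_compat_l; [apply pos_INR |].
  rewrite Cmod_inv by (apply Cmult_neq_0; apply Cpow_nz; auto).
  rewrite Cmod_mult, !Cmod_pow, !Cmod_csqrt by (auto; apply Re_zn_pos; auto).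
  set (r := sqrt (Cmod z)). assert (Hr : 0 < r) by (apply sqrt_lt_R0; auto).
  assert (Hrr : r * r = Cmod z) by (apply sqrt_sqrt; lra).
  assert (E : sqrt x / (2 * r) <= sqrt (Cmod (zn z n))).
  { assert (E1 : zn z n = ((z * z + RtoC (4 * (PI * PI) * INR n)) / (4 * z))%C).
    { unfold zn. rewrite !RtoC_mult. field. auto. }
    rewrite E1. unfold Cdiv. rewrite Cmod_mult, Cmod_inv, Cmod_mult, Cmod_R, Rabs_pos_eq by (try lra; apply Cmult_neq_0; auto).
    replace (sqrt x / (2 * r)) with (sqrt (x * / (4 * Cmod z))).
    - apply sqrt_le_1_alt. apply Rmult_le_compat_r; auto. left. apply Rinv_0_lt_compat. lra.
    - rewrite sqrt_mult by (try lra; left; apply Rinv_0_lt_compat; lra).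
      unfold Rdiv. f_equal. rewrite <- Hrr. replace (4 * (r * r)) with ((2 * r) * (2 * r)) by ring.
      rewrite sqrt_inv, sqrt_square; lra. }
  assert (Hsx : 0 < sqrt x) by (apply sqrt_lt_R0; auto).
  assert (E2 : (sqrt x / (2 * r)) ^ (nu + 1) <= sqrt (Cmod (zn z n)) ^ (nu + 1)).
  { apply pow_incr. split; auto. left. apply Rdiv_lt_0_compat; lra. }
  apply Rle_trans with (/ (r ^ (nu - 1) * (sqrt x / (2 * r)) ^ (nu + 1))).
  - apply Rinv_le_contravar.
    + apply Rmult_lt_0_compat; [apply pow_lt; auto |]. apply pow_lt, Rdiv_lt_0_compat; lra.
    + apply Rmult_le_compat_l; auto. apply pow_le; lra.
  - right. unfold Rdiv. rewrite Rpow_mult_distr, pow_inv, Rpow_mult_distr.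
    rewrite <- Hrr. replace (nu + 1)%nat with (S (S (nu - 1))) by lia.
    assert (0 < r ^ (nu - 1)) by (apply pow_lt; auto). assert (0 < 2 ^ (nu - 1)) by (apply pow_lt; lra).
    assert (0 < sqrt x ^ (nu - 1)) by (apply pow_lt; auto). simpl pow. field. repeat split; lra.
Qed.

Definition adiff (n m : nat) : nat := (n - m + (m - n))%nat.

(** On each side of m the distance to m is injective in n, so the bound for the unshifted series
    serves twice, uniformly in m. *)
Lemma shift_sum d : 0 < d -> exists B, 0 < B /\ forall m L, NoDup L ->
  rsum (fun n => Rpower (INR (adiff n m) + 1) (- (1 + d))) L <= B.
Proof.
  intros Hd. destruct (smb_power d Hd) as [B [Hp HB]]. set (f := fun n => Rpower (INR n + 1) (- (1 + d))) in *.
  assert (HB0 : 0 <= B) by (specialize (HB nil (NoDup_nil _)); exact HB).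
  exists (B + B + 1). split; [lra |]. intros m L HL.
  assert (K : rsum (fun n => f (adiff n m)) L =
    rsum (fun n => f (adiff n m)) (filter (fun n => Nat.leb n m) L) +
    rsum (fun n => f (adiff n m)) (filter (fun n => negb (Nat.leb n m)) L)).
  { clear HL. induction L as [| n L IH]; [unfold rsum; simpl; ring |]. unfold rsum in *. cbn [filter fold_right]. rewrite IH.
    destruct (Nat.leb n m); cbn [negb fold_right]; ring. }
  fold f. change (rsum (fun n => f (adiff n m)) L <= B + B + 1). rewrite K. clear K.
  assert (Q : forall p, (forall x y, p x = true -> p y = true -> adiff x m = adiff y m -> x = y) ->
    rsum (fun n => f (adiff n m)) (filter p L) <= B).
  { intros p Hinj. rewrite <- (rsum_map (fun n => adiff n m) f). apply HB.
    apply NoDup_map_NoDup_ForallPairs; [| apply NoDup_filter; auto].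
    intros x y Hx Hy. apply filter_In in Hx, Hy. apply Hinj; tauto. }
  pose proof (Q (fun n => Nat.leb n m)) as Q1. pose proof (Q (fun n => negb (Nat.leb n m))) as Q2.
  assert (rsum (fun n => f (adiff n m)) (filter (fun n => Nat.leb n m) L) <= B).
  { apply Q1. intros x y Hx Hy. apply Nat.leb_le in Hx, Hy. unfold adiff. lia. }
  assert (rsum (fun n => f (adiff n m)) (filter (fun n => negb (Nat.leb n m)) L) <= B).
  { apply Q2. intros x y Hx Hy. apply Bool.negb_true_iff in Hx, Hy. apply Nat.leb_gt in Hx, Hy. unfold adiff. lia. }
  lra.
Qed.

Lemma inv_sqrt_pow x m : 0 < x -> / sqrt x ^ m = Rpower x (- (INR m / 2)).
Proof.
  intros Hx. rewrite Rpower_Ropp. f_equal. rewrite <- Rpower_sqrt by auto.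
  rewrite <- Rpower_pow by apply exp_pos. rewrite Rpower_mult. f_equal. field.
Qed.

Lemma Rpower_neg_le x y e : 0 < x <= y -> 0 <= e -> Rpower y (- e) <= Rpower x (- e).
Proof.
  intros H He. rewrite !Rpower_Ropp. apply Rinv_le_contravar; [apply exp_pos |]. apply Rle_Rpower_l; auto.
Qed.

(* X stands for n - k^2 q^2 with q^2 = n0 / b^2, and w for b^2. *)
Lemma gap_geometry (n k n0 b : nat) : (1 <= k)%nat -> (1 <= n0)%nat -> (1 <= b)%nat -> (b * b * n <> k * k * n0)%nat ->
  let X := INR n - INR k * INR k * INR n0 / (INR b * INR b) in
  / (INR b * INR b) <= Rabs X /\
  INR n + 1 <= (1 + INR n0 + INR b * INR b) * (INR k * INR k) * Rabs X /\
  (INR (adiff n (k * k * n0 / (b * b))) + 1) / (1 + 2 * (INR b * INR b)) <= Rabs X.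
Proof.
  intros Hk Hn0 Hb Hne X.
  assert (HkR : 1 <= INR k) by (apply (le_INR 1); auto). assert (Hn0R : 1 <= INR n0) by (apply (le_INR 1); auto).
  assert (HbR : 1 <= INR b) by (apply (le_INR 1); auto).
  set (w := INR b * INR b). assert (Hw : 1 <= w) by (unfold w; nra).
  (* D is the modulus of the integer b^2 n - k^2 n0, nonzero off resonance, so |X| = D/w >= 1/w. The
     other two bounds absorb their additive constants through w |X| >= 1. *)
  set (D := adiff (b * b * n) (k * k * n0)).
  assert (HD : (1 <= D)%nat) by (unfold D, adiff; lia).
  assert (HX : Rabs X = INR D / w).
  { assert (E : X = (INR (b * b * n) - INR (k * k * n0)) / w).
    { unfold X. rewrite !mult_INR. fold w. field. lra. }
    rewrite E. unfold Rdiv. rewrite Rabs_mult, (Rabs_pos_eq (/ w)) by (left; apply Rinv_0_lt_compat; lra). f_equal.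
    unfold D, adiff. rewrite plus_INR.
    destruct (Nat.le_gt_cases (b * b * n) (k * k * n0)) as [L | L].
    - replace (b * b * n - k * k * n0)%nat with 0%nat by lia. rewrite minus_INR by auto.
      rewrite Rabs_left1; [simpl (INR 0); ring |]. apply le_INR in L. lra.
    - replace (k * k * n0 - b * b * n)%nat with 0%nat by lia. rewrite minus_INR by lia.
      rewrite Rabs_pos_eq; [simpl (INR 0); ring |]. apply lt_INR in L. lra. }
  assert (HDR : 1 <= INR D) by (apply (le_INR 1); auto).
  assert (H1 : / w <= Rabs X).
  { rewrite HX. unfold Rdiv. rewrite <- (Rmult_1_l (/ w)) at 1. apply Rmult_le_compat_r; auto. left; apply Rinv_0_lt_compat; lra. }
  assert (H1' : 1 <= w * Rabs X).
  { apply Rmult_le_compat_l with (r := w) in H1; [| lra]. rewrite Rinv_r in H1 by lra. auto. }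
  assert (HX0 : 0 < Rabs X) by nra.
  split; auto. split.
  - assert (A1 : INR n <= Rabs X + INR k * INR k * INR n0 / w).
    { pose proof (Rle_abs X) as Q. unfold X at 1 in Q. fold w in Q. lra. }
    assert (A2 : INR k * INR k * INR n0 / w <= INR k * INR k * INR n0 * Rabs X).
    { unfold Rdiv. apply Rmult_le_compat_l; auto. apply Rmult_le_pos; [nra | lra]. }
    assert (A3 : 1 <= INR k * INR k) by nra.
    assert (A4 : Rabs X <= INR k * INR k * Rabs X) by nra.
    assert (A5 : w * Rabs X <= INR k * INR k * (w * Rabs X)) by nra.
    replace ((1 + INR n0 + w) * (INR k * INR k) * Rabs X) with
      (INR k * INR k * Rabs X + INR k * INR k * INR n0 * Rabs X + INR k * INR k * (w * Rabs X)) by ring. lra.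
  - set (m := (k * k * n0 / (b * b))%nat).
    assert (Hbb : (b * b <> 0)%nat) by nia.
    pose proof (Nat.Div0.mul_div_le (k * k * n0) (b * b)) as M1.
    pose proof (Nat.mul_succ_div_gt (k * k * n0) (b * b) Hbb) as M2. fold m in M1, M2.
    assert (HA : (b * b * adiff n m <= D + b * b)%nat).
    { unfold D. clearbody m. clear - M1 M2. generalize dependent (b * b)%nat. intros c. generalize (k * k * n0)%nat.
      intros y M1 M2. unfold adiff. rewrite Nat.mul_add_distr_l, !Nat.mul_sub_distr_l. lia. }
    apply le_INR in HA. rewrite mult_INR, plus_INR, mult_INR in HA. fold w in HA.
    assert (E : INR D = w * Rabs X) by (rewrite HX; field; lra). rewrite E in HA.
    assert (HA' : INR (adiff n m) <= Rabs X + 1) by nra.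
    apply Rmult_le_reg_r with (1 + 2 * w); [lra |]. unfold Rdiv. rewrite Rmult_assoc, Rinv_l by lra. nra.
Qed.

(** * Non-resonant terms *)

Section Asymptotics.
Variables (n0 b : nat).
Hypothesis Hn0 : (1 <= n0)%nat.
Hypothesis Hb : (1 <= b)%nat.

Definition tau_of : R := 2 * PI * (sqrt (INR n0) / INR b).
Let w := INR b * INR b.

Lemma tau_pos : 0 < tau_of.
Proof.
  unfold tau_of. pose proof PI_RGT_0. apply Rmult_lt_0_compat; [lra |]. apply Rdiv_lt_0_compat.
  - apply sqrt_lt_R0, lt_0_INR. lia.
  - apply lt_0_INR. lia.
Qed.

Lemma tau_sq : tau_of * tau_of = 4 * (PI * PI) * (INR n0 / w).
Proof.
  unfold tau_of, w. assert (INR b <> 0) by (apply not_0_INR; lia).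
  replace (2 * PI * (sqrt (INR n0) / INR b) * (2 * PI * (sqrt (INR n0) / INR b))) with
    (4 * (PI * PI) * ((sqrt (INR n0) * sqrt (INR n0)) / (INR b * INR b))) by (field; auto).
  rewrite sqrt_sqrt by apply pos_INR. reflexivity.
Qed.

(** The point k s with s = h^2 + i tau. Taking h as the square root of the real part turns
    sigma^(-(nu+1)/2) into an integral power of h. *)
Definition zk (k : nat) (h : R) : C := (RtoC (INR k) * ((h * h)%R, tau_of))%C.

Lemma Re_zk k h : Re (zk k h) = INR k * (h * h).
Proof. unfold zk. rewrite Re_RM. reflexivity. Qed.

Lemma Re_zk_pos k h : (1 <= k)%nat -> 0 < h -> 0 < Re (zk k h).
Proof. intros Hk Hh. rewrite Re_zk. assert (0 < INR k) by (apply lt_0_INR; lia). apply Rmult_lt_0_compat; nra. Qed.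

Lemma quad_lower k n h : (1 <= k)%nat -> 0 < h -> INR k * INR k * ((h * h) * (h * h)) <= 2 * (PI * PI) / w ->
  (b * b * n <> k * k * n0)%nat ->
  Rabs (INR n - INR k * INR k * INR n0 / w) <= Cmod (zk k h * zk k h + RtoC (4 * (PI * PI) * INR n)).
Proof.
  intros Hk Hh Hs Hne. destruct (gap_geometry n k n0 b Hk Hn0 Hb Hne) as [G1 _]. fold w in G1.
  set (X := INR n - INR k * INR k * INR n0 / w) in *.
  assert (Hw : 0 < w). { unfold w. assert (0 < INR b) by (apply lt_0_INR; lia). nra. }
  pose proof PI2_1 as HP. assert (HPP : 4 < PI * PI) by nra.
  eapply Rle_trans; [| apply re_le_Cmod].
  assert (E : Re (zk k h * zk k h + RtoC (4 * (PI * PI) * INR n)) = 4 * (PI * PI) * X + INR k * INR k * ((h * h) * (h * h))).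
  { unfold zk. cri. unfold Re, Im. simpl. ring_simplify.
    replace (tau_of ^ 2) with (4 * (PI * PI) * (INR n0 / w)) by (rewrite <- tau_sq; ring). unfold X. field. lra. }
  rewrite E. set (P := PI * PI) in *. set (y := INR k * INR k * ((h * h) * (h * h))) in *.
  assert (Hy : 0 <= y) by (unfold y; apply Rmult_le_pos; nra).
  assert (Hy2 : y <= 2 * P * Rabs X).
  { eapply Rle_trans; [apply Hs |]. unfold Rdiv. apply Rmult_le_compat_l; [lra | auto]. }
  destruct (Rle_lt_dec 0 X) as [HX | HX].
  - rewrite (Rabs_pos_eq X) in * by auto. rewrite Rabs_pos_eq by nra. nra.
  - rewrite (Rabs_left X) in * by auto. rewrite Rabs_left1 by nra. nra.
Qed.

Variable nu : nat.
Hypothesis Hnu : (2 <= nu)%nat.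
Let mu := (INR nu - 2) / 2 + / 3.

(** As n + 1 = O(k^2 |X|), the bound r(n) = O((n+1)^mu) gives k^(2 mu) |X|^mu; the factor |z| is
    O(k), and the denominator is |X|^((nu+1)/2). The exponents add up to 2 mu + 1 = nu - 1/3 for k
    and to -7/6 for |X|, which is at least a constant times one plus the distance of n from its
    nearly resonant position. *)
Lemma off_pointwise : exists Cc, 0 < Cc /\ forall k n h, (1 <= k)%nat -> 0 < h <= 1 ->
  INR k * INR k * ((h * h) * (h * h)) <= 2 * (PI * PI) / w -> (b * b * n <> k * k * n0)%nat ->
  Cmod (theta_term nu (zk k h) n) <= Cc * Rpower (INR k) (INR nu - / 3) *
    Rpower (INR (adiff n (k * k * n0 / (b * b))) + 1) (- (1 + / 6)).
Proof.
  assert (Hmu : 0 <= mu). { unfold mu. pose proof (le_INR 2 nu Hnu) as Q. simpl in Q. lra. }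
  assert (HM : exists M, 0 < M /\ forall n, INR (rr nu n) <= M * Rpower (INR n + 1) mu).
  { destruct nu as [| [| p]]; try lia. destruct (rr_bound p) as [M [HM H]]. exists M. split; auto.
    intros n. eapply Rle_trans; [apply H |]. right. f_equal. f_equal. unfold mu. rewrite !S_INR. field. }
  destruct HM as [M [HM Hrr]].
  set (C2 := 1 + INR n0 + w). set (D := 1 + 2 * w).
  assert (Hw : 0 < w). { unfold w. assert (0 < INR b) by (apply lt_0_INR; lia). nra. }
  assert (HC2 : 0 < C2). { unfold C2. pose proof (pos_INR n0). lra. }
  assert (HD : 0 < D) by (unfold D; lra). pose proof tau_pos as Ht.
  exists (M * Rpower C2 mu * (2 ^ (nu + 1) * (1 + tau_of)) * Rpower D (1 + / 6)).
  assert (H2n : 0 < 2 ^ (nu + 1)) by (apply pow_lt; lra).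
  split.
  { apply Rmult_lt_0_compat; [| apply exp_pos]. apply Rmult_lt_0_compat; [apply Rmult_lt_0_compat; [auto | apply exp_pos] |].
    apply Rmult_lt_0_compat; lra. }
  intros k n h Hk Hh Hs Hne. destruct (gap_geometry n k n0 b Hk Hn0 Hb Hne) as [G1 [G2 G3]].
  pose proof (quad_lower k n h Hk ltac:(lra) Hs Hne) as HQ. fold w in G1, G2, G3. fold C2 in G2. fold D in G3.
  set (X := Rabs (INR n - INR k * INR k * INR n0 / w)) in *.
  assert (HX : 0 < X) by (eapply Rlt_le_trans; [apply Rinv_0_lt_compat, Hw | auto]).
  assert (HkR : 1 <= INR k) by (apply (le_INR 1); auto).
  eapply Rle_trans; [apply (theta_term_mod nu (zk k h) n X); auto; apply Re_zk_pos; auto; lra |].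
  set (A := INR (adiff n (k * k * n0 / (b * b))) + 1) in *.
  assert (HA : 0 < A). { unfold A. pose proof (pos_INR (adiff n (k * k * n0 / (b * b)))). lra. }
  pose proof (pos_INR n) as Hn.
  assert (B1 : INR (rr nu n) <= M * (Rpower C2 mu * Rpower (INR k) (mu + mu) * Rpower X mu)).
  { eapply Rle_trans; [apply Hrr |]. apply Rmult_le_compat_l; [lra |].
    rewrite Rpower_plus, !Rpower_mult_distr by (try lra; apply Rmult_lt_0_compat; nra).
    apply Rle_Rpower_l; auto. split; lra. }
  assert (B2 : Cmod (zk k h) <= Rpower (INR k) 1 * (1 + tau_of)).
  { rewrite Rpower_1 by lra. unfold zk. rewrite Cmod_RM by lra. apply Rmult_le_compat_l; [lra |].
    eapply Rle_trans; [apply Cmod_ReIm |]. unfold Re, Im. simpl. rewrite !Rabs_pos_eq by nra. nra. }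
  assert (B3 : / sqrt X ^ (nu + 1) = Rpower X (- ((INR nu + 1) / 2))).
  { rewrite inv_sqrt_pow, plus_INR by auto. reflexivity. }
  assert (B4 : Rpower X mu * Rpower X (- ((INR nu + 1) / 2)) <= Rpower D (1 + / 6) * Rpower A (- (1 + / 6))).
  { rewrite <- Rpower_plus. replace (mu + - ((INR nu + 1) / 2)) with (- (1 + / 6)) by (unfold mu; field).
    eapply Rle_trans; [apply (Rpower_neg_le (A / D) X); [split; [apply Rdiv_lt_0_compat; auto | auto] | lra] |].
    right. unfold Rdiv. rewrite <- Rpower_mult_distr by (auto; apply Rinv_0_lt_compat; auto).
    rewrite Rmult_comm. f_equal. rewrite Rpower_Ropp. unfold Rpower. rewrite ln_Rinv by auto.
    rewrite <- exp_Ropp. f_equal. ring. }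
  rewrite B3.
  apply Rle_trans with (M * (Rpower C2 mu * Rpower (INR k) (mu + mu) * Rpower X mu) *
    (2 ^ (nu + 1) * (Rpower (INR k) 1 * (1 + tau_of)) * Rpower X (- ((INR nu + 1) / 2)))).
  - apply Rmult_le_compat; [apply pos_INR | | auto |].
    + apply Rmult_le_pos; [apply Rmult_le_pos; [lra | apply Cmod_ge_0] | left; apply exp_pos].
    + apply Rmult_le_compat_r; [left; apply exp_pos |]. apply Rmult_le_compat_l; [lra | auto].
  - replace (INR nu - / 3) with ((mu + mu) + 1) by (unfold mu; field). rewrite (Rpower_plus (mu + mu) 1).
    replace (M * (Rpower C2 mu * Rpower (INR k) (mu + mu) * Rpower X mu) *
      (2 ^ (nu + 1) * (Rpower (INR k) 1 * (1 + tau_of)) * Rpower X (- ((INR nu + 1) / 2)))) with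
      ((M * Rpower C2 mu * (2 ^ (nu + 1) * (1 + tau_of)) * (Rpower (INR k) (mu + mu) * Rpower (INR k) 1)) *
       (Rpower X mu * Rpower X (- ((INR nu + 1) / 2)))) by ring.
    replace (M * Rpower C2 mu * (2 ^ (nu + 1) * (1 + tau_of)) * Rpower D (1 + / 6) * (Rpower (INR k) (mu + mu) * Rpower (INR k) 1) * Rpower A (- (1 + / 6)))
      with ((M * Rpower C2 mu * (2 ^ (nu + 1) * (1 + tau_of)) * (Rpower (INR k) (mu + mu) * Rpower (INR k) 1)) *
       (Rpower D (1 + / 6) * Rpower A (- (1 + / 6)))) by ring.
    apply Rmult_le_compat_l; auto.
    apply Rmult_le_pos; [apply Rmult_le_pos; [apply Rmult_le_pos; [lra | left; apply exp_pos] |] |].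
    + apply Rmult_le_pos; lra.
    + apply Rmult_le_pos; left; apply exp_pos.
Qed.

Lemma off_sum : exists Cc, 0 < Cc /\ forall k h L, (1 <= k)%nat -> 0 < h <= 1 ->
  INR k * INR k * ((h * h) * (h * h)) <= 2 * (PI * PI) / w -> NoDup L ->
  rsum (fun n => if Nat.eqb (b * b * n) (k * k * n0) then 0 else Cmod (theta_term nu (zk k h) n)) L
    <= Cc * Rpower (INR k) (INR nu - / 3).
Proof.
  destruct off_pointwise as [C1 [HC1 H1]]. destruct (shift_sum (/ 6) ltac:(lra)) as [B [HB HS]].
  exists (C1 * B). split; [apply Rmult_lt_0_compat; auto |]. intros k h L Hk Hh Hs HL.
  apply Rle_trans with (rsum (fun n => C1 * Rpower (INR k) (INR nu - / 3) *
    Rpower (INR (adiff n (k * k * n0 / (b * b))) + 1) (- (1 + / 6))) L).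
  - apply rsum_le. intros n _. destruct (Nat.eqb_spec (b * b * n) (k * k * n0)) as [E | E]; [| apply H1; auto].
    apply Rmult_le_pos; [apply Rmult_le_pos; [lra |] |]; left; apply exp_pos.
  - rewrite rsum_scal. replace (C1 * B * Rpower (INR k) (INR nu - / 3)) with (C1 * Rpower (INR k) (INR nu - / 3) * B) by ring.
    apply Rmult_le_compat_l; [apply Rmult_le_pos; [lra | left; apply exp_pos] | apply HS; auto].
Qed.
End Asymptotics.

(* (s^2 + tau^2) / (4 s h^2) for s = h^2 + i tau, which tends to 1/2. *)
Definition ratio_pt (tau h : R) : C :=
  (((h * h) * (h * h) + 2 * (tau * tau)) / (4 * ((h * h) * (h * h) + tau * tau)),
   (h * h) * tau / (4 * ((h * h) * (h * h) + tau * tau))).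

(* Up to a real factor, the inverse of the theta term at a resonance. *)
Definition Uden (nu : nat) (tau h : R) : C :=
  (csqrt ((h * h)%R, tau) ^ (nu - 1) * csqrt (ratio_pt tau h) ^ (nu + 1))%C.

Lemma ratio_pt_spec tau h : 0 < tau -> (4 * ((h * h)%R, tau) * ratio_pt tau h)%C = ((h * h)%R, (2 * tau)%R).
Proof.
  intros Ht. assert (0 < h * h * (h * h) + tau * tau).
  { pose proof (Rle_0_sqr (h * h)). unfold Rsqr in *. nra. }
  apply C_eq; cri; unfold ratio_pt, Re, Im; simpl; field; lra.
Qed.

Lemma Re_ratio_pt tau h : 0 < tau -> 0 < Re (ratio_pt tau h).
Proof.
  intros Ht. pose proof (Rle_0_sqr (h * h)). unfold Rsqr in *. unfold ratio_pt, Re. simpl. apply Rdiv_lt_0_compat; nra.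
Qed.

(** At a resonance 4 pi^2 n = k^2 tau^2, so zn (k s) n = k (s^2 + tau^2)/(4 s), which is k h^2 times
    [ratio_pt]: the dependence on k and the singular power of h come out as real factors. *)
Lemma res_term nu n0 b k n h : (2 <= nu)%nat -> (1 <= n0)%nat -> (1 <= b)%nat -> (1 <= k)%nat -> 0 < h ->
  (b * b * n = k * k * n0)%nat ->
  theta_term nu (zk n0 b k h) n =
    (RtoC (INR (rr nu n) * / INR k ^ nu * / h ^ (nu + 1)) * / Uden nu (tau_of n0 b) h)%C.
Proof.
  intros Hnu Hn0 Hb Hk Hh E. set (tau := tau_of n0 b). pose proof (tau_pos n0 b Hn0 Hb) as Ht. fold tau in Ht.
  assert (HkR : 0 < INR k) by (apply lt_0_INR; lia). assert (HbR : 0 < INR b) by (apply lt_0_INR; lia).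
  set (s := ((h * h)%R, tau) : C). assert (Hs : 0 < Re s) by (unfold s, Re; simpl; nra).
  assert (Hsnz : s <> 0) by (intros K; rewrite K in Hs; simpl in Hs; lra).
  assert (HkC : RtoC (INR k) <> 0) by (intros K; apply RtoC_inj in K; lra).
  assert (H4C : RtoC 4 <> 0) by (intros K; apply RtoC_inj in K; lra).
  assert (Hr := Re_ratio_pt tau h Ht).
  assert (Ez : zn (zk n0 b k h) n = (RtoC (INR k * (h * h)) * ratio_pt tau h)%C).
  { assert (En : PI * PI * INR n = INR k * INR k * (tau * tau) / 4).
    { unfold tau. rewrite tau_sq by auto. apply (f_equal INR) in E. rewrite !mult_INR in E.
      apply Rmult_eq_reg_l with (INR b * INR b); [| nra].
      replace (INR b * INR b * (PI * PI * INR n)) with (PI * PI * (INR b * INR b * INR n)) by ring.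
      rewrite E. field. lra. }
    unfold zn. rewrite En. change (zk n0 b k h) with (RtoC (INR k) * s)%C.
    assert (Q : ((RtoC (INR k) * s) * (4 * s * (RtoC (INR k) * s / 4 + RtoC (INR k * INR k * (tau * tau) / 4) * / (RtoC (INR k) * s))) =
      (RtoC (INR k) * s) * (4 * s * (RtoC (INR k * (h * h)) * ratio_pt tau h)))%C).
    { replace (4 * s * (RtoC (INR k * (h * h)) * ratio_pt tau h))%C with (RtoC (INR k * (h * h)) * (4 * s * ratio_pt tau h))%C by ring.
      unfold s at 6. rewrite ratio_pt_spec by auto.
      replace (RtoC (INR k * INR k * (tau * tau) / 4)) with (RtoC (INR k) * RtoC (INR k) * (RtoC tau * RtoC tau) / 4)%C.
      2:{ unfold Rdiv. rewrite !RtoC_mult, RtoC_inv by lra. reflexivity. }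
      replace (RtoC (INR k) * s * (4 * s * (RtoC (INR k) * s / 4 + RtoC (INR k) * RtoC (INR k) * (RtoC tau * RtoC tau) / 4 * / (RtoC (INR k) * s))))%C
        with (RtoC (INR k) * RtoC (INR k) * s * (s * s + RtoC tau * RtoC tau))%C by (field; auto).
      rewrite RtoC_mult.
      replace (s * s + RtoC tau * RtoC tau)%C with (RtoC (h * h) * ((h * h)%R, (2 * tau)%R))%C; [ring |].
      unfold s. apply C_eq; cri; unfold Re, Im; simpl; ring. }
    assert (Hks : (RtoC (INR k) * s)%C <> 0) by (apply Cmult_neq_0; auto).
    assert (H4s : (4 * s)%C <> 0) by (apply Cmult_neq_0; auto).
    set (y1 := (RtoC (INR k) * s / 4 + RtoC (INR k * INR k * (tau * tau) / 4) * / (RtoC (INR k) * s))%C) in *.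
    set (y2 := (RtoC (INR k * (h * h)) * ratio_pt tau h)%C) in *.
    replace y1 with (/ (4 * s) * (/ (RtoC (INR k) * s) * (RtoC (INR k) * s * (4 * s * y1))))%C by (field; auto).
    rewrite Q. field; auto. }
  unfold theta_term. rewrite Ez. change (zk n0 b k h) with (RtoC (INR k) * s)%C.
  rewrite !csqrt_scal by (auto; apply Rmult_lt_0_compat; nra).
  rewrite sqrt_mult, sqrt_square by nra. fold tau. unfold Uden. fold s.
  rewrite !RtoC_mult. pose proof (csqrt_neq_0 s Hs) as Hu. pose proof (csqrt_neq_0 _ Hr) as Hv.
  set (u := csqrt s) in *. set (v := csqrt (ratio_pt tau h)) in *.
  assert (Hsk : 0 < sqrt (INR k)) by (apply sqrt_lt_R0; auto).
  assert (Ek : RtoC (INR k ^ nu) = (RtoC (sqrt (INR k)) ^ (nu - 1) * RtoC (sqrt (INR k)) ^ (nu + 1))%C).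
  { rewrite <- Cpow_add_r. replace (nu - 1 + (nu + 1))%nat with (2 * nu)%nat by lia. rewrite <- RtoC_pow. f_equal.
    rewrite pow_mult. f_equal. simpl. rewrite Rmult_1_r. symmetry. apply sqrt_sqrt. lra. }
  rewrite !RtoC_inv by (apply pow_nonzero; lra). rewrite Ek, (RtoC_pow h).
  assert (HskC : RtoC (sqrt (INR k)) <> 0) by (intros K; apply RtoC_inj in K; lra).
  assert (HhC : RtoC h <> 0) by (intros K; apply RtoC_inj in K; lra).
  rewrite !Cpow_mult_l.
  pose proof (Cpow_nz _ (nu - 1) HskC). pose proof (Cpow_nz _ (nu + 1) HskC). pose proof (Cpow_nz _ (nu + 1) HhC).
  pose proof (Cpow_nz _ (nu - 1) Hu). pose proof (Cpow_nz _ (nu + 1) Hv).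
  field. repeat split; auto.
Qed.

Lemma ex_derive_csqrt (A B : R -> R) x : ex_derive A x -> ex_derive B x ->
  0 < A x * A x + B x * B x -> 0 < sqrt (A x * A x + B x * B x) + A x ->
  ex_derive (fun t => sqrt ((sqrt (A t * A t + B t * B t) + A t) / 2)) x /\
  ex_derive (fun t => B t / (2 * sqrt ((sqrt (A t * A t + B t * B t) + A t) / 2))) x.
Proof.
  intros H1 H2 H3 H4. split; auto_derive; repeat split; auto; try lra.
  apply Rgt_not_eq. apply Rmult_lt_0_compat; [lra |]. apply sqrt_lt_R0. lra.
Qed.

Lemma Cc_csqrt f x : ex_derive (fun t => Re (f t)) x -> ex_derive (fun t => Im (f t)) x ->
  0 < Cmod (f x) -> 0 < Cmod (f x) + Re (f x) -> Cc (fun t => csqrt (f t)) x.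
Proof.
  intros H1 H2 H3 H4.
  assert (E : forall t, sqrt (Re (f t) * Re (f t) + Im (f t) * Im (f t)) = Cmod (f t)).
  { intros t. rewrite <- Cmod_sq. apply sqrt_square, Cmod_ge_0. }
  destruct (ex_derive_csqrt _ _ x H1 H2) as [D1 D2].
  - rewrite <- Cmod_sq. apply Rmult_lt_0_compat; auto.
  - rewrite E. auto.
  - split; apply exder_cont; [eapply ex_derive_ext; [| apply D1] | eapply ex_derive_ext; [| apply D2]];
      intros t; cbv beta; rewrite E; reflexivity.
Qed.

Lemma Cc_pow f x m : Cc f x -> Cc (fun t => f t ^ m)%C x.
Proof.
  intros H. induction m as [| m IH]; [apply (Cc_const 1) |]. simpl. apply Cc_mult; auto.
Qed.

(** At h = 0 the argument of the first root is i tau, on the edge of the half plane, where the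
    explicit formula of [csqrt] is still smooth because |z| + Re z > 0. *)
Lemma Uden_cont nu tau : 0 < tau -> Cc (Uden nu tau) 0.
Proof.
  intros Ht. unfold Uden. apply Cc_mult; apply Cc_pow; apply Cc_csqrt.
  - unfold Re. simpl. auto_derive. auto.
  - unfold Im. simpl. auto_derive. auto.
  - apply Cmod_gt_0. intros K. apply (f_equal Im) in K. unfold Im in K. simpl in K. lra.
  - assert (0 < Cmod ((0 * 0)%R, tau)).
    { apply Cmod_gt_0. intros K. apply (f_equal Im) in K. unfold Im in K. simpl in K. lra. }
    unfold Re. simpl. lra.
  - unfold ratio_pt, Re. simpl. auto_derive. nra.
  - unfold ratio_pt, Im. simpl. auto_derive. nra.
  - pose proof (Re_ratio_pt tau 0 Ht). eapply Rlt_le_trans; [apply H | apply Cmod_Re_le].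
  - pose proof (Re_ratio_pt tau 0 Ht). pose proof (Cmod_ge_0 (ratio_pt tau 0)). lra.
Qed.

(** The two roots are sqrt(tau/2) (1 + i) and sqrt(1/2), so the limit has argument (nu - 1) pi/4,
    whose cosine is nonzero for nu = 2, 4, 8. *)
Lemma Uden_0 nu tau : 0 < tau -> exists rho, 0 < rho /\ Uden nu tau 0 = (RtoC rho * (1, 1) ^ (nu - 1))%C.
Proof.
  intros Ht. set (p := sqrt (tau / 2)). assert (Hp : 0 < p) by (apply sqrt_lt_R0; lra).
  assert (Hp2 : p * p = tau / 2) by (apply sqrt_sqrt; lra).
  assert (E1 : csqrt ((0 * 0)%R, tau) = (RtoC p * (1, 1))%C).
  { unfold csqrt. assert (Q : Cmod ((0 * 0)%R, tau) = tau).
    { unfold Cmod. simpl. replace (0 * 0 * (0 * 0 * 1) + tau * (tau * 1)) with (tau * tau) by ring. apply sqrt_square. lra. }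
    rewrite Q. unfold Re, Im. simpl. rewrite Rmult_0_l, Rplus_0_r. fold p.
    replace (tau / (2 * p)) with p by (replace tau with (2 * (p * p)) by lra; field; lra).
    apply C_eq; simpl; ring. }
  assert (E2 : csqrt (ratio_pt tau 0) = RtoC (sqrt (/ 2))).
  { assert (Q : ratio_pt tau 0 = RtoC (/ 2)) by (unfold ratio_pt; apply C_eq; unfold Re, Im; simpl; field; lra).
    rewrite Q. unfold csqrt. rewrite Cmod_R, Rabs_pos_eq, Re_R, Im_R by lra.
    replace ((/ 2 + / 2) / 2) with (/ 2) by field. unfold RtoC. f_equal. unfold Rdiv. ring. }
  assert (0 < sqrt (/ 2)) by (apply sqrt_lt_R0; lra).
  exists (p ^ (nu - 1) * sqrt (/ 2) ^ (nu + 1)). split; [apply Rmult_lt_0_compat; apply pow_lt; auto |].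
  unfold Uden. rewrite E1, E2, Cpow_mult_l, RtoC_mult, <- !RtoC_pow. ring.
Qed.

(* The sign of Re (1 + i)^(nu - 1). *)
Definition sgn (nu : nat) : R := if Nat.eqb nu 4 then -1 else 1.

Lemma Re_inv_low (z : C) sg r M : sg = 1 \/ sg = -1 -> 0 < r -> r <= sg * Re z -> Rabs (Re z) <= M -> Rabs (Im z) <= M ->
  r / (2 * (M * M)) <= sg * Re (/ z).
Proof.
  intros Hsg Hr H1 H2 H3.
  assert (E : Re (/ z) = Re z / (Re z * (Re z * 1) + Im z * (Im z * 1))) by reflexivity.
  rewrite E.
  assert (HM : 0 < M). { eapply Rlt_le_trans; [| apply H2]. apply Rabs_pos_lt. intros K. rewrite K in H1. lra. }
  apply Rabs_le_between in H2. apply Rabs_le_between in H3.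
  assert (HR : Re z <> 0) by (intros K; rewrite K in H1; lra).
  assert (D0 : 0 < Re z * (Re z * 1) + Im z * (Im z * 1)).
  { pose proof (Rle_0_sqr (Im z)). pose proof (Rsqr_pos_lt _ HR). unfold Rsqr in *. nra. }
  assert (D1 : Re z * (Re z * 1) + Im z * (Im z * 1) <= 2 * (M * M)) by nra.
  unfold Rdiv. rewrite <- (Rmult_assoc sg). apply Rmult_le_compat; [lra | left; apply Rinv_0_lt_compat; nra | auto |].
  apply Rinv_le_contravar; auto.
Qed.

Lemma Uden_sign nu tau : nu = 2%nat \/ nu = 4%nat \/ nu = 8%nat -> 0 < tau ->
  exists w0 eta, 0 < w0 /\ 0 < eta /\ forall h, 0 < h < eta -> w0 <= sgn nu * Re (/ Uden nu tau h).
Proof.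
  intros Hnu Ht. destruct (Uden_0 nu tau Ht) as [rho [Hrho E]].
  assert (H0 : 0 < sgn nu * Re (Uden nu tau 0)).
  { rewrite E, Re_RM. destruct Hnu as [-> | [-> | ->]]; unfold sgn, Re; simpl; lra. }
  destruct (Uden_cont nu tau Ht) as [C1 C2].
  set (r := sgn nu * Re (Uden nu tau 0)) in *.
  assert (Hsg : sgn nu = 1 \/ sgn nu = -1) by (unfold sgn; destruct (Nat.eqb nu 4); auto).
  destruct (C1 (r / 2) ltac:(lra)) as [d1 [Hd1 B1]]. destruct (C2 1 ltac:(lra)) as [d2 [Hd2 B2]].
  set (M := Rabs (Re (Uden nu tau 0)) + r + Rabs (Im (Uden nu tau 0)) + 1).
  pose proof (Rabs_pos (Re (Uden nu tau 0))). pose proof (Rabs_pos (Im (Uden nu tau 0))).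
  assert (HM : 0 < M) by (unfold M; lra).
  exists (r / 2 / (2 * (M * M))), (Rmin d1 d2). split; [apply Rdiv_lt_0_compat; nra |].
  split; [apply Rmin_glb_lt; auto |]. intros h [Hh Hh2].
  assert (Hin : forall d, h < d -> D_x no_cond 0 h /\ R_dist h 0 < d).
  { intros d Hd. split; [split; [exact I | lra] |]. unfold R_dist. rewrite Rminus_0_r, Rabs_pos_eq by lra. auto. }
  specialize (B1 h (Hin d1 ltac:(eapply Rlt_le_trans; [apply Hh2 | apply Rmin_l]))).
  specialize (B2 h (Hin d2 ltac:(eapply Rlt_le_trans; [apply Hh2 | apply Rmin_r]))).
  change (Rabs (Re (Uden nu tau h) - Re (Uden nu tau 0)) < r / 2) in B1.
  change (Rabs (Im (Uden nu tau h) - Im (Uden nu tau 0)) < 1) in B2.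
  apply Re_inv_low; auto; [lra | | |].
  - apply Rabs_lt_between in B1. assert (Er : r = sgn nu * Re (Uden nu tau 0)) by reflexivity. clearbody r.
    destruct Hsg as [Q | Q]; rewrite Q in *; lra.
  - pose proof (Rabs_triang (Re (Uden nu tau h) - Re (Uden nu tau 0)) (Re (Uden nu tau 0))) as Q.
    replace (Re (Uden nu tau h) - Re (Uden nu tau 0) + Re (Uden nu tau 0)) with (Re (Uden nu tau h)) in Q by ring. unfold M. lra.
  - pose proof (Rabs_triang (Im (Uden nu tau h) - Im (Uden nu tau 0)) (Im (Uden nu tau 0))) as Q.
    replace (Im (Uden nu tau h) - Im (Uden nu tau 0) + Im (Uden nu tau 0)) with (Im (Uden nu tau h)) in Q by ring. unfold M. lra.
Qed.

Lemma pow_le_1 h n : 0 <= h <= 1 -> h ^ n <= 1.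
Proof. intros Hh. rewrite <- (pow1 n). apply pow_incr. auto. Qed.

Lemma rsum_multiples (f : nat -> R) b J : (1 <= b)%nat ->
  rsum (fun k => if Nat.eqb (k mod b) 0 then f (k / b)%nat else 0) (seq 1 (b * J)) = rsum f (seq 1 J).
Proof.
  intros Hb. induction J as [| J IH]; [rewrite Nat.mul_0_r; reflexivity |].
  rewrite rsum_snoc, <- IH. rewrite Nat.mul_succ_r, seq_app, rsum_app. f_equal.
  assert (Es : seq (1 + b * J) b = seq (1 + b * J) (b - 1) ++ (S J * b)%nat :: nil).
  { replace b with (S (b - 1)) at 2 by lia. rewrite seq_S. do 2 f_equal. lia. }
  rewrite Es, rsum_app, rsum_zero.
  - unfold rsum. cbn [fold_right].
    rewrite Nat.Div0.mod_mul, Nat.eqb_refl, Nat.div_mul by lia. ring.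
  - intros t Ht. apply in_seq in Ht. destruct (Nat.eqb_spec (t mod b) 0) as [E | E]; auto. exfalso.
    apply Nat.Div0.mod_divides in E. destruct E as [c E]. subst t.
    assert (J < c)%nat by nia. assert (c < S J)%nat by nia. lia.
Qed.

Lemma hs_tail_bound (f : nat -> C) (g : nat -> R) l K B : hs f l -> (forall k, Cmod (f k) <= g k) ->
  (forall N, rsum g (seq K N) <= B) -> Cmod (l - csum f (seq 0 K)) <= B.
Proof.
  intros Hl Hg HB. apply le_epsilon. intros eps He.
  destruct (hs_nat_lim f l Hl eps He) as [N HN]. specialize (HN (K + N)%nat ltac:(lia)).
  rewrite seq_app, csum_app in HN. simpl (0 + K)%nat in HN.
  set (a := csum f (seq 0 K)) in *. set (r := csum f (seq K N)) in *.
  replace (l - a)%C with (r - (a + r - l))%C by ring. eapply Rle_trans; [apply Cmod_triangle |]. rewrite Cmod_opp.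
  apply Rplus_le_compat; [| lra]. eapply Rle_trans; [apply (csum_le f g) | apply HB]. auto.
Qed.

Lemma tail_pow nu K N : (2 <= nu)%nat -> (1 <= K)%nat ->
  rsum (fun k => / INR (S k) ^ nu) (seq K N) <= / INR K ^ (nu - 1).
Proof.
  intros Hnu HK. assert (HKR : 0 < INR K) by (apply lt_0_INR; lia).
  apply Rle_trans with (rsum (fun k => / INR K ^ (nu - 2) * / (INR (S k) * INR (S k))) (seq K N)).
  - apply rsum_le. intros k Hk. apply in_seq in Hk. assert (INR K <= INR (S k)) by (apply le_INR; lia).
    rewrite <- Rinv_mult. apply Rinv_le_contravar.
    + apply Rmult_lt_0_compat; [apply pow_lt; auto | nra].
    + replace nu with (nu - 2 + 2)%nat at 2 by lia. rewrite pow_add.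
      replace (INR (S k) ^ 2) with (INR (S k) * INR (S k)) by ring.
      apply Rmult_le_compat_r; [nra |]. apply pow_incr. lra.
  - rewrite rsum_scal. rewrite <- (rsum_map S (fun d => / (INR d * INR d))). rewrite seq_shift.
    pose proof (tail_inv_sq K N HK) as Q. replace (nu - 1)%nat with (nu - 2 + 1)%nat by lia.
    rewrite pow_add, Rinv_mult, pow_1. apply Rmult_le_compat_l; auto.
    left. apply Rinv_0_lt_compat, pow_lt. auto.
Qed.

(** * Lower bound for zeta on approach to a resonance *)

Section BlowUp.
Variables (nu n0 b : nat).
Hypothesis Hnu : (2 <= nu)%nat.
Hypothesis Hn0 : (1 <= n0)%nat.
Hypothesis Hb : (1 <= b)%nat.
Hypothesis Hdiv : forall k, Nat.divide (b * b) (k * k * n0) -> Nat.divide b k.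

Definition res_part (kap : R) (k : nat) (h : R) : C :=
  (RtoC (kap * (if Nat.eqb (k mod b) 0 then INR (rr nu (n0 * (k / b * (k / b)))) * / INR k ^ nu else 0) * / h ^ (nu + 1))
    * / Uden nu (tau_of n0 b) h)%C.

(** For each k at most one n is resonant, and by the divisibility condition only when b divides k;
    subtracting this term leaves the sum bounded by Cc. *)
Lemma near_resonance kap Cc k h Th : 0 < kap -> (1 <= k)%nat -> 0 < h ->
  (forall L, NoDup L -> rsum (fun n => if Nat.eqb (b * b * n) (k * k * n0) then 0 else Cmod (theta_term nu (zk n0 b k h) n)) L <= Cc) ->
  hs (fun n => RtoC kap * theta_term nu (zk n0 b k h) n)%C Th ->
  Cmod (Th - res_part kap k h) <= kap * Cc.
Proof.
  intros Hkap Hk Hh HC HT.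
  set (de := fun n => if Nat.eqb (b * b * n) (k * k * n0) then (RtoC kap * theta_term nu (zk n0 b k h) n)%C else RtoC 0).
  assert (Hbb : (b * b <> 0)%nat) by nia.
  assert (Hde : hs de (res_part kap k h)).
  { unfold res_part. destruct (Nat.eqb_spec (k mod b) 0) as [E | E].
    - apply Nat.Div0.mod_divides in E. destruct E as [j E].
      assert (Ej : (k / b = j)%nat) by (rewrite E, Nat.mul_comm; apply Nat.div_mul; lia). rewrite Ej.
      set (m0 := (n0 * (j * j))%nat).
      assert (Em : (b * b * m0 = k * k * n0)%nat) by (unfold m0; rewrite E; lia).
      replace (RtoC (kap * (INR (rr nu m0) * / INR k ^ nu) * / h ^ (nu + 1)) * / Uden nu (tau_of n0 b) h)%C with (de m0).
      + apply hs_single. intros n Hn. unfold de. destruct (Nat.eqb_spec (b * b * n) (k * k * n0)) as [E2 | E2]; auto.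
        exfalso. apply Hn. rewrite <- Em in E2. apply Nat.mul_cancel_l in E2; auto.
      + unfold de. rewrite Em, Nat.eqb_refl. rewrite (res_term nu n0 b k m0 h); auto. rewrite !RtoC_mult. ring.
    - replace (RtoC (kap * 0 * / h ^ (nu + 1)) * / Uden nu (tau_of n0 b) h)%C with (RtoC 0).
      2:{ rewrite Rmult_0_r, Rmult_0_l. ring. }
      apply (hs_ext (fun _ => 0)); [| apply hs_zero]. intros n. unfold de.
      destruct (Nat.eqb_spec (b * b * n) (k * k * n0)) as [E2 | E2]; auto. exfalso. apply E.
      apply Nat.Div0.mod_divides. destruct (Hdiv k) as [c Hc]; [exists n; lia |]. exists c. lia. }
  apply (hs_bound _ (fun n => kap * (if Nat.eqb (b * b * n) (k * k * n0) then 0 else Cmod (theta_term nu (zk n0 b k h) n))) _ _ (hs_minus _ _ _ _ HT Hde)).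
  - intros n. cbv beta. unfold de. destruct (Nat.eqb (b * b * n) (k * k * n0)).
    + replace (_ - _)%C with (RtoC 0) by ring. rewrite Cmod_0. lra.
    + replace (_ - _)%C with (RtoC kap * theta_term nu (zk n0 b k h) n)%C by ring. rewrite Cmod_RM by lra. lra.
  - intros L HL. rewrite rsum_scal. apply Rmult_le_compat_l; [lra | auto].
Qed.

(** Cutting the sum over k at a multiple b J makes the resonant contribution exactly a partial sum
    of [tm] up to J. *)
Lemma res_part_sum kap h J :
  rsum (fun k => Re (RtoC (cf (S k)) * res_part kap (S k) h)) (seq 0 (b * J)) =
  kap * / h ^ (nu + 1) * Re (/ Uden nu (tau_of n0 b) h) * rsum (tm nu n0 b) (seq 1 J).
Proof.
  rewrite <- (rsum_multiples (tm nu n0 b) b J Hb), <- rsum_scal, <- seq_shift, rsum_map.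
  apply rsum_ext_in. intros k _. unfold res_part. rewrite !Re_RM.
  destruct (Nat.eqb_spec (S k mod b) 0) as [E | E]; [| ring].
  apply Nat.Div0.mod_divides in E. destruct E as [j E]. rewrite E.
  replace (b * j / b)%nat with j by (rewrite Nat.mul_comm; symmetry; apply Nat.div_mul; lia). unfold tm. ring.
Qed.

(** After multiplication by H = h^(nu+1) the resonant part of Re log zeta is at least E, while the
    tail in k and the remaining terms are at most E/4 each, so Re l >= E/(2 H) >= E/(2 h). The
    inequality exp x >= 1 + x carries this over to |zeta|. *)
Lemma blow_up w0 eta0 d J0 sg : sg = 1 \/ sg = -1 -> 0 < w0 -> 0 < eta0 -> 0 < d ->
  (forall h, 0 < h < eta0 -> w0 <= sg * Re (/ Uden nu (tau_of n0 b) h)) ->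
  (forall J, (J0 <= J)%nat -> d <= sg * rsum (tm nu n0 b) (seq 1 J)) ->
  exists c eta, 0 < c /\ 0 < eta /\ forall h (Zs : C), 0 < h < eta ->
    filterlim (partial_prod nu ((h * h)%R, tau_of n0 b)) eventually (locally Zs) -> c / h <= Cmod Zs.
Proof.
  intros Hsg Hw0 Heta Hd HU HS.
  destruct (zeta_log_series nu Hnu) as [M [HM HZ]].
  destruct (theta_formula nu Hnu) as [kap [Hkap HT]].
  destruct (off_sum n0 b Hn0 Hb nu Hnu) as [Cc [HCc HO]].
  set (E := kap * w0 * d). assert (HE : 0 < E) by (unfold E; apply Rmult_lt_0_compat; auto; apply Rmult_lt_0_compat; auto).
  (* The tail k > K, scaled by H, is at most M/(K h)^(nu-1); with K h >= A >= 1 it is at most M/A <=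
     E/4. *)
  set (A := 1 + 4 * M / E). assert (HME : 0 < 4 * M / E) by (apply Rdiv_lt_0_compat; lra).
  assert (HA : 1 <= A) by (unfold A; lra).
  assert (HbR : 1 <= INR b) by (apply (le_INR 1); auto).
  (* An upper bound for K h when K = b J, J exceeds A/h by at most 1 and h <= 1. *)
  set (B := INR b * (A + 1)). assert (HB : 1 <= B) by (unfold B; nra).
  (* Summing k^(nu-1/3) over k <= K costs K^(nu+2/3), so H times the non-resonant part is
     O(h^(1/3)); the condition h < x1^3 in [eta] makes it at most E/8. *)
  set (e1 := INR nu + 2 * / 3).
  set (x1 := E / 8 / (kap * Cc * Rpower B e1)).
  assert (Hx1 : 0 < x1).
  { apply Rdiv_lt_0_compat; [lra |]. apply Rmult_lt_0_compat; [apply Rmult_lt_0_compat; auto | apply exp_pos]. }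
  (* The five bounds serve, in order, the sign of Re (1/U), J >= J0, the non-resonant sum, the
     smallness condition of [off_sum] together with h <= 1, and the constants 1 in Theta - 1. *)
  set (eta := Rmin (Rmin eta0 (/ (INR J0 + 1))) (Rmin (Rpower x1 3) (Rmin (/ (B * INR b)) (E / 8 / B)))).
  assert (HbB : 1 <= B * INR b) by nra.
  exists (E / 2), eta. split; [lra |]. split.
  { unfold eta. repeat apply Rmin_glb_lt; auto; try apply exp_pos.
    - apply Rinv_0_lt_compat. pose proof (pos_INR J0). lra.
    - apply Rinv_0_lt_compat. lra.
    - apply Rdiv_lt_0_compat; lra. }
  intros h Zs [Hh Hhe] HZs.
  assert (H1 : h < eta0 /\ h < / (INR J0 + 1) /\ h < Rpower x1 3 /\ h < / (B * INR b) /\ h < E / 8 / B).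
  { unfold eta in Hhe. repeat split; eapply Rlt_le_trans; try apply Hhe.
    - eapply Rle_trans; apply Rmin_l.
    - eapply Rle_trans; [apply Rmin_l | apply Rmin_r].
    - eapply Rle_trans; [apply Rmin_r | apply Rmin_l].
    - eapply Rle_trans; [apply Rmin_r |]. eapply Rle_trans; [apply Rmin_r | apply Rmin_l].
    - eapply Rle_trans; [apply Rmin_r |]. eapply Rle_trans; [apply Rmin_r | apply Rmin_r]. }
  clear Hhe. destruct H1 as [Hh1 [Hh2 [Hh3 [Hh4 Hh5]]]]. clearbody eta.
  assert (HhB : h * (B * INR b) < 1).
  { apply Rmult_lt_compat_r with (r := B * INR b) in Hh4; [| lra]. rewrite Rinv_l in Hh4 by lra. auto. }
  assert (Hhle : h <= 1) by nra.
  destruct (nfloor_ex (A / h)) as [J1 [HJ1 HJ2]].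
  { apply Rmult_le_pos; [lra | left; apply Rinv_0_lt_compat; auto]. }
  set (J := S J1). assert (HJ : A / h < INR J <= A / h + 1) by (unfold J; rewrite S_INR; lra).
  set (K := (b * J)%nat).
  assert (HAh : A / h * h = A) by (field; lra).
  assert (HJh : A < INR J * h) by nra.
  assert (HK1 : (1 <= K)%nat) by (unfold K, J; nia).
  assert (HKR : INR K = INR b * INR J) by (unfold K; apply mult_INR).
  assert (HKh : A <= INR K * h) by (rewrite HKR; nra).
  assert (HKB : INR K * h <= B) by (rewrite HKR; unfold B; nra).
  assert (HJJ0 : (J0 <= J)%nat).
  { apply INR_le. assert (INR J0 + 1 < A / h).
    { apply Rmult_lt_reg_r with h; auto. rewrite HAh.
      assert (h * (INR J0 + 1) < 1); [| lra]. pose proof (pos_INR J0).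
      apply Rmult_lt_compat_r with (r := INR J0 + 1) in Hh2; [| lra]. rewrite Rinv_l in Hh2 by lra. auto. }
    lra. }
  set (s := ((h * h)%R, tau_of n0 b) : C).
  assert (Hs : 0 < Re s) by (unfold s, Re; simpl; nra).
  destruct (HZ s Zs Hs HZs) as [l [Th [EZ [HTh [HTb Hl]]]]].
  set (f := fun k => (RtoC (cf (S k)) * (Th k - 1))%C) in *.
  set (H := h ^ (nu + 1)). assert (HH : 0 < H) by (apply pow_lt; auto).
  assert (Htail : H * Cmod (l - csum f (seq 0 K)) <= E / 4).
  { assert (Q : Cmod (l - csum f (seq 0 K)) <= M * / (h * h) ^ nu * / INR K ^ (nu - 1)).
    { apply (hs_tail_bound f (fun k => M * / (h * h) ^ nu * / INR (S k) ^ nu)); auto.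
      - intros k. unfold f. rewrite Cmod_mult, Cmod_R.
        pose proof (cf_le1 (S k) ltac:(lia)) as Q1. specialize (HTb k).
        replace (Re s) with (h * h) in HTb by reflexivity. rewrite Rpow_mult_distr, Rinv_mult, <- Rmult_assoc in HTb.
        pose proof (Rabs_pos (cf (S k))). pose proof (Cmod_ge_0 (Th k - 1)). nra.
      - intros N. rewrite rsum_scal. apply Rmult_le_compat_l; [| apply tail_pow; auto].
        apply Rmult_le_pos; [lra | left; apply Rinv_0_lt_compat, pow_lt; nra]. }
    apply Rle_trans with (H * (M * / (h * h) ^ nu * / INR K ^ (nu - 1))); [apply Rmult_le_compat_l; lra |].
    assert (HKpos : 0 < INR K) by (apply lt_0_INR; lia).
    replace (H * (M * / (h * h) ^ nu * / INR K ^ (nu - 1))) with (M * / (INR K * h) ^ (nu - 1)).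
    - apply Rle_trans with (M * / A).
      + apply Rmult_le_compat_l; [lra |]. apply Rinv_le_contravar; [lra |].
        replace (nu - 1)%nat with (S (nu - 2)) by lia. simpl.
        assert (1 <= (INR K * h) ^ (nu - 2)) by (apply pow_R1_Rle; lra). nra.
      + apply Rmult_le_reg_r with A; [lra |]. rewrite Rmult_assoc, Rinv_l by lra. unfold A.
        replace (E / 4 * (1 + 4 * M / E)) with (E / 4 + M) by (field; lra). lra.
    - unfold H. rewrite !Rpow_mult_distr. rewrite !Rinv_mult.
      replace (h ^ (nu + 1)) with (h ^ (nu - 1) * (h * h)) by (replace (nu + 1)%nat with (nu - 1 + 2)%nat by lia; rewrite pow_add; ring).
      replace (h ^ nu) with (h ^ (nu - 1) * h) by (replace nu with (nu - 1 + 1)%nat at 2 by lia; rewrite pow_add; ring).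
      field. repeat split; try (apply pow_nonzero; lra); lra. }
  assert (Hoff : forall k, (k < K)%nat -> Cmod (Th k - res_part kap (S k) h) <= kap * (Cc * Rpower (INR K) (INR nu - / 3))).
  { intros k Hk. assert (HkK : INR (S k) <= INR K) by (apply le_INR; lia).
    assert (Hk1 : 1 <= INR (S k)) by (apply (le_INR 1); lia).
    apply Rle_trans with (kap * (Cc * Rpower (INR (S k)) (INR nu - / 3))).
    - apply near_resonance; auto; [lia | | apply HT; [apply Re_zk_pos; auto; lia | apply HTh]].
      intros L HL. apply HO; auto; [lia |].
      set (y := INR (S k) * (h * h)). assert (Hy : 0 <= y <= B * h).
      { unfold y. split; [nra |]. apply Rle_trans with (INR K * h * h); [nra |]. apply Rmult_le_compat_r; lra. }
      assert (Hyb : 0 <= y * INR b <= 1) by nra.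
      replace (INR (S k) * INR (S k) * (h * h * (h * h))) with (y * y) by (unfold y; ring).
      apply Rmult_le_reg_r with (INR b * INR b); [nra |]. unfold Rdiv. rewrite Rmult_assoc, (Rmult_assoc _ (/ _)), Rinv_l by nra.
      pose proof PI2_1. assert (1 <= 2 * (PI * PI) * 1) by nra.
      replace (y * (y * (INR b * INR b))) with ((y * INR b) * (y * INR b)) by ring. nra.
    - apply Rmult_le_compat_l; [lra |]. apply Rmult_le_compat_l; [lra |]. apply Rle_Rpower_l; [| lra].
      pose proof (le_INR 2 nu Hnu) as Q. simpl in Q. lra. }
  assert (Hmain : E <= H * (kap * / H * Re (/ Uden nu (tau_of n0 b) h) * rsum (tm nu n0 b) (seq 1 J))).
  { replace (H * (kap * / H * Re (/ Uden nu (tau_of n0 b) h) * rsum (tm nu n0 b) (seq 1 J))) with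
      (kap * (Re (/ Uden nu (tau_of n0 b) h) * rsum (tm nu n0 b) (seq 1 J))) by (field; lra).
    unfold E. rewrite Rmult_assoc. apply Rmult_le_compat_l; [lra |].
    specialize (HU h ltac:(lra)). specialize (HS J HJJ0).
    set (x := Re (/ Uden nu (tau_of n0 b) h)) in *. set (y := rsum (tm nu n0 b) (seq 1 J)) in *.
    replace (x * y) with ((sg * x) * (sg * y)) by (destruct Hsg as [-> | ->]; ring).
    apply Rmult_le_compat; lra. }
  assert (Herr : Cmod (csum (fun k => RtoC (cf (S k)) * (Th k - 1 - res_part kap (S k) h))%C (seq 0 K)) <=
    INR K * (kap * (Cc * Rpower (INR K) (INR nu - / 3)) + 1)).
  { eapply Rle_trans; [apply (csum_le _ (fun _ => kap * (Cc * Rpower (INR K) (INR nu - / 3)) + 1)) |].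
    - intros k Hk. apply in_seq in Hk. specialize (Hoff k ltac:(lia)). pose proof (cf_le1 (S k) ltac:(lia)) as Q1.
      rewrite Cmod_mult, Cmod_R. pose proof (Rabs_pos (cf (S k))).
      replace (Th k - 1 - res_part kap (S k) h)%C with ((Th k - res_part kap (S k) h) + - (1))%C by ring.
      pose proof (Cmod_triangle (Th k - res_part kap (S k) h) (- (1))) as Q2. rewrite Cmod_opp, Cmod_1 in Q2.
      pose proof (Cmod_ge_0 (Th k - res_part kap (S k) h + - (1))). nra.
    - rewrite rsum_const, length_seq. lra. }
  assert (Hsmall : H * (INR K * (kap * (Cc * Rpower (INR K) (INR nu - / 3)) + 1)) <= E / 4).
  { assert (HKpos : 0 < INR K) by (apply lt_0_INR; lia).
    assert (HKBh : INR K <= B / h).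
    { apply Rmult_le_reg_r with h; auto. unfold Rdiv. rewrite Rmult_assoc, Rinv_l by lra. lra. }
    assert (S1 : H * INR K <= E / 8).
    { unfold H. replace (nu + 1)%nat with (S (S (nu - 1))) by lia. cbn [pow].
      assert (P1 : 0 <= h ^ (nu - 1) <= 1) by (split; [apply pow_le; lra | apply pow_le_1; lra]).
      apply Rle_trans with (h * B).
      { replace (h * (h * h ^ (nu - 1)) * INR K) with (h * (h ^ (nu - 1) * (INR K * h))) by ring.
        apply Rmult_le_compat_l; [lra |]. apply Rle_trans with (1 * (INR K * h)); [| lra].
        apply Rmult_le_compat_r; lra. }
      apply Rmult_lt_compat_r with (r := B) in Hh5; [| lra]. replace (E / 8 / B * B) with (E / 8) in Hh5 by (field; lra). lra. }
    assert (S2 : H * (INR K * (kap * (Cc * Rpower (INR K) (INR nu - / 3)))) <= E / 8).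
    { assert (R1 : INR K * Rpower (INR K) (INR nu - / 3) <= Rpower (B * / h) e1).
      { rewrite <- (Rpower_1 (INR K)) at 1 by auto. rewrite <- Rpower_plus.
        replace (1 + (INR nu - / 3)) with e1 by (unfold e1; field).
        apply Rle_Rpower_l; [unfold e1; pose proof (pos_INR nu); lra |]. split; auto. }
      assert (R2 : H = Rpower h (INR nu + 1)).
      { unfold H. rewrite <- Rpower_pow, plus_INR by auto. reflexivity. }
      assert (R3 : H * Rpower (B * / h) e1 = Rpower B e1 * Rpower h (/ 3)).
      { rewrite <- Rpower_mult_distr by (try lra; apply Rinv_0_lt_compat; auto).
        assert (R4 : Rpower (/ h) e1 = Rpower h (- e1)) by (unfold Rpower; rewrite ln_Rinv by auto; f_equal; ring).
        rewrite R4, R2. replace (/ 3) with ((INR nu + 1) + - e1) by (unfold e1; field). rewrite (Rpower_plus (INR nu + 1)). ring. }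
      assert (R5 : Rpower h (/ 3) <= x1).
      { apply Rle_trans with (Rpower (Rpower x1 3) (/ 3)).
        - apply Rle_Rpower_l; lra.
        - rewrite Rpower_mult. replace (3 * / 3) with 1 by field. rewrite Rpower_1; lra. }
      replace (H * (INR K * (kap * (Cc * Rpower (INR K) (INR nu - / 3))))) with
        (kap * Cc * (H * (INR K * Rpower (INR K) (INR nu - / 3)))) by ring.
      assert (0 < kap * Cc) by (apply Rmult_lt_0_compat; auto).
      apply Rle_trans with (kap * Cc * (Rpower B e1 * x1)).
      - apply Rmult_le_compat_l; [lra |]. apply Rle_trans with (H * Rpower (B * / h) e1); [apply Rmult_le_compat_l; lra |].
        rewrite R3. apply Rmult_le_compat_l; [left; apply exp_pos | auto].
      - right. unfold x1. field. split; [apply Rgt_not_eq, exp_pos | lra]. }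
    lra. }
  assert (Hsplit : csum f (seq 0 K) = (csum (fun k => RtoC (cf (S k)) * res_part kap (S k) h) (seq 0 K) +
    csum (fun k => RtoC (cf (S k)) * (Th k - 1 - res_part kap (S k) h)) (seq 0 K))%C).
  { rewrite <- csum_plus. apply csum_ext_in. intros k _. unfold f. ring. }
  assert (HRe : E / 2 <= H * Re l).
  { set (e := csum (fun k => RtoC (cf (S k)) * (Th k - 1 - res_part kap (S k) h))%C (seq 0 K)) in *.
    set (t := (l - csum f (seq 0 K))%C) in *.
    assert (El : l = (csum (fun k => RtoC (cf (S k)) * res_part kap (S k) h)%C (seq 0 K) + e + t)%C).
    { unfold t. rewrite Hsplit. ring. }
    rewrite El, !Re_plus, csum_re. unfold K at 1. rewrite res_part_sum. fold H.
    pose proof (re_le_Cmod e) as Q1. pose proof (re_le_Cmod t) as Q2.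
    apply Rabs_le_between in Q1. apply Rabs_le_between in Q2.
    assert (H * Cmod e <= E / 4) by (eapply Rle_trans; [apply Rmult_le_compat_l; [lra | apply Herr] | auto]).
    assert (H * - Cmod e <= H * Re e) by (apply Rmult_le_compat_l; lra).
    assert (H * - Cmod t <= H * Re t) by (apply Rmult_le_compat_l; lra).
    lra. }
  rewrite EZ, Cmod_cexp.
  assert (HHh : H <= h).
  { unfold H. replace (nu + 1)%nat with (S nu) by lia. simpl.
    assert (P1 : 0 <= h ^ nu <= 1) by (split; [apply pow_le; lra | apply pow_le_1; lra]). nra. }
  assert (HRl : E / 2 <= h * Re l).
  { assert (0 <= Re l) by nra. nra. }
  apply Rle_trans with (Re l).
  - apply Rmult_le_reg_r with h; auto. unfold Rdiv at 1. rewrite Rmult_assoc, Rinv_l by lra. lra.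
  - pose proof (exp_ineq1_le (Re l)). lra.
Qed.
End BlowUp.

(** * Conjugation symmetry and the contradiction *)

Lemma cexp_conj z : cexp (Cconj z) = Cconj (cexp z).
Proof. unfold cexp, Cconj, Re, Im. simpl. rewrite cos_neg, sin_neg. apply C_eq; simpl; ring. Qed.

Lemma factor_conj s p : factor (Cconj s) p = Cconj (factor s p).
Proof.
  unfold factor. rewrite !cexp_neg_cexp.
  assert (E : cexp (- (Cconj s * vnorm p)) = Cconj (cexp (- (s * vnorm p)))).
  { rewrite <- cexp_conj. f_equal. apply C_eq; unfold Cconj; cri; unfold Re, Im; simpl; ring. }
  rewrite E. set (w := cexp (- (s * vnorm p))). unfold Cinv, Cconj. apply C_eq; unfold Re, Im; simpl.
  - f_equal. ring.
  - unfold Rdiv.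
    replace (1 * 1) with 1 by ring.
    match goal with |- ?a * / ?b = - (?c * / ?d) => replace b with d by ring; replace a with (- c) by ring end. ring.
Qed.

Lemma partial_prod_conj nu s N : partial_prod nu (Cconj s) N = Cconj (partial_prod nu s N).
Proof.
  unfold partial_prod. induction (filter Defs.primitive (box nu N)) as [| p l IH].
  - simpl. unfold Cconj. apply C_eq; simpl; ring.
  - cbn [map fold_right]. rewrite IH, factor_conj. apply C_eq; cri; unfold Re, Im, Cconj; simpl; ring.
Qed.

Lemma filterlim_conj nu s (Zs : C) : filterlim (partial_prod nu s) eventually (locally Zs) ->
  filterlim (partial_prod nu (Cconj s)) eventually (locally (Cconj Zs)).
Proof.
  intros H P [eps HP].
  assert (L : locally Zs (fun z => P (Cconj z))).
  { exists eps. intros z [B1 B2]. apply HP. split; [exact B1 |].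
    unfold ball in *. simpl in *. unfold AbsRing_ball, minus, plus, opp, abs in *. simpl in *.
    replace (- snd z + - - snd Zs) with (- (snd z + - snd Zs)) by ring. rewrite Rabs_Ropp. exact B2. }
  apply H in L. destruct L as [N HN]. exists N. intros n Hn. rewrite partial_prod_conj. apply HN. auto.
Qed.

Lemma holo_bounded g z : C_holo_at g z -> exists d, 0 < d /\ forall w, Cmod (w - z) < d -> Cmod (g w) <= Cmod (g z) + 2.
Proof.
  intros H. apply ex_derive_continuous in H.
  assert (L : locally (g z) (fun y => Cmod (y - g z) < 2)).
  { exists (mkposreal 1 Rlt_0_1). intros y [B1 B2]. cbn [pos] in *.
    eapply Rle_lt_trans; [apply Cmod_ReIm |].
    unfold ball in B1, B2. simpl in B1, B2. unfold AbsRing_ball, minus, plus, opp, abs in B1, B2. simpl in B1, B2.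
    rewrite Re_minus, Im_minus. unfold Rminus, Re, Im. lra. }
  destruct (H _ L) as [d Hd]. exists d. split; [apply cond_pos |]. intros w Hw.
  specialize (Hd w Hw). cbv beta in Hd. pose proof (Cmod_dist (g w) (g z)). lra.
Qed.

Theorem mainTheorem2 (nu : nat) (Hnu : nu = 2%nat \/ nu = 4%nat \/ nu = 8%nat)
  (Z : C -> C)
  (HZ : forall s : C, 0 < Re s ->
        filterlim (partial_prod nu s) eventually (locally (Z s)))
  (t0 r : R) (Hr : 0 < r) :
  ~ exists g : C -> C,
      meromorphic_on (fun s => 0 < Re s \/ Cmod (Cminus s (0, t0)) < r) g /\
      (forall s : C, 0 < Re s -> g s = Z s).
Proof.
  intros [g [[P [HPU [Hdisc [Hholo _]]]] Hg]].
  assert (Hnu2 : (2 <= nu)%nat) by (destruct Hnu as [-> | [-> | ->]]; lia).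
  (* Isolation of poles at the centre: within r' the only possible pole is i t0 itself, so every
     other nearby point of the axis inside the disc is a point of holomorphy. *)
  destruct (Hdisc (0, t0)) as [r' [Hr' Hiso]].
  { right. replace (Cminus (0, t0) (0, t0)) with (RtoC 0) by (apply C_eq; simpl; ring). rewrite Cmod_0. auto. }
  set (rho := Rmin r r'). assert (Hrho : 0 < rho) by (apply Rmin_glb_lt; auto).
  pose proof PI_RGT_0 as HPI. pose proof (Rabs_pos t0) as Ht0.
  (* For tau = 2 pi q this window means |t0| < tau < |t0| + rho, also when t0 = 0: the point
     approached lies in the disc, differs from i t0 and is not a pole. The sign [sgn nu] makes the
     resonance sum and W combine to a positive product. *)
  destruct (resonance_exists nu ((Rabs t0 + rho / 2) / (2 * PI)) ((Rabs t0 + rho) / (2 * PI)) (sgn nu) Hnu) as [n0 [b HR]].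
  { split; [apply Rdiv_lt_0_compat; lra |]. apply Rmult_lt_compat_r; [apply Rinv_0_lt_compat |]; lra. }
  { unfold sgn. destruct (Nat.eqb nu 4); auto. }
  destruct HR as [Hn0 [Hb [Hq [Hdiv [d [J0 [Hd HS]]]]]]].
  set (tau := tau_of n0 b).
  assert (Htau : Rabs t0 < tau < Rabs t0 + rho).
  { unfold tau, tau_of. destruct Hq as [Q1 Q2].
    apply Rmult_lt_compat_l with (r := 2 * PI) in Q1; [| lra]. apply Rmult_lt_compat_l with (r := 2 * PI) in Q2; [| lra].
    replace (2 * PI * ((Rabs t0 + rho / 2) / (2 * PI))) with (Rabs t0 + rho / 2) in Q1 by (field; lra).
    replace (2 * PI * ((Rabs t0 + rho) / (2 * PI))) with (Rabs t0 + rho) in Q2 by (field; lra). lra. }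
  destruct (Uden_sign nu tau Hnu ltac:(lra)) as [w0 [eta0 [Hw0 [Heta0 HU]]]].
  destruct (blow_up nu n0 b Hnu2 Hn0 Hb Hdiv w0 eta0 d J0 (sgn nu)) as [c [eta [Hc [Heta HB]]]]; auto.
  { unfold sgn. destruct (Nat.eqb nu 4); auto. }
  fold tau in HB.
  (* The complex conjugation symmetry of Z covers negative t0. *)
  assert (Heps : exists t1, (t1 = tau \/ t1 = - tau) /\ Rabs (t1 - t0) < rho /\ t1 <> t0 /\
    forall h, 0 < h < eta -> c / h <= Cmod (Z ((h * h)%R, t1))).
  { destruct (Rle_lt_dec 0 t0) as [H0 | H0].
    - rewrite (Rabs_pos_eq t0) in Htau by auto. exists tau. repeat split; auto; [rewrite Rabs_pos_eq; lra | lra |].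
      intros h Hh. apply HB; auto. apply HZ. unfold Re. simpl. nra.
    - rewrite (Rabs_left t0) in Htau by auto. exists (- tau). repeat split; auto; [rewrite Rabs_left; lra | lra |].
      intros h Hh. rewrite <- Cmod_conj. apply HB; auto.
      replace (((h * h)%R, tau) : C) with (Cconj ((h * h)%R, - tau)) by (unfold Cconj; simpl; rewrite Ropp_involutive; reflexivity).
      apply filterlim_conj, HZ. unfold Re. simpl. nra. }
  destruct Heps as [t1 [_ [Ht1 [Hne HZ1]]]].
  assert (HD : forall t, Cmod (Cminus (0, t) (0, t0)) = Rabs (t - t0)).
  { intros t. replace (Cminus (0, t) (0, t0)) with (Ci * RtoC (t - t0))%C by (apply C_eq; simpl; ring).
    rewrite Cmod_mult, Cmod_R. replace (Cmod Ci) with 1; [ring |].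
    unfold Cmod, Ci. simpl. replace (0 * (0 * 1) + 1 * (1 * 1)) with 1 by ring. symmetry. apply sqrt_1. }
  assert (HnP : ~ P (0, t1)).
  { intros HP. apply Hne. apply Hiso in HP; [congruence |]. rewrite HD. eapply Rlt_le_trans; [apply Ht1 | apply Rmin_r]. }
  destruct (holo_bounded g (0, t1)) as [e [He Hbd]].
  { apply Hholo; auto. right. rewrite HD. eapply Rlt_le_trans; [apply Ht1 | apply Rmin_l]. }
  set (M := Cmod (g (0, t1)) + 2). assert (HM : 0 < M) by (pose proof (Cmod_ge_0 (g (0, t1))); unfold M; lra).
  (* h <= 1 and h <= e/2 put h^2 + i t1 into the disc where |g| <= M, while h <= c/(2 M) makes the
     lower bound c/h at least 2 M. *)
  set (h := Rmin (Rmin (eta / 2) 1) (Rmin (e / 2) (c / (2 * M)))).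
  assert (Hcm : 0 < c / (2 * M)) by (apply Rdiv_lt_0_compat; lra).
  assert (Hh : 0 < h) by (repeat apply Rmin_glb_lt; lra).
  assert (H1 : h <= eta / 2) by (eapply Rle_trans; [apply Rmin_l | apply Rmin_l]).
  assert (H2 : h <= 1) by (eapply Rle_trans; [apply Rmin_l | apply Rmin_r]).
  assert (H3 : h <= e / 2) by (eapply Rle_trans; [apply Rmin_r | apply Rmin_l]).
  assert (H4 : h <= c / (2 * M)) by (eapply Rle_trans; [apply Rmin_r | apply Rmin_r]).
  specialize (HZ1 h ltac:(lra)).
  assert (Hs : 0 < Re ((h * h)%R, t1)) by (unfold Re; simpl; nra).
  rewrite <- Hg in HZ1 by auto.
  assert (Hlow : Cmod (g ((h * h)%R, t1)) <= M).
  { apply Hbd. replace (((h * h)%R, t1) - (0, t1))%C with (RtoC (h * h)) by (apply C_eq; simpl; ring).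
    rewrite Cmod_R, Rabs_pos_eq by nra. nra. }
  assert (2 * M <= c / h); [| lra].
  apply Rmult_le_reg_r with h; auto. replace (c / h * h) with c by (field; lra).
  apply Rmult_le_compat_l with (r := 2 * M) in H4; [| lra]. replace (2 * M * (c / (2 * M))) with c in H4 by (field; lra). lra.
Qed.
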